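(* Let $r\ge2$ and let $D$ be any parabolic connection on the parabolic bundle $\mathrm{Sym}^{r-1}(E_* )$. Then: (1) For any $1\le j\le r-1$, the parabolic subbundle $\mathcal F^j_*\subset\mathrm{Sym}^{r-1}(E_* )$ is not preserved by $D$. (2) $D(\mathcal F^j_0)\subset\mathcal F^{j+1}_0\otimes K_X(S)$ for all $1\le j\le r-1$, where $\mathcal F^i_0$ is the holomorphic vector bundle underlying $\mathcal F^i_*$.
   Context: SETTING. $X$ is a compact connected Riemann surface with canonical bundle $K_X$; $S=\{x_1,\dots,x_n\}\subset X$ is a set of $n\ge 1$ distinct points, and $n\ge 3$ if $X$ has genus $0$. $S$ also denotes the reduced divisor $\sum x_i$, and $F(kS):=F\otimes\mathcal O_X(kS)$. For each $i$ fix a real number $c_i>1$. PARABOLIC BUNDLES. A parabolic bundle $E_*$ is a holomorphic vector bundle $E$ with, at each $x_i$, a filtration $E_{x_i}=E_{i,1}\supset\cdots\supset E_{i,l_i}\supset E_{i,l_i+1}=0$ and weights $0\le\alpha_{i,1}<\cdots<\alpha_{i,l_i}<1$. Equivalently it is the decreasing filtered sheaf $(E_t)_{t\in\mathbb R}$: for $0\le t<1$, $E_t\subset E$ consists of sections $s$ with $s(x_i)\in E_{i,j}$, $j$ the smallest index with $\alpha_{i,j}\ge t$ ($s(x_i)=0$ if there is none), and $E_{t+1}=E_t(-S)$. Tensor product: $(V_*\otimes W_* )_t=\sum_{a+b=t}V_a\otimes W_b$; $\mathrm{Sym}^m(E_* )_t$ is the image of $(E_*^{\otimes m})_t$ in the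 symmetric power (on $X\setminus S$, meromorphic along $S$); $\mathrm{Sym}^0(E_* )=\mathcal O_X$ with trivial parabolic structure. A logarithmic connection on $E$ singular over $S$ is $D:E\to E\otimes K_X(S)$ satisfying the Leibniz rule, with residue $\mathrm{Res}(D,x_i)\in\mathrm{End}(E_{x_i})$. A parabolic connection on $E_*$ is such a $D$ with $\mathrm{Res}(D,x_i)(E_{i,j})\subset E_{i,j}$ and with $\mathrm{Res}(D,x_i)$ acting on $E_{i,j}/E_{i,j+1}$ as multiplication by $\alpha_{i,j}$. A subbundle with underlying bundle $F$ is preserved by $D$ if $D(F)\subset F\otimes K_X(S)$. THE PARABOLIC GUNNING BUNDLE. Fix a holomorphic line bundle $\mathcal L$ with an isomorphism $\mathcal L^{\otimes2}\cong K_X$. Let $0\to\mathcal L\to\widetilde E\xrightarrow{p_0}\mathcal L^*\to0$ be the extension with class $1\in H^1(X,\mathrm{Hom}(\mathcal L^*,\mathcal L))=H^1(X,K_X)=\mathbb C$, and $E:=p_0^{-1}(\mathcal L^*(-S))$, so $0\to\mathcal L\to E\xrightarrow{p}\mathcal L^*(-S)\to0$. For $x\in S$, the image of $\widetilde E(-S)_x\to E_x$ (induced by the inclusion $\widetilde E(-S)\subset E$) is a line mapped isomorphically by $p$ to $\mathcal L^*(-S)_x$; it is denoted $\mathcal L^*(-S)_x\subset E_x$. $E_*$ is $E$ with filtration $0\subset\mathcal L^*(-S)_{x_i}\subset E_{x_i}$, the weight of the line being $\frac{c_i+1}{2c_i+1}$ and that of $E_{x_i}$ being $\frac{c_i}{2c_i+1}$.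 $\mathcal L_*$ is $\mathcal L\subset E$ with the induced parabolic structure (weight $\frac{c_i}{2c_i+1}$ at $x_i$). THE FILTRATION. For $1\le j\le r$, $\mathcal F^j_*$ is the image of the natural injective homomorphism $\mathrm{Sym}^{j-1}(E_* )\otimes(\mathcal L_* )^{\otimes(r-j)}\to\mathrm{Sym}^{r-1}(E_* )$; it is a parabolic subbundle of rank $j$, and $0=\mathcal F^0_*\subset\mathcal F^1_*\subset\cdots\subset\mathcal F^r_*=\mathrm{Sym}^{r-1}(E_* )$. *)

(* Defs.v *)
From HB Require Import structures.
From mathcomp Require Import all_boot all_order all_algebra.
From mathcomp Require Import all_classical all_reals all_analysis.
From mathcomp Require Import complex.
(* The notations of mpoly clash with those of mathcomp-analysis. *)
From mathcomp Require Import -(notations, coercions) mpoly.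

Set Implicit Arguments.
Unset Strict Implicit.
Unset Printing Implicit Defensive.

Import Order.TTheory GRing.Theory Num.Theory.
Import numFieldNormedType.Exports.

Local Open Scope classical_set_scope.
Local Open Scope ring_scope.

(* R[i], presented as a numClosedFieldType so that the topology and the
   derivative that mathcomp-analysis attaches to a numFieldType apply to it;
   [derivable f z 1] is then complex differentiability of f at z. *)
Definition Cx (R : realType) : numClosedFieldType := R[i].

(* [rs_coord i] is the coordinate z_i on the chart domain [rs_dom i];
   [rs_param i] is its inverse (irrelevant outside z_i(U_i)).  Holomorphy on an
   open set is complex differentiability at each of its points. *)
Record riemann_surface (R : realType) := RiemannSurface {
  rs_space :> topologicalType;
  rs_hausdorff : hausdorff_space rs_space;
  rs_connected : connected [set: rs_space];
  rs_idx : Type;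
  rs_dom : rs_idx -> set rs_space;
  rs_coord : rs_idx -> rs_space -> Cx R;
  rs_param : rs_idx -> Cx R -> rs_space;
  rs_open_dom : forall i, open (rs_dom i);
  rs_cover : forall x, exists i, rs_dom i x;
  rs_open_image : forall i, open (rs_coord i @` rs_dom i);
  rs_coordK : forall i x, rs_dom i x -> rs_param i (rs_coord i x) = x;
  rs_coord_cont : forall i x, rs_dom i x -> {for x, continuous (rs_coord i)};
  rs_param_cont : forall i x, rs_dom i x ->
    {for rs_coord i x, continuous (rs_param i)};
  rs_trans_hol : forall i j x, rs_dom i x -> rs_dom j x ->
    derivable (rs_coord j \o rs_param i) (rs_coord i x) 1
}.

Section Setting.
Variables (R : realType) (X : riemann_surface R).
Local Notation C := (Cx R).
Local Notation idx := (rs_idx X).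
Local Notation dom := (@rs_dom R X).
Local Notation z := (@rs_coord R X).

Definition holo_on (W : set X) (f : X -> C) : Prop :=
  forall i x, W x -> dom i x -> derivable (f \o rs_param i) (z i x) 1.

(* df/dz_i *)
Definition chart_deriv (i : idx) (f : X -> C) (x : X) : C :=
  derive1 (f \o rs_param i) (z i x).

(* A section of K_X, possibly with values in a module M, is encoded by its
   coefficients w_i with respect to the frames dz_i. *)
Definition form_on (M : lmodType C) (W : set X) (w : idx -> X -> M) : Prop :=
  forall i j x, W x -> dom i x -> dom j x ->
    w i x = chart_deriv i (z j) x *: w j x.

Definition hol_form (w : idx -> X -> C) : Prop :=
  (forall i j x, dom i x -> dom j x ->
     w i x = chart_deriv i (z j) x * w j x) /\
  forall i, holo_on (dom i) (w i).

(* g = dim H^0(X, K_X) *)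
Definition has_genus (g : nat) : Prop :=
  exists w : 'I_g -> idx -> X -> C,
    (forall k, hol_form (w k)) /\
    forall f, hol_form f -> exists! a : 'rV[C]_g,
      forall i x, dom i x -> f i x = \sum_k a 0 k * w k i x.

(* c is the coefficient of (z_i - z_i(x))^-1 in the Laurent expansion of f at
   x; f is required to be meromorphic at x. *)
Definition has_residue (i : idx) (x : X) (f : X -> C) (c : C) : Prop :=
  exists (N : nat) (a : nat -> C) (W : set X) (g : X -> C),
    [/\ open W, W x, holo_on W g, a 0%N = c &
        forall y, W y -> dom i y -> y <> x ->
          f y = \sum_(k < N.+1) a k / (z i y - z i x) ^+ k.+1 + g y].

(* Every fibre is identified with the column space C^r, with no continuity in
   the point; the holomorphic structure is carried by the local trivializations
   [vb_triv a x : E_x = C^r -> C^r] over [vb_dom a].  Sections and homomorphisms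
   are thus plain functions on X. *)
Record vbundle (r : nat) := VBundle {
  vb_idx : Type;
  vb_dom : vb_idx -> set X;
  vb_triv : vb_idx -> X -> 'M[C]_r;
  vb_open_dom : forall a, open (vb_dom a);
  vb_cover : forall x, exists a, vb_dom a x;
  vb_unit : forall a x, vb_dom a x -> vb_triv a x \in unitmx;
  vb_trans_hol : forall a b i j, holo_on (vb_dom a `&` vb_dom b)
    (fun x => (vb_triv b x *m invmx (vb_triv a x)) i j)
}.

Arguments vb_dom {r} v _ _.
Arguments vb_triv {r} v _ _.

Definition hol_section r (F : vbundle r) (W : set X) (s : X -> 'cV[C]_r) : Prop :=
  forall a i, holo_on (W `&` vb_dom F a) (fun x => (vb_triv F a x *m s x) i 0).

Definition hol_hom r s (F : vbundle r) (G : vbundle s) (W : set X)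
    (A : X -> 'M[C]_(s, r)) : Prop :=
  forall a b i j, holo_on (W `&` (vb_dom F a `&` vb_dom G b))
    (fun x => (vb_triv G b x *m A x *m invmx (vb_triv F a x)) i j).

Lemma dual_unit r (F : vbundle r) a x :
  vb_dom F a x -> (invmx (vb_triv F a x))^T \in unitmx.
Proof. by move=> Fax; rewrite unitmx_tr unitmx_inv; exact: vb_unit. Qed.

Lemma dual_trans_hol r (F : vbundle r) a b i j :
  holo_on (vb_dom F a `&` vb_dom F b)
    (fun x => ((invmx (vb_triv F b x))^T *m
               invmx (invmx (vb_triv F a x))^T) i j).
Proof.
rewrite setIC (_ : (fun x => _) =
  fun x => (vb_triv F a x *m invmx (vb_triv F b x)) j i).
  exact: vb_trans_hol.
by apply/funext => x; rewrite -trmx_inv invmxK -trmx_mul mxE.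
Qed.

(* The pairing of the fibre C^r of the dual with that of F is (xi, v) |-> xi^T v. *)
Definition dual_vb r (F : vbundle r) : vbundle r :=
  @VBundle r (vb_idx F) (vb_dom F) (fun a x => (invmx (vb_triv F a x))^T)
    (@vb_open_dom r F) (@vb_cover r F) (@dual_unit r F) (@dual_trans_hol r F).

(* An isomorphism of the square of L with K_X:
   u (x) v |-> kappa_i u v dz_i over the domain of z_i. *)
Definition square_root_of_K (L : vbundle 1) (kappa : idx -> X -> C) : Prop :=
  [/\ forall i j x, dom i x -> dom j x ->
        kappa i x = chart_deriv i (z j) x * kappa j x,
      forall i x, dom i x -> kappa i x != 0 &
      forall i (W : set X) (u v : X -> 'cV[C]_1), open W ->
        hol_section L W u -> hol_section L W v ->
        holo_on (W `&` dom i) (fun x => kappa i x * u x 0 0 * v x 0 0)].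

Definition short_exact (L Q : vbundle 1) (E : vbundle 2)
    (iota : X -> 'M[C]_(2, 1)) (p : X -> 'M[C]_(1, 2)) : Prop :=
  [/\ hol_hom L E setT iota, hol_hom E Q setT p &
      forall x, [/\ \rank (iota x) = 1%N, \rank (p x) = 1%N &
                    p x *m iota x = 0]].

(* The class c in H^1(X, Hom(L^*, L)) = H^1(X, K_X) = C of an extension of L^*
   by L, computed by residues: sg is a meromorphic splitting with poles among
   the y_k, tau a holomorphic splitting near y_k, and c is the sum of the
   residues of the principal parts sg - tau.  Here
   eta : L^* -> L, an element of L (x) L, becomes the form kappa_i eta dz_i. *)
Definition extension_class (L : vbundle 1) (kappa : idx -> X -> C)
    (E : vbundle 2) (iota : X -> 'M[C]_(2, 1)) (p : X -> 'M[C]_(1, 2))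
    (c : C) : Prop :=
  exists (m : nat) (y : 'I_m -> X) (rho : 'I_m -> C) (sg : X -> 'M[C]_(2, 1)),
  [/\ injective y,
      hol_hom (dual_vb L) E (~` range y) sg,
      forall x, ~ range y x -> p x *m sg x = 1%:M,
      forall k, exists (W : set X) (tau : X -> 'M[C]_(2, 1)) (eta : X -> 'M[C]_1),
        [/\ open W /\ W (y k),
            hol_hom (dual_vb L) E W tau,
            forall x, W x -> p x *m tau x = 1%:M,
            forall x, W x -> ~ range y x -> sg x - tau x = iota x *m eta x &
            forall i, dom i (y k) ->
              has_residue i (y k) (fun x => kappa i x * eta x 0 0) (rho k)] &
      \sum_k rho k = c].

Record gunning_bundle := GunningBundle {
  gL : vbundle 1;
  gkappa : idx -> X -> C;
  gE : vbundle 2;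
  giota : X -> 'M[C]_(2, 1);
  gp : X -> 'M[C]_(1, 2);
  g_square_root : square_root_of_K gL gkappa;
  g_exact : short_exact gL (dual_vb gL) gE giota gp;
  g_class : extension_class gL gkappa gE giota gp 1
}.

Variables (n : nat) (pts : 'I_n -> X).
Local Notation S := (range pts).

(* Sections over U are functions of which only the values on U \ S matter, so
   that poles along S are allowed; every predicate F below is invariant under
   [eq_off_S]. *)
Definition sheaf (M : Type) := set X -> (X -> M) -> Prop.

Definition eq_off_S (M : Type) (U : set X) (s s' : X -> M) : Prop :=
  forall x, U x -> ~ S x -> s x = s' x.

Definition sections r (F : vbundle r) : sheaf 'cV[C]_r :=
  fun U s => exists2 s', hol_section F U s' & eq_off_S U s s'.

(* h is a local equation over W of the reduced divisor S. *)
Definition local_equation (W : set X) (h : X -> C) : Prop :=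
  holo_on W h /\
  forall x, W x -> (h x = 0 <-> S x) /\
    (S x -> forall i, dom i x -> chart_deriv i h x != 0).

(* F(kS) *)
Definition twist (M : lmodType C) (k : int) (F : sheaf M) : sheaf M :=
  fun U s => forall y, U y -> exists (W : set X) (h : X -> C),
    [/\ open W, W y, W `<=` U, local_equation W h &
        F W (fun x => (h x ^ k) *: s x)].

Variables (c : 'I_n -> R) (G : gunning_bundle).

Definition Esheaf : sheaf 'cV[C]_2 := fun U s =>
  sections (gE G) U s /\
  twist (-1) (sections (dual_vb (gL G))) U (fun x => gp G x *m s x).

(* s(x) = 0 in the fibre of E at x *)
Definition E_zero_at (x : X) (s : X -> 'cV[C]_2) : Prop :=
  exists W, [/\ open W, W x & twist (-1) Esheaf W s].

(* s(x) lies in the image of the fibre at x of Etilde(-S) *)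
Definition E_line_at (x : X) (s : X -> 'cV[C]_2) : Prop :=
  exists (W : set X) (s' : X -> 'cV[C]_2),
    [/\ open W, W x, twist (-1) (sections (gE G)) W s' &
        E_zero_at x (fun y => s y - s' y)].

Definition weight_E (k : 'I_n) : R := c k / (2 * c k + 1).
Definition weight_line (k : 'I_n) : R := (c k + 1) / (2 * c k + 1).

(* E_t for 0 <= t < 1 *)
Definition Epar01 (t : R) : sheaf 'cV[C]_2 := fun U s =>
  Esheaf U s /\
  forall k, U (pts k) ->
    (weight_E k < t -> E_line_at (pts k) s) /\
    (weight_line k < t -> E_zero_at (pts k) s).

(* E_(t + 1) = E_t(-S) *)
Definition Epar (t : R) : sheaf 'cV[C]_2 :=
  twist (- Num.floor t) (Epar01 (t - (Num.floor t)%:~R)).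

Definition Lpar (t : R) : sheaf 'cV[C]_2 := fun U s =>
  Epar t U s /\
  exists u : X -> 'cV[C]_1, eq_off_S U s (fun x => giota G x *m u x).

(* Sym(C^2) = C[X_0, X_1], in which Sym^m(C^2) is the part of degree m and a
   vector is the corresponding linear form. *)
Definition linear_form (v : 'cV[C]_2) : mpoly 2 C :=
  \sum_(i < 2) v i 0 *: mpolyX C (mnm1 i).

Definition filtered := R -> sheaf (mpoly 2 C).

Definition in_degree1 (F : R -> sheaf 'cV[C]_2) : filtered := fun t U s =>
  exists2 v, F t U v & eq_off_S U s (fun x => linear_form (v x)).

(* O_X with its trivial parabolic structure (weight 0): O_t = O(-ceil(t) S). *)
Definition trivial_par : filtered := fun t =>
  twist (- Num.ceil t) (fun U s =>
    exists2 f, holo_on U f & eq_off_S U s (fun x => mpolyC 2 (f x))).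

(* The image of (F (x) G)_t = sum_(a + b = t) F_a (x) G_b in the symmetric
   algebra. *)
Definition par_mul (F F' : filtered) : filtered := fun t U s =>
  forall y, U y ->
    exists (W : set X) (N : nat) (a : 'I_N -> R) (u v : 'I_N -> X -> mpoly 2 C),
    [/\ open W, W y, W `<=` U,
        forall k, F (a k) W (u k) /\ F' (t - a k) W (v k) &
        eq_off_S W s (fun x => \sum_k u k x * v k x)].

Definition par_pow (F : filtered) (m : nat) : filtered :=
  iter m (par_mul F) trivial_par.

Definition SymE (m : nat) : filtered := par_pow (in_degree1 Epar) m.

(* The filtration step of rank j of SymE r.-1, for 1 <= j <= r. *)
Definition filtration (r j : nat) : filtered :=
  par_mul (SymE j.-1) (par_pow (in_degree1 Lpar) (r - j)).

(* [D U s i] is the coefficient of dz_i in D(s), for s a section over U. *)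
Definition operator := set X -> (X -> mpoly 2 C) -> idx -> X -> mpoly 2 C.

(* D(F) is contained in F' (x) K_X(S). *)
Definition sends_into (D : operator) (F F' : sheaf (mpoly 2 C)) : Prop :=
  forall U s i, open U -> F U s -> twist 1 F' (U `&` dom i) (D U s i).

(* A morphism of sheaves V -> V (x) K_X(S) satisfying the Leibniz rule, which
   together with additivity gives C-linearity. *)
Definition log_connection (V : sheaf (mpoly 2 C)) (D : operator) : Prop :=
  [/\ sends_into D V V,
      forall U s, open U -> V U s -> form_on (U `\` S) (D U s),
      forall U W s s' i, open U -> open W -> W `<=` U -> V U s -> V W s' ->
        eq_off_S W s s' -> eq_off_S (W `&` dom i) (D U s i) (D W s' i),
      forall U s s' i, open U -> V U s -> V U s' ->
        eq_off_S (U `&` dom i) (D U (fun x => s x + s' x) i)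
          (fun x => D U s i x + D U s' i x) &
      forall U f s i, open U -> holo_on U f -> V U s ->
        eq_off_S (U `&` dom i) (D U (fun x => f x *: s x) i)
          (fun x => f x *: D U s i x + chart_deriv i f x *: s x)].

(* The value at x of the section s of V_0 lies in the image of the stalk of V_t
   in the fibre V_0 / V_0(-S) at x, for 0 <= t <= 1.  As t varies these
   subspaces are the steps of the filtration of the fibre, and t = 1 gives 0. *)
Definition in_flag (V : filtered) (t : R) (x : X) (s : X -> mpoly 2 C) : Prop :=
  exists (W : set X) (s' : X -> mpoly 2 C),
    [/\ open W, W x, V t W s' &
        twist (-1) (V 0) W (fun y => s y - s' y)].

(* A representative of Res(D, x)(s(x)). *)
Definition residue_rep (D : operator) (i : idx) (x : X) (U : set X)
    (s : X -> mpoly 2 C) : X -> mpoly 2 C :=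
  fun y => (z i y - z i x) *: D U s i y.

(* Writing E_t for the flag at x in the fibre, the residue preserves each E_t
   and is multiplication by t on E_t / E_(>t); when t is not a weight this
   quotient is 0. *)
Definition parabolic_connection (V : filtered) (D : operator) : Prop :=
  log_connection (V 0) D /\
  forall (k : 'I_n) (i : idx) (U : set X) (s : X -> mpoly 2 C) (t : R),
    dom i (pts k) -> open U -> U (pts k) -> V 0 U s ->
    0 <= t < 1 -> in_flag V t (pts k) s ->
    in_flag V t (pts k) (residue_rep D i (pts k) U s) /\
    exists2 t', t < t' <= 1 &
      in_flag V t' (pts k)
        (fun y => residue_rep D i (pts k) U s y - ((t%:C)%C : C) *: s y).

End Setting.

(* Main.v *)
Require Import Defs.
From HB Require Import structures.
From mathcomp Require Import all_boot all_order all_algebra.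
From mathcomp Require Import all_classical all_reals all_analysis.
From mathcomp Require Import complex.
From mathcomp Require Import -(notations, coercions) mpoly.
From mathcomp Require Import ring lra zify.

Set Implicit Arguments.
Unset Strict Implicit.
Unset Printing Implicit Defensive.

Import Order.TTheory GRing.Theory Num.Theory.
Import numFieldNormedType.Exports.
Local Open Scope classical_set_scope.
Local Open Scope ring_scope.

(* In local frames [e] of [L] and [t] of a splitting, [D] on Sym^N, N = r-1, has
   a matrix [A c b] in the basis e^(N-b) t^b, and at a point of weight [g] of
   [L] the parabolic condition gives [A c b], c <> b, order at least
   floor(2(c-b)g). Suppose that A (b+m') b = 0 for all m' > m. With [k dz]
   the image of e^2 in K_X and [phi] a meromorphic 1-form,
   A (b+m) b phi^(m-1) k^-m is a global function, whose order bounds sum to at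
   least 0, so that it is a multiple lamb_b of a fixed function. A meromorphic
   splitting, whose poles carry the extension class, gives a 1-form with
   coefficient A (b+m-1) b; its residues sum to 0, and for m >= 2 this reads
   (b+m) lamb_b = b lamb_(b-1), whence lamb = 0. For m = 1 it gives
   lamb_b = K (N-b) with K = sum g + deg K_X / 2 > 0: statements (2) and (1).
   The form [phi] comes from Perron's method and Schwarz's alternating method,
   the residue theorem for [th] from the function w |-> sum Res (th / (f - w)). *)

(** The weights of [E] are [g] and [1 - g], and [1 - g] agrees with [-g] modulo 1; so [t] counts
    with weight [-g] and [e^(N-b) t^b] with weight [(N - 2b) g], the source of [2(c-b)g]. The
    condition [c_i > 1] says [g > 1/3], whence [3 floor(2mg) >= 2(m-1)] at each marked point. Three
    times the sum of the order bounds is then at least [(m-1)(2n + 3 deg phi)], and in genus 0 three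
    marked points pay for a double pole of [phi]. So only a lower bound on the divisor of [phi]
    matters: any non-zero holomorphic form will do, or in genus 0 a form with one double pole. When
    the bounds are attained they force [floor(2mg) <= floor(2(m-1)g)], so that the 1-form made from
    the next diagonal has no poles but those of the splitting. The recursion starts because its
    right side vanishes at [b = 0]. For [m = 1] the diagonal entries are not 1-forms; half a
    logarithmic derivative corrects them and brings [deg K_X / 2] into [K]. On the analytic side,
    contour integrals are limits, along an ultrafilter, of averages over dyadic roots of unity, and
    neither Stokes' theorem nor a triangulation is used. *)

Section Plane.
Variable R : realType.
Local Notation C := (Cx R).

(** * Complex numbers with real-valued modulus; complex derivatives *)

Section ComplexNumbers.

(** The norm of [C] takes values in [C], whose order is partial. Real-valued parts and modulus keep
    all estimates in the real field, where linear arithmetic applies. *)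
Definition re (z : C) : R := complex.Re z.
Definition im (z : C) : R := complex.Im z.
Definition cr (x : R) : C := (x%:C)%C.
Definition ci : C := 'i%C.
Definition nm (z : C) : R := Normc.normc z.

Lemma normE (z : C) : `|z| = cr (nm z).
Proof. by []. Qed.

Lemma crD x y : cr (x + y) = cr x + cr y. Proof. exact: rmorphD. Qed.
Lemma crB x y : cr (x - y) = cr x - cr y. Proof. exact: rmorphB. Qed.
Lemma crM x y : cr (x * y) = cr x * cr y. Proof. exact: rmorphM. Qed.
Lemma cr0 : cr 0 = 0. Proof. exact: rmorph0. Qed.
Lemma cr1 : cr 1 = 1. Proof. exact: rmorph1. Qed.
Lemma crV x : cr x^-1 = (cr x)^-1. Proof. exact: fmorphV. Qed.
Lemma crX x n : cr (x ^+ n) = cr x ^+ n. Proof. exact: rmorphXn. Qed.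
Lemma cr_nat n : cr n%:R = n%:R. Proof. exact: rmorph_nat. Qed.
Lemma cr_inj : injective cr. Proof. exact: complexI. Qed.
Lemma cr_eq0 x : (cr x == 0) = (x == 0). Proof. by rewrite -cr0 (inj_eq cr_inj). Qed.
Lemma ltr_cr x y : (cr x < cr y) = (x < y). Proof. exact: ltcR. Qed.

Lemma reD x y : re (x + y) = re x + re y. Proof. by case: x; case: y. Qed.
Lemma imD x y : im (x + y) = im x + im y. Proof. by case: x; case: y. Qed.
Lemma reN x : re (- x) = - re x. Proof. by case: x. Qed.
Lemma imN x : im (- x) = - im x. Proof. by case: x. Qed.
Lemma reB x y : re (x - y) = re x - re y. Proof. by rewrite reD reN. Qed.
Lemma imB x y : im (x - y) = im x - im y. Proof. by rewrite imD imN. Qed.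
Lemma reM x y : re (x * y) = re x * re y - im x * im y. Proof. by case: x; case: y. Qed.
Lemma imM x y : im (x * y) = re x * im y + im x * re y. Proof. by case: x; case: y. Qed.
Lemma re_cr x : re (cr x) = x. Proof. by []. Qed.
Lemma im_cr x : im (cr x) = 0. Proof. by []. Qed.
Lemma re_ci : re ci = 0. Proof. by []. Qed.
Lemma im_ci : im ci = 1. Proof. by []. Qed.
Lemma re0 : re 0 = 0. Proof. by []. Qed.
Lemma im0 : im 0 = 0. Proof. by []. Qed.
Lemma re1 : re 1 = 1. Proof. by []. Qed.
Lemma im1 : im 1 = 0. Proof. by []. Qed.
Lemma re_crM x z : re (cr x * z) = x * re z.
Proof. by rewrite reM re_cr im_cr mul0r subr0. Qed.
Lemma im_crM x z : im (cr x * z) = x * im z.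
Proof. by rewrite imM re_cr im_cr mul0r addr0. Qed.

Lemma re_sum I (s : seq I) (P : pred I) (F : I -> C) :
  re (\sum_(i <- s | P i) F i) = \sum_(i <- s | P i) re (F i).
Proof. by apply: (big_morph re reD re0). Qed.
Lemma im_sum I (s : seq I) (P : pred I) (F : I -> C) :
  im (\sum_(i <- s | P i) F i) = \sum_(i <- s | P i) im (F i).
Proof. by apply: (big_morph im imD im0). Qed.

Lemma reim_eq (z w : C) : re z = re w -> im z = im w -> z = w.
Proof. by case: z => a b; case: w => c d /= -> ->. Qed.
Lemma reimE (z : C) : z = cr (re z) + ci * cr (im z).
Proof. exact: complexE. Qed.

Lemma nm_sqr (z : C) : nm z ^+ 2 = re z ^+ 2 + im z ^+ 2.
Proof. by case: z => a b; rewrite sqr_sqrtr // addr_ge0 // sqr_ge0. Qed.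
Lemma nm_ge0 z : 0 <= nm z.
Proof. by case: z => a b; rewrite sqrtr_ge0. Qed.
Lemma nm0 : nm 0 = 0. Proof. exact: Normc.normc0. Qed.
Lemma nm1 : nm 1 = 1. Proof. exact: Normc.normc1. Qed.
Lemma nmM x y : nm (x * y) = nm x * nm y. Proof. exact: Normc.normcM. Qed.
Lemma nmV x : nm x^-1 = (nm x)^-1. Proof. exact: Normc.normcV. Qed.
Lemma nmN x : nm (- x) = nm x. Proof. exact: normcN. Qed.
Lemma nmD x y : nm (x + y) <= nm x + nm y. Proof. exact: le_normcD. Qed.
Lemma nmB x y : nm (x - y) <= nm x + nm y.
Proof. by rewrite -(nmN y) nmD. Qed.
Lemma nmC x y : nm (x - y) = nm (y - x).
Proof. by rewrite -nmN opprB. Qed.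
Lemma nm_tri y x z : nm (x - z) <= nm (x - y) + nm (y - z).
Proof. by rewrite (le_trans _ (nmD _ _)) // [x - y + _]addrA subrK. Qed.
Lemma nm_triB x y : nm x - nm y <= nm (x - y).
Proof. by rewrite lerBlDr (le_trans _ (nmD _ _)) // subrK. Qed.
Lemma nm_eq0 x : (nm x == 0) = (x == 0).
Proof.
by apply/eqP/eqP => [/Normc.eq0_normc //|->]; exact: nm0.
Qed.
Lemma nm_gt0 x : (0 < nm x) = (x != 0).
Proof. by rewrite lt_neqAle nm_ge0 andbT eq_sym nm_eq0. Qed.
Lemma nmX x n : nm (x ^+ n) = nm x ^+ n.
Proof. by elim: n => [|n IH]; rewrite ?expr0 ?nm1 // !exprS nmM IH. Qed.
Lemma nm_cr x : nm (cr x) = `|x|.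
Proof. by rewrite /nm /= expr0n /= addr0 sqrtr_sqr. Qed.
Lemma nm_ci : nm ci = 1.
Proof. by rewrite /nm /= expr0n /= add0r expr1n sqrtr1. Qed.
Lemma re_le_nm z : `|re z| <= nm z.
Proof.
by rewrite -(@ler_pXn2r _ 2) ?nnegrE ?nm_ge0 // nm_sqr real_normK ?num_real // lerDl sqr_ge0.
Qed.
Lemma im_le_nm z : `|im z| <= nm z.
Proof.
by rewrite -(@ler_pXn2r _ 2) ?nnegrE ?nm_ge0 // nm_sqr real_normK ?num_real // lerDr sqr_ge0.
Qed.
Lemma re_le z : re z <= nm z.
Proof. exact: le_trans (ler_norm _) (re_le_nm z). Qed.
Lemma nm_le_reim z : nm z <= `|re z| + `|im z|.
Proof.
rewrite {1}(reimE z) (le_trans (nmD _ _)) //.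
by rewrite nmM nm_ci mul1r !nm_cr.
Qed.
Lemma nm_sum I (s : seq I) (P : pred I) (F : I -> C) :
  nm (\sum_(i <- s | P i) F i) <= \sum_(i <- s | P i) nm (F i).
Proof.
elim/big_ind2: _ => [|x a y b xa yb|//]; first by rewrite nm0.
exact: le_trans (nmD _ _) (lerD xa yb).
Qed.

Definition cj (z : C) : C := (z^*)%C.
Lemma cjM x y : cj (x * y) = cj x * cj y. Proof. exact: rmorphM. Qed.
Lemma cjD x y : cj (x + y) = cj x + cj y. Proof. exact: rmorphD. Qed.
Lemma re_cj x : re (cj x) = re x. Proof. by case: x. Qed.
Lemma im_cj x : im (cj x) = - im x. Proof. by case: x. Qed.
Lemma nm_cj x : nm (cj x) = nm x. Proof. by case: x => a b; rewrite /nm /= sqrrN. Qed.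
Lemma mul_cj x : x * cj x = cr (nm x ^+ 2).
Proof.
apply: reim_eq.
  by rewrite reM re_cj im_cj re_cr nm_sqr !expr2 mulrN opprK.
by rewrite imM re_cj im_cj im_cr mulrN [im x * _]mulrC addNr.
Qed.

Lemma Cnbhs (z : C) (A : set C) :
  nbhs z A <-> exists2 e : R, 0 < e & forall w, nm (w - z) < e -> A w.
Proof.
split=> [/nbhs_ballP [e /= e0 eA]|[e e0 eA]].
  have ee : e = cr (re e).
    move: e0; rewrite ltcE /= => /andP[/eqP ie _].
    by apply: reim_eq; rewrite ?re_cr ?im_cr.
  exists (re e) => [|w wz]; first by rewrite -ltr_cr cr0 -ee.
  by apply: eA; rewrite /ball /= normE ee ltr_cr nmC.
apply/nbhs_ballP; exists (cr e) => /=; first by rewrite -cr0 ltr_cr.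
by move=> w; rewrite /ball /= normE ltr_cr nmC; exact: eA.
Qed.

Lemma Copen (A : set C) : open A <->
  forall z, A z -> exists2 e : R, 0 < e & forall w, nm (w - z) < e -> A w.
Proof.
rewrite openE; split => [oA z /oA /Cnbhs //|oA z Az].
by apply/Cnbhs; exact: oA.
Qed.

(** Equivalent to the existence of the limit of difference quotients ([cdiff_cvg]), but with the
    remainder exposed: Goursat's argument and the mean value estimates use it in this form. *)
Definition cdiff (f : C -> C) (z d : C) : Prop := forall e : R, 0 < e -> exists2 dl : R, 0 < dl &
    forall h, nm h < dl -> nm (f (z + h) - f z - d * h) <= e * nm h.

Lemma Ccvg_dnbhs (g : C -> C) (l : C) :
  g @ 0^' --> l <-> forall e : R, 0 < e -> exists2 dl : R, 0 < dl &
    forall h, h != 0 -> nm h < dl -> nm (g h - l) < e.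
Proof.
split=> [gl e e0|gl A].
  have := gl [set w | nm (w - l) < e].
  case.
    by apply/Cnbhs; exists e.
  move=> e' e'0 eA.
  have : nbhs (0 : C) (fun h => h != 0 -> nm (g h - l) < e).
    by apply/nbhs_ballP; exists e' => // h he h0; exact: eA.
  by move/Cnbhs => [dl dl0 H]; exists dl => // h h0 hd; apply: H => //; rewrite subr0.
move/Cnbhs => [e e0 eA]; have [dl dl0 H] := gl _ e0.
have : nbhs (0 : C) (fun h => h != 0 -> A (g h)).
  by apply/Cnbhs; exists dl => // h; rewrite subr0 => hd h0; apply: eA; exact: H.
by [].
Qed.

Lemma cdiff_cvg f z d : cdiff f z d <-> (fun h => h^-1 * (f (z + h) - f z)) @ (0 : C)^' --> d.
Proof.
rewrite Ccvg_dnbhs; split=> H e e0.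
  have e20 : 0 < e / 2 by rewrite divr_gt0.
  have [dl dl0 Hd] := H _ e20; exists dl => // h h0 hd.
  have -> : h^-1 * (f (z + h) - f z) - d = h^-1 * (f (z + h) - f z - d * h).
    by rewrite [RHS]mulrBr [d * h]mulrC mulKf.
  rewrite nmM nmV mulrC ltr_pdivrMr ?nm_gt0 //.
  apply: le_lt_trans (Hd _ hd) _.
  by rewrite ltr_pM2r ?nm_gt0 // ltr_pdivrMr // mulr_natr mulr2n ltrDl.
have [dl dl0 Hd] := H _ e0; exists dl => // h hd.
have [->|h0] := eqVneq h 0.
  by rewrite addr0 subrr mulr0 subrr nm0 mulr0.
have -> : f (z + h) - f z - d * h = h * (h^-1 * (f (z + h) - f z) - d).
  by rewrite [RHS]mulrBr mulVKf // [h * d]mulrC.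
by rewrite nmM mulrC ler_pM2r ?nm_gt0 // ltW // Hd.
Qed.

Lemma cdiff_derivable f z d : cdiff f z d -> derivable f z 1.
Proof.
move/cdiff_cvg => H; rewrite /derivable; refine (@cvgP _ _ d _).
rewrite (_ : (fun h : C => _) = (fun h => h^-1 * (f (z + h) - f z))) //.
by apply/funext => h /=; rewrite /GRing.scale /= mulr1 [h + z]addrC.
Qed.

Lemma derivable_cdiff (f : C -> C) (z : C) : derivable f z 1 -> exists d, cdiff f z d.
Proof.
rewrite /derivable => /cvg_ex [d H]; exists d; apply/cdiff_cvg.
rewrite (_ : (fun h : C => _) = (fun h : C => h^-1 *: ((f \o shift z) (h *: (1 : C)) - f z))) //.
by apply/funext => h /=; rewrite /GRing.scale /= mulr1 [h + z]addrC.
Qed.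

Lemma cdiff_derive1 f z d : cdiff f z d -> derive1 f z = d.
Proof.
move/cdiff_cvg => H; rewrite /derive1; apply: cvg_lim => //.
rewrite (_ : (fun h : C => _) = (fun h => h^-1 * (f (z + h) - f z))) //.
by apply/funext => h /=; rewrite /GRing.scale /= [h + z]addrC.
Qed.

Lemma cdiff_unique f z d d' : cdiff f z d -> cdiff f z d' -> d = d'.
Proof. by move=> /cdiff_derive1 <- /cdiff_derive1. Qed.

Lemma derivable_cdiff1 (f : C -> C) (z : C) : derivable f z 1 -> cdiff f z (derive1 f z).
Proof. by move=> /derivable_cdiff [d H]; rewrite (cdiff_derive1 H). Qed.

End ComplexNumbers.

(** * Rules of differentiation and primitives on an interval *)

Section Calculus.

Lemma cdiffP (f : C -> C) (z d : C) : cdiff f z d <-> is_derive z (1 : C) f d.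
Proof.
split=> [H|H].
  apply: DeriveDef; first exact: cdiff_derivable H.
  by rewrite -derive1E; exact: cdiff_derive1.
have := derivable_cdiff1 (@ex_derive _ _ _ _ _ _ _ H).
by rewrite derive1E derive_val.
Qed.

Lemma cdiffC (k z : C) : cdiff (fun=> k) z 0.
Proof. by apply/cdiffP; exact: is_derive_cst. Qed.

Lemma cdiff_id (z : C) : cdiff id z 1.
Proof. by apply/cdiffP; exact: is_derive_id. Qed.

Lemma cdiffD (f g : C -> C) z d d' : cdiff f z d -> cdiff g z d' ->
  cdiff (fun x => f x + g x) z (d + d').
Proof. by move=> /cdiffP fd /cdiffP gd; apply/cdiffP; exact: is_deriveD. Qed.

Lemma cdiffN (f : C -> C) z d : cdiff f z d -> cdiff (fun x => - f x) z (- d).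
Proof. by move=> /cdiffP fd; apply/cdiffP; exact: is_deriveN. Qed.

Lemma cdiffB (f g : C -> C) z d d' : cdiff f z d -> cdiff g z d' ->
  cdiff (fun x => f x - g x) z (d - d').
Proof. by move=> fd /cdiffN gd; exact: cdiffD. Qed.

Lemma cdiffM (f g : C -> C) z d d' : cdiff f z d -> cdiff g z d' ->
  cdiff (fun x => f x * g x) z (d * g z + f z * d').
Proof.
move=> /cdiffP fd /cdiffP gd; apply/cdiffP.
by apply: is_derive_eq; rewrite /GRing.scale /= addrC [g z * d]mulrC.
Qed.

Lemma cdiffMl (k : C) (f : C -> C) z d : cdiff f z d -> cdiff (fun x => k * f x) z (k * d).
Proof. by move=> /(cdiffM (cdiffC k z)); rewrite mul0r add0r. Qed.

Lemma cdiffX (f : C -> C) z d n : cdiff f z d ->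
  cdiff (fun x => f x ^+ n) z (n%:R * f z ^+ n.-1 * d).
Proof.
move=> fd; elim: n => [|n IH].
  by rewrite !mul0r; exact: cdiffC.
rewrite (_ : (fun x => _) = (fun x => f x * f x ^+ n)); last first.
  by apply/funext => x; rewrite exprS.
rewrite [X in cdiff _ _ X](_ : _ = d * f z ^+ n + f z * (n%:R * f z ^+ n.-1 * d)).
  exact: cdiffM.
case: n {IH} => [|n] /=; first by rewrite expr0 !mul0r mulr0 !mulr1 addr0 mul1r.
by rewrite !exprS -[in LHS]natr1; ring.
Qed.

Lemma cdiff_cont (f : C -> C) z d : cdiff f z d -> forall e : R, 0 < e -> exists2 dl : R, 0 < dl &
    forall w, nm (w - z) < dl -> nm (f w - f z) < e.
Proof.
move=> fd e e0; have [dl dl0 H] := fd _ ltr01.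
have k0 : 0 < nm d + 1 by rewrite ltr_wpDl ?nm_ge0.
exists (Num.min dl (e / (nm d + 1))).
  by rewrite lt_min dl0 divr_gt0.
move=> w; rewrite lt_min ltr_pdivlMr // => /andP[wd we].
have := H _ wd; rewrite [z + _]addrC subrK => Hw.
have := nm_triB (f w - f z) (d * (w - z)).
rewrite nmM => Hw2; nra.
Qed.

Lemma cdiff_comp (f g : C -> C) z d d' : cdiff g z d' -> cdiff f (g z) d ->
  cdiff (fun x => f (g x)) z (d * d').
Proof.
move=> gd fd e e0.
have d1 : 0 < nm d' + 1 by rewrite ltr_wpDl ?nm_ge0.
have d2 : 0 < nm d + 1 by rewrite ltr_wpDl ?nm_ge0.
have e1 : 0 < e / 2 / (nm d' + 1) by rewrite !divr_gt0.
have e2 : 0 < Num.min 1 (e / 2 / (nm d + 1)) by rewrite lt_min ltr01 !divr_gt0.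
have [a a0 Ha] := fd _ e1; have [b b0 Hb] := gd _ e2.
exists (Num.min b (a / (nm d' + 1))); first by rewrite lt_min b0 divr_gt0.
move=> h; rewrite lt_min ltr_pdivlMr // => /andP[hb ha].
have := Hb _ hb; set u := g (z + h) - g z => Hu.
have h0 := nm_ge0 h; have d'0 := nm_ge0 d'.
have m1 : Num.min 1 (e / 2 / (nm d + 1)) <= 1 by rewrite ge_min lexx.
have m2 : Num.min 1 (e / 2 / (nm d + 1)) <= e / 2 / (nm d + 1).
  by rewrite ge_min lexx orbT.
have ule : nm u <= (nm d' + 1) * nm h.
  have := nm_triB u (d' * h); rewrite nmM; nra.
have ua : nm u < a by rewrite (le_lt_trans ule) // mulrC.
have := Ha _ ua; have -> : g z + u = g (z + h) by rewrite /u addrC subrK.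
move=> Hf.
have -> : f (g (z + h)) - f (g z) - d * d' * h =
  (f (g (z + h)) - f (g z) - d * u) + d * (u - d' * h) by ring.
apply: le_trans (nmD _ _) _; rewrite nmM.
have t1 : e / 2 / (nm d' + 1) * nm u <= e / 2 * nm h.
  rewrite -mulrA ler_pM2l ?divr_gt0 // [_^-1 * _]mulrC ler_pdivrMr //.
  by rewrite [nm h * _]mulrC.
have t2 : nm d * nm (u - d' * h) <= e / 2 * nm h.
  apply: (@le_trans _ _ ((nm d + 1) * (e / 2 / (nm d + 1) * nm h))); last first.
    by rewrite mulrA [(nm d + 1) * _]mulrC divfK // gt_eqF.
  apply: ler_pM; rewrite ?nm_ge0 ?lerDl ?ler01 //.
  by apply: le_trans Hu _; rewrite ler_wpM2r.
rewrite [X in _ <= X](_ : _ = e / 2 * nm h + e / 2 * nm h); last by field.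
by apply: lerD => //; exact: le_trans Hf t1.
Qed.

Lemma cdiffV (z : C) : z != 0 -> cdiff (fun x => x^-1) z (- z ^- 2).
Proof.
move=> z0; apply/cdiffP; apply: DeriveDef.
  by apply: derivableV => //; exact: derivable_id.
by rewrite deriveV // derive_id /GRing.scale /= mulr1.
Qed.

Lemma cdiff_inv (f : C -> C) z d : f z != 0 -> cdiff f z d ->
  cdiff (fun x => (f x)^-1) z (- f z ^- 2 * d).
Proof. by move=> fz fd; exact: (cdiff_comp fd (cdiffV fz)). Qed.

Lemma cdiff_div (f g : C -> C) z d d' : g z != 0 -> cdiff f z d -> cdiff g z d' ->
  cdiff (fun x => f x / g x) z (d / g z + f z * (- g z ^- 2 * d')).
Proof. by move=> gz fd gd; exact: (cdiffM fd (cdiff_inv gz gd)). Qed.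

Lemma cdiff_near (f g : C -> C) z d (e : R) : 0 < e ->
  (forall w, nm (w - z) < e -> f w = g w) -> cdiff f z d -> cdiff g z d.
Proof.
move=> e0 fg fd k k0; have [dl dl0 H] := fd _ k0.
exists (Num.min dl e); first by rewrite lt_min dl0.
move=> h; rewrite lt_min => /andP[hd he].
rewrite -!fg; first exact: H.
  by rewrite subrr nm0.
by rewrite addrC addKr.
Qed.

Lemma cdiff_shift (f : C -> C) a z d : cdiff f (z + a) d -> cdiff (fun x => f (x + a)) z d.
Proof.
move=> fd; have := cdiff_comp (cdiffD (cdiff_id z) (cdiffC a z)) fd.
by rewrite addr0 mulr1.
Qed.

(* A primitive, described by its increments: they are controlled by affine
   approximations of the function. *)
Lemma real_primitive (g : R -> R) (a b : R) : continuous g ->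
  exists G : R -> R, forall s t c c1 e : R, a <= s -> s <= t -> t <= b ->
    (forall x, s <= x <= t -> `|g x - (c + c1 * x)| <= e) ->
    `|G t - G s - (c * (t - s) + c1 * (t ^+ 2 - s ^+ 2) / 2)| <= e * (t - s).
Proof.
move=> cg.
have [ab|ba] := leP a b; last first.
  by exists (fun=> 0) => s t c c1 e as_ st tb; have := le_lt_trans (le_trans as_ (le_trans st tb)) ba; rewrite ltxx.
(* Integrating from [a - 1] makes both [a] and [b] interior points, as the fundamental theorem of
   calculus requires. *)
pose G := fun x : R => (\int[lebesgue_measure]_(t in [set` `[a - 1, x]%R]) g t)%R.
have Gd (x : R) : a - 1 < x -> x < b + 1 -> derivable G x 1 /\ derive1 G x = g x.
  move=> ax xb; apply: (@continuous_FTC1_closed R g (a - 1) x (b + 1)) => //.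
    apply: continuous_compact_integrable; first exact: segment_compact.
    by apply: continuous_subspaceT => y; exact: cg.
  exact: cg.
exists G => s t c c1 e as_ st tb He.
(* Once a primitive of the affine approximation is subtracted, the derivative is at most [e] in
   absolute value, and the mean value theorem concludes. *)
pose K := fun x : R => G x - (c * x + c1 / 2 * x ^+ 2).
have Kd (x : R) : x \in `[s, t]%R -> is_derive x 1 K (g x - (c + c1 * x)).
  rewrite in_itv /= => /andP[sx xt].
  have [Gx Gx'] : derivable G x 1 /\ derive1 G x = g x by apply: Gd; lra.
  have GD : is_derive x 1 G (g x) by apply: (DeriveDef Gx); rewrite -derive1E.
  apply: is_derive_eq.
  by rewrite /GRing.scale /= !mulr1; field.
have Kc : {within `[s, t], continuous K}.
  apply: derivable_within_continuous => x xst.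
  exact: (@ex_derive _ _ _ _ _ _ _ (Kd _ xst)).
have Kd' (x : R) : x \in `]s, t[%R -> is_derive x 1 K (g x - (c + c1 * x)).
  by rewrite in_itv /= => /andP[/ltW sx /ltW xt]; apply: Kd; rewrite in_itv /= sx.
have [x xst KE] := MVT_segment st Kd' Kc.
have -> : G t - G s - (c * (t - s) + c1 * (t ^+ 2 - s ^+ 2) / 2) = K t - K s.
  by rewrite /K; field.
rewrite KE normrM [`|t - s|]ger0_norm ?subr_ge0 // ler_wpM2r ?subr_ge0 //.
by apply: He; rewrite in_itv /= in xst.
Qed.

End Calculus.

(** * Goursat's lemma and local primitives *)

Section Goursat.

Definition mkc (x y : R) : C := cr x + ci * cr y.

Lemma re_mkc x y : re (mkc x y) = x.
Proof. by rewrite reD reM re_ci im_ci !re_cr im_cr mul0r mulr0 subr0 addr0. Qed.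
Lemma im_mkc x y : im (mkc x y) = y.
Proof. by rewrite imD imM re_ci im_ci !re_cr !im_cr mulr0 mul1r !add0r. Qed.
Lemma mkcE (z : C) : mkc (re z) (im z) = z.
Proof. by rewrite [RHS]reimE. Qed.

Lemma real_continuous (g : R -> R) : (forall x e : R, 0 < e -> exists2 dl : R, 0 < dl &
     forall y, `|y - x| < dl -> `|g y - g x| < e) -> continuous g.
Proof.
move=> H x; apply/cvgrPdist_lt => e e0; have [dl dl0 Hd] := H x _ e0.
apply/nbhs_ballP; exists dl => // y; rewrite /ball /= distrC => xy.
by rewrite distrC; exact: Hd.
Qed.

(** Real and imaginary parts are integrated separately, which costs the factor 2 in the error. *)
Lemma complex_primitive (f : R -> C) (a b : R) :
  (forall x e : R, a <= x <= b -> 0 < e -> exists2 dl : R, 0 < dl &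
     forall y, a <= y <= b -> `|y - x| < dl -> nm (f y - f x) < e) ->
  exists G : R -> C, forall (s t e : R) (c c1 : C), a <= s -> s <= t -> t <= b ->
    (forall x, s <= x <= t -> nm (f x - (c + c1 * cr x)) <= e) ->
    nm (G t - G s - (c * cr (t - s) + c1 * cr ((t ^+ 2 - s ^+ 2) / 2))) <= e * (t - s) *+ 2.
Proof.
move=> cf; have [ab|ba] := leP a b; last first.
  exists (fun=> 0) => s t e c c1 as_ st tb.
  by have := le_lt_trans (le_trans as_ (le_trans st tb)) ba; rewrite ltxx.
(* Clamping to [[a, b]] extends [f] continuously to the whole line, where [real_primitive]
   applies. *)
pose cl (x : R) := Num.max a (Num.min b x).
have cl_in x : a <= cl x <= b.
  by rewrite /cl le_max lexx /= ge_max ab /= ge_min lexx.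
have cl_id x : a <= x <= b -> cl x = x.
  by move=> /andP[ax xb]; rewrite /cl (min_idPr xb) (max_idPr ax).
have cl_lip x y : `|cl y - cl x| <= `|y - x|.
  have h1 := ler_norm (y - x); have h2 := ler_norm (x - y).
  rewrite distrC in h2; rewrite ler_norml /cl /Num.max /Num.min.
  by case: (ltP b y) => ?; case: (ltP b x) => ?; do ![case: ltP => ?]; lra.
have cont (p : C -> R) : (forall u v, p (u - v) = p u - p v) ->
    (forall u, `|p u| <= nm u) -> continuous (fun x => p (f (cl x))).
  move=> pB pn; apply: real_continuous => x e e0.
  have [dl dl0 H] := cf _ _ (cl_in x) e0; exists dl => // y yx.
  rewrite -pB; apply: le_lt_trans (pn _) _; apply: H => //.
  exact: le_lt_trans (cl_lip _ _) yx.
have [Gr HGr] := real_primitive a b (cont _ (@reB) (@re_le_nm)).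
have [Gi HGi] := real_primitive a b (cont _ (@imB) (@im_le_nm)).
exists (fun x => mkc (Gr x) (Gi x)) => s t e c c1 as_ st tb H.
have H' (p : C -> R) : (forall u v, p (u - v) = p u - p v) ->
  (forall u v, p (u + v) = p u + p v) -> (forall u x, p (u * cr x) = p u * x) ->
    (forall u, `|p u| <= nm u) -> forall x, s <= x <= t -> `|p (f (cl x)) - (p c + p c1 * x)| <= e.
  move=> pB pD pM pn x /andP[sx xt]; rewrite -pM -pD -pB.
  apply: le_trans (pn _) _; rewrite cl_id; first by apply: H; rewrite sx.
  by rewrite (le_trans as_ sx) (le_trans xt tb).
have reMcr (u : C) x : re (u * cr x) = re u * x by rewrite mulrC re_crM mulrC.
have imMcr (u : C) x : im (u * cr x) = im u * x by rewrite mulrC im_crM mulrC.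
have hr := HGr _ _ _ _ _ as_ st tb (H' _ (@reB) (@reD) reMcr (@re_le_nm)).
have hi := HGi _ _ _ _ _ as_ st tb (H' _ (@imB) (@imD) imMcr (@im_le_nm)).
rewrite mulr2n; apply: le_trans (nm_le_reim _) _; apply: lerD.
  rewrite reB reB !re_mkc reD !reMcr.
  by rewrite -[re c1 * _ / 2]mulrA in hr.
rewrite imB imB !im_mkc imD !imMcr.
by rewrite -[im c1 * _ / 2]mulrA in hi.
Qed.

Lemma half_pow_lt (w e : R) : 0 < e -> exists n, w / 2 ^+ n < e.
Proof.
move=> e0; pose k := Num.bound `|w / e|.
have kw : w / e < k%:R by exact: le_lt_trans (ler_norm _) (archi_boundP (normr_ge0 _)).
exists k; rewrite ltr_pdivrMr ?exprn_gt0 // mulrC -ltr_pdivrMr //.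
apply: lt_trans kw _; rewrite -natrX ltr_nat; exact: ltn_expl.
Qed.

(** Cousin's form of compactness: a property that passes from the four quarters to the whole, and
    holds for all small rectangles around each point, holds. Besides Goursat's lemma it serves
    wherever a compact plane set calls for uniformity. *)
Lemma rectangle_bisection (P : R -> R -> R -> R -> Prop) (x0 x1 y0 y1 : R) : x0 <= x1 -> y0 <= y1 ->
  (forall x x' y y', x <= x' -> y <= y' -> let mx := (x + x') / 2 in let my := (y + y') / 2 in
     P x mx y my -> P x mx my y' -> P mx x' y my -> P mx x' my y' -> P x x' y y') ->
  (forall u v, x0 <= u <= x1 -> y0 <= v <= y1 -> exists2 dl : R, 0 < dl &
     forall x x' y y', x0 <= x -> x' <= x1 -> y0 <= y -> y' <= y1 ->
       x <= u <= x' -> y <= v <= y' -> x' - x < dl -> y' - y < dl -> P x x' y y') -> P x0 x1 y0 y1.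
Proof.
move=> x01 y01 Psub Ploc; apply: contrapT => nP.
pose st := (R * R * R * R)%type.
pose bad (s : st) := [/\ s.1.1.1 <= s.1.1.2, s.1.2 <= s.2 & ~ P s.1.1.1 s.1.1.2 s.1.2 s.2].
pose lo (b : bool) (x x' : R) := if b then (x + x') / 2 else x.
pose hi (b : bool) (x x' : R) := if b then x' else (x + x') / 2.
have stepP (s : st) : exists s' : st, bad s -> bad s' /\ exists b c : bool,
    s' = (lo b s.1.1.1 s.1.1.2, hi b s.1.1.1 s.1.1.2, lo c s.1.2 s.2, hi c s.1.2 s.2).
  have [bs|nb] := pselect (bad s); last by exists s.
  case: bs => sx sy nPs.
  have [[b c] nPbc] : exists bc : bool * bool,
      ~ P (lo bc.1 s.1.1.1 s.1.1.2) (hi bc.1 s.1.1.1 s.1.1.2)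
          (lo bc.2 s.1.2 s.2) (hi bc.2 s.1.2 s.2).
    apply: contrapT => /forallNP H; apply: nPs.
    apply: Psub => //=; apply: contrapT.
    - exact: H (false, false).
    - exact: H (false, true).
    - exact: H (true, false).
    - exact: H (true, true).
  exists (lo b s.1.1.1 s.1.1.2, hi b s.1.1.1 s.1.1.2, lo c s.1.2 s.2, hi c s.1.2 s.2).
  move=> _; split; last by exists b, c.
  by split=> //=; rewrite /lo /hi; [case: (b)|case: (c)]; lra.
have [nx nxP] := choice stepP.
pose S n : st := iter n nx (x0, x1, y0, y1).
have S0 : bad (S 0%N) by split.
have Sbad n : bad (S n) by elim: n => [//|n IH]; case: (nxP _ IH).
have SS n : exists b c : bool, S n.+1 = (lo b (S n).1.1.1 (S n).1.1.2, hi b (S n).1.1.1 (S n).1.1.2,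
     lo c (S n).1.2 (S n).2, hi c (S n).1.2 (S n).2).
  by case: (nxP _ (Sbad n)).
have mono n : [/\ (S n).1.1.1 <= (S n.+1).1.1.1, (S n.+1).1.1.2 <= (S n).1.1.2,
   (S n).1.2 <= (S n.+1).1.2 & (S n.+1).2 <= (S n).2] /\
   ((S n.+1).1.1.2 - (S n.+1).1.1.1 = ((S n).1.1.2 - (S n).1.1.1) / 2 /\
   (S n.+1).2 - (S n.+1).1.2 = ((S n).2 - (S n).1.2) / 2).
  have [b [c ->]] := SS n; have [/= + + _] := Sbad n.
  case: (S n) => [[[s1 s2] s3] s4] /=; clear => sx sy.
  by rewrite /lo /hi; case: b; case: c; split; split; lra.
have width n : (S n).1.1.2 - (S n).1.1.1 = (x1 - x0) / 2 ^+ n /\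
               (S n).2 - (S n).1.2 = (y1 - y0) / 2 ^+ n.
  elim: n => [|n [IH1 IH2]]; first by rewrite expr0 !divr1.
  have [_ [-> ->]] := mono n.
  by rewrite IH1 IH2 exprS; split; field; rewrite expf_neq0 //.
have limpt (l h : nat -> R) : (forall n, l n <= l n.+1) -> (forall n, h n.+1 <= h n) ->
    (forall n, l n <= h n) -> exists u, forall n, l n <= u <= h n.
  move=> ll hh lh.
  have lm n m : l n <= l (n + m)%N.
    by elim: m => [|m IH]; rewrite ?addn0 // addnS (le_trans IH).
  have hm n m : h (n + m)%N <= h n.
    by elim: m => [|m IH]; rewrite ?addn0 // addnS (le_trans _ IH).
  have lh' n m : l n <= h m.
    by apply: le_trans (lm n m) _; apply: le_trans (lh _) _; rewrite addnC.
  exists (sup (range l)) => n; apply/andP; split.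
    apply: ub_le_sup; last by exists n.
    by exists (h 0%N) => _ [m _ <-].
  apply: ge_sup; first by exists (l 0%N), 0%N.
  by move=> _ [m _ <-].
(* The nested bad rectangles share a point; the local hypothesis there contradicts their badness
   once they are small. *)
have [u Hu] := limpt (fun n => (S n).1.1.1) (fun n => (S n).1.1.2)
  (fun n => let: conj (And4 a _ _ _) _ := mono n in a)
  (fun n => let: conj (And4 _ a _ _) _ := mono n in a)
  (fun n => let: And3 a _ _ := Sbad n in a).
have [v Hv] := limpt (fun n => (S n).1.2) (fun n => (S n).2)
  (fun n => let: conj (And4 _ _ a _) _ := mono n in a)
  (fun n => let: conj (And4 _ _ _ a) _ := mono n in a)
  (fun n => let: And3 _ a _ := Sbad n in a).
have [dl dl0 Hdl] := Ploc u v (Hu 0%N) (Hv 0%N).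
have [n Hn] := half_pow_lt ((x1 - x0) + (y1 - y0)) dl0.
have inbox m : [/\ x0 <= (S m).1.1.1, (S m).1.1.2 <= x1, y0 <= (S m).1.2 & (S m).2 <= y1].
  elim: m => [|m [i1 i2 i3 i4]]; first by split.
  by have [[j1 j2 j3 j4] _] := mono m; split; lra.
have [i1 i2 i3 i4] := inbox n; have [_ _] := Sbad n; apply.
have [w1 w2] := width n.
have p2 : 0 < (2 ^+ n)^-1 :> R by rewrite invr_gt0 exprn_gt0.
by apply: Hdl => //; rewrite ?w1 ?w2; nra.
Qed.

Lemma segment_estimate (G phi : R -> C) (a b u v k : R) (cc : C) : (forall (s t e : R) (c c1 : C), a <= s -> s <= t -> t <= b ->
  (forall x, s <= x <= t -> nm (phi x - (c + c1 * cr x)) <= e) ->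
  nm (G t - G s - (c * cr (t - s) + c1 * cr ((t ^+ 2 - s ^+ 2) / 2))) <= e * (t - s) *+ 2) ->
  a <= u <= b -> a <= v <= b -> (forall s, `|s - u| <= `|v - u| -> nm (phi s - cc) <= k) ->
  nm (G v - G u - cc * cr (v - u)) <= k * `|v - u| *+ 2.
Proof.
move=> HG au av Hp; have [uv|/ltW uv] := leP u v.
  have := HG u v k cc 0; rewrite mul0r addr0 ger0_norm ?subr_ge0 //; apply; try lra.
  by move=> s /andP[us sv]; rewrite mul0r addr0; apply: Hp; rewrite !ger0_norm ?subr_ge0 // lerD2r.
rewrite ler0_norm ?subr_le0 // opprB.
have -> : G v - G u - cc * cr (v - u) = - (G u - G v - cc * cr (u - v)) by rewrite !crB; ring.
have := HG v u k cc 0; rewrite mul0r addr0 nmN; apply; try lra.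
by move=> s /andP[us sv]; rewrite mul0r addr0; apply: Hp; rewrite !ler0_norm ?subr_le0 // lerN2 lerD2r.
Qed.

Section Rectangle.
Variables (f : C -> C) (x0 x1 y0 y1 : R).
Hypothesis hf : forall x y, x0 <= x <= x1 -> y0 <= y <= y1 -> exists d, cdiff f (mkc x y) d.

Let fcont x y : x0 <= x <= x1 -> y0 <= y <= y1 -> forall e : R, 0 < e -> exists2 dl : R, 0 < dl &
    forall x' y', `|x' - x| < dl -> `|y' - y| < dl -> nm (f (mkc x' y') - f (mkc x y)) < e.
Proof.
move=> hx hy e e0; have [d fd] := hf hx hy.
have [dl dl0 H] := cdiff_cont fd e0; exists (dl / 2); first by rewrite divr_gt0.
move=> x' y' xx yy; apply: H; apply: le_lt_trans (nm_le_reim _) _.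
rewrite reB imB !re_mkc !im_mkc; lra.
Qed.

(** [H y] and [V x] are primitives along horizontal and vertical segments. Differentiability at a
    point makes the boundary integral of a small rectangle around it negligible against its area
    scale, so by bisection all boundary integrals vanish, and the integral along a two-segment path
    is a primitive. *)
Lemma goursat_primitive : exists F : C -> C, forall x y,
  x0 < x < x1 -> y0 < y < y1 -> cdiff F (mkc x y) (f (mkc x y)).
Proof.
have exH (y : R) : exists G : R -> C, y0 <= y <= y1 ->
  forall (s t e : R) (c c1 : C), x0 <= s -> s <= t -> t <= x1 ->
    (forall x, s <= x <= t -> nm (f (mkc x y) - (c + c1 * cr x)) <= e) ->
    nm (G t - G s - (c * cr (t - s) + c1 * cr ((t ^+ 2 - s ^+ 2) / 2))) <= e * (t - s) *+ 2.
  have [hy|ny] := boolP (y0 <= y <= y1); last by exists (fun=> 0).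
  have [|G HG] := @complex_primitive (fun x => f (mkc x y)) x0 x1; last by exists G.
  move=> x e hx e0; have [dl dl0 H] := fcont hx hy e0.
  by exists dl => // x' _ hx'; apply: H; rewrite // subrr normr0.
have exV (x : R) : exists G : R -> C, x0 <= x <= x1 ->
  forall (s t e : R) (c c1 : C), y0 <= s -> s <= t -> t <= y1 ->
    (forall y, s <= y <= t -> nm (f (mkc x y) - (c + c1 * cr y)) <= e) ->
    nm (G t - G s - (c * cr (t - s) + c1 * cr ((t ^+ 2 - s ^+ 2) / 2))) <= e * (t - s) *+ 2.
  have [hx|nx] := boolP (x0 <= x <= x1); last by exists (fun=> 0).
  have [|G HG] := @complex_primitive (fun y => f (mkc x y)) y0 y1; last by exists G.
  move=> y e hy e0; have [dl dl0 H] := fcont hx hy e0.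
  by exists dl => // y' _ hy'; apply: H; rewrite // subrr normr0.
have [H HH] := choice exH; have [V HV] := choice exV.
(* The integral of [f] along the boundary of the rectangle, counterclockwise. *)
pose B x x' y y' := (H y x' - H y x) + ci * (V x' y' - V x' y)
   - (H y' x' - H y' x) - ci * (V x y' - V x y).
have B0 x x' y y' : x0 <= x -> x <= x' -> x' <= x1 -> y0 <= y -> y <= y' -> y' <= y1 ->
    B x x' y y' = 0.
  move=> hx0 hxx hx1 hy0 hyy hy1.
  suff Bs (e : R) : 0 < e -> nm (B x x' y y') <= e * ((x' - x) + (y' - y)) ^+ 2.
    apply/eqP; rewrite -nm_eq0 eq_le nm_ge0 andbT; apply/ler_addgt0Pr => e e0.
    rewrite add0r; pose L := ((x' - x) + (y' - y)) ^+ 2 + 1.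
    have L0 : 0 < L by rewrite ltr_wpDl ?sqr_ge0.
    apply: le_trans (Bs (e / L) _) _; first exact: divr_gt0.
    by rewrite mulrAC ler_pdivrMr // ler_pM2l // lerDl ler01.
  (* The bound is additive under quartering: a quarter has half the perimeter, hence a fourth of the
     bound. *)
  move=> e0; apply: (rectangle_bisection (P := fun x x' y y' =>
    nm (B x x' y y') <= e * ((x' - x) + (y' - y)) ^+ 2)) => //.
    move=> a a' b b' aa bb /=; set m := (a + a') / 2; set k := (b + b') / 2.
    move=> b1 b2 b3 b4.
    have -> : B a a' b b' = (B a m b k + B a m k b') + (B m a' b k + B m a' k b').
      by rewrite /B; ring.
    apply: le_trans (nmD _ _) _.
    have t1 := nmD (B a m b k) (B a m k b').
    have t2 := nmD (B m a' b k) (B m a' k b').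
    apply: le_trans (lerD (le_trans t1 (lerD b1 b2)) (le_trans t2 (lerD b3 b4))) _.
    by rewrite le_eqVlt /m /k; apply/orP; left; apply/eqP; field.
  move=> u v /andP[hu1 hu2] /andP[hv1 hv2].
  have hu : x0 <= u <= x1 by lra.
  have hv : y0 <= v <= y1 by lra.
  have [d fd] := hf hu hv.
  (* An affine function integrates to 0 around the rectangle. The remainder, at most [e / 4 * L],
     counts twice because of real and imaginary parts, along a perimeter [2 * L]: in all
     [e * L ^+ 2]. *)
  have e4 : 0 < e / 4 by rewrite divr_gt0.
  have [dl dl0 Hd] := fd _ e4; exists (dl / 2); first by rewrite divr_gt0.
  move=> a a' b b' ha ha' hb hb' /andP[au ua'] /andP[bv vb'] da db.
  set L := (a' - a) + (b' - b); set z := mkc u v; set A := f z - d * z.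
  have key s t : a <= s <= a' -> b <= t <= b' -> nm (f (mkc s t) - (A + d * mkc s t)) <= e / 4 * L.
    move=> hs ht; have hL : nm (mkc s t - z) <= L.
      apply: le_trans (nm_le_reim _) _; rewrite reB imB !re_mkc !im_mkc /L.
      by rewrite lerD // ler_norml; lra.
    have hl : nm (mkc s t - z) < dl by apply: le_lt_trans hL _; rewrite /L; lra.
    have := Hd _ hl; rewrite [mkc u v + _]addrC subrK => Hd'.
    have -> : f (mkc s t) - (A + d * mkc s t) = f (mkc s t) - f z - d * (mkc s t - z).
      by rewrite /A; ring.
    by apply: le_trans Hd' _; rewrite ler_pM2l.
  have hest t : b <= t <= b' -> nm (H t a' - H t a - ((A + d * (ci * cr t)) * cr (a' - a)
       + d * cr ((a' ^+ 2 - a ^+ 2) / 2))) <= e / 4 * L * (a' - a) *+ 2.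
    move=> ht; have [t1 t2] := andP ht; apply: HH.
    - by rewrite (le_trans (le_trans hy0 hb) t1) (le_trans t2 (le_trans hb' hy1)).
    - exact: le_trans hx0 ha.
    - exact: le_trans au ua'.
    - exact: le_trans ha' hx1.
    move=> s hs; have := key s t hs ht; congr (nm (_ - _) <= _).
    by rewrite /mkc; ring.
  have vest s : a <= s <= a' -> nm (V s b' - V s b - ((A + d * cr s) * cr (b' - b)
       + d * ci * cr ((b' ^+ 2 - b ^+ 2) / 2))) <= e / 4 * L * (b' - b) *+ 2.
    move=> hs; have [t1 t2] := andP hs; apply: HV.
    - by rewrite (le_trans (le_trans hx0 ha) t1) (le_trans t2 (le_trans ha' hx1)).
    - exact: le_trans hy0 hb.
    - exact: le_trans bv vb'.
    - exact: le_trans hb' hy1.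
    move=> t ht; have := key s t hs ht; congr (nm (_ - _) <= _).
    by rewrite /mkc; ring.
  have hb1 : b <= b <= b' by lra.
  have hb2 : b <= b' <= b' by lra.
  have ha1 : a <= a <= a' by lra.
  have ha2 : a <= a' <= a' by lra.
  have := hest _ hb1; have := hest _ hb2; have := vest _ ha1; have := vest _ ha2.
  set V1 := _ - _ - _; set V0 := _ - _ - _; set H1 := _ - _ - _; set H0 := _ - _ - _.
  move=> v1 v0 h1 h0.
  have -> : B a a' b b' = H0 + ci * V1 - H1 - ci * V0.
    rewrite /B /H0 /H1 /V0 /V1 !crB.
    set i := ci; set X := cr ((a' ^+ 2 - _) / 2); set Y := cr ((b' ^+ 2 - _) / 2).
    by ring.
  apply: le_trans (nmB _ _) _; rewrite nmM nm_ci mul1r.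
  have q1 := nmB (H0 + ci * V1) H1.
  have q2 := nmD H0 (ci * V1); rewrite nmM nm_ci mul1r in q2.
  have L0 : 0 <= L by rewrite /L; lra.
  rewrite mulr2n in v1 v0 h1 h0.
  have -> : e * L ^+ 2 = e / 4 * L * (a' - a) + e / 4 * L * (a' - a) +
    (e / 4 * L * (b' - b) + e / 4 * L * (b' - b)) + (e / 4 * L * (a' - a) + e / 4 * L * (a' - a)) +
    (e / 4 * L * (b' - b) + e / 4 * L * (b' - b)) by rewrite /L; field.
  lra.
have inI (a b a' b' : R) : a' < b < b' -> `|a - b| < Num.min (b - a') (b' - b) -> a' <= a <= b'.
  by move=> hb; rewrite lt_min ltr_norml ltr_norml => /andP[/andP[? ?] /andP[? ?]]; lra.
pose p x y := H y0 x + ci * (V x y - V x y0).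
exists (fun z => p (re z) (im z)) => x y hx hy e e0.
rewrite re_mkc im_mkc.
have e4 : 0 < e / 4 by rewrite divr_gt0.
have hx' : x0 <= x <= x1 by lra.
have hy' : y0 <= y <= y1 by lra.
have [dl dl0 Hd] := fcont hx' hy' e4.
have [/andP[gx1 gx2] /andP[gy1 gy2]] := (hx, hy).
exists (Num.min dl (Num.min (Num.min (x - x0) (x1 - x)) (Num.min (y - y0) (y1 - y)))).
  by rewrite !lt_min dl0 !subr_gt0 gx1 gx2 gy1 gy2.
move=> h; rewrite [in X in X -> _]lt_min [in X in X -> _]lt_min => /andP[hd /andP[h1 h2]].
rewrite reD imD re_mkc im_mkc.
set x' := x + re h; set y' := y + im h.
have rex : `|x' - x| <= nm h by rewrite /x' addrC addKr re_le_nm.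
have imy : `|y' - y| <= nm h by rewrite /y' addrC addKr im_le_nm.
have ix' : x0 <= x' <= x1 by apply: inI hx _; exact: le_lt_trans rex h1.
have iy' : y0 <= y' <= y1 by apply: inI hy _; exact: le_lt_trans imy h2.
have [[a1 a2] [a3 a4] [a5 a6]] := And3 (andP hx') (andP ix') (andP hy').
(* The vanishing boundary integral moves the horizontal increment from height [y0] to height [y];
   the case split is the orientation of the rectangle. *)
have BE : ci * (V x' y - V x' y0) - ci * (V x y - V x y0) = (H y x' - H y x) - (H y0 x' - H y0 x).
  have [xx|/ltW xx] := leP x x'.
    have : B x x' y0 y = 0 by exact: B0.
    rewrite /B => B00; apply/eqP; rewrite -subr_eq0 -B00; apply/eqP; ring.
  have : B x' x y0 y = 0 by exact: B0.
  rewrite /B => B00; apply/eqP; rewrite -subr_eq0 -oppr_eq0 -B00; apply/eqP; ring.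
have -> : p x' y' - p x y - f (mkc x y) * h = (H y x' - H y x - f (mkc x y) * cr (x' - x)) +
   ci * (V x' y' - V x' y - f (mkc x y) * cr (y' - y)).
  have -> : p x' y' - p x y = (H y0 x' - H y0 x) +
     (ci * (V x' y - V x' y0) - ci * (V x y - V x y0)) + ci * (V x' y' - V x' y).
    by rewrite /p; ring.
  have -> : f (mkc x y) * h = f (mkc x y) * (cr (x' - x) + ci * cr (y' - y)).
    by congr (_ * _); rewrite /x' /y' [x + _]addrC [y + _]addrC !addrK -reimE.
  by rewrite BE; ring.
have Hest : nm (H y x' - H y x - f (mkc x y) * cr (x' - x)) <= e / 4 * `|x' - x| *+ 2.
  apply: (segment_estimate (HH y hy') hx' ix') => s sx.
  by rewrite ltW // Hd ?subrr ?normr0 // (le_lt_trans (le_trans sx rex)).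
have Vest : nm (V x' y' - V x' y - f (mkc x y) * cr (y' - y)) <= e / 4 * `|y' - y| *+ 2.
  apply: (segment_estimate (HV x' ix') hy' iy') => s sy.
  by rewrite ltW // Hd // ?(le_lt_trans rex) // (le_lt_trans (le_trans sy imy)).
apply: le_trans (nmD _ _) _; rewrite nmM nm_ci mul1r.
rewrite mulr2n in Hest; rewrite mulr2n in Vest.
apply: le_trans (lerD Hest Vest) _.
have := ler_wpM2l (ltW e4) rex; have := ler_wpM2l (ltW e4) imy; lra.
Qed.
End Rectangle.

Lemma holomorphic_local_primitive (f : C -> C) (a : C) (r : R) : 0 < r ->
  (forall z, nm (z - a) < r -> exists d, cdiff f z d) ->
  exists F : C -> C, forall z, nm (z - a) < r / 4 -> cdiff F z (f z).
Proof.
move=> r0 hf.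
have [|F HF] := @goursat_primitive f (re a - r / 4) (re a + r / 4) (im a - r / 4) (im a + r / 4).
  move=> x y hx hy; apply: hf; apply: le_lt_trans (nm_le_reim _) _.
  rewrite reB imB re_mkc im_mkc (@le_lt_trans _ _ (r / 4 + r / 4)) //; last by lra.
  by rewrite lerD // ler_norml; lra.
exists F => z za; rewrite -(mkcE z); apply: HF.
  by have := le_lt_trans (re_le_nm _) za; rewrite reB ltr_norml; lra.
by have := le_lt_trans (im_le_nm _) za; rewrite imB ltr_norml; lra.
Qed.
End Goursat.

(** * Means over the unit circle *)

Section CircleMean.

Lemma exists_ultra_nat : exists U : set_system nat, UltraFilter U /\ (\oo `<=` U).
Proof. exact: ultraFilterLemma. Qed.

(** Along a fixed ultrafilter finer than [\oo] every bounded sequence has a limit. Means over the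
    circle thus exist for all bounded functions, and linearity needs no regularity of the
    integrand. *)
Definition ultra_nat := projT1 (cid exists_ultra_nat).
Let U := ultra_nat.
Lemma ultra_natP : UltraFilter U. Proof. by have [] := projT2 (cid exists_ultra_nat). Qed.
Local Instance U_ultra : UltraFilter U := ultra_natP.
Local Instance U_proper : ProperFilter U := ultra_proper.
Lemma ultra_ge (A : set nat) n0 : (forall n, (n0 <= n)%N -> A n) -> U A.
Proof.
move=> H; have [_] := projT2 (cid exists_ultra_nat); apply.
by exists n0 => // n /= ; exact: H.
Qed.

Definition is_ulim (u : nat -> C) (l : C) := forall e : R, 0 < e -> U [set n | nm (u n - l) < e].

Lemma is_ulim_unique u l l' : is_ulim u l -> is_ulim u l' -> l = l'.
Proof.
move=> ul ul'; apply/eqP; rewrite -subr_eq0 -nm_eq0 eq_le nm_ge0 andbT.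
apply/ler_addgt0Pr => e e0; rewrite add0r.
have e2 : 0 < e / 2 by rewrite divr_gt0.
have [n [/= a b]] := filter_ex (filterI (ul _ e2) (ul' _ e2)).
have := nm_tri (u n) l l'; rewrite [nm (l - u n)]nmC; lra.
Qed.

Lemma real_ulim (u : nat -> R) (K : R) : (forall n, `|u n| <= K) ->
  exists l : R, forall e, 0 < e -> U [set n | `|u n - l| < e].
Proof.
move=> uK; pose S := [set x : R | U [set n | x <= u n]].
have SK : has_sup S.
  split; first exists (- K).
    by apply: (@ultra_ge _ 0%N) => n _ /=; have := uK n; rewrite ler_norml => /andP[].
  exists K => x Sx; have [n /= xn] := filter_ex Sx.
  by apply: le_trans xn _; exact: le_trans (ler_norm _) (uK n).
exists (sup S) => e e0.
have e2 : 0 < e / 2 by rewrite divr_gt0.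
have [x Sx xs] := sup_adherent e2 SK.
have U1 : U (~` [set n | sup S + e / 2 <= u n]).
  have [US|//] := in_ultra_setVsetC [set n | sup S + e / 2 <= u n] U_ultra.
  have h : sup S + e / 2 <= sup S by apply: (ub_le_sup SK.2); exact: US.
  by move: h; rewrite gerDl leNgt e2.
apply: filterS (filterI Sx U1) => n /= [xu /negP]; rewrite -ltNge => us.
by rewrite ltr_norml; lra.
Qed.

Definition ulim (u : nat -> C) : C := xget 0 [set l | is_ulim u l].

Lemma ulim_eq u l : is_ulim u l -> ulim u = l.
Proof.
by move=> ul; apply: is_ulim_unique (ul); exact: (xgetI 0 (P := [set l | is_ulim u l]) ul).
Qed.

Lemma ulimP u (K : R) : (forall n, nm (u n) <= K) -> is_ulim u (ulim u).
Proof.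
move=> uK; suff [l ul] : exists l, is_ulim u l by rewrite (ulim_eq ul).
have [a Ha] := @real_ulim (fun n => re (u n)) K (fun n => le_trans (re_le_nm _) (uK n)).
have [b Hb] := @real_ulim (fun n => im (u n)) K (fun n => le_trans (im_le_nm _) (uK n)).
exists (mkc a b) => e e0.
have e2 : 0 < e / 2 by rewrite divr_gt0.
apply: filterS (filterI (Ha _ e2) (Hb _ e2)) => n /= [h1 h2].
apply: le_lt_trans (nm_le_reim _) _; rewrite reB imB re_mkc im_mkc; lra.
Qed.

(** Primitive [2 ^ n]-th roots of unity, each a square root of the preceding one. Taking the root
    with non-negative real part makes them tend to 1, so that consecutive powers become close on the
    circle. *)
Fixpoint dyroot (n : nat) : C := if n is n'.+1 then let w := dyroot n' in if n' is 0%N then -1 else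
    if 0 <= re (sqrtC w) then sqrtC w else - sqrtC w else 1.

Lemma dyroot_sqr n : dyroot n.+1 ^+ 2 = dyroot n.
Proof.
case: n => [|n]; first by rewrite sqrrN expr1n.
rewrite [LHS]/=; rewrite -/(dyroot n.+1).
by case: ifP => _; rewrite ?sqrrN sqrtCK.
Qed.

Lemma dyroot_re n : 0 <= re (dyroot n.+2).
Proof.
rewrite [X in re X]/=; rewrite -/(dyroot n.+1).
by case: ifPn => //; rewrite -ltNge reN oppr_ge0 => /ltW.
Qed.

Lemma dyroot_exp n k : dyroot (n + k) ^+ (2 ^ k) = dyroot n.
Proof.
elim: k => [|k IH]; first by rewrite addn0 expn0 expr1.
by rewrite addnS expnS exprM dyroot_sqr.
Qed.

Lemma dyroot1 n : dyroot n ^+ (2 ^ n) = 1.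
Proof. by rewrite -[n in dyroot n]add0n dyroot_exp. Qed.

Lemma nm_unit_root (z : C) n : (0 < n)%N -> z ^+ n = 1 -> nm z = 1.
Proof.
move=> n0 zn; have := nmX z n; rewrite zn nm1 => /esym/eqP.
by rewrite pexpr_eq1 ?nm_ge0 // => /eqP.
Qed.

Lemma nm_dyroot n : nm (dyroot n) = 1.
Proof. by apply: (nm_unit_root _ (dyroot1 n)); rewrite expn_gt0. Qed.

Lemma nm_dyrootX n j : nm (dyroot n ^+ j) = 1.
Proof. by rewrite nmX nm_dyroot expr1n. Qed.

(** From [w ^+ 2 - 1 = (w - 1) * (w + 1)], where [nm (w + 1) ^+ 2 >= 2] because the real part of [w]
    is non-negative: each step at least halves the square of the distance to 1. *)
Lemma dyroot_close n : nm (dyroot n.+1 - 1) ^+ 2 <= 4 / 2 ^+ n.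
Proof.
elim: n => [|n IH].
  have -> : dyroot 1 - 1 = - cr 2 by rewrite cr_nat -opprD.
  by rewrite nmN nm_cr ger0_norm // expr0 divr1 -natrX.
have := dyroot_sqr n.+1; set w := dyroot n.+2; set v := dyroot n.+1 in IH * => wv.
have -> : nm (w - 1) ^+ 2 = nm (v - 1) ^+ 2 / nm (w + 1) ^+ 2.
  rewrite -wv -[w ^+ 2 - 1]/(w ^+ 2 - 1) -{2}[1](expr1n _ 2) subr_sqr nmM exprMn mulfK //.
  rewrite expf_neq0 // nm_eq0; apply/eqP => w1.
  have := dyroot_re n; rewrite -/w => wre.
  have : re (w + 1) = 0 by rewrite w1.
  by rewrite reD re1; lra.
have w2 : 2 <= nm (w + 1) ^+ 2.
  have wn : nm w ^+ 2 = 1 by rewrite nm_dyroot expr1n.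
  rewrite nm_sqr in wn; rewrite nm_sqr reD imD re1 im1 addr0.
  have := dyroot_re n; rewrite -/w => wre; nra.
rewrite ler_pdivrMr ?(lt_le_trans _ w2) //; apply: le_trans IH _.
rewrite exprS invfM mulrA; set q := (2 ^+ n)^-1.
have : 0 <= q by rewrite invr_ge0 exprn_ge0.
nra.
Qed.

Lemma dyroot_near (e : R) : 0 < e -> exists n0, forall n, (n0 <= n)%N -> nm (dyroot n - 1) < e.
Proof.
move=> e0; have e2 : 0 < e ^+ 2 by rewrite exprn_gt0.
have [n0 H] := half_pow_lt 4 e2; exists n0.+1 => -[//|n nn0].
rewrite -(ltr_pXn2r (n := 2)) // ?nnegrE ?nm_ge0 ?ltW //.
apply: le_lt_trans (dyroot_close n) _; apply: le_lt_trans H.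
rewrite ler_pM2l // lef_pV2 ?posrE ?exprn_gt0 //.
by apply: ler_weXn2l => //; rewrite ler1n.
Qed.

Definition avg (n : nat) (f : C -> C) : C := cr (2 ^+ n)^-1 * \sum_(j < 2 ^ n) f (dyroot n ^+ j).

Definition bdc (f : C -> C) := exists K : R, forall z, nm z = 1 -> nm (f z) <= K.

Lemma avg_bound n f (K : R) : (forall z, nm z = 1 -> nm (f z) <= K) -> nm (avg n f) <= K.
Proof.
move=> H; rewrite /avg nmM nm_cr ger0_norm ?invr_ge0 ?exprn_ge0 //.
rewrite mulrC ler_pdivrMr ?exprn_gt0 //.
apply: le_trans (nm_sum _ _ _) _.
apply: (@le_trans _ _ (\sum_(j < 2 ^ n) K)).
  by apply: ler_sum => j _; apply: H; rewrite nm_dyrootX.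
by rewrite sumr_const card_ord -[K *+ _]mulr_natr natrX.
Qed.

Lemma avgD n f g : avg n (fun z => f z + g z) = avg n f + avg n g.
Proof. by rewrite /avg big_split mulrDr. Qed.
Lemma avgM n k f : avg n (fun z => k * f z) = k * avg n f.
Proof. by rewrite /avg -mulr_sumr mulrCA. Qed.
Lemma avg_ext n f g : (forall z, nm z = 1 -> f z = g z) -> avg n f = avg n g.
Proof. by move=> H; congr (_ * _); apply: eq_bigr => j _; apply: H; rewrite nm_dyrootX. Qed.
Lemma avg_cst n k : avg n (fun=> k) = k.
Proof.
rewrite /avg sumr_const card_ord -[k *+ _]mulr_natl mulrA -[RHS]mul1r; congr (_ * _).
by rewrite -(cr_nat) -crM natrX mulVf ?cr1 // expf_neq0.
Qed.

(** The normalized integral over the unit circle, as a limit of dyadic Riemann sums along the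
    ultrafilter. *)
Definition cmean (f : C -> C) : C := ulim (fun n => avg n f).

Lemma cmeanP f : bdc f -> is_ulim (fun n => avg n f) (cmean f).
Proof. by move=> [K HK]; apply: (@ulimP _ K) => n; exact: avg_bound. Qed.

Lemma cmean_ext f g : (forall z, nm z = 1 -> f z = g z) -> cmean f = cmean g.
Proof. by move=> H; congr ulim; apply/funext => n; exact: avg_ext. Qed.

Lemma cmean_near f l : (forall e : R, 0 < e -> exists n0, forall n, (n0 <= n)%N ->
  nm (avg n f - l) < e) -> cmean f = l.
Proof. by move=> H; apply: ulim_eq => e /H [n0 Hn]; exact: ultra_ge Hn. Qed.

Lemma cmeanD f g : bdc f -> bdc g -> cmean (fun z => f z + g z) = cmean f + cmean g.
Proof.
move=> bf bg; apply: ulim_eq => e e0.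
have e2 : 0 < e / 2 by rewrite divr_gt0.
apply: filterS (filterI (cmeanP bf e2) (cmeanP bg e2)) => n /= [h1 h2].
rewrite avgD opprD addrACA; apply: le_lt_trans (nmD _ _) _; lra.
Qed.

Lemma cmeanM k f : bdc f -> cmean (fun z => k * f z) = k * cmean f.
Proof.
move=> bf; apply: ulim_eq => e e0.
have k1 : 0 < nm k + 1 by rewrite ltr_wpDl ?nm_ge0.
have e2 : 0 < e / (nm k + 1) by rewrite divr_gt0.
apply: filterS (cmeanP bf e2) => n /=; rewrite ltr_pdivlMr // => h.
rewrite avgM -mulrBr nmM; apply: le_lt_trans h.
by rewrite mulrC ler_wpM2l ?nm_ge0 // lerDl ler01.
Qed.

Lemma cmean_cst k : cmean (fun=> k) = k.
Proof. by apply: cmean_near => e e0; exists 0%N => n _; rewrite avg_cst subrr nm0. Qed.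

Lemma bdcM f g : bdc f -> bdc g -> bdc (fun z => f z * g z).
Proof.
move=> [K HK] [L HL]; exists (K * L) => z z1; rewrite nmM.
by apply: ler_pM; rewrite ?nm_ge0 ?HK ?HL.
Qed.
Lemma bdcD f g : bdc f -> bdc g -> bdc (fun z => f z + g z).
Proof.
move=> [K HK] [L HL]; exists (K + L) => z z1.
by apply: le_trans (nmD _ _) (lerD _ _); rewrite ?HK ?HL.
Qed.
Lemma bdc_cst k : bdc (fun=> k). Proof. by exists (nm k). Qed.
Lemma bdc_id : bdc id. Proof. by exists 1 => z ->. Qed.
Lemma bdcMl k f : bdc f -> bdc (fun z => k * f z).
Proof. by move=> /(bdcM (bdc_cst k)). Qed.
Lemma bdcB f g : bdc f -> bdc g -> bdc (fun z => f z - g z).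
Proof.
move=> [K HK] [L HL]; exists (K + L) => z z1.
by apply: le_trans (nmB _ _) (lerD _ _); rewrite ?HK ?HL.
Qed.
Lemma cmeanB f g : bdc f -> bdc g -> cmean (fun z => f z - g z) = cmean f - cmean g.
Proof.
move=> bf bg; rewrite -[- cmean g]mulN1r -cmeanM // -cmeanD //; last exact: bdcMl.
by apply: cmean_ext => z _; rewrite mulN1r.
Qed.

Lemma cmean_bound f (K : R) : (forall z, nm z = 1 -> nm (f z) <= K) -> nm (cmean f) <= K.
Proof.
move=> H; have bf : bdc f by exists K.
apply/ler_addgt0Pr => e e0; have [n /= h] := filter_ex (cmeanP bf e0).
have := nm_triB (cmean f) (avg n f); rewrite nmC; have := avg_bound n H; lra.
Qed.

Lemma cmean_real f : bdc f -> (forall z, nm z = 1 -> im (f z) = 0) -> im (cmean f) = 0.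
Proof.
move=> bf H; apply/eqP; rewrite -normr_eq0 eq_le normr_ge0 andbT.
apply/ler_addgt0Pr => e e0; rewrite add0r.
have [n /= h] := filter_ex (cmeanP bf e0).
have : im (avg n f) = 0.
  rewrite im_crM im_sum big1 ?mulr0 // => j _.
  by rewrite H // nm_dyrootX.
move=> h0; have h1 := im_le_nm (avg n f - cmean f).
by rewrite imB h0 sub0r normrN in h1; apply: le_trans h1 (ltW h).
Qed.

Lemma cmean_re_ge0 f : bdc f -> (forall z, nm z = 1 -> 0 <= re (f z)) -> 0 <= re (cmean f).
Proof.
move=> bf H; apply/ler_addgt0Pr => e e0.
have [n /= h] := filter_ex (cmeanP bf e0).
have : 0 <= re (avg n f).
  rewrite re_crM re_sum mulr_ge0 ?invr_ge0 ?exprn_ge0 //.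
  by apply: sumr_ge0 => j _; rewrite H // nm_dyrootX.
have := re_le (avg n f - cmean f); rewrite reB; lra.
Qed.

(** Primitivity. For odd [k] the power [2 ^ n] of [dyroot n.+1 ^+ k] is -1; for even [k] the
    exponent is halved and the level drops by one. *)
Lemma dyroot_gt n k : (0 < k < 2 ^ n)%N -> dyroot n ^+ k != 1.
Proof.
elim: n k => [|n IH] k; first by rewrite expn0 ltnS => /andP[]; case: k.
move=> /andP[k0 kn]; apply/eqP => dk.
have [ko|ke] := boolP (odd k).
  have d1 : dyroot n.+1 ^+ (2 ^ n) = -1.
    by rewrite -add1n dyroot_exp.
  have : (dyroot n.+1 ^+ k) ^+ (2 ^ n) = 1 by rewrite dk expr1n.
  rewrite -exprM mulnC exprM d1 -signr_odd ko expr1 => /eqP.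
  by rewrite eq_sym -subr_eq0 opprK (pnatr_eq0 _ 2).
have kE : k = (2 * k./2)%N by rewrite mul2n even_halfK.
suff /IH/eqP : (0 < k./2 < 2 ^ n)%N.
  by apply; rewrite -dyroot_sqr -exprM -kE dk.
apply/andP; split; first by rewrite half_gt0; case: (k) ke k0 => [|[]].
by rewrite -(ltn_pmul2l (m := 2)) // -kE -expnS.
Qed.

End CircleMean.

(** * Cauchy's formula *)

Section Cauchy.
Implicit Types (f g F : C -> C) (a b z w : C).

Lemma pexp_le n (x y : R) : 0 <= x -> x <= y -> x ^+ n <= y ^+ n.
Proof. by move=> x0 xy; apply: lerXn2r => //; rewrite nnegrE ?(le_trans x0). Qed.

(** A Lebesgue number argument: a scale valid near each point and stable under shrinking can be
    chosen uniformly on a closed disc. *)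
Lemma uniform_scale (Q : C -> R -> Prop) (r : R) :
  (forall z d d', 0 < d' -> d' <= d -> Q z d -> Q z d') ->
  (forall z0, exists2 d : R, 0 < d & forall z, nm (z - z0) < d -> Q z d) ->
  exists2 d : R, 0 < d & forall z, nm z <= r -> Q z d.
Proof.
move=> Qm Ql.
have [r0|r0] := ltP r 0.
  by exists 1 => // z zr; have := le_lt_trans (le_trans (nm_ge0 z) zr) r0; rewrite ltxx.
suff [d d0 H] : exists2 d : R, 0 < d & forall s t, - r <= s <= r -> - r <= t <= r -> Q (mkc s t) d.
  exists d => // z zr; rewrite -(mkcE z); apply: H; rewrite -ler_norml.
    exact: le_trans (re_le_nm _) zr.
  exact: le_trans (im_le_nm _) zr.
apply: (rectangle_bisection (P := fun x x' y y' => exists2 d : R, 0 < d &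
    forall s t, x <= s <= x' -> y <= t <= y' -> Q (mkc s t) d)); try lra.
  move=> x x' y y' _ _ mx my [d1 p1 H1] [d2 p2 H2] [d3 p3 H3] [d4 p4 H4].
  pose d := Num.min (Num.min d1 d2) (Num.min d3 d4).
  have d0 : 0 < d by rewrite !lt_min p1 p2 p3 p4.
  have [l1 l2] : d <= d1 /\ d <= d2 by rewrite /d !ge_min !lexx ?orbT.
  have [l3 l4] : d <= d3 /\ d <= d4 by rewrite /d !ge_min !lexx ?orbT.
  exists d => // s t /andP[s1 s2] /andP[t1 t2].
  have [sm|/ltW sm] := leP s mx; have [tm|/ltW tm] := leP t my.
  - by apply: Qm d0 l1 _; apply: H1; rewrite ?s1 ?t1.
  - by apply: Qm d0 l2 _; apply: H2; rewrite ?s1 ?t2 ?andbT.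
  - by apply: Qm d0 l3 _; apply: H3; rewrite ?s2 ?t1 ?andbT.
  - by apply: Qm d0 l4 _; apply: H4; rewrite ?s2 ?t2 ?andbT.
move=> u v _ _; have [d d0 H] := Ql (mkc u v).
exists (d / 2); first by rewrite divr_gt0.
move=> x x' y y' _ _ _ _ hu hv dx dy; exists d => // s t hs ht; apply: H.
apply: le_lt_trans (nm_le_reim _) _; rewrite reB imB !re_mkc !im_mkc.
have h1 : `|s - u| <= x' - x by rewrite ler_norml; move: hu hs; clear; lra.
have h2 : `|t - v| <= y' - y by rewrite ler_norml; move: hv ht; clear; lra.
move: h1 h2 dx dy; clear; lra.
Qed.

Definition rcdiff (p : R -> C) (t : R) (d : C) := forall e : R, 0 < e ->
  exists2 dl : R, 0 < dl & forall s, `|s - t| < dl ->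
    nm (p s - p t - d * cr (s - t)) <= e * `|s - t|.

Lemma rcdiff_ext p q t d : p =1 q -> rcdiff p t d -> rcdiff q t d.
Proof. by move=> /funext ->. Qed.

Lemma rcdiffD p q t d d' : rcdiff p t d -> rcdiff q t d' -> rcdiff (fun s => p s + q s) t (d + d').
Proof.
move=> hp hq e e0; have e2 : 0 < e / 2 by rewrite divr_gt0.
have [a a0 ha] := hp _ e2; have [b b0 hb] := hq _ e2.
exists (Num.min a b); first by rewrite lt_min a0.
move=> s; rewrite lt_min => /andP[sa sb].
have -> : p s + q s - (p t + q t) - (d + d') * cr (s - t) =
  (p s - p t - d * cr (s - t)) + (q s - q t - d' * cr (s - t)) by ring.
apply: le_trans (nmD _ _) _.
have := ha _ sa; have := hb _ sb; lra.
Qed.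

Lemma rcdiff0 t : rcdiff (fun=> 0) t 0.
Proof. by move=> e e0; exists 1 => // s _; rewrite mul0r !subr0 nm0 mulr_ge0 // ltW. Qed.

Lemma rcdiffMl k p t d : rcdiff p t d -> rcdiff (fun s => k * p s) t (k * d).
Proof.
move=> hp e e0; have k1 : 0 < nm k + 1 by rewrite ltr_wpDl ?nm_ge0.
have e2 : 0 < e / (nm k + 1) by rewrite divr_gt0.
have [a a0 ha] := hp _ e2; exists a => // s sa.
have -> : k * p s - k * p t - k * d * cr (s - t) = k * (p s - p t - d * cr (s - t)) by ring.
rewrite nmM; apply: le_trans (ler_wpM2l (nm_ge0 _) (ha _ sa)) _.
rewrite mulrA ler_wpM2r // mulrA ler_pdivrMr // mulrC ler_pM2l // lerDl; exact: ler01.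
Qed.

Lemma rcdiff_sum (I : Type) (s : seq I) (p : I -> R -> C) (d : I -> C) t :
  (forall i, rcdiff (p i) t (d i)) -> rcdiff (fun x => \sum_(i <- s) p i x) t (\sum_(i <- s) d i).
Proof.
move=> H; elim: s => [|i s IH].
  by rewrite big_nil; apply: rcdiff_ext (rcdiff0 t) => x; rewrite big_nil.
rewrite big_cons; apply: rcdiff_ext (rcdiffD (H i) IH) => x.
by rewrite big_cons.
Qed.

(** A complex-valued curve has no intermediate derivative equal to its mean slope. The bound itself
    is inherited from halves and, with slack [k], holds on short intervals around each point;
    bisection applies with the second side degenerate. *)
Lemma mean_value (p : R -> C) (a b : R) (c : C) (e : R) : a <= b ->
  (forall t, a <= t <= b -> exists2 d, nm (d - c) <= e & rcdiff p t d) ->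
  nm (p b - p a - c * cr (b - a)) <= e * (b - a).
Proof.
move=> ab H; have e0 : 0 <= e.
  have [|d de _] := H a; first by rewrite lexx.
  exact: le_trans (nm_ge0 _) de.
suff key (k : R) : 0 < k -> nm (p b - p a - c * cr (b - a)) <= (e + k) * (b - a).
  apply/ler_addgt0Pr => k k0; have l0 : 0 < b - a + 1 by move: ab; clear; lra.
  apply: le_trans (key (k / (b - a + 1)) _) _; first exact: divr_gt0.
  rewrite mulrDl lerD2l mulrAC ler_pdivrMr // ler_pM2l //; lra.
move=> k0; apply: (rectangle_bisection (y0 := 0) (y1 := 0)
  (P := fun x x' _ _ => nm (p x' - p x - c * cr (x' - x)) <= (e + k) * (x' - x))) => //.
  move=> x x' _ _ _ _ m _ h1 _ h2 _.
  have -> : p x' - p x - c * cr (x' - x) =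
    (p m - p x - c * cr (m - x)) + (p x' - p m - c * cr (x' - m)) by rewrite !crB; ring.
  apply: le_trans (nmD _ _) _; apply: le_trans (lerD h1 h2) _.
  by rewrite -mulrDr (_ : m - x + (x' - m) = x' - x) //; ring.
move=> u v hu _; have [d de pd] := H u hu.
have [dl dl0 Hd] := pd _ k0; exists dl => //.
move=> x x' _ _ _ _ _ _ /andP[xu ux'] _ xx _.
have h1 : `|x' - u| < dl by rewrite ger0_norm ?subr_ge0 //; move: xx xu; clear; lra.
have h2 : `|x - u| < dl by rewrite ler0_norm ?subr_le0 // opprB; move: xx ux'; clear; lra.
have := Hd _ h1; have := Hd _ h2; rewrite [`|x - u|]distrC !ger0_norm ?subr_ge0 //.
move=> i1 i2.
have -> : p x' - p x - c * cr (x' - x) = (p x' - p u - d * cr (x' - u)) -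
   (p x - p u - d * cr (x - u)) + (d - c) * cr (x' - x) by rewrite !crB; ring.
apply: le_trans (nmD _ _) _; rewrite nmM nm_cr ger0_norm; last by rewrite subr_ge0 (le_trans xu).
have i3 : nm (d - c) * (x' - x) <= e * (x' - x) by rewrite ler_wpM2r // subr_ge0 (le_trans xu).
have := nmB (p x' - p u - d * cr (x' - u)) (p x - p u - d * cr (x - u)).
move: i1 i2 i3; clear; lra.
Qed.

Lemma cdiff_rcdiff f a v (t : R) d : cdiff f (a + cr t * v) d ->
  rcdiff (fun s => f (a + cr s * v)) t (d * v).
Proof.
move=> fd e e0; have v1 : 0 < nm v + 1 by rewrite ltr_wpDl ?nm_ge0.
have e2 : 0 < e / (nm v + 1) by rewrite divr_gt0.
have [dl dl0 H] := fd _ e2; exists (dl / (nm v + 1)); first exact: divr_gt0.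
move=> s; rewrite ltr_pdivlMr // => sd.
have hn : nm (cr (s - t) * v) = `|s - t| * nm v by rewrite nmM nm_cr.
have hd : nm (cr (s - t) * v) < dl.
  by rewrite hn; apply: le_lt_trans sd; rewrite ler_wpM2l // lerDl ler01.
have E : a + cr t * v + cr (s - t) * v = a + cr s * v by rewrite crB; ring.
have := H _ hd; rewrite E => H'.
rewrite -mulrA [v * _]mulrC; apply: le_trans H' _; rewrite hn.
rewrite mulrAC ler_pdivrMr // mulrA ler_wpM2l ?lerDl ?ler01 //.
by rewrite mulr_ge0 // ltW.
Qed.

Lemma complex_mean_value f (g : C -> C) a b c (e : R) :
  (forall t, 0 <= t <= 1 -> cdiff f (a + cr t * (b - a)) (g (a + cr t * (b - a)))) ->
  (forall t, 0 <= t <= 1 -> nm (g (a + cr t * (b - a)) - c) <= e) ->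
  nm (f b - f a - c * (b - a)) <= e * nm (b - a).
Proof.
move=> hf hg.
have := @mean_value (fun s => f (a + cr s * (b - a))) 0 1 (c * (b - a)) (e * nm (b - a)) ler01.
rewrite cr1 mul1r cr0 mul0r addr0 [a + _]addrC subrK subr0 cr1 !mulr1; apply.
move=> t ht; exists (g (a + cr t * (b - a)) * (b - a)); last exact/cdiff_rcdiff/hf.
by rewrite -mulrBl nmM ler_wpM2r ?nm_ge0 // hg.
Qed.

Lemma ball_convex a b c (r t : R) : 0 <= t <= 1 -> nm (b - a) <= r -> nm (c - a) <= r ->
  nm (b + cr t * (c - b) - a) <= r.
Proof.
move=> /andP[t0 t1] hb hc.
have -> : b + cr t * (c - b) - a = cr (1 - t) * (b - a) + cr t * (c - a).
  by rewrite crB cr1; ring.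
apply: le_trans (nmD _ _) _; rewrite !nmM !nm_cr !ger0_norm ?subr_ge0 //.
have h1 : (1 - t) * nm (b - a) <= (1 - t) * r by rewrite ler_wpM2l ?subr_ge0.
have h2 : t * nm (c - a) <= t * r by rewrite ler_wpM2l.
move: h1 h2; clear; lra.
Qed.

Definition c1_on a (r : R) f g := forall z, nm (z - a) < r ->
  cdiff f z (g z) /\ forall e : R, 0 < e -> exists2 dl : R, 0 < dl &
    forall w, nm (w - z) < dl -> nm (g w - g z) < e.

(** Continuity of [g] at a uniform scale, combined with the mean value estimate along chords, makes
    differentiability uniform on the smaller closed disc. *)
Lemma c1_uniform a (r r' : R) f g : r < r' -> c1_on a r' f g ->
  forall e : R, 0 < e -> exists2 dl : R, 0 < dl & forall b c, nm (b - a) <= r ->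
    nm (c - a) <= r -> nm (c - b) < dl -> nm (f c - f b - g b * (c - b)) <= e * nm (c - b).
Proof.
move=> rr' fg e e0.
have [|z0|d d0 Hd] := @uniform_scale (fun z d => nm z <= r -> forall c, nm (c - a) <= r ->
    nm (c - (a + z)) < d -> nm (f c - f (a + z) - g (a + z) * (c - (a + z)))
      <= e * nm (c - (a + z))) r.
- by move=> z d d' _ dd' H zr c cr' cd; apply: H => //; exact: lt_le_trans cd dd'.
- have [z0r|rz0] := leP (nm z0) r; last first.
    exists (nm z0 - r); first by rewrite subr_gt0.
    move=> z zz zr; have := nm_triB z0 z; rewrite nmC => h.
    by move: (le_lt_trans h zz); rewrite ltrD2l ltrN2 ltNge zr.
  have [|_ gc] := fg (a + z0); first by rewrite addrC addKr; exact: le_lt_trans rr'.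
  have e2 : 0 < e / 2 by rewrite divr_gt0.
  have [dl dl0 Hg] := gc _ e2; exists (dl / 2); first by rewrite divr_gt0.
  move=> z zz zr c cr' cz.
  have bz : nm (a + z - a) <= r by rewrite addrC addKr.
  apply: (@complex_mean_value f g) => t ht.
    by have [|//] := fg (a + z + cr t * (c - (a + z))); apply: le_lt_trans rr'; exact: ball_convex.
  apply: ltW; apply: le_lt_trans (nm_tri (g (a + z0)) _ _) _.
  have l0 : 0 < dl / 2 by rewrite divr_gt0.
  have g1 : nm (g (a + z + cr t * (c - (a + z))) - g (a + z0)) < e / 2.
    apply: Hg; apply: le_lt_trans (nm_tri (a + z) _ _) _.
    have -> : a + z - (a + z0) = z - z0 by ring.
    rewrite [a + z + _]addrC addrK nmM nm_cr.
    have [t0 t1] := andP ht; rewrite ger0_norm //.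
    have h : t * nm (c - (a + z)) <= nm (c - (a + z)).
      by rewrite -[X in _ <= X]mul1r ler_wpM2r ?nm_ge0.
    move: h cz zz; clear; lra.
  have g2 : nm (g (a + z0) - g (a + z)) < e / 2.
    rewrite nmC; apply: Hg; have -> : a + z - (a + z0) = z - z0 by ring.
    by move: zz l0; clear; lra.
  by move: g1 g2; clear; lra.
exists d => // b c hb hc bc; have := Hd (b - a) hb hb c hc.
by rewrite [a + _]addrC subrK; exact.
Qed.

Lemma avg_telescope n (h : C -> C) : avg n (fun z => h (dyroot n * z) - h z) = 0.
Proof.
rewrite /avg; suff -> : \sum_(j < 2 ^ n) (h (dyroot n * dyroot n ^+ j) - h (dyroot n ^+ j)) = 0.
  by rewrite mulr0.
under eq_bigr do rewrite -exprS.
rewrite -(big_mkord xpredT (fun j => h (dyroot n ^+ j.+1) - h (dyroot n ^+ j))).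
by rewrite telescope_sumr // dyroot1 expr0 subrr.
Qed.

(** The Riemann sum of a derivative round a circle is nearly telescoping: up to a factor, [z * g] is
    the increment of [f] from [z] to [dyroot n * z] with a uniformly small error. The threshold [n0]
    serves all circles in the disc at once, as the homotopy in [c1_cauchy] demands. *)
Lemma avg_closed_curve a (r r' : R) f g : r < r' -> c1_on a r' f g ->
  forall e : R, 0 < e -> exists n0, forall n, (n0 <= n)%N -> forall b (p : R),
    0 <= p <= r -> (forall z, nm z = 1 -> nm (b + cr p * z - a) <= r) ->
    nm (avg n (fun z => z * g (b + cr p * z))) <= e.
Proof.
move=> rr' fg e e0; have [dl dl0 Hdl] := c1_uniform rr' fg e0.
have r1 : 0 < `|r| + 1 by rewrite ltr_wpDl.
have d1 : 0 < dl / (`|r| + 1) by rewrite divr_gt0.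
have [n0 Hn0] := dyroot_near d1; exists n0.+1 => n nn0 b p /andP[p0 pr] hb.
have n1 : (0 < n)%N by exact: leq_trans nn0.
set w := dyroot n.
have wd : nm (w - 1) < dl / (`|r| + 1) by apply: Hn0; exact: ltnW.
have w1 : w != 1.
  have := @dyroot_gt n 1; rewrite expr1; apply.
  by rewrite /= -{1}(expn0 2) ltn_exp2l.
have w0 : 0 < nm (w - 1) by rewrite nm_gt0 subr_eq0.
(* For radius 0 the increment cannot be divided by [p]; the average of [z] is then a geometric sum
   equal to 0. *)
have [->|pn0] := eqVneq p 0.
  under avg_ext => z _ do rewrite cr0 mul0r addr0 mulrC.
  rewrite avgM /avg.
  have : (w - 1) * \sum_(j < 2 ^ n) w ^+ j = 0 by rewrite -subrX1 dyroot1 subrr.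
  move=> /eqP; rewrite mulf_eq0 subr_eq0 (negPf w1) /= => /eqP h.
  by rewrite [X in cr _ * X]h !mulr0 nm0 ltW.
have pp : 0 < p by rewrite lt_neqAle eq_sym pn0.
have -> : avg n (fun z => z * g (b + cr p * z)) =
   (- (cr p * (w - 1))^-1) * avg n (fun z => f (b + cr p * (w * z)) - f (b + cr p * z) -
      g (b + cr p * z) * (cr p * (w * z) - cr p * z)).
  have h : avg n (fun z => f (b + cr p * (w * z)) - f (b + cr p * z)) = 0.
    exact: (avg_telescope n (fun z => f (b + cr p * z))).
  rewrite avgD h add0r -avgM; apply: avg_ext => z _.
  have -> : cr p * (w * z) - cr p * z = (cr p * (w - 1)) * z by ring.
  rewrite mulrNN [g _ * _]mulrCA mulKf 1?mulrC //.
  by rewrite mulf_neq0 ?cr_eq0 ?subr_eq0.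
rewrite nmM nmN nmV nmM nm_cr ger0_norm // mulrC ler_pdivrMr ?mulr_gt0 //.
apply: avg_bound => z z1.
have ph : nm (cr p * (w * z) - cr p * z) = p * nm (w - 1).
  have -> : cr p * (w * z) - cr p * z = cr p * (w - 1) * z by ring.
  by rewrite !nmM z1 mulr1 nm_cr ger0_norm.
rewrite -ph.
have -> : cr p * (w * z) - cr p * z = b + cr p * (w * z) - (b + cr p * z) by ring.
apply: Hdl; [exact: hb| |].
  by apply: hb; rewrite nmM nm_dyroot z1 mulr1.
have -> : b + cr p * (w * z) - (b + cr p * z) = cr p * (w * z) - cr p * z by ring.
rewrite ph; rewrite ltr_pdivlMr // mulrC in wd; apply: le_lt_trans wd.
rewrite ler_wpM2r ?nm_ge0 //; apply: le_trans pr _.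
by rewrite (le_trans (ler_norm _)) // lerDl ler01.
Qed.

(** On roots of unity of order [M = 2 ^ n] the geometric series in [v / z] closes up after [M]
    terms, and averaging kills every power of [z] but the zeroth. *)
Lemma avg_kernel n v : nm v < 1 -> avg n (fun z => z / (z - v)) = (1 - v ^+ (2 ^ n))^-1.
Proof.
move=> v1; set M := (2 ^ n)%N; pose w := dyroot n.
have M0 : M%:R != 0 :> C by rewrite pnatr_eq0 expn_eq0.
have wM : w ^+ M = 1 by rewrite dyroot1.
have q0 : 1 - v ^+ M != 0.
  apply/eqP => /eqP; rewrite subr_eq0 => /eqP h.
  have : nm v ^+ M < 1 by rewrite exprn_ilt1 ?nm_ge0 // expn_eq0.
  by rewrite -nmX -h nm1 ltxx.
have w0 j : w ^+ j != 0 by rewrite -nm_gt0 nm_dyrootX.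
have geo j : w ^+ j / (w ^+ j - v) = (\sum_(k < M) v ^+ k * (w ^- j) ^+ k) / (1 - v ^+ M).
  have d0 : w ^+ j - v != 0.
    by rewrite -nm_gt0 (lt_le_trans _ (nm_triB _ _)) // nm_dyrootX subr_gt0.
  apply: (mulIf q0); rewrite divfK //; apply: (mulfI d0); rewrite mulrA [_ * (w ^+ j / _)]mulrC divfK //.
  have -> : \sum_(k < M) v ^+ k * (w ^- j) ^+ k = \sum_(k < M) (v / w ^+ j) ^+ k.
    by apply: eq_bigr => k _; rewrite exprMn.
  have -> : w ^+ j - v = w ^+ j * - (v / w ^+ j - 1) by rewrite mulrN mulrBr mulrC divfK // mulr1 opprB.
  by rewrite -mulrA mulNr -subrX1 expr_div_n exprAC wM expr1n divr1 opprB.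
rewrite /avg; under eq_bigr do rewrite geo.
rewrite -mulr_suml exchange_big /= -(prednK (_ : (0 < M)%N)) ?expn_gt0 // big_ord_recl [X in _ + X]big1 ?addr0.
  under eq_bigr do rewrite /= !expr0 mulr1.
  rewrite sumr_const card_ord prednK ?expn_gt0 //.
  have -> : cr (2 ^- n) = (M%:R)^-1 :> C by rewrite crV crX cr_nat natrX.
  by rewrite mulrA mulVf // mul1r.
move=> k _; rewrite -mulr_sumr; have kM : (0 < lift ord0 k < M)%N.
  by rewrite lift0 /= -[X in (_ < X)%N](prednK (_ : (0 < M)%N)) ?expn_gt0 // ltnS ltn_ord.
have w1 : w ^- lift ord0 k != 1.
  by rewrite -invr1 (inj_eq invr_inj); exact: dyroot_gt.
under eq_bigr do rewrite -exprVn -exprM mulnC exprM exprVn.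
have : (w ^- lift ord0 k - 1) * \sum_(j < M) (w ^- lift ord0 k) ^+ j = 0.
  by rewrite -subrX1 -exprVn exprAC exprVn wM invr1 expr1n subrr.
by move=> /eqP; rewrite mulf_eq0 subr_eq0 (negPf w1) => /eqP E; rewrite [X in _ * X]E mulr0.
Qed.

Lemma cmean_kernel (r : R) (u : C) : nm u < r -> cmean (fun z => cr r * z / (cr r * z - u)) = 1.
Proof.
move=> ur; have r0 : 0 < r by exact: le_lt_trans (nm_ge0 _) ur.
have c0 : cr r != 0 by rewrite cr_eq0 gt_eqF.
pose v := u / cr r; have v1 : nm v < 1 by rewrite nmM nmV nm_cr gtr0_norm // ltr_pdivrMr // mul1r.
rewrite (cmean_ext (g := fun z => z / (z - v))); last first.
  move=> z z1; have -> : cr r * z - u = cr r * (z - v) by rewrite mulrBr [cr r * v]mulrC divfK.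
  by rewrite invfM mulrACA divff // mul1r.
apply: cmean_near => e e0; pose q := nm v.
have cv : (fun n => q ^+ n) @ \oo --> (0 : R) by apply: cvg_expr; rewrite ger0_norm ?nm_ge0.
have e1 : 0 < e / (e + 1) by rewrite divr_gt0 // addr_gt0.
move/cvgrPdist_lt: cv => /(_ _ e1) [n0 _ H]; exists n0 => n nn0.
have M0 : (n0 <= 2 ^ n)%N by apply: leq_trans nn0 (ltnW _); exact: ltn_expl.
have := H _ M0; rewrite /= sub0r normrN ger0_norm ?exprn_ge0 ?nm_ge0 // -nmX avg_kernel //.
move: (v ^+ (2 ^ n)) => x; rewrite ltr_pdivlMr ?addr_gt0 // => h.
have xn : 0 < nm (1 - x).
  have := nm_triB 1 x; rewrite nm1; have := nm_ge0 x; move: h e0; clear.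
  by move=> h e0 x0; have : nm x < 1; [nra|lra].
have -> : (1 - x)^-1 - 1 = x / (1 - x) by field; rewrite -nm_gt0.
rewrite nmM nmV ltr_pdivrMr //; have := nm_triB 1 x; rewrite nm1; move: h e0; clear; nra.
Qed.

Lemma c1_bounded a (r r' : R) f g : r < r' -> c1_on a r' f g ->
  exists K : R, forall z, nm (z - a) <= r -> nm (f z) <= K.
Proof.
move=> rr' fg.
have [|z0|d d0 Hd] := @uniform_scale (fun z d => nm z <= r -> nm (f (a + z)) <= d^-1) r.
- move=> z d d' d'0 dd' H /H h; apply: le_trans h _.
  by rewrite lef_pV2 ?posrE ?(lt_le_trans d'0).
- have [z0r|rz0] := leP (nm z0) r; last first.
    exists (nm z0 - r); first by rewrite subr_gt0.
    move=> z zz zr; have := nm_triB z0 z; rewrite nmC => h.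
    by move: (le_lt_trans h zz); rewrite ltrD2l ltrN2 ltNge zr.
  have [|fd _] := fg (a + z0); first by rewrite addrC addKr; exact: le_lt_trans rr'.
  have [dl dl0 H] := cdiff_cont fd ltr01.
  have k1 : 0 < nm (f (a + z0)) + 1 by rewrite ltr_wpDl ?nm_ge0.
  exists (Num.min dl (nm (f (a + z0)) + 1)^-1); first by rewrite lt_min dl0 invr_gt0.
  move=> z; rewrite lt_min => /andP[zd _] _.
  have h1 : nm (f (a + z)) <= nm (f (a + z0)) + 1.
    have h : nm (f (a + z) - f (a + z0)) < 1.
      by apply: H; have -> : a + z - (a + z0) = z - z0 by ring.
    by have := nm_triB (f (a + z)) (f (a + z0)); move: h; clear; lra.
  apply: le_trans h1 _; rewrite -[X in X <= _]invrK lef_pV2 ?posrE ?invr_gt0 //.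
    by rewrite ge_min lexx orbT.
  by rewrite lt_min dl0 invr_gt0.
exists d^-1 => z za; have := Hd (z - a) za za.
by rewrite [a + _]addrC subrK.
Qed.

Lemma nm_circle_sub a (r : R) z w : nm z = 1 -> 0 < r -> r - nm (w - a) <= nm (a + cr r * z - w).
Proof.
move=> z1 r0; have -> : a + cr r * z - w = cr r * z - (w - a) by ring.
by have := nm_triB (cr r * z) (w - a); rewrite nmM nm_cr z1 mulr1 gtr0_norm.
Qed.

(** The circle is contracted to [w] along segments. The mean with kernel [k] varies with [t] by the
    average of [g] round a closed curve, which tends to 0 uniformly in [t]; at [t = 0] it is [f w]
    times the mean of [k], which is 1. *)
Lemma c1_cauchy a (r r' : R) f g w : r < r' -> c1_on a r' f g -> nm (w - a) < r ->
  cmean (fun z => f (a + cr r * z) * (cr r * z / (a + cr r * z - w))) = f w.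
Proof.
move=> rr' fg wr; have r0 : 0 < r by exact: le_lt_trans (nm_ge0 _) wr.
have dr : 0 < r - nm (w - a) by rewrite subr_gt0.
pose k z := cr r * z / (a + cr r * z - w).
have kn z : nm z = 1 -> a + cr r * z - w != 0.
  by move=> z1; rewrite -nm_gt0 (lt_le_trans dr) // nm_circle_sub.
have bk : bdc k.
  exists (r / (r - nm (w - a))) => z z1; rewrite nmM nmV nmM nm_cr z1 mulr1 gtr0_norm //.
  by rewrite ler_pM2l // lef_pV2 ?posrE ?nm_gt0 ?kn // nm_circle_sub.
have [K HK] := c1_bounded rr' fg.
have bf : bdc (fun z => f (a + cr r * z)).
  by exists K => z z1; apply: HK; rewrite addrC addKr nmM nm_cr z1 mulr1 gtr0_norm.
have k1 : cmean k = 1.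
  rewrite -(cmean_kernel wr); apply: cmean_ext => z _; rewrite /k.
  by congr (_ / _); ring.
suff : cmean (fun z => f (a + cr r * z) * k z - f w * k z) = 0.
  rewrite cmeanB; [|exact: bdcM|exact: bdcMl].
  by rewrite cmeanM // k1 mulr1 => /eqP; rewrite subr_eq0 => /eqP.
apply: cmean_near => e e0; have er : 0 < e / 2 / r by rewrite !divr_gt0.
have [n0 Hn] := avg_closed_curve rr' fg er; exists n0 => n nn0; rewrite subr0.
pose P (t : R) := avg n (fun z => f (w + cr t * (a + cr r * z - w)) * k z).
have -> : avg n (fun z => f (a + cr r * z) * k z - f w * k z) = P 1 - P 0 - 0 * cr (1 - 0).
  rewrite mul0r subr0 /P -[- avg _ _]mulN1r -avgM -avgD; apply: avg_ext => z _.
  by rewrite cr1 mul1r cr0 mul0r addr0 mulN1r [w + _]addrC subrK.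
apply: (@le_lt_trans _ _ (e / 2 * (1 - 0))); last first.
  by rewrite subr0 mulr1 ltr_pdivrMr // mulr_natr mulr2n ltrDl.
apply: mean_value => // t /andP[t0 t1].
(* The factor [a + cr r * z - w] produced by differentiating in [t] cancels the denominator of
   [k]. *)
exists (avg n (fun z => g (w + cr t * (a + cr r * z - w)) * (cr r * z))).
  rewrite subr0; have := Hn n nn0 (w + cr t * (a - w)) (t * r).
  have wE z : w + cr t * (a - w) + cr (t * r) * z = w + cr t * (a + cr r * z - w).
    by rewrite crM; ring.
  have -> : avg n (fun z => g (w + cr t * (a + cr r * z - w)) * (cr r * z)) =
    cr r * avg n (fun z => z * g (w + cr t * (a - w) + cr (t * r) * z)).
    by rewrite -avgM; apply: avg_ext => z _; rewrite wE; ring.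
  move=> H; rewrite nmM nm_cr gtr0_norm // -ler_pdivlMl // [r^-1 * _]mulrC; apply: H.
    apply/andP; split; first by rewrite mulr_ge0 // ltW.
    by rewrite -[X in _ <= X]mul1r ler_wpM2r // ltW.
  move=> z z1; rewrite wE; apply: ball_convex; first by rewrite t0.
    exact: ltW.
  by rewrite addrC addKr nmM nm_cr z1 mulr1 gtr0_norm.
rewrite /P /avg; apply: rcdiffMl; apply: rcdiff_sum => j.
set z := dyroot n ^+ j.
have z1 : nm z = 1 by rewrite nm_dyrootX.
apply: (@rcdiff_ext (fun s => k z * f (w + cr s * (a + cr r * z - w)))).
  by move=> s; rewrite mulrC.
have -> : g (w + cr t * (a + cr r * z - w)) * (cr r * z) =
  k z * (g (w + cr t * (a + cr r * z - w)) * (a + cr r * z - w)).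
  by rewrite /k [RHS]mulrCA divfK // kn.
apply/rcdiffMl/cdiff_rcdiff.
have [|//] := fg (w + cr t * (a + cr r * z - w)).
apply: le_lt_trans rr'; apply: ball_convex; [by rewrite t0|exact: ltW|].
by rewrite addrC addKr nmM nm_cr z1 mulr1 gtr0_norm.
Qed.

Lemma cmean_cdiff (P : C -> C -> C) (P' : C -> C) w (K dl : R) : 0 < dl ->
  (forall h, nm h < dl -> bdc (fun z => P z (w + h))) -> bdc P' ->
  (forall z h, nm z = 1 -> nm h < dl -> nm (P z (w + h) - P z w - P' z * h) <= K * nm h ^+ 2) ->
  cdiff (fun w => cmean (fun z => P z w)) w (cmean P').
Proof.
move=> dl0 bP bP' H e e0; pose K' := `|K| + 1.
have K0 : 0 < K' by rewrite ltr_wpDl.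
exists (Num.min dl (e / K')); first by rewrite lt_min dl0 divr_gt0.
move=> h; rewrite lt_min ltr_pdivlMr // => /andP[hd he].
have b0 : bdc (fun z => P z w) by have := bP 0; rewrite addr0 nm0; apply.
have b1 := bP h hd.
rewrite -cmeanB // [cmean P' * h]mulrC -cmeanM // -cmeanB; last first.
- exact: bdcMl.
- exact: bdcB.
apply: (@le_trans _ _ (K * nm h ^+ 2)).
  by apply: cmean_bound => z z1; rewrite [h * _]mulrC; exact: H.
rewrite expr2 mulrA ler_wpM2r ?nm_ge0 //.
apply: le_trans (ltW he); rewrite mulrC ler_wpM2l ?nm_ge0 // /K'.
by rewrite (le_trans (ler_norm _)) // lerDl ler01.
Qed.

(** Here [u] and [v] stand for the inverses of [F - w] and [F - (w + h)]. The relation between them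
    replaces divisions, so that the second-order remainder follows by induction on [n]. *)
Lemma kernel_remainder (D : R) n : 0 <= D -> exists K : R, forall u v h : C, nm u <= D -> nm v <= D ->
  v = u + h * u * v -> nm (v ^+ n - u ^+ n - n%:R * u ^+ n.+1 * h) <= K * nm h ^+ 2.
Proof.
move=> D0; elim: n => [|n [K IH]].
  by exists 0 => u v h _ _ _; rewrite !expr0 !mul0r subr0 subrr nm0.
exists (D * K + n.+1%:R * D ^+ n.+3) => u v h uD vD e.
have -> : v ^+ n.+1 - u ^+ n.+1 - n.+1%:R * u ^+ n.+2 * h =
    v * (v ^+ n - u ^+ n - n%:R * u ^+ n.+1 * h) + n.+1%:R * (u ^+ n.+2 * v) * h ^+ 2.
  apply/eqP; rewrite -subr_eq0; apply/eqP.
  transitivity (u ^+ n * (v - (u + h * u * v)) * (1 + n.+1%:R * u * h)); last by rewrite -e subrr mulr0 mul0r.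
  by rewrite -natr1 !exprS; ring.
apply: le_trans (nmD _ _) _; rewrite mulrDl; apply: lerD.
  by rewrite nmM -[X in _ <= X]mulrA; apply: ler_pM; rewrite ?nm_ge0 ?IH.
rewrite nmM nmX ler_wpM2r ?exprn_ge0 ?nm_ge0 // nmM -(cr_nat) nm_cr ger0_norm // ler_wpM2l //.
by rewrite nmM nmX [D ^+ _]exprSr ler_pM ?exprn_ge0 ?nm_ge0 ?pexp_le ?nm_ge0.
Qed.

Lemma kernel_cdiff n (s F : C -> C) w (d : R) : 0 < d -> bdc s ->
  (forall t, nm t = 1 -> d <= nm (F t - w)) ->
  cdiff (fun w => cmean (fun t => s t / (F t - w) ^+ n)) w
    (cmean (fun t => n%:R * s t / (F t - w) ^+ n.+1)).
Proof.
move=> d0 [L HL] lo; have L0 : 0 <= L by apply: le_trans (nm_ge0 _) (HL 1 _); rewrite nm1.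
have D0 : 0 <= 2 / d by rewrite divr_ge0 // ltW.
have nb t h : nm t = 1 -> nm h < d / 2 -> F t - (w + h) != 0 /\ nm (F t - (w + h))^-1 <= 2 / d.
  move=> t1 hd; have l : d / 2 <= nm (F t - (w + h)).
    have := nm_triB (F t - w) h; have := lo t t1.
    by have -> : F t - w - h = F t - (w + h) by [ring]; move: hd; clear; lra.
  have p : 0 < nm (F t - (w + h)) by apply: lt_le_trans l; rewrite divr_gt0.
  by split; [rewrite -nm_gt0|rewrite nmV -invf_div lef_pV2 ?posrE ?divr_gt0].
have nb0 t : nm t = 1 -> F t - w != 0 /\ nm (F t - w)^-1 <= 2 / d.
  by move=> t1; have := nb t 0 t1; rewrite addr0 nm0 divr_gt0 //; apply.
have [K HK] := kernel_remainder n D0.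
apply: (@cmean_cdiff _ _ _ (L * K) (d / 2)); first exact: divr_gt0.
- move=> h hd; exists (L * (2 / d) ^+ n) => t t1; have [_ v1] := nb t h t1 hd.
  by rewrite nmM -exprVn nmX ler_pM ?nm_ge0 ?HL ?exprn_ge0 ?pexp_le ?nm_ge0.
- exists (n%:R * L * (2 / d) ^+ n.+1) => t t1; have [_ v1] := nb0 t t1.
  rewrite !nmM -exprVn nmX -(cr_nat) nm_cr ger0_norm // ler_pM ?mulr_ge0 ?exprn_ge0 ?nm_ge0 ?pexp_le ?nm_ge0 //.
  by rewrite ler_wpM2l ?HL.
move=> t h t1 hd; have [vn v1] := nb t h t1 hd; have [un u1] := nb0 t t1.
have e : (F t - (w + h))^-1 = (F t - w)^-1 + h * (F t - w)^-1 * (F t - (w + h))^-1 by field; rewrite un vn.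
have := HK _ _ h u1 v1 e; rewrite !exprVn.
move: (F t - (w + h)) (F t - w) => p q H.
have -> : s t / p ^+ n - s t / q ^+ n - n%:R * s t / q ^+ n.+1 * h =
    s t * (p ^- n - q ^- n - n%:R / q ^+ n.+1 * h) by ring.
by rewrite nmM -[X in _ <= X]mulrA ler_pM ?nm_ge0 ?HL.
Qed.

Lemma cauchy_transform_cdiff n (s : C -> C) a (r : R) w : bdc s -> nm (w - a) < r ->
  cdiff (fun w => cmean (fun z => s z / (a + cr r * z - w) ^+ n)) w
        (cmean (fun z => n%:R * s z / (a + cr r * z - w) ^+ n.+1)).
Proof.
move=> bs wr; apply: (kernel_cdiff n (F := fun z => a + cr r * z) _ bs (d := r - nm (w - a))).
  by rewrite subr_gt0.
by move=> t t1; apply: nm_circle_sub => //; exact: le_lt_trans (nm_ge0 _) wr.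
Qed.

Definition hol a (r : R) f := forall z, nm (z - a) < r -> exists d, cdiff f z d.

Lemma hol_cdiff a (r : R) f z : hol a r f -> nm (z - a) < r -> cdiff f z (derive1 f z).
Proof. by move=> fh zr; have [d fd] := fh z zr; rewrite (cdiff_derive1 fd). Qed.

(** Goursat supplies a local primitive [F], whose derivative [f] is continuous; so Cauchy's formula
    holds for [F]. Differentiating it three times under the mean gives [f], [f'] and a derivative of
    [f']. *)
Lemma hol_derive1 a (r : R) f : hol a r f -> hol a r (derive1 f).
Proof.
move=> fh b br; pose p := (r - nm (b - a)).
have p0 : 0 < p by rewrite subr_gt0.
have fhb : hol b p f.
  move=> z zb; apply: fh; have := nm_tri b z a; move: zb; rewrite /p; clear; lra.
have [F HF] := holomorphic_local_primitive p0 fhb.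
have c1F : c1_on b (p / 4) F f.
  move=> z zb; split; first exact: HF.
  have [|d fd] := fhb z; first by move: zb p0; clear; lra.
  exact: cdiff_cont fd.
pose q := p / 8; have q0 : 0 < q by rewrite divr_gt0.
have qp : q < p / 4 by move: p0; rewrite /q; clear; lra.
have [K HK] := c1_bounded qp c1F.
pose s z := F (b + cr q * z) * (cr q * z).
have bs : bdc s.
  exists (K * q) => z z1; rewrite nmM nmM nm_cr z1 mulr1 gtr0_norm //.
  rewrite ler_pM2r // HK // addrC addKr nmM nm_cr z1 mulr1 gtr0_norm //.
have FE w : nm (w - b) < q -> cmean (fun z => s z / (b + cr q * z - w)) = F w.
  move=> wq; rewrite -(c1_cauchy qp c1F wq); apply: cmean_ext => z _.
  by rewrite /s -mulrA.
have near0 (w : C) : nm (w - b) < q -> 0 < q - nm (w - b) by rewrite subr_gt0.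
have nearq (w w' : C) : nm (w' - w) < q - nm (w - b) -> nm (w' - b) < q.
  by have := nm_tri w w' b; clear; lra.
have fE w : nm (w - b) < q -> cmean (fun z => 1%:R * s z / (b + cr q * z - w) ^+ 2) = f w.
  move=> wq; have := cauchy_transform_cdiff 1 bs wq.
  move=> /(cdiff_near (near0 _ wq) (fun w' hw => FE w' (nearq _ _ hw))) h.
  by apply: cdiff_unique h _; apply: HF; exact: lt_trans wq qp.
have b1 : bdc (fun z => 1%:R * s z) by exact: bdcMl.
have b2 : bdc (fun z => 2%:R * (1%:R * s z)) by exact: bdcMl.
have f'E w : nm (w - b) < q -> cmean (fun z => 2%:R * (1%:R * s z) / (b + cr q * z - w) ^+ 3) = derive1 f w.
  move=> wq; apply/esym/cdiff_derive1.
  by apply: (cdiff_near (near0 _ wq)) (cauchy_transform_cdiff 2 b1 wq) => w' hw; apply: fE; exact: nearq hw.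
have bb : nm (b - b) < q by rewrite subrr nm0.
eexists; apply: cdiff_near (near0 _ bb) _ (cauchy_transform_cdiff 3 b2 bb).
by move=> w' hw; apply: f'E; exact: nearq hw.
Qed.

Lemma hol_c1 a (r : R) f : hol a r f -> c1_on a r f (derive1 f).
Proof.
move=> fh z zr; split; first exact: hol_cdiff zr.
by have [d] := hol_derive1 fh zr; exact: cdiff_cont.
Qed.

Theorem cauchy_formula a (r r' : R) f w : r < r' -> hol a r' f -> nm (w - a) < r ->
  cmean (fun z => f (a + cr r * z) * (cr r * z / (a + cr r * z - w))) = f w.
Proof. by move=> rr' fh; exact: c1_cauchy rr' (hol_c1 fh). Qed.

Lemma hol_bounded a (r r' : R) f : r < r' -> hol a r' f ->
  exists K : R, forall z, nm (z - a) <= r -> nm (f z) <= K.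
Proof. by move=> rr' /hol_c1; exact: c1_bounded. Qed.

End Cauchy.

(** * Zeros, removable singularities and Liouville's theorem *)

Section LocalTheory.
Implicit Types (f g F : C -> C) (a b z w : C).

Lemma hol_cst a (r : R) k : hol a r (fun=> k).
Proof. by move=> z _; exists 0; exact: cdiffC. Qed.
Lemma hol_id a (r : R) : hol a r id.
Proof. by move=> z _; exists 1; exact: cdiff_id. Qed.
Lemma holD a (r : R) f g : hol a r f -> hol a r g -> hol a r (fun z => f z + g z).
Proof.
move=> hf hg z zr; have [d fd] := hf z zr; have [d' gd] := hg z zr.
by exists (d + d'); exact: cdiffD.
Qed.
Lemma holB a (r : R) f g : hol a r f -> hol a r g -> hol a r (fun z => f z - g z).
Proof.
move=> hf hg z zr; have [d fd] := hf z zr; have [d' gd] := hg z zr.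
by exists (d - d'); exact: cdiffB.
Qed.
Lemma holM a (r : R) f g : hol a r f -> hol a r g -> hol a r (fun z => f z * g z).
Proof.
move=> hf hg z zr; have [d fd] := hf z zr; have [d' gd] := hg z zr.
by exists (d * g z + f z * d'); exact: cdiffM.
Qed.
Lemma holV a (r : R) f : hol a r f -> (forall z, nm (z - a) < r -> f z != 0) ->
  hol a r (fun z => (f z)^-1).
Proof.
move=> hf f0 z zr; have [d fd] := hf z zr.
by exists (- f z ^- 2 * d); apply: cdiff_inv => //; exact: f0.
Qed.
Lemma holX a (r : R) f n : hol a r f -> hol a r (fun z => f z ^+ n).
Proof.
by move=> hf z zr; have [d fd] := hf z zr; exists (n%:R * f z ^+ n.-1 * d); exact: cdiffX.
Qed.
Lemma hol_sub a (r r' : R) f : r' <= r -> hol a r f -> hol a r' f.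
Proof. by move=> rr hf z zr; apply: hf; exact: lt_le_trans rr. Qed.
Lemma hol_cont a (r : R) f z : hol a r f -> nm (z - a) < r ->
  forall e : R, 0 < e -> exists2 dl : R, 0 < dl & forall w, nm (w - z) < dl -> nm (f w - f z) < e.
Proof. by move=> hf zr; have [d fd] := hf z zr; exact: cdiff_cont fd. Qed.

Definition divdiff f a z := if z == a then derive1 f a else (f z - f a) / (z - a).

Lemma divdiffE f a z : f z = f a + (z - a) * divdiff f a z.
Proof.
rewrite /divdiff; have [->|za] := eqVneq z a; first by rewrite subrr mul0r addr0.
by rewrite mulrC divfK ?subr_eq0 // addrC subrK.
Qed.

Lemma circle_in a (r : R) z : nm z = 1 -> 0 < r -> nm (a + cr r * z - a) = r.
Proof. by move=> z1 r0; rewrite addrC addKr nmM nm_cr z1 mulr1 gtr0_norm. Qed.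

(** Only the centre matters. There the divided difference is the Cauchy transform [T] of the
    boundary values, because the Cauchy kernels at [w] and at [a] differ by [w - a] times the
    inverse of the distance vector to [w]. *)
Lemma hol_divdiff a (r : R) f : hol a r f -> hol a r (divdiff f a).
Proof.
move=> hf; have hoff z : z != a -> nm (z - a) < r -> exists d, cdiff (divdiff f a) z d.
  move=> za zr; have [d fd] := hf z zr.
  have zn : z - a != 0 by rewrite subr_eq0.
  have := cdiff_div (f := fun x => f x - f a) (g := fun x => x - a) zn
    (cdiffB fd (cdiffC (f a) z)) (cdiffB (cdiff_id z) (cdiffC a z)).
  set D := _ + _ => hD; exists D.
  have n0 : 0 < nm (z - a) by rewrite nm_gt0.
  apply: cdiff_near n0 _ hD => w wz; rewrite /divdiff ifN //.
  by apply: contraTneq wz => ->; rewrite nmC ltxx.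
move=> z zr; have [za|za] := eqVneq z a; last exact: hoff.
rewrite za in zr *; have r0 : 0 < r by rewrite subrr nm0 in zr.
have [q q0 qr] : exists2 q : R, 0 < q & q < r.
  by exists (r / 2); move: r0; clear; lra.
have [K HK] := hol_bounded qr hf.
pose s (z : C) := f (a + cr q * z).
have bs : bdc s by exists K => y y1; apply: HK; rewrite circle_in.
pose T w := cmean (fun z => s z / (a + cr q * z - w)).
have aq : nm (a - a) < q by rewrite subrr nm0.
have kn w y : nm y = 1 -> nm (w - a) < q -> a + cr q * y - w != 0.
  move=> y1 wq; rewrite -nm_gt0; apply: lt_le_trans (nm_circle_sub _ _ y1 q0).
  by rewrite subr_gt0.
have bk w : nm (w - a) < q -> bdc (fun z => (a + cr q * z - w)^-1).
  move=> wq; exists (q - nm (w - a))^-1 => y y1; rewrite nmV.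
  by rewrite lef_pV2 ?posrE ?nm_gt0 ?subr_gt0 ?kn // nm_circle_sub.
have TE w : nm (w - a) < q -> f w = f a + (w - a) * T w.
  move=> wq; suff -> : (w - a) * T w = f w - f a by rewrite addrC subrK.
  rewrite -(cauchy_formula qr hf wq) -(cauchy_formula qr hf aq) -cmeanM; last exact: bdcM (bk _ wq).
  have bq w' : nm (w' - a) < q -> bdc (fun z => cr q * z / (a + cr q * z - w')).
    by move=> /bk h; exact: bdcM (bdcMl _ bdc_id) h.
  rewrite -cmeanB; [|exact: bdcM (bq _ wq)|exact: bdcM (bq _ aq)].
  apply: cmean_ext => y y1; have k1 := kn _ _ y1 wq; have k2 := kn _ _ y1 aq.
  rewrite /s; move: k2; have -> : a + cr q * y - a = cr q * y by ring.
  move=> k2; have h : a + cr q * y - w = cr q * y - (w - a) by ring.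
  by rewrite divff // mulr1; field; rewrite -/(_ != _) k1.
have [d Td] : exists d, cdiff T a d by eexists; exact: (cauchy_transform_cdiff 1 bs aq).
exists d; apply: (cdiff_near q0 _ Td) => w wq; rewrite /divdiff.
case: eqVneq => [->|wa]; last first.
  by rewrite (TE w wq) [_ - f a]addrC addKr mulrC mulKf ?subr_eq0.
have [e fe] := hf a zr; rewrite (cdiff_derive1 fe).
have f'T : cdiff f a (1 * T a + (a - a) * d).
  apply: (cdiff_near q0); last first.
    have := cdiffD (cdiffC (f a) a) (cdiffM (cdiffB (cdiff_id a) (cdiffC a a)) Td).
    by rewrite subr0 add0r; apply.
  by move=> w' wq'; rewrite [RHS](TE w' wq').
by rewrite (cdiff_unique fe f'T) mul1r subrr mul0r addr0.
Qed.

(** Divide by [z - a] as long as possible. If this never stops, Cauchy's formula bounds [f z] by a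
    constant times [(nm (z - a) / q) ^+ N] for every [N], hence [f z = 0]. *)
Lemma zero_order a (r : R) f : 0 < r -> hol a r f -> (forall z, nm (z - a) < r -> f z = 0) \/
  exists N g, [/\ hol a r g, g a != 0 & forall z, f z = (z - a) ^+ N * g z].
Proof.
move=> r0 hf.
pose P N := exists2 g, hol a r g & forall z, f z = (z - a) ^+ N * g z.
have [allP|/existsNP [N0 nP]] := pselect (forall N, P N); last first.
  have exN : exists N, ~~ `[< P N >] by exists N0; apply/negP => /asboolP.
  case: (ex_minnP exN) => -[|N] /negP nPN minN.
    by exfalso; apply: nPN; apply/asboolP; exists f => // z; rewrite expr0 mul1r.
  have [g hg fg] : P N.
    apply: contrapT => nP'; have /minN : ~~ `[< P N >] by apply/asboolPn.
    by rewrite ltnn.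
  right; exists N, g; split => //; apply/eqP => ga; apply: nPN; apply/asboolP.
  exists (divdiff g a); first exact: hol_divdiff.
  by move=> z; rewrite fg (divdiffE g a z) ga add0r exprSr mulrA.
left => z zr.
have [q [zq q0 qr]] : exists q : R, [/\ nm (z - a) < q, 0 < q & q < r].
  exists ((nm (z - a) + r) / 2); have := nm_ge0 (z - a); move: zr r0; clear; split; lra.
have [K HK] := hol_bounded qr hf.
have K0 : 0 <= K by apply: le_trans (nm_ge0 _) (HK a _); rewrite subrr nm0 ltW.
have d0 : 0 < q - nm (z - a) by rewrite subr_gt0.
have bound N : nm (f z) <= (nm (z - a) / q) ^+ N * (K * (q / (q - nm (z - a)))).
  have [g hg fg] := allP N.
  rewrite fg nmM nmX expr_div_n -mulrA ler_wpM2l ?exprn_ge0 ?nm_ge0 //.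
  rewrite -(cauchy_formula qr hg zq) mulrA; apply: cmean_bound => y y1.
  rewrite nmM; apply: ler_pM; rewrite ?nm_ge0 //.
    rewrite ler_pdivlMl ?exprn_gt0 //.
    have := HK (a + cr q * y); rewrite circle_in // lexx => /(_ isT).
    by rewrite fg nmM nmX circle_in.
  rewrite nmM nmV nmM nm_cr y1 mulr1 gtr0_norm // ler_pM2l //.
  have c0 := nm_circle_sub a z y1 q0.
  by rewrite lef_pV2 ?posrE ?(lt_le_trans d0).
apply/eqP; rewrite -nm_eq0 eq_le nm_ge0 andbT; apply/ler_addgt0Pr => e e0; rewrite add0r.
set L := K * _ in bound; have L0 : 0 <= L by rewrite mulr_ge0 // divr_ge0 // ltW.
have p0 : 0 <= nm (z - a) / q by rewrite divr_ge0 ?nm_ge0 // ltW.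
have p1 : nm (z - a) / q < 1 by rewrite ltr_pdivrMr // mul1r.
have L1 : 0 < L + 1 by rewrite ltr_wpDl.
have e1 : 0 < e / (L + 1) by rewrite divr_gt0.
have cv : (fun n => (nm (z - a) / q) ^+ n) @ \oo --> (0 : R).
  by apply: cvg_expr; rewrite ger0_norm.
move/cvgrPdist_lt: cv => /(_ _ e1) [N _ HN].
have := HN N (leqnn N); rewrite /= sub0r normrN ger0_norm ?exprn_ge0 // => hN.
apply: le_trans (bound N) _; rewrite ltr_pdivlMr // in hN.
apply: le_trans (ltW hN); rewrite ler_wpM2l ?exprn_ge0 // lerDl; exact: ler01.
Qed.

(** Riemann's device: [(z - a) ^+ 2 * f z], extended by 0, is differentiable at [a] with derivative
    0, so two divided differences undo the factor. *)
Lemma removable a (r K : R) f : 0 < r -> (forall z, 0 < nm (z - a) < r -> exists d, cdiff f z d) ->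
  (forall z, 0 < nm (z - a) < r -> nm (f z) <= K) ->
  exists2 g, hol a r g & forall z, z != a -> g z = f z.
Proof.
move=> r0 hf hK; pose h z := if z == a then 0 else (z - a) ^+ 2 * f z.
have h0 : cdiff h a 0.
  move=> e e0; have K1 : 0 < `|K| + 1 by rewrite ltr_wpDl.
  exists (Num.min r (e / (`|K| + 1))); first by rewrite lt_min r0 divr_gt0.
  move=> y; rewrite lt_min => /andP[yr]; rewrite ltr_pdivlMr // => ye.
  rewrite /h eqxx mul0r !subr0; case: eqVneq => ya.
    by rewrite nm0 mulr_ge0 ?nm_ge0 ?ltW.
  have y0 : y != 0 by apply: contraNneq ya => ->; rewrite addr0.
  have E : a + y - a = y by rewrite addrC addKr.
  have := hK (a + y); rewrite E nm_gt0 y0 yr => /(_ isT) hy.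
  rewrite nmM nmX expr2 -mulrA mulrC; apply: ler_wpM2r; first exact: nm_ge0.
  apply: le_trans (ltW ye); rewrite ler_wpM2l ?nm_ge0 //.
  by apply: le_trans hy _; rewrite (le_trans (ler_norm _)) // lerDl ler01.
have hh : hol a r h.
  move=> z zr; have [->|za] := eqVneq z a; first by exists 0.
  have n0 : 0 < nm (z - a) by rewrite nm_gt0 subr_eq0.
  have [|d fd] := hf z; first by rewrite n0.
  have := cdiffM (cdiffX 2 (cdiffB (cdiff_id z) (cdiffC a z))) fd.
  set D := _ + _ => hD; exists D; apply: cdiff_near n0 _ hD => w wz.
  by rewrite /h ifN //; apply: contraTneq wz => ->; rewrite nmC ltxx.
exists (divdiff (divdiff h a) a); first by do 2 apply: hol_divdiff.
move=> z za; have h'a : divdiff h a a = 0 by rewrite /divdiff eqxx (cdiff_derive1 h0).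
have zn : z - a != 0 by rewrite subr_eq0.
have := divdiffE h a z; rewrite (divdiffE (divdiff h a) a z) h'a add0r.
rewrite {1 2}/h eqxx (negPf za) add0r mulrA -expr2.
by move=> /mulfI ->; rewrite // expf_neq0.
Qed.

(** Liouville for functions that vanish at infinity: [f z] is the mean over any circle around [z],
    and on a large one [f] is below [e]. *)
Lemma entire_vanish f : (forall z, exists d, cdiff f z d) ->
  (forall e : R, 0 < e -> exists A : R, forall z, A <= nm z -> nm (f z) <= e) -> forall z, f z = 0.
Proof.
move=> hf hv z; apply/eqP; rewrite -nm_eq0 eq_le nm_ge0 andbT.
apply/ler_addgt0Pr => e e0; rewrite add0r; have [A HA] := hv _ e0.
pose r : R := `|A| + nm z + 1.
have r0 : 0 < r by rewrite ltr_wpDl ?addr_ge0 ?nm_ge0.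
have rr : r < r + 1 by rewrite ltrDl.
have zz : nm (z - z) < r by rewrite subrr nm0.
have hz : hol z (r + 1) f by move=> w _; exact: hf.
rewrite -(cauchy_formula rr hz zz); apply: cmean_bound => y y1.
have E : z + cr r * y - z = cr r * y by rewrite addrC addKr.
rewrite E divff; last by rewrite -nm_gt0 nmM nm_cr y1 mulr1 gtr0_norm.
rewrite mulr1; apply: HA; have := nm_triB (cr r * y) (- z).
rewrite opprK nmN nmM nm_cr y1 mulr1 gtr0_norm // [z + _]addrC => h.
by apply: le_trans h; rewrite /r; have := ler_norm A; clear; lra.
Qed.

End LocalTheory.

(** * Poisson's formula and harmonic functions in a disc *)

Section Poisson.
Implicit Types (f g F : C -> C) (a b z w v : C) (p q : C -> R).

Definition rmean p : R := re (cmean (fun z => cr (p z))).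
Definition bdr p := exists K : R, forall z, nm z = 1 -> `|p z| <= K.

Lemma bdr_bdc p : bdr p -> bdc (fun z => cr (p z)).
Proof. by move=> [K HK]; exists K => z z1; rewrite nm_cr HK. Qed.
Lemma bdc_re f : bdc f -> bdr (fun z => re (f z)).
Proof. by move=> [K HK]; exists K => z z1; apply: le_trans (re_le_nm _) (HK _ z1). Qed.
Lemma bdc_im f : bdc f -> bdr (fun z => im (f z)).
Proof. by move=> [K HK]; exists K => z z1; apply: le_trans (im_le_nm _) (HK _ z1). Qed.
Lemma bdr_cst k : bdr (fun=> k). Proof. by exists `|k|. Qed.
Lemma bdrD p q : bdr p -> bdr q -> bdr (fun z => p z + q z).
Proof.
move=> [K HK] [L HL]; exists (K + L) => z z1.
by apply: le_trans (ler_normD _ _) (lerD _ _); rewrite ?HK ?HL.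
Qed.
Lemma bdrM p q : bdr p -> bdr q -> bdr (fun z => p z * q z).
Proof.
move=> [K HK] [L HL]; exists (K * L) => z z1; rewrite normrM.
by apply: ler_pM; rewrite ?normr_ge0 ?HK ?HL.
Qed.
Lemma bdrMl k p : bdr p -> bdr (fun z => k * p z).
Proof. exact: bdrM (bdr_cst k). Qed.
Lemma bdrB p q : bdr p -> bdr q -> bdr (fun z => p z - q z).
Proof.
move=> [K HK] [L HL]; exists (K + L) => z z1.
by apply: le_trans (ler_normB _ _) (lerD _ _); rewrite ?HK ?HL.
Qed.

Lemma rmean_ext p q : (forall z, nm z = 1 -> p z = q z) -> rmean p = rmean q.
Proof. by move=> H; congr re; apply: cmean_ext => z z1; rewrite H. Qed.
Lemma rmean_cst k : rmean (fun=> k) = k.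
Proof. by rewrite /rmean cmean_cst. Qed.
Lemma rmeanD p q : bdr p -> bdr q -> rmean (fun z => p z + q z) = rmean p + rmean q.
Proof.
move=> /bdr_bdc bp /bdr_bdc bq; rewrite /rmean -reD -cmeanD //.
by congr re; apply: cmean_ext => z _; rewrite crD.
Qed.
Lemma rmeanMl k p : bdr p -> rmean (fun z => k * p z) = k * rmean p.
Proof.
move=> /bdr_bdc bp; rewrite /rmean -re_crM -cmeanM //.
by congr re; apply: cmean_ext => z _; rewrite crM.
Qed.
Lemma rmeanB p q : bdr p -> bdr q -> rmean (fun z => p z - q z) = rmean p - rmean q.
Proof.
move=> bp bq; rewrite -[- rmean q]mulN1r -rmeanMl // -rmeanD //; last exact: bdrMl.
by apply: rmean_ext => z _; rewrite mulN1r.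
Qed.
Lemma rmean_ge0 p : bdr p -> (forall z, nm z = 1 -> 0 <= p z) -> 0 <= rmean p.
Proof. by move=> /bdr_bdc bp H; apply: cmean_re_ge0 => // z z1; rewrite re_cr H. Qed.
Lemma rmean_le p q : bdr p -> bdr q -> (forall z, nm z = 1 -> p z <= q z) -> rmean p <= rmean q.
Proof.
move=> bp bq H; rewrite -subr_ge0 -rmeanB //; apply: rmean_ge0; first exact: bdrB.
by move=> z z1; rewrite subr_ge0 H.
Qed.
Lemma rmean_bound p (K : R) : (forall z, nm z = 1 -> `|p z| <= K) -> `|rmean p| <= K.
Proof.
move=> H; apply: le_trans (re_le_nm _) _.
by apply: cmean_bound => z z1; rewrite nm_cr H.
Qed.

Lemma re_cmean f : bdc f -> re (cmean f) = rmean (fun z => re (f z)).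
Proof.
move=> bf; have br := bdr_bdc (bdc_re bf); have bi := bdr_bdc (bdc_im bf).
have fE : cmean f = cmean (fun z => cr (re (f z))) + ci * cmean (fun z => cr (im (f z))).
  rewrite -cmeanM // -cmeanD //; last exact: bdcMl.
  by apply: cmean_ext => z _; exact: reimE.
rewrite fE reD [re (ci * _)]reM re_ci im_ci mul0r sub0r mul1r.
rewrite [im (cmean _)]cmean_real ?oppr0 ?addr0 //.
Qed.

Definition pker (r : R) v z : R := re ((cr r * z + v) / (cr r * z - v)).

Section Kernel.
Variables (r : R) (v : C).
Hypothesis vr : nm v < r.
Let r0 : 0 < r. Proof. exact: le_lt_trans (nm_ge0 _) vr. Qed.

Lemma ker_sub_ge z : nm z = 1 -> r - nm v <= nm (cr r * z - v).
Proof. by move=> z1; have := nm_triB (cr r * z) v; rewrite nmM nm_cr z1 mulr1 gtr0_norm. Qed.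
Lemma ker_sub_le z : nm z = 1 -> nm (cr r * z - v) <= r + nm v.
Proof. by move=> z1; have := nmB (cr r * z) v; rewrite nmM nm_cr z1 mulr1 gtr0_norm. Qed.
Lemma ker_sub_gt0 z : nm z = 1 -> 0 < nm (cr r * z - v).
Proof. by move=> z1; apply: lt_le_trans (ker_sub_ge z1); rewrite subr_gt0. Qed.

Lemma pkerE z : nm z = 1 -> pker r v z = (r ^+ 2 - nm v ^+ 2) / nm (cr r * z - v) ^+ 2.
Proof.
move=> z1; have d0 := ker_sub_gt0 z1; set d := cr r * z - v in d0 *.
have dn : d != 0 by rewrite -nm_gt0.
have -> : pker r v z = re (cr (nm d ^+ 2)^-1 * ((cr r * z + v) * cj d)).
  have cdn : cj d != 0 by rewrite -nm_gt0 nm_cj.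
  by rewrite /pker -/d; congr re; rewrite crV -mul_cj; field; rewrite dn cdn.
rewrite re_crM mulrC; congr (_ / _).
rewrite /d reM reD imD re_cj im_cj reB imB re_crM im_crM.
have := nm_sqr z; rewrite z1 expr1n => h.
rewrite nm_sqr; move: h; clear; nra.
Qed.

Lemma pker_ge z : nm z = 1 -> (r - nm v) / (r + nm v) <= pker r v z.
Proof.
move=> z1; rewrite pkerE //; have v0 := nm_ge0 v.
have s0 : 0 < r + nm v by rewrite ltr_pwDl.
have := ker_sub_le z1; have := ker_sub_gt0 z1; set d := nm _ => d0 dl.
rewrite ler_pdivlMr ?exprn_gt0 // subr_sqr mulrAC ler_pdivrMr //.
rewrite -mulrA ler_pM2l ?subr_gt0 // -expr2.
by apply: pexp_le => //; exact: ltW.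
Qed.

Lemma pker_le z : nm z = 1 -> pker r v z <= (r + nm v) / (r - nm v).
Proof.
move=> z1; rewrite pkerE //; have v0 := nm_ge0 v.
have s0 : 0 < r - nm v by rewrite subr_gt0.
have := ker_sub_ge z1; have := ker_sub_gt0 z1; set d := nm _ => d0 dl.
rewrite ler_pdivrMr ?exprn_gt0 // subr_sqr mulrAC ler_pdivlMr // mulrAC mulrC.
rewrite ler_pM2l ?ltr_pwDl // -expr2.
by apply: pexp_le => //; exact: ltW.
Qed.

Lemma pker_gt0 z : nm z = 1 -> 0 < pker r v z.
Proof.
move=> z1; apply: lt_le_trans (pker_ge z1).
by rewrite divr_gt0 ?subr_gt0 // ltr_pwDl ?nm_ge0.
Qed.

Lemma bdr_pker : bdr (pker r v).
Proof.
exists ((r + nm v) / (r - nm v)) => z z1.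
by rewrite gtr0_norm ?pker_gt0 ?pker_le.
Qed.

Lemma pker_half z : nm v <= r / 2 -> nm z = 1 -> 1 / 3 <= pker r v z <= 3.
Proof.
move=> vh z1; have v0 := nm_ge0 v; apply/andP; split.
  apply: le_trans (pker_ge z1); rewrite ler_pdivlMr ?ltr_pwDl //.
  by lra.
apply: le_trans (pker_le z1) _; rewrite ler_pdivrMr ?subr_gt0 //.
by lra.
Qed.

(** Cauchy's kernel at [a + v] is [1 + u]. On the circle the conjugate of [u] is the restriction of
    a holomorphic function vanishing at [a], so it may be added without changing the mean;
    [1 + u + cj u] is the Poisson kernel. *)
Lemma poisson_formula a (r' : R) F : r < r' -> hol a r' F ->
  re (F (a + v)) = rmean (fun z => re (F (a + cr r * z)) * pker r v z).
Proof.
move=> rr' hF.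
have [K HK] := hol_bounded rr' hF.
have bF : bdc (fun z => F (a + cr r * z)) by exists K => z z1; apply: HK; rewrite circle_in.
pose u z := v / (cr r * z - v).
have bu : bdc u.
  exists (nm v / (r - nm v)) => z z1; rewrite nmM nmV ler_wpM2l ?nm_ge0 //.
  by rewrite lef_pV2 ?posrE ?ker_sub_gt0 ?subr_gt0 // ker_sub_ge.
have dn z : nm z = 1 -> cr r * z - v != 0 by move=> /ker_sub_gt0; rewrite nm_gt0.
have e1 : F (a + v) = cmean (fun z => F (a + cr r * z) * (1 + u z)).
  have va : nm (a + v - a) < r by rewrite addrC addKr.
  rewrite -(cauchy_formula rr' hF va); apply: cmean_ext => z z1; congr (_ * _).
  have -> : a + cr r * z - (a + v) = cr r * z - v by ring.
  by rewrite /u; field; exact: dn.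
have bcu : bdc (fun z => cj (u z)).
  by have [L HL] := bu; exists L => z z1; rewrite nm_cj HL.
have e2 : cmean (fun z => F (a + cr r * z) * cj (u z)) = 0.
  have [s [s0 vs sr]] : exists s : R, [/\ 0 < s, nm v < s & s < r].
    by have v0 := nm_ge0 v; have rp : 0 < r := r0; exists ((nm v + r) / 2); move: vr rp v0 => h1 h2 h3; split; lra.
  (* The reflected kernel can have a pole only at distance [r ^+ 2 / nm v] from [a], beyond [r2], so
     it is holomorphic past the circle. *)
  pose r2 := Num.min r' (r ^+ 2 / s).
  have rs : r < r ^+ 2 / s by rewrite ltr_pdivlMr // expr2 ltr_pM2l.
  have rr2 : r < r2 by rewrite lt_min rr'.
  have den z : nm (z - a) < r2 -> cr (r ^+ 2) - cj v * (z - a) != 0.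
    rewrite lt_min => /andP[_]; rewrite ltr_pdivlMr // => h.
    rewrite -nm_gt0; apply: lt_le_trans (nm_triB _ _); rewrite subr_gt0 nmM nm_cj nm_cr.
    rewrite ger0_norm ?exprn_ge0 ?(ltW r0) //; apply: le_lt_trans h; rewrite mulrC.
    by rewrite ler_wpM2l ?nm_ge0 // ltW.
  pose G z := F z * (cj v * (z - a) / (cr (r ^+ 2) - cj v * (z - a))).
  have hl : hol a r2 (fun z => cj v * (z - a)).
    by apply: holM; [exact: hol_cst|apply: holB; [exact: hol_id|exact: hol_cst]].
  have hG : hol a r2 G.
    apply: holM; first by apply: hol_sub hF; rewrite ge_min lexx.
    by apply: holM => //; apply: holV => //; apply: holB => //; exact: hol_cst.
  have aa : nm (a - a) < r by rewrite subrr nm0.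
  have := cauchy_formula rr2 hG aa; rewrite {2}/G subrr mulr0 mul0r mulr0 => <-.
  apply: cmean_ext => z z1.
  have zn : z != 0 by rewrite -nm_gt0 z1.
  have crn : cr r != 0 by rewrite cr_eq0 gt_eqF.
  have E : a + cr r * z - a = cr r * z by rewrite addrC addKr.
  rewrite /G E divff ?mulf_neq0 // mulr1; congr (_ * _).
  have zc : cj z = z^-1 by apply: (mulfI zn); rewrite divff // mul_cj z1 expr1n cr1.
  have cjr : cj (cr r) = cr r by exact: conjc_real.
  have -> : cj (u z) = cj v / (cr r * z^-1 - cj v).
    by rewrite /u /cj rmorphM fmorphV rmorphB /= -!/(cj _) cjM cjr zc.
  have d1 : cr r * z^-1 - cj v != 0.
    rewrite -zc -cjr -cjM; have -> : cj (cr r * z) - cj v = cj (cr r * z - v).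
      by rewrite /cj rmorphB.
    by rewrite -nm_gt0 nm_cj ker_sub_gt0.
  have d2 : r%:C%C ^+ 2 - cj v * (cr r * z) != 0.
    by have := den (a + cr r * z); rewrite E crX; apply; rewrite nmM nm_cr z1 mulr1 gtr0_norm.
  rewrite crX; rewrite -/(cr r) in d2.
  have -> : cr r ^+ 2 - cj v * (cr r * z) = (cr r * z^-1 - cj v) * (cr r * z).
    by field; exact: zn.
  by rewrite invfM mulrACA divff ?mulf_neq0 // mulr1.
have e3 : F (a + v) = cmean (fun z => F (a + cr r * z) * cr (pker r v z)).
  have b1 : bdc (fun z => F (a + cr r * z) * (1 + u z)).
    by apply: bdcM => //; apply: bdcD => //; exact: bdc_cst.
  rewrite e1 -[LHS]addr0 -e2 -cmeanD //; last exact: bdcM.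
  apply: cmean_ext => z z1; rewrite -mulrDr; congr (_ * _).
  have -> : cr (pker r v z) = cr (re (1 + 2 * u z)).
    by congr (cr (re _)); rewrite /u; field; exact: dn.
  have uu : u z + cj (u z) = 2 * cr (re (u z)) by exact: addcJ.
  by rewrite -addrA uu reD re1 crD cr1 -[2]cr_nat re_crM crM.
rewrite e3 re_cmean; last by apply: bdcM => //; exact: bdr_bdc bdr_pker.
by apply: rmean_ext => z _; rewrite mulrC re_crM mulrC.
Qed.

Lemma rmean_pker : rmean (pker r v) = 1.
Proof.
have rr' : r < r + 1 by rewrite ltrDl.
have := poisson_formula rr' (@hol_cst 0 (r + 1) 1); rewrite re1 => ->.
by apply: rmean_ext => z _; rewrite mul1r.
Qed.
End Kernel.

(** The Poisson integral of the boundary values [p], at the point [v] of the disc of radius [r]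
    centred at 0. *)
Definition dext (r : R) p v : R := rmean (fun z => p z * pker r v z).

(** The Poisson integral is the real part of the Schwarz integral, and
    [(cr r * z + v) / (cr r * z - v)] is -1 plus twice a Cauchy kernel. *)
Lemma dext_hol (r : R) p : bdr p -> exists2 H, hol 0 r H & forall v, nm v < r -> dext r p v = re (H v).
Proof.
move=> bp; have bcp := bdr_bdc bp.
exists (fun v => - cmean (fun z => cr (p z)) +
  2 * cmean (fun z => cr (p z) * (cr r * z) / (0 + cr r * z - v))).
  move=> v vr; eexists; apply: cdiffD; first exact: cdiffC.
  apply: cdiffMl; apply: (cauchy_transform_cdiff 1 _ vr).
  by apply: bdcM => //; apply: bdcMl; exact: bdc_id.
move=> v vr.
have bk : bdc (fun z => (cr r * z + v) / (cr r * z - v)).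
  exists ((r + nm v) / (r - nm v)) => z z1; rewrite nmM nmV.
  have r0 : 0 < r by exact: le_lt_trans (nm_ge0 _) vr.
  apply: ler_pM; rewrite ?nm_ge0 ?invr_ge0 ?nm_ge0 //.
    by apply: le_trans (nmD _ _) _; rewrite nmM nm_cr z1 mulr1 gtr0_norm.
  by rewrite lef_pV2 ?posrE ?ker_sub_gt0 ?subr_gt0 // ker_sub_ge.
have -> : dext r p v = re (cmean (fun z => cr (p z) * ((cr r * z + v) / (cr r * z - v)))).
  rewrite re_cmean; last exact: bdcM.
  by apply: rmean_ext => z _; rewrite re_crM.
have bz : bdc (fun z => cr (p z) * (cr r * z) / (0 + cr r * z - v)).
  exists ((sval (cid bcp) * r) / (r - nm v)) => z z1.
  have r0 : 0 < r by exact: le_lt_trans (nm_ge0 _) vr.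
  rewrite add0r nmM nmV nmM nmM nm_cr [nm (cr r)]nm_cr z1 mulr1 [`|r|]gtr0_norm //.
  apply: ler_pM; rewrite ?mulr_ge0 ?invr_ge0 ?nm_ge0 ?(ltW r0) //.
    by rewrite ler_pM2r // -nm_cr; case: cid => K HK /=; exact: HK.
  by rewrite lef_pV2 ?posrE ?ker_sub_gt0 ?subr_gt0 // ker_sub_ge.
congr re; rewrite -[- cmean _]mulN1r -!cmeanM // -cmeanD; [|exact: bdcMl..].
apply: cmean_ext => z z1.
have dn : cr r * z - v != 0 by rewrite -nm_gt0 ker_sub_gt0.
by rewrite add0r; field.
Qed.

(** The oscillation of [p] is dominated by [e / 2 + L * nm (z - z0) ^+ 2]. Against the Poisson
    kernel, [nm (cr r * z - v) ^+ 2] has mean exactly [r ^+ 2 - nm v ^+ 2], which tends to 0 at the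
    boundary; no estimate of the kernel is needed. *)
Lemma dext_boundary (r : R) p z0 : 0 < r -> bdr p -> nm z0 = 1 ->
  (forall e : R, 0 < e -> exists2 d : R, 0 < d &
    forall z, nm z = 1 -> nm (z - z0) < d -> `|p z - p z0| < e) ->
  forall e : R, 0 < e -> exists2 d : R, 0 < d &
    forall v, nm v < r -> nm (v - cr r * z0) < d -> `|dext r p v - p z0| < e.
Proof.
move=> r0 [K HK] z01 pc e e0.
have e2 : 0 < e / 2 by rewrite divr_gt0.
have [d0 d00 Hd] := pc _ e2.
have K0 : 0 <= K by apply: le_trans (normr_ge0 _) (HK 1 _); rewrite nm1.
pose L := 2 * K / d0 ^+ 2; have L0 : 0 <= L by apply: divr_ge0; [exact: mulr_ge0|exact: sqr_ge0].
have crn : cr r != 0 by rewrite cr_eq0 gt_eqF.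
exists (Num.min r (e * r / (16 * (L + 1)))).
  by rewrite lt_min r0 divr_gt0 ?mulr_gt0 // ltr_wpDl.
move=> v vr; rewrite lt_min => /andP[vz1 vz2].
set t := nm (v - cr r * z0) in vz1 vz2.
have bP := bdr_pker vr; have bp : bdr p by exists K.
have -> : dext r p v - p z0 = rmean (fun z => (p z - p z0) * pker r v z).
  rewrite -[X in _ - X]mulr1 -(rmean_pker vr) -rmeanMl // -rmeanB; [|exact: bdrM|exact: bdrMl].
  by apply: rmean_ext => z _; rewrite mulrBl.
have pw z : nm z = 1 -> `|p z - p z0| <= e / 2 + L * nm (z - z0) ^+ 2.
  move=> z1; have [h|h] := ltP (nm (z - z0)) d0.
    apply: le_trans (ltW (Hd _ z1 h)) _.
    by rewrite lerDl mulr_ge0 // exprn_ge0 // nm_ge0.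
  apply: le_trans (ler_normB _ _) _; apply: (@le_trans _ _ (2 * K)).
    by have := HK _ z1; have := HK _ z01; move=> h1 h2; rewrite mulr2n mulrDl mul1r lerD.
  apply: le_trans (_ : _ <= L * nm (z - z0) ^+ 2) _; last by rewrite lerDr ltW.
  rewrite /L mulrAC ler_pdivlMr ?exprn_gt0 // ler_wpM2l ?mulr_ge0 //.
  by apply: pexp_le => //; exact: ltW.
have zr z : nm z = 1 -> nm (z - z0) ^+ 2 <= 2 / r ^+ 2 * nm (cr r * z - v) ^+ 2 + 2 / r ^+ 2 * t ^+ 2.
  move=> z1; rewrite -mulrDr mulrAC ler_pdivlMr ?exprn_gt0 //.
  have : nm (cr r * (z - z0)) <= nm (cr r * z - v) + t.
    apply: le_trans (nmD _ _); rewrite le_eqVlt; apply/orP; left; apply/eqP.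
    by congr nm; ring.
  rewrite nmM nm_cr gtr0_norm // => h.
  have h2 : (r * nm (z - z0)) ^+ 2 <= (nm (cr r * z - v) + t) ^+ 2.
    by apply: pexp_le => //; rewrite mulr_ge0 ?nm_ge0 // ltW.
  rewrite [X in X <= _]mulrC -exprMn; apply: le_trans h2 _.
  rewrite -subr_ge0 (_ : _ - _ = (nm (cr r * z - v) - t) ^+ 2) ?sqr_ge0 //.
  by ring.
have bker : bdr (fun z => nm (cr r * z - v) ^+ 2).
  exists ((r + nm v) ^+ 2) => z z1; rewrite ger0_norm ?sqr_ge0 //.
  by apply: pexp_le; [exact: nm_ge0|exact: ker_sub_le].
pose A := e / 2 + L * (2 / r ^+ 2 * t ^+ 2); pose B := L * (2 / r ^+ 2).
have kE : rmean (fun z => A * pker r v z + B * (nm (cr r * z - v) ^+ 2 * pker r v z)) =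
    A + B * (r ^+ 2 - nm v ^+ 2).
  rewrite rmeanD; [|exact: bdrMl|exact: bdrMl (bdrM bker bP)].
  rewrite rmeanMl // rmean_pker // mulr1 rmeanMl; last exact: bdrM.
  congr (_ + _ * _); rewrite -[RHS](@rmean_cst (r ^+ 2 - nm v ^+ 2)).
  apply: rmean_ext => z z1; rewrite pkerE // mulrC divfK //.
  by rewrite expf_neq0 // gt_eqF // ker_sub_gt0.
have bnd : `|rmean (fun z => (p z - p z0) * pker r v z)| <= A + B * (r ^+ 2 - nm v ^+ 2).
  have b1 : bdr (fun z => (p z - p z0) * pker r v z) by apply: bdrM => //; exact: bdrB (bdr_cst _).
  have b2 : bdr (fun z => A * pker r v z + B * (nm (cr r * z - v) ^+ 2 * pker r v z)).
    by apply: bdrD; apply: bdrMl => //; exact: bdrM.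
  have b3 z : nm z = 1 -> `|(p z - p z0) * pker r v z| <=
      A * pker r v z + B * (nm (cr r * z - v) ^+ 2 * pker r v z).
    move=> z1; have P0 := pker_gt0 vr z1; rewrite normrM [`|pker _ _ _|]gtr0_norm //.
    rewrite mulrA -mulrDl ler_pM2r //; apply: le_trans (pw _ z1) _.
    have h := ler_wpM2l L0 (zr _ z1); rewrite mulrDr !mulrA in h.
    by rewrite /A /B !mulrA; move: h; clear; lra.
  rewrite -kE ler_norml; apply/andP; split; last first.
    by apply: rmean_le => // z z1; apply: le_trans (ler_norm _) (b3 _ z1).
  rewrite -[- rmean _]mulN1r -rmeanMl //; apply: rmean_le => //; first exact: bdrMl.
  move=> z z1; rewrite mulN1r lerNl; apply: le_trans (b3 _ z1).
  by rewrite -normrN ler_norm.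
apply: le_lt_trans bnd _; rewrite /A /B.
have rv : r - nm v <= t.
  rewrite /t nmC; have := nm_triB (cr r * z0) v.
  by rewrite nmM nm_cr z01 mulr1 gtr0_norm.
have t0 : 0 <= t by exact: nm_ge0.
have sq : r ^+ 2 - nm v ^+ 2 <= 2 * r * t.
  have v0 := nm_ge0 v; have h1 : r + nm v <= 2 * r by move: vr; clear; lra.
  have h2 : 0 <= r - nm v by rewrite subr_ge0 ltW.
  rewrite subr_sqr [2 * r * t]mulrC; apply: ler_pM => //.
  by rewrite addr_ge0 // ltW.
have tt : t ^+ 2 <= r * t by rewrite expr2 ler_wpM2r // ltW.
have q0 : 0 <= L * (2 / r ^+ 2) by rewrite mulr_ge0 // divr_ge0 // sqr_ge0.
have h1 : L * (2 / r ^+ 2 * t ^+ 2) + L * (2 / r ^+ 2) * (r ^+ 2 - nm v ^+ 2) <=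
    L * (2 / r ^+ 2) * (3 * r * t).
  rewrite [L * (_ * t ^+ 2)]mulrA -mulrDr ler_wpM2l //; move: sq tt; clear; lra.
have h2 : L * (2 / r ^+ 2) * (3 * r * t) = 6 * L * t / r.
  by field; rewrite gt_eqF.
have h3 : 6 * L * t / r < e / 2.
  rewrite ltr_pdivrMr //; rewrite ltr_pdivlMr in vz2; last by rewrite mulr_gt0 // ltr_wpDl.
  have er : 0 < e * r by rewrite mulr_gt0.
  have tL : 0 <= t * L by rewrite mulr_ge0.
  by move: vz2 er tL t0; clear; nra.
by move: h1 h3; rewrite h2; clear; lra.
Qed.

(** On a circle around [a] the deficit [re (F a) - re F] is non-negative with mean 0. By Poisson's
    formula the deficit at an interior point is at most a constant times this mean. *)
Lemma harmonic_max a (r : R) F : hol a r F -> (forall z, nm (z - a) < r -> re (F z) <= re (F a)) ->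
  forall z, nm (z - a) < r -> re (F z) = re (F a).
Proof.
move=> hF hmax z zr.
have [q [zq q0 qr]] : exists q : R, [/\ nm (z - a) < q, 0 < q & q < r].
  by have z0 := nm_ge0 (z - a); exists ((nm (z - a) + r) / 2); move: zr z0; clear; split; lra.
have [K HK] := hol_bounded qr hF.
have bF : bdr (fun y => re (F (a + cr q * y))).
  by apply: bdc_re; exists K => y y1; apply: HK; rewrite circle_in.
have v0 : nm (0 : C) < q by rewrite nm0.
have m0 : rmean (fun y => re (F a) - re (F (a + cr q * y))) = 0.
  rewrite rmeanB //; last exact: bdr_cst.
  rewrite rmean_cst -{1}[a]addr0 (poisson_formula v0 qr hF) -[X in X - _]/(rmean _).
  rewrite [X in X - _](_ : _ = rmean (fun y => re (F (a + cr q * y)))) ?subrr //.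
  apply: rmean_ext => y y1; rewrite /pker addr0 subr0 divff ?mulr1 //.
  by rewrite -nm_gt0 nmM nm_cr y1 mulr1 gtr0_norm.
have bk := bdr_pker zq.
have b1 : bdr (fun y => re (F a) - re (F (a + cr q * y))) by exact: bdrB (bdr_cst _) bF.
have le0 y : nm y = 1 -> 0 <= re (F a) - re (F (a + cr q * y)).
  by move=> y1; rewrite subr_ge0 hmax // circle_in.
have e1 : re (F a) - re (F z) = rmean (fun y => (re (F a) - re (F (a + cr q * y))) * pker q (z - a) y).
  have zE : z = a + (z - a) by rewrite addrC subrK.
  rewrite {1}zE (poisson_formula zq qr hF) -[X in X - _]mulr1 -(rmean_pker zq) -rmeanMl //.
  rewrite -rmeanB; [|exact: bdrMl|exact: bdrM].
  by apply: rmean_ext => y _; rewrite mulrBl.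
have [M HM] := bk.
have : re (F a) - re (F z) <= M * rmean (fun y => re (F a) - re (F (a + cr q * y))).
  rewrite e1 -rmeanMl //; apply: rmean_le; [exact: bdrM|exact: bdrMl|].
  move=> y y1; rewrite mulrC ler_wpM2r ?le0 //.
  exact: le_trans (ler_norm _) (HM _ y1).
rewrite m0 mulr0 => h; apply/eqP; rewrite eq_le hmax //=; move: h; clear; lra.
Qed.

(** The approximants are Poisson integrals of their boundary values; in the limit [u] is the Poisson
    integral of its own, hence a real part. *)
Lemma harmonic_uniform_limit a (r r' : R) (u : C -> R) : 0 < r -> r < r' ->
  (forall e : R, 0 < e -> exists2 F, hol a r' F &
     forall z, nm (z - a) < r' -> `|u z - re (F z)| <= e) ->
  exists2 G, hol a r G & forall z, nm (z - a) < r -> u z = re (G z).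
Proof.
move=> r0 rr' H; pose p z := u (a + cr r * z).
have cin y : nm y = 1 -> nm (a + cr r * y - a) < r' by move=> y1; rewrite circle_in.
have bp : bdr p.
  have [F hF uF] := H _ ltr01; have [K HK] := hol_bounded rr' hF.
  exists (1 + K) => y y1; rewrite /p.
  have h1 := uF _ (cin _ y1).
  have h2 : `|re (F (a + cr r * y))| <= K.
    by apply: le_trans (re_le_nm _) (HK _ _); rewrite circle_in.
  rewrite -[u _](subrK (re (F (a + cr r * y)))); apply: le_trans (ler_normD _ _) _.
  exact: lerD.
have [G hG GE] := dext_hol r bp.
exists (fun z => G (z - a)).
  move=> z zr; have [|d Gd] := hG (z - a); first by rewrite subr0.
  by exists d; exact: cdiff_shift.
move=> z zr; rewrite -GE //; apply/eqP; rewrite -subr_eq0 -normr_eq0 eq_le normr_ge0 andbT.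
apply/ler_addgt0Pr => e e0; rewrite add0r.
have e2 : 0 < e / 2 by rewrite divr_gt0.
have [F hF uF] := H _ e2.
have zE : z = a + (z - a) by rewrite addrC subrK.
have h1 := uF _ (lt_trans zr rr').
have h2 : `|re (F z) - dext r p (z - a)| <= e / 2.
  have [K HK] := hol_bounded rr' hF.
  have bF : bdr (fun y => re (F (a + cr r * y))).
    by apply: bdc_re; exists K => y y1; apply: HK; rewrite circle_in.
  have bk := bdr_pker zr.
  rewrite {1}zE (poisson_formula zr rr' hF) /dext -rmeanB; [|exact: bdrM|exact: bdrM].
  have pw y : nm y = 1 -> `|re (F (a + cr r * y)) * pker r (z - a) y - p y * pker r (z - a) y|
      <= e / 2 * pker r (z - a) y.
    move=> y1; rewrite -mulrBl normrM [`|pker _ _ _|]gtr0_norm ?pker_gt0 //.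
    by rewrite ler_pM2r ?pker_gt0 // distrC; exact: uF (cin _ y1).
  have b1 : bdr (fun y => re (F (a + cr r * y)) * pker r (z - a) y - p y * pker r (z - a) y).
    by apply: bdrB; exact: bdrM.
  have E : rmean (fun y => e / 2 * pker r (z - a) y) = e / 2.
    by rewrite rmeanMl // rmean_pker // mulr1.
  rewrite -E ler_norml; apply/andP; split; last first.
    by apply: rmean_le => //; [exact: bdrMl|move=> y y1; apply: le_trans (ler_norm _) (pw _ y1)].
  rewrite -[- rmean _]mulN1r -rmeanMl //; last exact: bdrMl.
  apply: rmean_le => //; first by apply: bdrMl; exact: bdrMl.
  by move=> y y1; rewrite mulN1r lerNl; apply: le_trans (pw _ y1); rewrite -normrN ler_norm.
have := ler_distD (re (F z)) (u z) (dext r p (z - a)); move: h1 h2; clear; lra.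
Qed.

End Poisson.

(** * Principal parts and residues in the plane *)

Section PlaneResidues.
Implicit Types (f g h : C -> C) (a b y z w c : C).

Lemma is_ulim_cj (u : nat -> C) l : is_ulim u l -> is_ulim (fun n => cj (u n)) (cj l).
Proof.
move=> ul e e0; have FF := @ultra_proper _ _ ultra_natP.
apply: filterS (ul e e0) => n /=.
have -> : cj (u n) - cj l = cj (u n - l) by rewrite /cj rmorphB.
by rewrite nm_cj.
Qed.

Lemma cmean_conj f : bdc f -> cmean (fun z => cj (f z)) = cj (cmean f).
Proof.
move=> bf; apply: ulim_eq; have := is_ulim_cj (cmeanP bf); congr is_ulim.
apply/funext => n; rewrite /avg cjM [cj (cr _)]conjc_real; congr (_ * _).
by rewrite /cj rmorph_sum.
Qed.

Lemma cdiff_conj f z d : cdiff f (cj z) d -> cdiff (fun w => cj (f (cj w))) z (cj d).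
Proof.
move=> fd e e0; have [dl dl0 H] := fd _ e0; exists dl => // h hd.
have := H (cj h); rewrite nm_cj => /(_ hd) H'.
rewrite cjD; apply: le_trans H'; rewrite -[X in X <= _]nm_cj le_eqVlt; apply/orP; left.
by apply/eqP; congr nm; rewrite /cj !rmorphB rmorphM /= !conjcK.
Qed.

(** On the unit circle [cj z] is [z^-1], so this evaluates means of power series in negative powers
    of [z]. *)
Lemma cmean_hol_conj (r : R) g : 1 < r -> hol 0 r g -> cmean (fun z => g (cj z)) = g 0.
Proof.
move=> r1 hg; pose G w := cj (g (cj w)).
have hG : hol 0 r G.
  move=> z; rewrite subr0 => zr; have [|d gd] := hg (cj z); first by rewrite subr0 nm_cj.
  by exists (cj d); exact: cdiff_conj.
have z0 : nm (0 - 0 : C) < 1 by rewrite subr0 nm0.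
have [K HK] := hol_bounded r1 hG.
have E z : nm z = 1 -> G (0 + cr 1 * z) * (cr 1 * z / (0 + cr 1 * z - 0)) = G z.
  by move=> z1; rewrite cr1 !mul1r !add0r subr0 divff ?mulr1 // -nm_gt0 z1.
have GE : cmean G = G 0 by rewrite -[RHS](cauchy_formula r1 hG z0); apply: cmean_ext => z z1; rewrite E.
have bG : bdc G by exists K => z z1; apply: HK; rewrite subr0 z1.
have -> : cmean (fun z => g (cj z)) = cj (cmean G).
  by rewrite -cmean_conj //; apply: cmean_ext => z _; rewrite /G /cj !conjcK.
by rewrite GE /G /cj conjcK rmorph0.
Qed.

(** The contour integral of [f] over the circle of centre [a] and radius [r], divided by
    [2 pi i]. *)
Definition cint a (r : R) f := cmean (fun z => cr r * z * f (a + cr r * z)).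

Lemma cint_hol a (r r' : R) f : 0 < r -> r < r' -> hol a r' f -> cint a r f = 0.
Proof.
move=> r0 rr' hf; have hh : hol a r' (fun z => (z - a) * f z).
  by apply: holM => //; apply: holB; [exact: hol_id|exact: hol_cst].
have aa : nm (a - a) < r by rewrite subrr nm0.
have := cauchy_formula rr' hh aa; rewrite subrr mul0r => h0; rewrite -[RHS]h0 /cint.
apply: cmean_ext => z z1; have E : a + cr r * z - a = cr r * z by rewrite addrC addKr.
by rewrite E divff ?mulr1 // -nm_gt0 nmM nm_cr z1 mulr1 gtr0_norm.
Qed.

(** Since [cj z = z^-1] on the circle, the integrand is a holomorphic function of [cj z] on a larger
    disc, and its mean is the value at 0. *)
Lemma cint_pole a (r : R) y k : nm (y - a) < r -> cint a r (fun z => (z - y) ^- k.+1) = (k == 0)%:R.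
Proof.
move=> yr; have r0 : 0 < r by exact: le_lt_trans (nm_ge0 _) yr.
set v := y - a in yr *.
have crn : cr r != 0 by rewrite cr_eq0 gt_eqF.
have [s s1 sv] : exists2 s : R, 1 < s & nm v * s < r.
  have [vp|v0] := ltP 0 (nm v); last first.
    exists 2; first by rewrite ltr1n.
    by apply: le_lt_trans r0; rewrite mulr_le0_ge0.
  exists ((1 + r / nm v) / 2).
    by rewrite ltr_pdivlMr // mul1r -[2]/(1 + 1) ltrD2l ltr_pdivlMr // mul1r.
  rewrite mulrA ltr_pdivrMr // mulrDr mulr1 mulrCA divff ?gt_eqF // mulr1.
  by rewrite mulr_natr mulr2n ltrD2r.
pose u := v / cr r.
have du z : nm (z - 0) < s -> 1 - u * z != 0.
  rewrite subr0 => zs; rewrite -nm_gt0; apply: lt_le_trans (nm_triB _ _).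
  rewrite nm1 subr_gt0 !nmM nmV nm_cr gtr0_norm // mulrAC ltr_pdivrMr // mul1r.
  apply: le_lt_trans sv; rewrite ler_wpM2l ?nm_ge0 // ltW //.
pose g w := cr r ^- k * w ^+ k * (1 - u * w) ^- k.+1.
have hg : hol 0 s g.
  apply: holM; first by apply: holM; [exact: hol_cst|apply: holX; exact: hol_id].
  have h1 : hol 0 s (fun w => 1 - u * w).
    by apply: holB; [exact: hol_cst|apply: holM; [exact: hol_cst|exact: hol_id]].
  apply: holV; first exact: holX.
  by move=> z zs; rewrite expf_neq0 // du.
rewrite /cint (cmean_ext (g := fun z => g (cj z))).
  rewrite (cmean_hol_conj s1 hg) /g mulr0 subr0 expr1n invr1 mulr1 expr0n.
  by case: k {g hg} => [|k]; rewrite ?expr0 ?invr1 ?mulr1 //= mulr0.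
move=> z z1; have zn : z != 0 by rewrite -nm_gt0 z1.
have zc : cj z = z^-1 by apply: (mulfI zn); rewrite divff // mul_cj z1 expr1n cr1.
have E : a + cr r * z - y = cr r * z * (1 - u * cj z).
  by rewrite zc /u /v; field; rewrite zn crn.
have d1 : 1 - u * cj z != 0 by apply: du; rewrite subr0 nm_cj z1.
rewrite E /g zc exprMn invfM mulrA; congr (_ * _).
rewrite exprS invfM mulrA divff ?mulf_neq0 // mul1r exprMn invfM exprVn //.
Qed.

(* The principal part at [y] is [w * p.[w]] with [w = (z - y)^-1], so that the
   residue is the constant coefficient of [p]. *)
Definition ppart f y c := exists (p : {poly C}) (r : R) g,
  [/\ 0 < r, hol y r g, p`_0 = c & forall z, 0 < nm (z - y) < r ->
      f z = (z - y)^-1 * p.[(z - y)^-1] + g z].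

Lemma ppart_ext f g y c (r : R) : 0 < r -> (forall z, 0 < nm (z - y) < r -> f z = g z) ->
  ppart f y c -> ppart g y c.
Proof.
move=> r0 fg [p [q [h [q0 hh pc fE]]]].
exists p, (Num.min r q), h; split => //; first by rewrite lt_min r0.
  by apply: hol_sub hh; rewrite ge_min lexx orbT.
move=> z /andP[z0]; rewrite lt_min => /andP[zr zq].
by rewrite -fg ?z0 // fE ?z0.
Qed.

Lemma ppartD f g y c d : ppart f y c -> ppart g y d -> ppart (fun z => f z + g z) y (c + d).
Proof.
move=> [p [r [h [r0 hh pc fE]]]] [p' [r' [h' [r0' hh' pd gE]]]].
exists (p + p'), (Num.min r r'), (fun z => h z + h' z); split.
- by rewrite lt_min r0.
- apply: holD; [apply: hol_sub hh|apply: hol_sub hh'].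
    by rewrite ge_min lexx.
  by rewrite ge_min lexx orbT.
- by rewrite coefD pc pd.
move=> z /andP[z0]; rewrite lt_min => /andP[zr zr'].
by rewrite fE ?z0 // gE ?z0 // hornerD; ring.
Qed.

Lemma ppartMl k f y c : ppart f y c -> ppart (fun z => k * f z) y (k * c).
Proof.
move=> [p [r [h [r0 hh pc fE]]]]; exists (k *: p), r, (fun z => k * h z); split => //.
- by apply: holM => //; exact: hol_cst.
- by rewrite coefZ pc.
by move=> z zr; rewrite fE // hornerZ; ring.
Qed.

Lemma ppart_hol f y (r : R) : 0 < r -> hol y r f -> ppart f y 0.
Proof.
by move=> r0 hf; exists 0, r, f; split => //; [rewrite coef0|move=> z _; rewrite horner0 mulr0 add0r].
Qed.

Lemma ppart_pow h y (r : R) n : 0 < r -> hol y r h ->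
  exists c, ppart (fun z => h z / (z - y) ^+ n) y c.
Proof.
move=> r0; elim: n h => [|n IH] h hh.
  exists 0; apply: ppart_ext r0 _ (ppart_hol r0 hh) => z _.
  by rewrite expr0 divr1.
have [c hc] := IH _ (hol_divdiff hh).
have hp : ppart (fun z => h y / (z - y) ^+ n.+1) y (h y * ('X^n : {poly C})`_0).
  exists (h y *: 'X^n), r, (fun=> 0); split => //; first exact: hol_cst.
    by rewrite coefZ.
  by move=> z _; rewrite addr0 hornerZ hornerXn exprS invfM exprVn; ring.
exists (h y * ('X^n : {poly C})`_0 + c); apply: ppart_ext r0 _ (ppartD hp hc).
move=> z /andP[z0 _]; have zn : z - y != 0 by rewrite -nm_gt0.
rewrite [in RHS](divdiffE h y z) exprS; field.
by rewrite zn expf_neq0.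
Qed.

Lemma ppart_simple h y (r : R) : 0 < r -> hol y r h -> ppart (fun z => h z / (z - y)) y (h y).
Proof.
move=> r0 hh; exists (h y)%:P, r, (divdiff h y); split => //; first exact: hol_divdiff.
  by rewrite coefC.
move=> z /andP[z0 _]; have zn : z - y != 0 by rewrite -nm_gt0.
by rewrite hornerC [in LHS](divdiffE h y z); field.
Qed.

Lemma cdiff_horner (p : {poly C}) f z d : cdiff f z d ->
  cdiff (fun x => p.[f x]) z (p^`().[f z] * d).
Proof.
move=> fd; elim/poly_ind: p => [|p k IH].
  rewrite deriv0 horner0 mul0r (_ : (fun x => _) = (fun=> 0)); first exact: cdiffC.
  by apply/funext => x; rewrite horner0.
have := cdiffD (cdiffM IH fd) (cdiffC k z).
rewrite (_ : (fun x => p.[f x] * f x + k) = (fun x => (p * 'X + k%:P).[f x])); last first.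
  by apply/funext => x; rewrite !hornerE.
by congr cdiff; rewrite derivD derivM derivX derivC !hornerE /=; ring.
Qed.

(** Differentiating the principal part term by term leaves no term in [(z - y)^-1]. *)
Lemma ppart_deriv f g y c (r : R) : 0 < r ->
  (forall z, 0 < nm (z - y) < r -> cdiff f z (g z)) -> ppart f y c -> ppart g y 0.
Proof.
move=> r0 fg [p [q [h [q0 hh pc fE]]]].
exists (- ('X * (p + 'X * p^`()))), (Num.min r q), (derive1 h); split.
- by rewrite lt_min r0.
- by apply: hol_derive1; apply: hol_sub hh; rewrite ge_min lexx orbT.
- by rewrite coefN coefXM oppr0.
move=> z /andP[z0]; rewrite lt_min => /andP[zr zq].
have zn : z - y != 0 by rewrite -nm_gt0.
have fd := fg z; rewrite z0 zr in fd; have {}fd := fd isT.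
have wd : cdiff (fun x => (x - y)^-1) z (- (z - y) ^- 2).
  have := cdiff_inv (f := fun x => x - y) zn (cdiffB (cdiff_id z) (cdiffC y z)).
  by rewrite subr0 mulr1.
have Fd := cdiffD (cdiffM wd (cdiff_horner p wd)) (hol_cdiff hh zq).
have e0 : 0 < Num.min (nm (z - y)) (q - nm (z - y)) by rewrite lt_min z0 subr_gt0.
have := cdiff_near e0 _ Fd (g := f); move/(_ _)/cdiff_unique => H.
rewrite -(H _ _ fd) => [|w].
  by rewrite !hornerE /=; field.
rewrite lt_min => /andP[w1 w2]; rewrite fE //; apply/andP; split.
  by have := nm_tri w z y; have := nm_tri z w y; rewrite [nm (z - w)]nmC; move: w1; clear; lra.
by have := nm_tri z w y; move: w2; clear; lra.
Qed.

Lemma hol_pole (p : {poly C}) y z : z != y ->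
  hol z (nm (z - y)) (fun x => (x - y)^-1 * p.[(x - y)^-1]).
Proof.
move=> zy x xz; have xn : x - y != 0.
  rewrite -nm_gt0; have := nm_tri x z y; rewrite [nm (z - x)]nmC; move: xz; clear; lra.
have wd := cdiff_inv (f := fun x => x - y) xn (cdiffB (cdiff_id x) (cdiffC y x)).
by eexists; exact: cdiffM wd (cdiff_horner p wd).
Qed.

Lemma cint_ppart a (r : R) y (p : {poly C}) : nm (y - a) < r ->
  bdc (fun z => cr r * z * ((a + cr r * z - y)^-1 * p.[(a + cr r * z - y)^-1])) /\
  cint a r (fun z => (z - y)^-1 * p.[(z - y)^-1]) = p`_0.
Proof.
move=> yr; have r0 : 0 < r by exact: le_lt_trans (nm_ge0 _) yr.
have d0 : 0 < r - nm (y - a) by rewrite subr_gt0.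
have bk k : bdc (fun z => cr r * z * (a + cr r * z - y) ^- k).
  apply: bdcM; first exact: bdcMl _ bdc_id.
  exists ((r - nm (y - a)) ^- k) => z z1; rewrite nmV nmX.
  have h := nm_circle_sub a y z1 r0.
  rewrite lef_pV2 ?posrE ?exprn_gt0 ?(lt_le_trans d0) //.
  by apply: pexp_le => //; exact: ltW.
have pE z : (z - y)^-1 * p.[(z - y)^-1] = \sum_(k < size p) p`_k * (z - y) ^- k.+1.
  rewrite horner_coef mulr_sumr; apply: eq_bigr => k _.
  by rewrite exprS invfM exprVn; ring.
have key n : bdc (fun z => cr r * z * \sum_(k < n) p`_k * (a + cr r * z - y) ^- k.+1) /\
   cint a r (fun z => \sum_(k < n) p`_k * (z - y) ^- k.+1) = if n is 0%N then 0 else p`_0.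
  elim: n => [|n [IHb IH]].
    split; first by exists 0 => z _; rewrite big_ord0 mulr0 nm0.
    by rewrite /cint (cmean_ext (g := fun=> 0)) ?cmean_cst // => z _; rewrite big_ord0 mulr0.
  have E z : cr r * z * \sum_(k < n.+1) p`_k * (a + cr r * z - y) ^- k.+1 =
     cr r * z * \sum_(k < n) p`_k * (a + cr r * z - y) ^- k.+1 +
     p`_n * (cr r * z * (a + cr r * z - y) ^- n.+1).
    by rewrite big_ord_recr /=; ring.
  split.
    have [K HK] := bdcD IHb (bdcMl (p`_n) (bk n.+1)).
    by exists K => z z1; rewrite E; exact: HK.
  rewrite /cint (cmean_ext (fun z _ => E z)) cmeanD //; last exact: bdcMl (bk _).
  rewrite -/(cint a r (fun z => \sum_(k < n) p`_k * (z - y) ^- k.+1)) IH.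
  rewrite cmeanM // -/(cint a r (fun z => (z - y) ^- n.+1)) cint_pole //.
  by case: n {IHb IH E} => [|n]; rewrite ?add0r ?mulr1 //= mulr0 addr0.
have [kb kc] := key (size p); split.
  by have [K HK] := kb; exists K => z z1; rewrite pE; exact: HK.
rewrite /cint (cmean_ext (fun z _ => congr1 (fun x => cr r * z * x) (pE (a + cr r * z)))).
rewrite -/(cint a r (fun z => \sum_(k < size p) p`_k * (z - y) ^- k.+1)) kc.
by case: (size p) (@nth_default _ 0 p 0%N) => [->|].
Qed.

(** Principal parts are subtracted one pole at a time: each contributes its residue by [cint_pole],
    and the holomorphic remainder integrates to 0. *)
Lemma disc_residue a (r r' : R) f (s : seq C) (c : C -> C) : 0 < r -> r < r' -> uniq s ->
  (forall y, y \in s -> nm (y - a) < r) ->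
  (forall z, nm (z - a) < r' -> z \notin s -> exists d, cdiff f z d) ->
  (forall y, y \in s -> ppart f y (c y)) ->
  bdc (fun z => cr r * z * f (a + cr r * z)) /\ cint a r f = \sum_(y <- s) c y.
Proof.
move=> r0 rr'; elim: s f => [|y s IH] f us sr hf fp.
  have hh : hol a r' f by move=> z zr; apply: hf.
  have [K HK] := hol_bounded rr' hh; rewrite big_nil; split; last exact: cint_hol hh.
  apply: bdcM; first exact: bdcMl _ bdc_id.
  by exists K => z z1; apply: HK; rewrite circle_in.
move: us; rewrite /= => /andP[ys us].
have [p [q [g [q0 hg pc fE]]]] := fp y (mem_head _ _).
have yr : nm (y - a) < r by apply: sr; exact: mem_head.
pose P z := (z - y)^-1 * p.[(z - y)^-1].
pose f1 z := if z == y then g y else f z - P z.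
have f1y z : nm (z - y) < q -> f1 z = g z.
  rewrite /f1; case: eqVneq => [->//|zy zq].
  by rewrite fE ?nm_gt0 ?subr_eq0 ?zy // addrC addKr.
have zy0 z : z != y -> 0 < nm (z - y) by rewrite nm_gt0 subr_eq0.
have f1n z w : z != y -> nm (w - z) < nm (z - y) -> f1 w = f w - P w.
  by move=> zy wz; rewrite /f1 ifN //; apply: contraTneq wz => ->; rewrite nmC ltxx.
have [|||b1 e1] := IH f1 us.
- by move=> x xs; apply: sr; rewrite inE xs orbT.
- move=> z zr zs; have [->|zy] := eqVneq z y.
    have [|d gd] := hg y; first by rewrite subrr nm0.
    by exists d; apply: (cdiff_near q0 _ gd) => w wy; rewrite f1y.
  have [|d fd] := hf z zr; first by rewrite inE negb_or zy.
  have [|d' Pd] := @hol_pole p y z zy z; first by rewrite subrr nm0 zy0.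
  exists (d - d'); apply: (cdiff_near (zy0 _ zy) _ (cdiffB fd Pd)) => w wz.
  by rewrite (f1n z).
- move=> x xs; have xy : x != y by apply: contraNneq ys => <-.
  have := ppartD (fp x _) (ppartMl (-1) (ppart_hol (zy0 _ xy) (hol_pole p xy))).
  rewrite inE xs orbT mulr0 addr0 => /(_ isT); apply: ppart_ext (zy0 _ xy) _.
  by move=> z /andP[_ zx]; rewrite (f1n x) // mulN1r.
have [bP eP] := cint_ppart p yr.
have E z : nm z = 1 -> cr r * z * f (a + cr r * z) =
    cr r * z * f1 (a + cr r * z) + cr r * z * P (a + cr r * z).
  move=> z1; rewrite -mulrDr; congr (_ * _); rewrite /f1 ifN ?subrK //.
  by apply: contraTneq yr => <-; rewrite circle_in // ltxx.
split.
  by have [K HK] := bdcD b1 bP; exists K => z z1; rewrite E //; exact: HK.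
by rewrite big_cons /cint (cmean_ext E) cmeanD // -/(cint a r f1) -/(cint a r P) e1 eP pc addrC.
Qed.

(** Small circle integrals recover the residue, whence its uniqueness in [ppart_unique]. *)
Lemma ppart_cint f y c : ppart f y c -> exists2 r0 : R, 0 < r0 &
  forall r, 0 < r < r0 -> cint y r f = c.
Proof.
move=> fc; have [p [q [g [q0 hg pc fE]]]] := fc; exists q => // r /andP[r0 rq].
have [||||_ ->] := @disc_residue y r q f [:: y] (fun=> c) r0 rq.
- by [].
- by move=> x; rewrite inE => /eqP ->; rewrite subrr nm0.
- move=> z zq; rewrite inE => zy.
  have z0 : 0 < nm (z - y) by rewrite nm_gt0 subr_eq0.
  have [d gd] := hg z zq; have [|d' Pd] := @hol_pole p y z zy z; first by rewrite subrr nm0.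
  exists (d' + d).
  have e0 : 0 < Num.min (nm (z - y)) (q - nm (z - y)) by rewrite lt_min z0 subr_gt0.
  apply: (cdiff_near e0 _ (cdiffD Pd gd)) => w; rewrite lt_min => /andP[w1 w2].
  rewrite fE //; apply/andP; split.
    by have := nm_tri w z y; rewrite [nm (z - w)]nmC; move: w1; clear; lra.
  by have := nm_tri z w y; move: w2; clear; lra.
- by move=> x; rewrite inE => /eqP ->.
by rewrite big_seq1.
Qed.

Lemma ppart_unique f y c c' : ppart f y c -> ppart f y c' -> c = c'.
Proof.
move=> /ppart_cint [r r0 H] /ppart_cint [r' r0' H'].
have m0 : 0 < Num.min r r' by rewrite lt_min r0.
have m1 : 0 < Num.min r r' / 2 < Num.min r r'.
  by rewrite divr_gt0 // ltr_pdivrMr // mulr_natr mulr2n ltrDl m0.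
have /andP[m2 m3] := m1; move: m3; rewrite lt_min => /andP[m3 m4].
by rewrite -(H (Num.min r r' / 2)) ?m2 // (H' (Num.min r r' / 2)) // m2.
Qed.

(* Invariance of the residue of [f(z) dz] under [z = T(t)]. *)
Lemma ppart_comp f (T : C -> C) t0 (r : R) c : 0 < r -> hol t0 r T -> derive1 T t0 != 0 ->
  ppart f (T t0) c -> ppart (fun t => f (T t) * derive1 T t) t0 c.
Proof.
move=> r0 hT; have hT' := hol_derive1 hT.
have HT z : nm (z - t0) < r -> cdiff T z (derive1 T z) by exact: hol_cdiff hT.
have : exists q, [/\ hol t0 r q, q t0 = derive1 T t0 & forall t, T t - T t0 = (t - t0) * q t].
  exists (divdiff T t0); split; first exact: hol_divdiff.
    by rewrite /divdiff eqxx.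
  by move=> t; rewrite [T t](divdiffE T t0) addrC addKr.
move: (derive1 T) hT' HT => T' hT' HT [q [hq qt0 TE]].
move=> T'0 [p [rf [g [rf0 hg pc fE]]]].
have tt : nm (t0 - t0) < r by rewrite subrr nm0.

have q00 : 0 < nm (q t0) by rewrite nm_gt0 qt0.
have [d1 d10 H1] := hol_cont hq tt q00; have [d2 d20 H2] := hol_cont hT tt rf0.
pose d := Num.min r (Num.min d1 d2).
have d0 : 0 < d by rewrite !lt_min r0 d10.
have [dr [dd1 dd2]] : d <= r /\ d <= d1 /\ d <= d2 by rewrite /d !ge_min !lexx ?orbT.
have qn t : nm (t - t0) < d -> q t != 0.
  move=> td; rewrite -nm_gt0; have := nm_triB (q t0) (q t0 - q t).
  rewrite (_ : q t0 - (q t0 - q t) = q t); last by ring.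
  by have := H1 t (lt_le_trans td dd1); rewrite nmC; clear; lra.
have hTd : hol t0 d T by exact: hol_sub hT.
have hT'd : hol t0 d T' by exact: hol_sub hT'.
have hqd : hol t0 d q by exact: hol_sub hq.
(* For [k = 0] this is a logarithmic derivative with a simple zero; for [k > 0] it is the derivative
   of a multiple of [(T t - T t0) ^- k], hence without residue. *)
have pow k : ppart (fun t => (T t - T t0) ^- k.+1 * T' t) t0 (k == 0%N)%:R.
  case: k => [|k].
    have hh : hol t0 d (fun t => T' t / q t) by apply: holM => //; exact: holV.
    have h1 : T' t0 / q t0 = 1 by rewrite qt0 divff.
    have := ppart_simple d0 hh; rewrite h1; apply: ppart_ext d0 _.
    move=> t /andP[t1 td]; have tn : t - t0 != 0 by rewrite -nm_gt0.
    by rewrite TE expr1; field; rewrite tn qn.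
  have hh : hol t0 d (fun t => (q t ^+ k.+1)^-1).
    by apply: holV; [exact: holX|move=> t td; rewrite expf_neq0 // qn].
  have [c0 hc0] := ppart_pow k.+1 d0 hh.
  have Gd t : 0 < nm (t - t0) < d -> cdiff (fun t => (q t ^+ k.+1)^-1 / (t - t0) ^+ k.+1) t
      (- k.+1%:R * ((T t - T t0) ^- k.+2 * T' t)).
    move=> /andP[t1 td]; have tn : t - t0 != 0 by rewrite -nm_gt0.
    have Tn : T t - T t0 != 0 by rewrite TE mulf_neq0 ?qn.
    have Td : cdiff (fun x => T x - T t0) t (T' t).
      by have := cdiffB (HT t (lt_le_trans td dr)) (cdiffC (T t0) t); rewrite subr0.
    have Xn : (T t - T t0) ^+ k.+1 != 0 by rewrite expf_neq0.
    have e0 : 0 < 1 :> R by [].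
    have := cdiff_inv (f := fun x => (T x - T t0) ^+ k.+1) Xn (cdiffX k.+1 Td).
    rewrite (_ : (fun x => _) = (fun t => (q t ^+ k.+1)^-1 / (t - t0) ^+ k.+1)); last first.
      by apply/funext => x; rewrite TE exprMn invfM mulrC.
    congr cdiff; rewrite /= !exprS; field.
    by rewrite Tn expf_neq0.
  have := ppartMl (- k.+1%:R)^-1 (ppart_deriv d0 Gd hc0).
  rewrite mulr0; apply: ppart_ext d0 _ => t _.
  by rewrite mulKf // oppr_eq0 pnatr_eq0.
have pE x : x^-1 * p.[x^-1] = \sum_(k < size p) p`_k * x ^- k.+1.
  rewrite horner_coef mulr_sumr; apply: eq_bigr => k _.
  by rewrite exprS invfM exprVn; ring.
have sum n : ppart (fun t => \sum_(k < n) p`_k * ((T t - T t0) ^- k.+1 * T' t)) t0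
    (if n is 0%N then 0 else c).
  elim: n => [|n IH].
    apply: ppart_ext d0 _ (ppart_hol d0 (hol_cst 0)) => t _; by rewrite big_ord0.
  have -> : c = (if n is 0%N then 0 else c) + p`_n * (n == 0%N)%:R.
    by case: n {IH} => [|n]; rewrite ?add0r ?mulr1 //= mulr0 addr0.
  by apply: ppart_ext d0 _ (ppartD IH (ppartMl (p`_n) (pow n))) => t _; rewrite big_ord_recr.
have hg' : hol t0 d (fun t => g (T t) * T' t).
  apply: holM => // t td; have [e Te] := hTd t td.
  have [|e' ge] := hg (T t); first by apply: H2; exact: lt_le_trans dd2.
  by exists (e' * e); exact: cdiff_comp.
have -> : c = (if size p is 0%N then 0 else c) + 0.
  by rewrite addr0 -pc; case: (size p) (@nth_default _ 0 p 0%N) => [->|].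
apply: ppart_ext d0 _ (ppartD (sum (size p)) (ppart_hol d0 hg')).
move=> t /andP[t1 td]; have tn : t - t0 != 0 by rewrite -nm_gt0.
rewrite fE; last first.
  by rewrite nm_gt0 TE mulf_neq0 ?qn //= -TE; apply: H2; exact: lt_le_trans dd2.
rewrite mulrDl pE mulr_suml; congr (_ + _); apply: eq_bigr => k _; by rewrite mulrA.
Qed.

End PlaneResidues.
End Plane.

Section RiemannSurfaces.
Variables (R : realType) (X : riemann_surface R).
Local Notation C := (Cx R).
Local Notation MP := (mpoly 2 C).
Local Notation dom := (@rs_dom R X).
Local Notation z := (@rs_coord R X).
Local Notation par := (@rs_param R X).

(** * Differentiability on the surface, in charts *)

Section Charts.
Implicit Types (f g : X -> C) (x y : X) (i j : rs_idx X).

Lemma clopen_full (T : set X) x0 : T x0 -> (forall x, T x -> nbhs x T) ->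
  (forall x, ~ T x -> nbhs x (~` T)) -> forall x, T x.
Proof.
move=> T0 oT cT x; suff -> : T = setT by [].
apply: (@rs_connected _ X); [by exists x0|exists T => //|exists T => //]; rewrite ?setTI //.
  by rewrite openE.
by rewrite -openC openE.
Qed.

Lemma nbhs_chart i x (A : set X) : dom i x -> nbhs x A ->
  exists2 e : R, 0 < e & forall w, nm (w - z i x) < e ->
    [/\ dom i (par i w), z i (par i w) = w & A (par i w)].
Proof.
move=> dx Ax; have AD : nbhs x (A `&` dom i).
  by apply: filterI => //; apply: open_nbhs_nbhs; split => //; exact: rs_open_dom.
have pc : par i @ z i x --> par i (z i x) := rs_param_cont dx.
rewrite (rs_coordK dx) in pc; have /Cnbhs [e e0 He] := pc _ AD.
have zx : (z i @` dom i) (z i x) by exists x.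
have /Copen /(_ _ zx) [e' e'0 He'] := @rs_open_image _ X i.
exists (Num.min e e'); first by rewrite lt_min e0.
move=> w; rewrite lt_min => /andP[we we']; have [Aw dw] := He _ we.
have [y dy yw] := He' _ we'; split => //.
by rewrite -yw rs_coordK.
Qed.

Lemma chart_nbhs i x (A : set X) (e : R) : dom i x -> 0 < e ->
  (forall y, dom i y -> nm (z i y - z i x) < e -> A y) -> nbhs x A.
Proof.
move=> dx e0 H.
have D : nbhs x (dom i) by apply: open_nbhs_nbhs; split => //; exact: rs_open_dom.
have := @rs_coord_cont _ X i x dx; move/(_ [set w | nm (w - z i x) < e]) => Z.
have : nbhs x (z i @^-1` [set w | nm (w - z i x) < e]).
  by apply: Z; apply/Cnbhs; exists e.
move=> Z'; apply: filterS (filterI D Z') => y [/= dy]; exact: H.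
Qed.

Lemma coord_change i j x : dom i x -> dom j x -> exists2 d, d != 0 & cdiff (z i \o par j) (z j x) d.
Proof.
move=> dx dx'.
have [d Hd] := derivable_cdiff (rs_trans_hol dx' dx).
have [d' Hd'] := derivable_cdiff (rs_trans_hol dx dx').
exists d => //; apply/eqP => d0; rewrite d0 in Hd.
have e1 : z i x = (z i \o par j) (z j x) by rewrite /= rs_coordK.
rewrite e1 in Hd'; have := cdiff_comp Hd Hd'; rewrite mulr0 => H0.
have [e e0 He] := nbhs_chart dx' (open_nbhs_nbhs (conj (rs_open_dom i) dx)).
have : cdiff id (z j x) 0.
  apply: cdiff_near e0 _ H0 => w /He [dw zw di] /=.
  by rewrite rs_coordK.
move=> /(cdiff_unique (cdiff_id _)) /eqP; rewrite oner_eq0 //.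
Qed.

(** The pointwise form of [holo_on]. One chart suffices, since coordinate changes are differentiable
    ([hdiff_chart]). *)
Definition hdiff f x := exists2 i, dom i x & exists d, cdiff (f \o par i) (z i x) d.

Lemma hdiff_chart f x i : hdiff f x -> dom i x -> exists d, cdiff (f \o par i) (z i x) d.
Proof.
move=> [j dj [d fd]] di; have [d' _ Hd'] := coord_change dj di.
have e1 : z j x = (z j \o par i) (z i x) by rewrite /= rs_coordK.
rewrite e1 in fd; have H := cdiff_comp Hd' fd; exists (d * d').
have [e e0 He] := nbhs_chart di (open_nbhs_nbhs (conj (rs_open_dom j) dj)).
apply: cdiff_near e0 _ H => w /He [dw zw djw] /=.
by rewrite rs_coordK.
Qed.

Lemma holo_onP (W : set X) f : holo_on W f <-> forall x, W x -> hdiff f x.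
Proof.
split=> H.
  move=> x Wx; have [i di] := rs_cover x; exists i => //.
  exact/derivable_cdiff/H.
move=> i x Wx dx; have [d fd] := hdiff_chart (H x Wx) dx; exact: cdiff_derivable fd.
Qed.

Lemma chart_derivP f x i : hdiff f x -> dom i x -> cdiff (f \o par i) (z i x) (chart_deriv i f x).
Proof. by move=> hf di; have [d fd] := hdiff_chart hf di; rewrite /chart_deriv (cdiff_derive1 fd). Qed.

Lemma chart_derivE f x i d : cdiff (f \o par i) (z i x) d -> chart_deriv i f x = d.
Proof. exact: cdiff_derive1. Qed.

Lemma near_chart f g x i : dom i x -> (\forall y \near x, f y = g y) ->
  exists2 e : R, 0 < e & forall w, nm (w - z i x) < e -> (f \o par i) w = (g \o par i) w.
Proof.
by move=> di /(nbhs_chart di) [e e0 H]; exists e => // w /H [].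
Qed.

Lemma hdiff_near f g x : (\forall y \near x, f y = g y) -> hdiff f x -> hdiff g x.
Proof.
move=> fg [i di [d fd]]; have [e e0 H] := near_chart di fg.
by exists i => //; exists d; exact: cdiff_near e0 H fd.
Qed.

Lemma chart_deriv_near f g x i : dom i x -> (\forall y \near x, f y = g y) ->
  hdiff f x -> chart_deriv i f x = chart_deriv i g x.
Proof.
move=> di fg hf; have [e e0 H] := near_chart di fg.
by rewrite [RHS](chart_derivE (cdiff_near e0 H (chart_derivP hf di))).
Qed.

Lemma hdiffC k x : hdiff (fun=> k) x.
Proof. by have [i di] := rs_cover x; exists i => //; exists 0; exact: cdiffC. Qed.
Lemma hdiffD f g x : hdiff f x -> hdiff g x -> hdiff (fun y => f y + g y) x.
Proof.
move=> [i di [d fd]] hg; exists i => //; have [d' gd] := hdiff_chart hg di.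
by exists (d + d'); exact: cdiffD fd gd.
Qed.
Lemma hdiffB f g x : hdiff f x -> hdiff g x -> hdiff (fun y => f y - g y) x.
Proof.
move=> [i di [d fd]] hg; exists i => //; have [d' gd] := hdiff_chart hg di.
by exists (d - d'); exact: cdiffB fd gd.
Qed.
Lemma hdiffM f g x : hdiff f x -> hdiff g x -> hdiff (fun y => f y * g y) x.
Proof.
move=> [i di [d fd]] hg; exists i => //; have [d' gd] := hdiff_chart hg di.
by eexists; exact: cdiffM fd gd.
Qed.
Lemma hdiffV f x : f x != 0 -> hdiff f x -> hdiff (fun y => (f y)^-1) x.
Proof.
move=> fx [i di [d fd]]; exists i => //; eexists; apply: cdiff_inv fd.
by rewrite /= rs_coordK.
Qed.
Lemma hdiffX f x n : hdiff f x -> hdiff (fun y => f y ^+ n) x.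
Proof. by move=> [i di [d fd]]; exists i => //; eexists; exact: cdiffX fd. Qed.
Lemma hdiffXz f x (k : int) : f x != 0 -> hdiff f x -> hdiff (fun y => f y ^ k) x.
Proof.
case: k => n fx hf; first exact: hdiffX.
by rewrite /exprz; apply: hdiffV (hdiffX _ hf); rewrite expf_neq0.
Qed.
Lemma hdiff_sum (I : Type) (s : seq I) (F : I -> X -> C) x :
  (forall k, hdiff (F k) x) -> hdiff (fun y => \sum_(k <- s) F k y) x.
Proof.
move=> H; elim: s => [|k s IH].
  by apply: hdiff_near (hdiffC 0 x); near=> y; rewrite big_nil.
by apply: hdiff_near (hdiffD (H k) IH); near=> y; rewrite big_cons.
Unshelve. all: by end_near. Qed.

Lemma hdiff_coord i x : dom i x -> hdiff (z i) x.
Proof. by move=> di; exists i => //; have [d _ H] := coord_change di di; exists d. Qed.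

Lemma chart_deriv_id i x : dom i x -> chart_deriv i (z i) x = 1.
Proof.
move=> di; apply: chart_derivE.
have [e e0 He] := nbhs_chart di (@filterT _ (nbhs x) _).
by apply: cdiff_near e0 _ (cdiff_id _) => w /He [].
Qed.

Lemma chart_derivC i k x : chart_deriv i (fun=> k) x = 0.
Proof. by apply: chart_derivE; exact: (cdiffC k). Qed.
Lemma chart_derivD i f g x : dom i x -> hdiff f x -> hdiff g x ->
  chart_deriv i (fun y => f y + g y) x = chart_deriv i f x + chart_deriv i g x.
Proof. by move=> di hf hg; apply: chart_derivE; apply: cdiffD; exact: chart_derivP. Qed.
Lemma chart_derivB i f g x : dom i x -> hdiff f x -> hdiff g x ->
  chart_deriv i (fun y => f y - g y) x = chart_deriv i f x - chart_deriv i g x.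
Proof. by move=> di hf hg; apply: chart_derivE; apply: cdiffB; exact: chart_derivP. Qed.
Lemma chart_deriv_coordB i x (a : C) : dom i x -> chart_deriv i (fun y => z i y - a) x = 1.
Proof.
move=> di; have E := chart_derivB di (hdiff_coord di) (hdiffC a x); apply: (etrans E).
have E1 := chart_deriv_id di; have E2 := chart_derivC i a x.
by apply: (etrans (congr2 (fun u v => u - v) E1 E2)); rewrite subr0.
Qed.
Lemma chart_derivM i f g x : dom i x -> hdiff f x -> hdiff g x ->
  chart_deriv i (fun y => f y * g y) x = chart_deriv i f x * g x + f x * chart_deriv i g x.
Proof.
move=> di hf hg; apply: chart_derivE.
by have := cdiffM (chart_derivP hf di) (chart_derivP hg di); rewrite /= rs_coordK.
Qed.
Lemma chart_derivX i f x n : dom i x -> hdiff f x ->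
  chart_deriv i (fun y => f y ^+ n) x = n%:R * f x ^+ n.-1 * chart_deriv i f x.
Proof.
move=> di hf; apply: chart_derivE.
by have := cdiffX n (chart_derivP hf di); rewrite /= rs_coordK.
Qed.
Lemma chart_derivV i f x : dom i x -> f x != 0 -> hdiff f x ->
  chart_deriv i (fun y => (f y)^-1) x = - f x ^- 2 * chart_deriv i f x.
Proof.
move=> di fx hf; apply: chart_derivE.
have := cdiff_inv (f := f \o par i) _ (chart_derivP hf di); rewrite /= rs_coordK //.
exact.
Qed.

Lemma chain_rule i j f x : dom i x -> dom j x -> hdiff f x ->
  chart_deriv i f x = chart_deriv j f x * chart_deriv i (z j) x.
Proof.
move=> di dj hf; apply: chart_derivE.
have e1 : z j x = (z j \o par i) (z i x) by rewrite /= rs_coordK.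
have fd := chart_derivP hf dj; rewrite e1 in fd.
have zd := chart_derivP (hdiff_coord dj) di.
have [e e0 He] := nbhs_chart di (open_nbhs_nbhs (conj (rs_open_dom j) dj)).
apply: cdiff_near e0 _ (cdiff_comp zd fd) => w /He [dw zw djw] /=.
by rewrite rs_coordK.
Qed.

Lemma chart_deriv_neq0 i j x : dom i x -> dom j x -> chart_deriv i (z j) x != 0.
Proof.
move=> di dj; apply/eqP => h; have := chain_rule dj di (hdiff_coord dj).
by rewrite chart_deriv_id // h mul0r => /eqP; rewrite oner_eq0.
Qed.

Lemma hdiff_cont f x : hdiff f x -> forall e : R, 0 < e -> \forall y \near x, nm (f y - f x) < e.
Proof.
move=> [i di [d fd]] e e0; have [dl dl0 H] := cdiff_cont fd e0.
apply: (chart_nbhs di dl0) => y dy hy; have := H _ hy.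
by rewrite /= !rs_coordK.
Qed.

Lemma hdiff_neq0 f x : hdiff f x -> f x != 0 -> \forall y \near x, f y != 0.
Proof.
move=> hf fx; have f0 : 0 < nm (f x) by rewrite nm_gt0.
have := hdiff_cont hf f0; apply: filterS => y; apply: contraTneq => ->.
by rewrite sub0r nmN ltxx.
Qed.

Definition hnear f x := \forall y \near x, hdiff f y.

Lemma hnearW f x : hnear f x -> hdiff f x.
Proof. exact: nbhs_singleton. Qed.

Lemma hnear_hol f x i : hnear f x -> dom i x -> exists2 e : R, 0 < e & hol (z i x) e (f \o par i).
Proof.
move=> hf di; have [e e0 He] := nbhs_chart di hf; exists e => // w /He [dw zw hw].
by rewrite -zw; exact: hdiff_chart.
Qed.

Lemma hol_hnear (F : C -> C) x i (e : R) : dom i x -> 0 < e -> hol (z i x) e F ->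
  hnear (fun y => F (z i y)) x.
Proof.
move=> di e0 hF; apply: (chart_nbhs di e0) => y dy ye.
have [d Fd] := hF _ ye; exists i => //; exists d.
have [e' e'0 He] := nbhs_chart dy (@filterT _ (nbhs y) _).
by apply: cdiff_near e'0 _ Fd => w /He [dw zw _] /=; rewrite zw.
Qed.

Lemma hnear_deriv f x i : hnear f x -> dom i x -> hnear (chart_deriv i f) x.
Proof.
move=> hf di; have [e e0 he] := hnear_hol hf di.
have hh := hol_hnear di e0 (hol_derive1 he).
have Di : nbhs x (dom i) by exact: open_nbhs_nbhs (conj (rs_open_dom i) di).
have near_near (A : set X) : nbhs x A -> \forall y \near x, nbhs y A.
  by move=> Ax; apply: nbhs_interior.
apply: filterS (filterI (near_near _ hh) (near_near _ Di)) => y [hy dy].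
apply: hdiff_near (nbhs_singleton hy); apply: filterS dy => y' dy'.
by rewrite /chart_deriv.
Qed.

Lemma near_near (A : set X) x : nbhs x A -> \forall y \near x, nbhs y A.
Proof. by move=> Ax; apply: nbhs_interior. Qed.

Lemma hnear_near f g x : (\forall y \near x, f y = g y) -> hnear f x -> hnear g x.
Proof.
move=> fg hf; apply: filterS (filterI hf (near_near fg)) => y [hy].
by move=> /hdiff_near; apply.
Qed.

Lemma holo_hnear (W : set X) f x : open W -> W x -> holo_on W f -> hnear f x.
Proof.
move=> oW Wx /holo_onP hf; have : nbhs x W by apply: open_nbhs_nbhs.
by apply: filterS => y; exact: hf.
Qed.

End Charts.

(** * Harmonic and subharmonic functions; Poisson modification *)

Section Harmonic.
Implicit Types (x y : X) (i j : rs_idx X) (u v h : X -> R).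

Definition disk i (a : C) (r : R) : set X := [set y | dom i y /\ nm (z i y - a) < r].
Definition cdisk i (a : C) (r : R) : set X := [set y | dom i y /\ nm (z i y - a) <= r].
(** The chart covers the whole coordinate disc, so that circles in it lift to the surface. *)
Definition gdisk i (a : C) (r : R) := 0 < r /\
  forall w, nm (w - a) < r -> dom i (par i w) /\ z i (par i w) = w.

Lemma gdisk_exists i x (A : set X) : dom i x -> nbhs x A ->
  exists2 r : R, gdisk i (z i x) r & disk i (z i x) r `<=` A.
Proof.
move=> di /(nbhs_chart di) [e e0 He]; exists e.
  by split => // w /He [].
by move=> y [dy /He [_ _]]; rewrite rs_coordK.
Qed.

Lemma open_disk i a (r : R) : open (disk i a r).
Proof.
rewrite openE => y [dy yr]; have e0 : 0 < r - nm (z i y - a) by rewrite subr_gt0.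
apply: (chart_nbhs dy e0) => y' dy' h; split => //.
by have := nm_tri (z i y) (z i y') a; move: h; clear; lra.
Qed.

Lemma nbhs_disk i a (r : R) x : disk i a r x -> nbhs x (disk i a r).
Proof. by move=> dx; apply: open_nbhs_nbhs; split => //; exact: open_disk. Qed.

(** A compact subset of a Hausdorff space is closed. Bisecting a square around the disc replaces the
    choice of a finite subcover. *)
Lemma closed_cdisk i a (r r' : R) : gdisk i a r' -> r < r' -> closed (cdisk i a r).
Proof.
move=> [r'0 gd] rr'; rewrite -openC openE => y ny.
have loc (u v : R) : exists2 d : R, 0 < d & exists2 B, nbhs y B &
    forall w, nm (w - mkc u v) < d -> nm (w - a) <= r -> ~ B (par i w).
  set w0 := mkc u v; have [w0r|rw0] := leP (nm (w0 - a)) r; last first.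
    exists (nm (w0 - a) - r); first by rewrite subr_gt0.
    exists setT; first exact: filterT.
    move=> w wd wr; have := nm_tri w w0 a; rewrite [nm (w0 - w)]nmC.
    by move: wd wr; clear; lra.
  have [dw zw] := gd _ (le_lt_trans w0r rr').
  have : par i w0 != y.
    by apply/eqP => E; apply: ny; split; rewrite -E // zw.
  move=> /eqP wy.
  have := @rs_hausdorff _ X; rewrite open_hausdorff => /(_ (par i w0) y) [].
    exact/eqP.
  move=> [A B] /= [/set_mem Aw /set_mem By] [oA oB AB].
  have [e e0 He] := nbhs_chart dw (open_nbhs_nbhs (conj oA Aw)).
  exists e => //; exists B; first exact: open_nbhs_nbhs.
  move=> w wd _ Bw; rewrite -{1}zw in wd; have [_ _ Aw'] := He _ wd.
  have : (A `&` B) (par i w) by [].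
  by have -> : A `&` B = set0 by [exact: AB|exact/eqP].
have [r0|r0] := ltP r 0.
  apply: filterS (@filterT _ (nbhs y) _) => y' _ [_ h].
  by have := le_lt_trans (le_trans (nm_ge0 _) h) r0; rewrite ltxx.
pose P (x x' s s' : R) := exists2 B, nbhs y B &
   forall u v : R, x <= u <= x' -> s <= v <= s' -> nm (mkc u v - a) <= r -> ~ B (par i (mkc u v)).
have : P (re a - r) (re a + r) (im a - r) (im a + r).
  apply: rectangle_bisection; try (move: r0; clear; lra).
    move=> x x' s s' _ _ mx ms [B1 n1 h1] [B2 n2 h2] [B3 n3 h3] [B4 n4 h4].
    exists (B1 `&` B2 `&` (B3 `&` B4)); first by do !apply: filterI.
    move=> u v /andP[u1 u2] /andP[v1 v2] uv [[b1 b2] [b3 b4]].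
    have [um|/ltW um] := leP u mx; have [vm|/ltW vm] := leP v ms.
    - by apply: (h1 u v) => //; rewrite ?u1 ?v1.
    - by apply: (h2 u v) => //; rewrite ?u1 ?v2 ?andbT.
    - by apply: (h3 u v) => //; rewrite ?u2 ?v1 ?andbT.
    - by apply: (h4 u v) => //; rewrite ?u2 ?v2 ?andbT.
  move=> u v _ _; have [d d0 [B nB HB]] := loc u v.
  exists (d / 2); first by rewrite divr_gt0.
  move=> x x' s s' _ _ _ _ hu hv dx ds; exists B => // u' v' hu' hv'; apply: HB.
  apply: le_lt_trans (nm_le_reim _) _; rewrite reB imB !re_mkc !im_mkc.
  have h1 : `|u' - u| <= x' - x by rewrite ler_norml; move: hu hu'; clear; lra.
  have h2 : `|v' - v| <= s' - s by rewrite ler_norml; move: hv hv'; clear; lra.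
  by move: h1 h2 dx ds; clear; lra.
move=> [B nB HB]; apply: filterS nB => y' By' [dy' yr].
have := HB (re (z i y')) (im (z i y')); rewrite mkcE rs_coordK //.
have h1 := le_trans (re_le_nm _) yr; have h2 := le_trans (im_le_nm _) yr.
rewrite reB ler_norml in h1; rewrite imB ler_norml in h2.
by apply => //; [move: h1|move: h2]; clear; lra.
Qed.

Definition contK (K : set X) (g : X -> R) := forall x, K x -> forall e : R, 0 < e ->
  \forall y \near x, K y -> `|g y - g x| < e.

Lemma contK_within K g : contK K g -> {within K, continuous g}.
Proof.
move=> cg; apply/subspace_continuousP => x Kx; apply/cvgrPdist_lt => e e0.
have := cg x Kx e e0; rewrite /within; apply: filterS => y H Ky.
by rewrite distrC; exact: H.
Qed.

Lemma contK_sub K K' g : K' `<=` K -> contK K g -> contK K' g.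
Proof.
move=> KK cg x /KK Kx e e0; have := cg x Kx e e0.
by apply: filterS => y H /KK.
Qed.

Lemma contKD K f g : contK K f -> contK K g -> contK K (fun y => f y + g y).
Proof.
move=> cf cg x Kx e e0; have e2 : 0 < e / 2 by rewrite divr_gt0.
apply: filterS (filterI (cf x Kx _ e2) (cg x Kx _ e2)) => y [h1 h2] Ky.
have := h1 Ky; have := h2 Ky => i1 i2.
rewrite opprD addrACA; apply: le_lt_trans (ler_normD _ _) _; move: i1 i2; clear; lra.
Qed.

Lemma contKN K g : contK K g -> contK K (fun y => - g y).
Proof.
move=> cg x Kx e e0; have := cg x Kx e e0; apply: filterS => y H Ky.
by rewrite -opprD normrN H.
Qed.
Lemma contKB K f g : contK K f -> contK K g -> contK K (fun y => f y - g y).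
Proof. by move=> cf /contKN; exact: contKD. Qed.

Lemma contK_max K f g : contK K f -> contK K g -> contK K (fun y => Num.max (f y) (g y)).
Proof.
move=> cf cg x Kx e e0.
apply: filterS (filterI (cf x Kx _ e0) (cg x Kx _ e0)) => y [h1 h2] Ky.
have := h1 Ky; have := h2 Ky; rewrite !ltr_norml => /andP[a1 a2] /andP[b1 b2].
by case: (leP (f y) (g y)) => ?; case: (leP (f x) (g x)) => ?; apply/andP; split; lra.
Qed.

Lemma contK_cst K k : contK K (fun=> k).
Proof. by move=> x _ e e0; apply: filterE => y _; rewrite subrr normr0. Qed.

Hypothesis Xc : compact [set: X].

(** If all maximum points lay in [O], where maxima propagate, the set of maximum points would be
    open and closed, hence all of the connected surface; but [K] is proper. *)
Lemma max_principle (K O : set X) (g : X -> R) : closed K -> K !=set0 ->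
  (exists x, ~ K x) -> contK K g ->
  (forall x, O x -> K x -> (forall y, K y -> g y <= g x) -> \forall y \near x, K y /\ g y = g x) ->
  exists x, [/\ K x, ~ O x & forall y, K y -> g y <= g x].
Proof.
move=> cK K0 [p nKp] cg HO.
have coK : compact K by apply: (subclosed_compact cK Xc).
have [x0 /set_mem Kx0 mx0] := compact_EVT_max K0 coK (contK_within cg).
have {}mx0 y : K y -> g y <= g x0 by move=> Ky; apply: mx0; rewrite inE.
apply: contrapT => nex.
pose T := [set x | K x /\ g x = g x0].
have TO x : T x -> O x.
  move=> [Kx gx]; apply: contrapT => nO; apply: nex; exists x; split => // y Ky.
  by rewrite gx mx0.
suff [//] : T p; apply: (@clopen_full T x0) => // x; first move=> Tx.
  have [Kx gx] := Tx; have := HO x (TO x Tx) Kx; rewrite gx => /(_ mx0).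
  by apply: filterS => y [Ky gy]; split.
move=> nT; have [Kx|nK] := pselect (K x); last first.
  have : nbhs x (~` K) by apply: open_nbhs_nbhs; split => //; rewrite openC.
  by apply: filterS => y nKy [].
have e0 : 0 < g x0 - g x.
  by rewrite subr_gt0 lt_neqAle mx0 // andbT; apply/eqP => E; apply: nT.
have := cg x Kx _ e0; apply: filterS => y H [Ky gy].
by have := H Ky; rewrite gy gtr0_norm // ltxx.
Qed.

Lemma contK_bounded K g : closed K -> contK K g -> exists M : R, forall y, K y -> `|g y| <= M.
Proof.
move=> cK cg; have coK : compact K by apply: (subclosed_compact cK Xc).
have [[x0 Kx0]|nK] := pselect (K !=set0); last by exists 0 => y Ky; case: nK; exists y.
have K0 : K !=set0 by exists x0.
have [a _ ha] := compact_EVT_max K0 coK (contK_within cg).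
have [b _ hb] := compact_EVT_max K0 coK (contK_within (contKN cg)).
exists (`|g a| + `|g b|) => y Ky; have Ky' : y \in K by rewrite inE.
have h1 := ha _ Ky'; have h2 := hb _ Ky'; rewrite lerN2 in h2.
have := ler_norm (g a); have := ler_norm (- g b); rewrite normrN.
have := normr_ge0 (g a); have := normr_ge0 (g b).
by rewrite ler_norml; move: h1 h2; clear => *; apply/andP; split; lra.
Qed.

Definition harm u x := exists F : X -> C, \forall y \near x, hdiff F y /\ u y = re (F y).

Lemma harm_near u v x : (\forall y \near x, u y = v y) -> harm u x -> harm v x.
Proof.
move=> uv [F HF]; exists F; apply: filterS (filterI uv HF) => y [<- []].
by split.
Qed.
Lemma harm_cst k x : harm (fun=> k) x.
Proof. by exists (fun=> cr k); apply: filterE => y; split => //; exact: hdiffC. Qed.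
Lemma harmD u v x : harm u x -> harm v x -> harm (fun y => u y + v y) x.
Proof.
move=> [F HF] [G HG]; exists (fun y => F y + G y); apply: filterS (filterI HF HG).
by move=> y [[hF ->] [hG ->]]; rewrite reD; split => //; exact: hdiffD.
Qed.
Lemma harmMl k u x : harm u x -> harm (fun y => k * u y) x.
Proof.
move=> [F HF]; exists (fun y => cr k * F y); apply: filterS HF.
by move=> y [hF ->]; rewrite re_crM; split => //; apply: hdiffM => //; exact: hdiffC.
Qed.
Lemma harmN u x : harm u x -> harm (fun y => - u y) x.
Proof. by move=> /(harmMl (-1)); apply: harm_near; apply: filterE => y; rewrite mulN1r. Qed.
Lemma harmB u v x : harm u x -> harm v x -> harm (fun y => u y - v y) x.
Proof. by move=> hu /harmN; exact: harmD. Qed.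

Lemma harm_cont u x : harm u x -> forall e : R, 0 < e -> \forall y \near x, `|u y - u x| < e.
Proof.
move=> [F HF] e e0; have [hFx ux] := nbhs_singleton HF.
apply: filterS (filterI HF (hdiff_cont hFx e0)) => y [[_ uy] h].
by rewrite uy ux -reB; apply: le_lt_trans (re_le_nm _) h.
Qed.

Lemma harm_contK K u : (forall x, K x -> harm u x) -> contK K u.
Proof.
move=> H x /H hu e e0; have := harm_cont hu e0.
by apply: filterS => y h _.
Qed.

Lemma harm_max u x : harm u x -> (\forall y \near x, u y <= u x) -> \forall y \near x, u y = u x.
Proof.
move=> [F HF] um; have [i di] := rs_cover x.
have [e e0 He] := nbhs_chart di (filterI HF um).
have hF : hol (z i x) e (F \o par i).
  by move=> w /He [dw zw [[hFw _] _]]; rewrite -zw; exact: hdiff_chart.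
have [_ ux] := nbhs_singleton HF.
have key := harmonic_max hF _.
apply: (chart_nbhs di e0) => y dy ye.
have [_ _ [[_ uy] _]] := He _ ye; rewrite rs_coordK // in uy.
rewrite uy ux; have := key _ (z i y) ye; rewrite /= !rs_coordK //; apply.
by move=> w /He [dw zw [[_ uw] ule]]; rewrite -uw -ux.
Qed.

(* Subharmonicity on [A], in the form of a local maximum principle against
   harmonic functions. *)
Definition subh (A : set X) v := forall x, A x -> forall h, harm h x ->
  (\forall y \near x, v y - h y <= v x - h x) -> \forall y \near x, v y - h y = v x - h x.

Definition subh_at v x := forall h, harm h x ->
  (\forall y \near x, v y - h y <= v x - h x) -> \forall y \near x, v y - h y = v x - h x.

Lemma subh_at_near u v x : (\forall y \near x, u y = v y) -> subh_at u x -> subh_at v x.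
Proof.
move=> uv su h hh hm; have uvx := nbhs_singleton uv.
have : \forall y \near x, u y - h y = u x - h x.
  by apply: su => //; apply: filterS (filterI uv hm) => y [-> ]; rewrite uvx.
by move=> H; apply: filterS (filterI uv H) => y [-> ]; rewrite uvx.
Qed.

Lemma subh_at_harm v x : harm v x -> subh_at v x.
Proof. by move=> hv h hh; exact: harm_max (harmB hv hh). Qed.

(** Subharmonicity at [x] passes to a function touched from below at [x]. Both maxima and Poisson
    modifications are of this kind. *)
Lemma subh_at_ge v w x : subh_at v x -> v x = w x -> (\forall y \near x, v y <= w y) -> subh_at w x.
Proof.
move=> sv vw vlew h hh hm.
have : \forall y \near x, v y - h y = v x - h x.
  apply: sv => //; apply: filterS (filterI vlew hm) => y [h1 h2].
  by rewrite vw; apply: le_trans h2; rewrite lerD2r.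
move=> H; apply: filterS (filterI (filterI vlew hm) H) => y [[h1 h2] h3].
apply/eqP; rewrite eq_le h2 /= -vw -h3 lerD2r //.
Qed.

Lemma subh_at_max u v x : subh_at u x -> subh_at v x -> subh_at (fun y => Num.max (u y) (v y)) x.
Proof.
move=> su sv; have [uv|/ltW vu] := leP (u x) (v x).
  apply: subh_at_ge sv _ _; first by rewrite (max_idPr uv).
  by apply: filterE => y; rewrite le_max lexx orbT.
apply: subh_at_ge su _ _; first by rewrite (max_idPl vu).
by apply: filterE => y; rewrite le_max lexx.
Qed.

Section PoissonModification.
Variables (K A : set X) (j : rs_idx X) (b : C) (p p' : R).
Hypotheses (cK : closed K) (AK : A `<=` K) (p0 : 0 < p) (pp' : p < p').
Hypotheses (gd : gdisk j b p') (dA : disk j b p' `<=` A) (oA : open A).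
Hypothesis exA : exists x, ~ A x.

Let circ v (w : C) : R := v (par j (b + cr p * w)).

Lemma circ_in w : nm w = 1 -> [/\ dom j (par j (b + cr p * w)),
  z j (par j (b + cr p * w)) = b + cr p * w & disk j b p' (par j (b + cr p * w))].
Proof.
move=> w1; have h : nm (b + cr p * w - b) < p' by rewrite circle_in.
by have [d1 d2] := (gd.2 _ h); split => //; split => //; rewrite d2.
Qed.

Lemma bdr_circ v : contK K v -> bdr (circ v).
Proof.
move=> /(contK_bounded cK) [M HM]; exists M => w w1; apply: HM.
by apply: AK; apply: dA; have [] := circ_in w1.
Qed.

Definition dsol v y : R := dext p (circ v) (z j y - b).
(** The Poisson modification of Perron's method: inside the disc, [v] gives way to the harmonic
    function with the same boundary values. *)
Definition pmod v y : R := if `[< disk j b p y >] then dsol v y else v y.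

Lemma harm_dsol v y : contK K v -> disk j b p y -> harm (dsol v) y.
Proof.
move=> /bdr_circ bv dy; have [G hG GE] := dext_hol p bv.
exists (fun y => G (z j y - b)); apply: filterS (nbhs_disk dy) => y' [dy' h].
split; last exact: GE.
have [|d Gd] := hG (z j y' - b); first by rewrite subr0.
exists j => //; exists d.
have [e e0 He] := nbhs_chart dy' (@filterT _ (nbhs y') _).
apply: cdiff_near e0 _ (cdiff_shift (a := - b) Gd) => w /He [dw zw _] /=.
by rewrite zw.
Qed.

Lemma pmod_disk v y : disk j b p y -> pmod v y = dsol v y.
Proof. by move=> dy; rewrite /pmod asboolT. Qed.
Lemma pmod_out v y : ~ disk j b p y -> pmod v y = v y.
Proof. by move=> dy; rewrite /pmod asboolF. Qed.

Lemma pmod_harm v y : contK K v -> disk j b p y -> harm (pmod v) y.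
Proof.
move=> cv dy; apply: harm_near (harm_dsol cv dy).
by apply: filterS (nbhs_disk dy) => y' /pmod_disk ->.
Qed.

Lemma pmod_cont v : contK K v -> contK K (pmod v).
Proof.
move=> cv y Ky e e0; have [dy|ndy] := pselect (disk j b p y).
  by have := harm_cont (pmod_harm cv dy) e0; apply: filterS => y' h _.
rewrite (pmod_out v ndy); have [cy|ncy] := pselect (cdisk j b p y); last first.
  have nb : nbhs y (~` cdisk j b p).
    by apply: open_nbhs_nbhs; split => //; rewrite openC; exact: closed_cdisk gd pp'.
  apply: filterS (filterI nb (cv y Ky e e0)) => y' [n1 h] Ky'.
  rewrite pmod_out; first exact: h.
  by move=> [d1 d2]; apply: n1; split => //; exact: ltW.
have [dy yp] := cy.
have yp' : nm (z j y - b) = p.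
  by apply/eqP; rewrite eq_le yp leNgt; apply/negP => h; apply: ndy.
pose w0 := (cr p)^-1 * (z j y - b).
have crp : cr p != 0 by rewrite cr_eq0 gt_eqF.
have w01 : nm w0 = 1 by rewrite /w0 nmM nmV nm_cr gtr0_norm // yp' mulVf // gt_eqF.
have w0E : cr p * w0 = z j y - b by rewrite /w0 mulrA divff // mul1r.
have cw0 : circ v w0 = v y by rewrite /circ w0E addrC subrK rs_coordK.
have cc : forall k : R, 0 < k -> exists2 d : R, 0 < d & forall w, nm w = 1 ->
    nm (w - w0) < d -> `|circ v w - circ v w0| < k.
  move=> k k0; have [d d0 Hd] := nbhs_chart dy (cv y Ky k k0).
  exists (d / p); first by rewrite divr_gt0.
  move=> w w1 wd; rewrite cw0 /circ.
  have hw : nm (b + cr p * w - z j y) < d.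
    have -> : b + cr p * w - z j y = cr p * (w - w0) by rewrite mulrBr w0E; ring.
    by rewrite nmM nm_cr gtr0_norm // mulrC -ltr_pdivlMr.
  have [_ _ H] := Hd _ hw; apply: H; apply: AK; apply: dA.
  by have [] := circ_in w1.
have [d d0 Hd] := dext_boundary p0 (bdr_circ cv) w01 cc e0.
rewrite cw0 w0E in Hd.
have nb : \forall y' \near y, dom j y' /\ nm (z j y' - z j y) < d.
  by apply: (chart_nbhs dy d0) => y' dy' h.
apply: filterS (filterI nb (cv y Ky e e0)) => y' [[dy' zd] h] Ky'.
have [dd|nd] := pselect (disk j b p y'); last by rewrite pmod_out //; exact: h.
rewrite pmod_disk //; apply: Hd; first by have [] := dd.
by have -> : z j y' - b - (z j y - b) = z j y' - z j y by ring.
Qed.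

Lemma cdiskA : cdisk j b p `<=` A.
Proof. by move=> y [dy yp]; apply: dA; split => //; exact: le_lt_trans yp pp'. Qed.

(** The maximum principle on the closed disc applies to [v - pmod v], which vanishes on the bounding
    circle. *)
Lemma subh_le_pmod v : contK K v -> subh A v -> forall y, v y <= pmod v y.
Proof.
move=> cv sv y; have [dy|ndy] := pselect (disk j b p y); last by rewrite pmod_out.
have y1 : cdisk j b p y by have [d1 d2] := dy; split => //; exact: ltW.
have [||||| x [cx ndx mx]] := @max_principle (cdisk j b p) (disk j b p) (fun y => v y - pmod v y).
- exact: closed_cdisk gd pp'.
- by exists y.
- by have [q nq] := exA; exists q => /cdiskA.
- apply: (@contK_sub K); first by move=> t /cdiskA /AK.
  by apply: contKB => //; exact: pmod_cont.
- move=> x dx cx mx; have nb := nbhs_disk dx.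
  have Ax : A x by exact: cdiskA.
  have := sv x Ax (pmod v) (pmod_harm cv dx) _.
  have le1 : \forall y0 \near x, v y0 - pmod v y0 <= v x - pmod v x.
    by apply: filterS nb => t [d1 d2]; apply: mx; split => //; exact: ltW.
  move=> /(_ le1) H; apply: filterS (filterI nb H) => t [[d1 d2] ->].
  by split => //; split => //; exact: ltW.
have := mx y y1; rewrite (pmod_out v ndx) subrr subr_le0 //.
Qed.

Lemma pmod_subh v : contK K v -> subh A v -> subh A (pmod v).
Proof.
move=> cv sv x Ax; have [dx|ndx] := pselect (disk j b p x).
  exact: subh_at_harm (pmod_harm cv dx).
apply: (@subh_at_ge v); first exact: sv.
  by rewrite pmod_out.
by apply: filterE => y; exact: subh_le_pmod.
Qed.

(** Harnack's inequality: the Poisson kernel is at most 3 up to half the radius and equals 1 at the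
    centre. *)
Lemma pmod_harnack v v' y x : contK K v -> contK K v' -> (forall y, v y <= v' y) ->
  dom j x -> z j x = b -> dom j y -> nm (z j y - b) <= p / 2 ->
  pmod v' y - pmod v y <= 3 * (pmod v' x - pmod v x).
Proof.
move=> cv cv' vv dx zx dy yp.
have h2 : nm (z j y - b) < p by apply: le_lt_trans yp _; rewrite ltr_pdivrMr // mulr_natr mulr2n ltrDl.
have ddy : disk j b p y by [].
have ddx : disk j b p x by split => //; rewrite zx subrr nm0.
rewrite !pmod_disk // /dsol /dext zx subrr.
have bv := bdr_circ cv; have bv' := bdr_circ cv'.
have bk := bdr_pker h2; have h0 : nm (0 : C) < p by rewrite nm0.
have bk0 := bdr_pker h0.
rewrite -!rmeanB; [|exact: bdrM..].
have bd : bdr (fun w => circ v' w * pker p 0 w - circ v w * pker p 0 w) by apply: bdrB; exact: bdrM.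
rewrite -rmeanMl //; apply: rmean_le; [by apply: bdrB; exact: bdrM|exact: bdrMl|].
move=> w w1; rewrite -!mulrBl.
have -> : pker p 0 w = 1.
  by rewrite /pker addr0 subr0 divff // -nm_gt0 nmM nm_cr w1 mulr1 gtr0_norm.
rewrite mulr1 mulrC ler_wpM2r ?subr_ge0 ?vv //.
by have /andP[_] := pker_half h2 yp w1.
Qed.

End PoissonModification.
End Harmonic.

(** * Local branches of the logarithm *)

Section Logarithm.

Lemma ln_nm_le (h : C) : 1 + h != 0 -> ln (nm (1 + h)) <= re h + nm h ^+ 2 / 2.
Proof.
move=> h0; have n0 : 0 < nm (1 + h) by rewrite nm_gt0.
have E : nm (1 + h) ^+ 2 = 1 + (2 * re h + nm h ^+ 2).
  by rewrite !nm_sqr reD imD re1 im1; ring.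
have t1 : -1 < 2 * re h + nm h ^+ 2.
  by have : 0 < nm (1 + h) ^+ 2 by [exact: exprn_gt0]; rewrite E; lra.
have := le_ln1Dx t1; rewrite -E lnXn // mulr2n.
by move: (ln _) (re h) (nm h ^+ 2); clear; move=> x y t; lra.
Qed.

(** A primitive [L] of the inverse exists by Goursat. The inequality [ln_nm_le], used from [b] to
    [c] and back, shows that [ln (nm w) - re (L w)] has derivative 0; its constant value is added to
    [L]. *)
Lemma local_log (w0 : C) : w0 != 0 -> exists2 e : R, 0 < e & exists2 L : C -> C, (forall w, nm (w - w0) < e -> cdiff L w w^-1) &
  forall w, nm (w - w0) < e -> ln (nm w) = re (L w).
Proof.
move=> w00; have n0 : 0 < nm w0 by rewrite nm_gt0.
have ne0 (w : C) : nm (w - w0) < nm w0 -> w != 0.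
  by apply: contraTneq => ->; rewrite sub0r nmN ltxx.
have [L HL] : exists L : C -> C, forall w, nm (w - w0) < nm w0 / 4 -> cdiff L w w^-1.
  apply: (holomorphic_local_primitive (f := fun w => w^-1) n0) => w /ne0 w1.
  by eexists; apply: cdiff_inv (cdiff_id _).
have e0 : 0 < nm w0 / 4 by rewrite divr_gt0.
have ne1 (w : C) : nm (w - w0) < nm w0 / 4 -> w != 0.
  by move=> h; apply: ne0; move: h n0; clear; lra.
pose q w := ln (nm w) - re (L w).
have c1L : c1_on w0 (nm w0 / 4) L (fun w => w^-1).
  move=> w /[dup] wr /HL Lw; split=> //.
  exact: cdiff_cont (cdiff_inv (ne1 _ wr) (cdiff_id w)).
have qd (w : C) (e : R) : nm (w - w0) < nm w0 / 4 -> 0 < e -> exists2 d : R, 0 < d &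
    forall w', nm (w' - w) < d -> `|q w' - q w| <= e * nm (w' - w).
  move=> wr e1; pose r := (nm (w - w0) + nm w0 / 4) / 2.
  have rr : r < nm w0 / 4 by rewrite /r; move: wr; clear; lra.
  have e2 : 0 < e / 2 by rewrite divr_gt0.
  have [d d0 Hd] := c1_uniform rr c1L e2.
  have os b c : nm (b - w0) <= r -> nm (c - w0) <= r -> nm (c - b) < d -> nm (c - b) <= e * nm w0 ^+ 2 / 8 ->
      q c - q b <= e * nm (c - b).
    move=> br cr' cb cbe; have b0 := ne1 _ (le_lt_trans br rr); have c0 := ne1 _ (le_lt_trans cr' rr).
    have nb : 0 < nm b by rewrite nm_gt0.
    have E : 1 + (c - b) / b = c / b by field.
    have := ln_nm_le (_ : 1 + (c - b) / b != 0); rewrite E mulf_neq0 ?invr_eq0 // => /(_ isT).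
    rewrite nmM nmV lnM ?posrE ?invr_gt0 ?nm_gt0 // lnV ?posrE ?nm_gt0 // => H1.
    have H2 := le_trans (re_le_nm _) (Hd b c br cr' cb); rewrite reB reB in H2.
    have m2 : nm w0 / 2 <= nm b by have := nm_triB w0 b; move: (le_lt_trans br rr) n0; rewrite nmC; clear; lra.
    have H3 : nm ((c - b) / b) ^+ 2 <= e * nm (c - b).
      rewrite nmM nmV expr_div_n ler_pdivrMr ?exprn_gt0 // expr2.
      have HB : nm w0 ^+ 2 / 4 <= nm b ^+ 2.
        by have -> : nm w0 ^+ 2 / 4 = (nm w0 / 2) ^+ 2 by [field]; rewrite lerXn2r ?nnegrE ?nm_ge0 // divr_ge0 ?nm_ge0.
      have x0 := nm_ge0 (c - b); have ex : 0 <= e * nm (c - b) by rewrite mulr_ge0 // ltW.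
      have := ler_wpM2l x0 cbe; have := ler_wpM2l ex HB; have := mulr_ge0 ex (exprn_ge0 2 (nm_ge0 b)).
      move: (nm b ^+ 2) (nm w0 ^+ 2) (nm (c - b)) => B M x; clear; lra.
    rewrite /q; move: H1 H2 H3; rewrite [b^-1 * _]mulrC ler_norml; move: (re _) (ln _) => *.
    lra.
  exists (Num.min ((nm w0 / 4 - nm (w - w0)) / 2) (Num.min d (e * nm w0 ^+ 2 / 8))).
    by rewrite !lt_min d0 !divr_gt0 ?subr_gt0 // mulr_gt0 // exprn_gt0.
  move=> w'; rewrite !lt_min => /andP[h1 /andP[h2 /ltW h3]].
  have wr1 : nm (w - w0) <= r by rewrite /r; move: wr; clear; lra.
  have wr2 : nm (w' - w0) <= r by have := nm_tri w' w w0; have := nm_tri w w' w0; rewrite /r; move: h1; clear; lra.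
  rewrite ler_norml; apply/andP; split; last exact: os.
  by rewrite lerNl opprB [nm (w' - w)]nmC; apply: os => //; rewrite nmC.
have qc (w : C) : nm (w - w0) < nm w0 / 4 -> q w = q w0.
  move=> wr; apply/eqP; rewrite -subr_eq0 -normr_le0 -nm_cr.
  apply/ler_addgt0Pl => e e1; rewrite addr0.
  have N0 : 0 < nm (w - w0) + 1 by rewrite ltr_pwDr ?nm_ge0.
  have seg t : 0 <= t <= 1 -> nm (w0 + cr t * (w - w0) - w0) <= nm (w - w0).
    move=> /andP[t0 t1]; rewrite addrAC subrr add0r nmM nm_cr ger0_norm //.
    by rewrite ler_piMl ?nm_ge0.
  have := @mean_value R (fun t => cr (q (w0 + cr t * (w - w0)))) 0 1 0 e ler01.
  rewrite cr1 cr0 mul1r mul0r addr0 [w0 + _]addrC subrK subr0 mul0r subr0 mulr1 -crB.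
  apply => t t01; exists 0; first by rewrite subr0 nm0 ltW.
  move=> e' e'0; have := qd _ (e' / (nm (w - w0) + 1)) (le_lt_trans (seg t t01) wr).
  rewrite divr_gt0 // => /(_ isT) [d d0 Hd].
  exists (d / (nm (w - w0) + 1)); first by rewrite divr_gt0.
  move=> s st; rewrite mul0r subr0 -crB nm_cr.
  have E : nm (w0 + cr s * (w - w0) - (w0 + cr t * (w - w0))) = `|s - t| * nm (w - w0).
    by rewrite -nm_cr -nmM crB; congr nm; ring.
  have le1 : `|s - t| * nm (w - w0) <= `|s - t| * (nm (w - w0) + 1).
    by rewrite ler_wpM2l ?normr_ge0 // lerDl.
  have := Hd (w0 + cr s * (w - w0)); rewrite E => /(_ _) H1.
  apply: le_trans (H1 _) _.
    by apply: le_lt_trans le1 _; rewrite -ltr_pdivlMr.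
  apply: le_trans (ler_wpM2l _ le1) _; first by rewrite ltW // divr_gt0.
  by rewrite le_eqVlt; apply/orP; left; apply/eqP; field; rewrite gt_eqF.
exists (nm w0 / 4) => //; exists (fun w => L w + cr (q w0)).
  by move=> w wr; rewrite -[w^-1]addr0; apply: cdiffD (HL w wr) (cdiffC _ _).
by move=> w /qc; rewrite /q reD re_cr => E; rewrite -E; ring.
Qed.
End Logarithm.

Lemma mid_lt (x y : R) : x < y -> exists q, x < q < y.
Proof. by move=> xy; exists ((x + y) / 2); lra. Qed.

Lemma max_dist (a b c : R) : `|Num.max a b - Num.max a c| <= `|b - c|.
Proof.
have := ler_norm (b - c); have := ler_norm (- (b - c)); rewrite normrN => h1 h2.
have h0 := normr_ge0 (b - c).
by rewrite ler_norml; case: (leP a b) => ?; case: (leP a c) => ?; apply/andP; split; lra.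
Qed.

(** * Perron's method on the complement of a coordinate disc *)

Section Dirichlet.
Implicit Types (x y : X) (i j : rs_idx X) (u v h : X -> R).

Lemma harm_coord u x i (F : C -> C) (e : R) : dom i x -> 0 < e -> hol (z i x) e F ->
  (forall y, dom i y -> nm (z i y - z i x) < e -> u y = re (F (z i y))) -> harm u x.
Proof.
move=> di e0 hF uF; exists (fun y => F (z i y)); apply: filterI.
  exact: hol_hnear di e0 hF.
exact: chart_nbhs di e0 uF.
Qed.

Lemma harm_log i a x : dom i x -> z i x != a -> harm (fun y => ln (nm (z i y - a))) x.
Proof.
move=> di xa; have [|e e0 [L hL HL]] := @local_log (z i x - a); first by rewrite subr_eq0.
apply: (harm_coord (F := fun w => L (w - a)) di e0) => [w we|y dy ye].
  have Ld := hL (w - a); exists (w - a)^-1; apply: cdiff_shift; apply: Ld.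
  by have -> : w - a - (z i x - a) = w - z i x by ring.
by apply: HL; have -> : z i y - a - (z i x - a) = z i y - z i x by ring.
Qed.

Hypothesis Xc : compact [set: X].

Lemma subh_le (K O : set X) v (k : R) : closed K -> (exists x, ~ K x) -> contK K v ->
  (forall x, O x -> K x -> subh_at v x /\ nbhs x K) ->
  (forall x, K x -> ~ O x -> v x <= k) -> forall y, K y -> v y <= k.
Proof.
move=> cK nK cv HO hk y Ky.
have K0 : K !=set0 by exists y.
have [|x [Kx nO mx]] := @max_principle Xc K O v cK K0 nK cv.
  move=> x Ox Kx mx; have [sx Kn] := HO x Ox Kx.
  have H : \forall y0 \near x, v y0 - 0 = v x - 0.
    by apply: (sx (fun=> 0)) (harm_cst _ _) _; apply: filterS Kn => t /mx; rewrite !subr0.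
  by apply: filterS (filterI Kn H) => t [Kt]; rewrite !subr0.
by apply: le_trans (mx y Ky) _; exact: hk.
Qed.

Lemma subh_atD v h x : subh_at v x -> harm h x -> subh_at (fun y => v y + h y) x.
Proof.
move=> sv hh k hk km.
have E y : v y - (k y - h y) = v y + h y - k y by ring.
have := sv (fun y => k y - h y) (harmB hk hh).
rewrite E => /(_ _) H; have : \forall y \near x, v y - (k y - h y) = v x + h x - k x.
  by apply: H; apply: filterS km => y; rewrite E.
by apply: filterS => y; rewrite E.
Qed.

Variables (i0 : rs_idx X) (a : C) (r r1 R1 : R).
Hypotheses (gd : gdisk i0 a R1) (r0 : 0 < r) (rr1 : r < r1) (rR1 : r1 < R1).
Local Notation K := (~` disk i0 a r).
Local Notation A := (~` cdisk i0 a r).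
Local Notation rho := (fun y => nm (z i0 y - a)).
Local Notation Circ := (fun y => dom i0 y /\ rho y = r).

Lemma ext_closed : closed K.
Proof. by apply: open_closedC; exact: open_disk. Qed.
Lemma ext_open : open A.
Proof. by rewrite openC; apply: closed_cdisk gd _; exact: lt_trans rr1 rR1. Qed.
Lemma ext_sub : A `<=` K.
Proof. by move=> y nc [dy /ltW h]; apply: nc. Qed.
Lemma ext_circ y : K y -> ~ A y -> Circ y.
Proof.
move=> nd /contrapT [dy yr]; split => //; apply/eqP; rewrite eq_le yr leNgt.
by apply/negP => h; apply: nd.
Qed.
Lemma circ_ext y : Circ y -> K y /\ ~ A y.
Proof. by move=> [dy yr]; split => [[_]|]; [rewrite yr ltxx|apply; split; rewrite ?yr]. Qed.
Lemma center_in : dom i0 (par i0 a) /\ z i0 (par i0 a) = a.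
Proof. by apply: gd.2; rewrite subrr nm0; exact: gd.1. Qed.
Lemma ext_proper : exists x, ~ K x.
Proof.
have [d1 d2] := center_in; exists (par i0 a); apply; split => //.
by rewrite d2 subrr nm0.
Qed.
Lemma ext_properA : exists x, ~ A x.
Proof. by have [x nK] := ext_proper; exists x => /ext_sub. Qed.

Variables (H : X -> R) (m M : R).
Hypothesis hH : forall y, dom i0 y -> 0 < rho y < R1 -> harm H y.
Hypothesis mHM : forall y, Circ y -> m <= H y <= M.

(** Only the values of [H] on the circle enter. That [H] is harmonic on both sides of it is what
    supplies the barriers later. *)
Definition perron_family : set (X -> R) :=
  [set v | [/\ contK K v, subh A v & forall y, Circ y -> v y <= H y]].

Lemma family_le (v : X -> R) : perron_family v -> forall y, K y -> v y <= M.
Proof.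
move=> [cv sv vH]; apply: (subh_le ext_closed ext_proper cv (O := A)).
  move=> x Ax Kx; split; first exact: sv.
  by apply: filterS ext_sub _; apply: open_nbhs_nbhs; split => //; exact: ext_open.
move=> x Kx nA; have cx := ext_circ Kx nA.
by apply: le_trans (vH _ cx) _; have /andP[] := mHM cx.
Qed.

Lemma family_max u v : perron_family u -> perron_family v ->
  perron_family (fun y => Num.max (u y) (v y)).
Proof.
move=> [cu su uH] [cv sv vH]; split; first exact: contK_max.
  by move=> x Ax; apply: subh_at_max; [exact: su|exact: sv].
by move=> y cy; rewrite ge_max uH // vH.
Qed.

Lemma family_pmod j b (p p' : R) v : 0 < p -> p < p' -> gdisk j b p' ->
  disk j b p' `<=` A -> perron_family v -> perron_family (pmod j b p v).
Proof.
move=> p0 pp' gd' dA [cv sv vH]; split.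
- exact: (pmod_cont Xc ext_closed ext_sub p0 pp' gd' dA cv).
- exact: (pmod_subh Xc ext_closed ext_sub p0 pp' gd' dA ext_properA cv sv).
- move=> y cy; rewrite pmod_out ?vH // => -[d1 d2].
  have [_] := circ_ext cy; apply; apply: dA; split => //.
  exact: lt_trans pp'.
Qed.

Lemma family_cst : perron_family (fun=> m).
Proof.
split; first exact: contK_cst.
  by move=> x _; apply: subh_at_harm; exact: harm_cst.
by move=> y cy; have /andP[] := mHM cy.
Qed.

Definition perron y : R := sup [set t | exists2 v, perron_family v & t = v y].

Lemma perron_has_sup y : K y -> has_sup [set t | exists2 v, perron_family v & t = v y].
Proof.
move=> Ky; split; first by exists m; exists (fun=> m) => //; exact: family_cst.
by exists M => t [v fv ->]; exact: family_le.
Qed.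

Lemma perron_ge v y : K y -> perron_family v -> v y <= perron y.
Proof. by move=> Ky fv; apply: sup_upper_bound; [exact: perron_has_sup|exists v]. Qed.

Lemma perron_le y (k : R) : K y -> (forall v, perron_family v -> v y <= k) -> perron y <= k.
Proof.
move=> Ky Hk; apply: ge_sup; first by have [] := perron_has_sup Ky.
by move=> t [v fv ->]; exact: Hk.
Qed.

(** Take [v] within [e / 3] of the supremum at the centre. For any competitor [v'], Harnack's
    inequality for the modification of the maximum of [v] and [v'] spreads this defect to at most
    [e] on the half disc. So [perron] is a locally uniform limit of harmonic functions. *)
Lemma perron_harm x : A x -> harm perron x.
Proof.
move=> Ax; have [j dj] := rs_cover x.
have [p' gp' dA] := gdisk_exists dj (open_nbhs_nbhs (conj ext_open Ax)).
have p'0 := gp'.1; set b := z j x in gp' dA.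
have [p p0 pp'] : exists2 p : R, 0 < p & p < p' by exists (p' / 2); lra.
have p4 : 0 < p / 4 by rewrite divr_gt0.
have p42 : p / 4 < p / 2 by lra.
have [|G hG GE] := @harmonic_uniform_limit R b (p / 4) (p / 2) (perron \o par j) p4 p42.
  move=> e e0; have e3 : 0 < e / 3 by rewrite divr_gt0.
  have Kx : K x by exact: ext_sub.
  have [t [v fv ->] vx] := sup_adherent e3 (perron_has_sup Kx); rewrite -/(perron x) in vx.
  have [cv sv _] := fv.
  have inp w : nm (w - b) < p / 2 -> [/\ dom j (par j w), z j (par j w) = w & disk j b p (par j w)].
    move=> h; have h2 : nm (w - b) < p by lra.
    have [|d1 d2] := gp'.2 w; first exact: lt_trans pp'.
    by split => //; split => //; rewrite d2.

  have bv : bdr (fun w => v (par j (b + cr p * w))).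
    exact: (bdr_circ Xc ext_closed ext_sub p0 pp' gp' dA cv).
  have [F hF FE] := dext_hol p bv.
  exists (fun w => F (w - b)).
    move=> w wp; have [|d Fd] := hF (w - b); first by rewrite subr0; lra.
    by exists d; apply: cdiff_shift.
  move=> w wp; have [dw zw dk] := inp _ wp; rewrite /=.
  have -> : re (F (w - b)) = pmod j b p v (par j w).
    by rewrite pmod_disk // /dsol -FE ?zw //; lra.
  have Kw : K (par j w).
    by apply: ext_sub; apply: dA; split => //; rewrite zw; lra.
  have fp := family_pmod p0 pp' gp' dA.
  have lo := perron_ge Kw (fp _ fv).
  rewrite ger0_norm ?subr_ge0 // lerBlDr.
  apply: perron_le => // v' fv'; have fm := family_max fv fv'.
  have [cm sm _] := fm.
  have := pmod_harnack Xc ext_closed ext_sub p0 pp' gp' dA (y := par j w) (x := x) cv cm _ dj (erefl _) dw.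
  rewrite zw => /(_ _ (ltW wp)) Hk.
  have {}Hk := Hk (fun y => _); have {}Hk := Hk _.
  have g1 := subh_le_pmod Xc ext_closed ext_sub p0 pp' gp' dA ext_properA cm sm (par j w).
  have g2 := perron_ge Kx (fp _ fm).
  have g3 := subh_le_pmod Xc ext_closed ext_sub p0 pp' gp' dA ext_properA cv sv x.
  have g4 : v' (par j w) <= Num.max (v (par j w)) (v' (par j w)) by rewrite le_max lexx orbT.
  have g5 : pmod j b p (fun y => Num.max (v y) (v' y)) (par j w) - pmod j b p v (par j w) <=
     3 * (pmod j b p (fun y => Num.max (v y) (v' y)) x - pmod j b p v x).
    by apply: Hk => y; rewrite le_max lexx.
  by lra.
apply: (harm_coord dj p4 hG) => y dy yp; rewrite -GE //=.
by rewrite rs_coordK.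
Qed.

Lemma annulus_closed : closed (K `&` cdisk i0 a r1).
Proof. by apply: closedI; [exact: ext_closed|exact: closed_cdisk gd rR1]. Qed.

Lemma annulus_harm y : K y -> cdisk i0 a r1 y -> harm H y.
Proof.
move=> Ky [dy yr]; apply: hH => //; rewrite (le_lt_trans yr rR1) andbT.
by apply: lt_le_trans r0 _; rewrite leNgt; apply/negP => h; apply: Ky.
Qed.

(* log (|z - a| / r) vanishes on the circle and is positive outside; adding a
   multiple of it to [H] gives barriers at the circle. *)
Local Notation lam := (fun y => ln (rho y) - ln r).

Lemma lam_harm y : dom i0 y -> K y -> harm lam y.
Proof.
move=> dy Ky; apply: harmB (harm_cst _ _); apply: harm_log => //.
by apply/eqP => E; apply: Ky; split => //; rewrite E subrr nm0.
Qed.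

Lemma barrier_const : exists2 k : R, 0 < k &
  exists2 q : R, r < q < r1 & forall y, dom i0 y -> q <= rho y <= r1 ->
    H y - k * lam y <= m /\ M <= H y + k * lam y.
Proof.
have [B HB] : exists B : R, forall y, (K `&` cdisk i0 a r1) y -> `|H y| <= B.
  apply: (contK_bounded Xc annulus_closed); apply: harm_contK => y [Ky cy].
  exact: annulus_harm.
have [q q1] := mid_lt rr1; have r0' := r0.
have q0 : 0 < q by lra.
have lq : 0 < ln q - ln r by rewrite subr_gt0 ltr_ln ?posrE //; have /andP[] := q1.
(* With this [k] the barrier term exceeds the bounds of [H], [m] and [M] together from radius [q]
   on. *)
pose k := (`|B| + `|m| + `|M| + 1) / (ln q - ln r).
have kq : k * (ln q - ln r) = `|B| + `|m| + `|M| + 1 by rewrite /k divfK // gt_eqF.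
have k0 : 0 < k by rewrite divr_gt0 // ltr_pwDr // !addr_ge0.
exists k => //; exists q => // y dy /andP[qy yr].
have y0 : 0 < rho y := lt_le_trans q0 qy.
have : k * (ln q - ln r) <= k * lam y by rewrite ler_pM2l // lerD2r ler_ln ?posrE.
rewrite kq; have := HB y; rewrite ler_norml => /(_ _) HBy.
have /HBy : (K `&` cdisk i0 a r1) y.
  by split => // -[_]; lra.
move: (ler_norm B) (ler_norm (- m)) (ler_norm M) (normr_ge0 B) (normr_ge0 m) (normr_ge0 M); rewrite normrN.
by move=> *; split; lra.
Qed.

(** For the lower bound, the maximum of [m] and [H - k * lam], continued by [m] beyond radius [q],
    belongs to the family. For the upper bound, each member is compared with [H + k * lam] on the
    annulus between the radii [r] and [q]. *)
Lemma perron_barrier : exists2 k : R, 0 < k & exists2 q : R, r < q &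
  forall y, K y -> dom i0 y -> rho y <= q -> H y - k * lam y <= perron y <= H y + k * lam y.
Proof.
have [k k0 [q /andP[rq qr1] Hq]] := barrier_const; exists k => //; exists q => // y Ky dy yq.
have q0 : 0 < q by exact: lt_trans rq.
apply/andP; split.
  pose g y := if `[< dom i0 y /\ rho y < r1 >] then Num.max m (H y - k * lam y) else m.
  have gin y' : dom i0 y' -> rho y' < r1 -> g y' = Num.max m (H y' - k * lam y').
    by move=> h1 h2; rewrite /g asboolT.
  have gout y' : ~ cdisk i0 a q y' -> g y' = m.
    move=> nc; rewrite /g; case: asboolP => // -[d1 d2].
    have [|h _] := Hq y' d1; last by rewrite (max_idPl h).
    rewrite (ltW d2) andbT leNgt; apply/negP => h; apply: nc; split => //; exact: ltW.
  have hin y' : K y' -> dom i0 y' -> rho y' < r1 -> harm (fun y => H y - k * lam y) y'.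
    move=> h1 h2 h3; apply: harmB; last by apply: harmMl; exact: lam_harm.
    by apply: annulus_harm => //; split => //; exact: ltW.
  have nin y' : dom i0 y' -> rho y' < r1 -> \forall t \near y', g t = Num.max m (H t - k * lam t).
    move=> h1 h2; have : disk i0 a r1 y' by [].
    by move=> /nbhs_disk; apply: filterS => t [t1 t2]; exact: gin.
  have nout y' : ~ cdisk i0 a q y' -> \forall t \near y', g t = m.
    move=> nc; have : nbhs y' (~` cdisk i0 a q).
      apply: open_nbhs_nbhs; split => //; rewrite openC; apply: closed_cdisk gd _.
      exact: lt_trans qr1 rR1.
    by apply: filterS => t; exact: gout.
  have dec y' : (dom i0 y' /\ rho y' < r1) \/ ~ cdisk i0 a q y'.
    have [[d1 d2]|nc] := pselect (cdisk i0 a q y'); [left|by right].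
    by split => //; exact: le_lt_trans d2 qr1.
  have fg : perron_family g.
    split.
    - move=> y' Ky' e e0; have [[d1 d2]|nc] := dec y'.
        have c2 : contK [set y'] (fun t => Num.max m (H t - k * lam t)).
          apply: contK_max; first exact: contK_cst.
          by apply: harm_contK => t ->; exact: hin.
        have hc := harm_cont (hin _ Ky' d1 d2) e0.
        apply: filterS (filterI (nin _ d1 d2) hc) => t [-> h] _.
        by rewrite (gin _ d1 d2); apply: le_lt_trans (max_dist _ _ _) h.
      have nn := nout _ nc; apply: filterS nn => t -> _.
      by rewrite (gout _ nc) subrr normr0.
    - move=> y' Ay'; have Ky' := ext_sub Ay'; have [[d1 d2]|nc] := dec y'.
        have nn : \forall t \near y', Num.max m (H t - k * lam t) = g t.
          by apply: filterS (nin _ d1 d2) => t ->.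
        apply: (subh_at_near nn); apply: subh_at_max; apply: subh_at_harm.
          exact: harm_cst.
        exact: hin.
      have nn : \forall t \near y', m = g t by apply: filterS (nout _ nc) => t ->.
      by apply: (subh_at_near nn); apply: subh_at_harm; exact: harm_cst.
    - move=> y' [d1 d2]; rewrite gin // ?d2 // subrr mulr0 subr0 ge_max lexx andbT.
      by have /andP[] := mHM (conj d1 d2).
  have := perron_ge Ky fg; rewrite gin //; last exact: le_lt_trans yq qr1.
  by apply: le_trans; rewrite le_max lexx orbT.
apply: perron_le => // v fv; have [cv sv vH] := fv.
have qR1 : q < R1 by exact: lt_trans qr1 rR1.
have cl : closed (K `&` cdisk i0 a q).
  by apply: closedI; [exact: ext_closed|exact: closed_cdisk gd qR1].
have hHk t : K t -> cdisk i0 a q t -> harm (fun y => H y + k * lam y) t.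
  move=> h1 [h2 h3]; apply: harmD; last by apply: harmMl; exact: lam_harm.
  by apply: annulus_harm => //; split => //; apply: le_trans h3 (ltW qr1).
have := @subh_le (K `&` cdisk i0 a q) (A `&` disk i0 a q) (fun y => v y - (H y + k * lam y)) 0 cl.
move=> /(_ _ _ _ _ y) E; rewrite -subr_le0; apply: E => //.
- by have [x nK] := ext_proper; exists x => -[].
- apply: contKB; first by apply: contK_sub cv => t [].
  by apply: harm_contK => t [h1 h2]; exact: hHk.
- move=> x [Ax dx] [Kx cx]; split.
    by apply: subh_atD; [exact: sv|apply: harmN; exact: hHk].
  apply: filterS (filterI (open_nbhs_nbhs (conj ext_open Ax)) (nbhs_disk dx)).
  by move=> t [t1 [t2 t3]]; split; [exact: ext_sub|split => //; exact: ltW].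
- move=> x [Kx [dx xq]] nO; rewrite subr_le0.
  have [Ax|/(ext_circ Kx) cx] := pselect (A x).
    have xq' : rho x = q.
      apply/eqP; rewrite eq_le xq leNgt; apply/negP => h; apply: nO; split => //.
    have [|_] := Hq x dx; first by rewrite xq' lexx ltW.
    by apply: le_trans; exact: family_le.
  by have [_ ->] := cx; rewrite subrr mulr0 addr0; exact: vH.
Qed.

Lemma perron_circ y : Circ y -> perron y = H y.
Proof.
move=> cy; have [k k0 [q rq Hq]] := perron_barrier.
have [Ky _] := circ_ext cy; have [dy yr] := cy.
have := Hq y Ky dy; rewrite yr subrr mulr0 subr0 addr0 => /(_ (ltW rq)).
by rewrite -eq_le => /eqP.
Qed.

Lemma perron_contK : contK K perron.
Proof.
move=> y Ky e e0; have [Ay|/(ext_circ Ky) cy] := pselect (A y).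
  by have := harm_cont (perron_harm Ay) e0; apply: filterS => t h _.
have [k k0 [q rq Hq]] := perron_barrier; have [dy yr] := cy.
have hHy : harm H y by apply: hH => //; rewrite yr r0 (lt_trans rr1 rR1).
have hl := lam_harm dy Ky.
have c1 := harm_cont (harmB hHy (harmMl k hl)) e0.
have c2 := harm_cont (harmD hHy (harmMl k hl)) e0.
have nd : nbhs y (disk i0 a q) by apply: nbhs_disk; split; rewrite ?yr.
apply: filterS (filterI (filterI c1 c2) nd) => t [[h1 h2] [dt tq]] Kt.
have := Hq t Kt dt (ltW tq); rewrite (perron_circ cy).
move: h1 h2; rewrite !yr !subrr !mulr0 !subr0 !addr0 !ltr_norml.
by move=> /andP[? ?] /andP[? ?] /andP[? ?]; apply/andP; split; lra.
Qed.

Lemma perron_bound y : K y -> m <= perron y <= M.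
Proof.
move=> Ky; rewrite (perron_ge Ky family_cst) /=.
by apply: perron_le => // v fv; exact: family_le.
Qed.
End Dirichlet.

Lemma nested_intervals (lo hi : nat -> R) :
  (forall n, lo n <= lo n.+1) -> (forall n, hi n.+1 <= hi n) -> (forall n, lo n <= hi n) ->
  exists l, forall n, lo n <= l <= hi n.
Proof.
move=> hlo hhi hlh.
have mlo k n : (n <= k)%N -> lo n <= lo k.
  by elim: k => [|k IH]; rewrite leq_eqVlt => /orP[/eqP ->//|//]; rewrite ltnS => /IH h; exact: le_trans h (hlo k).
have mhi k n : (n <= k)%N -> hi k <= hi n.
  by elim: k => [|k IH]; rewrite leq_eqVlt => /orP[/eqP ->//|//]; rewrite ltnS => /IH h; exact: le_trans (hhi k) h.
have lohi n k : lo n <= hi k.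
  apply: le_trans (mlo _ _ (leq_maxl n k)) (le_trans (hlh _) (mhi _ _ (leq_maxr n k))).
have hs : has_sup (range lo).
  by split; [exists (lo 0%N); exists 0%N|exists (hi 0%N) => _ [n _ <-]].
exists (sup (range lo)) => n; apply/andP; split.
  by apply: sup_upper_bound => //; exists n.
by apply: ge_sup; [exists (lo 0%N); exists 0%N|move=> _ [k _ <-]].
Qed.

Lemma geometric_small (k e : R) : 0 <= k -> 0 < e -> exists n, k * (2 / 3) ^+ n < e.
Proof.
move=> k0 e0; have [n hn] := half_pow_lt k e0; exists (2 * n)%N.
apply: le_lt_trans hn; apply: ler_wpM2l => //.
rewrite exprM -exprVn; apply: lerXn2r; rewrite ?nnegrE ?expr2; lra.
Qed.

(** * Schwarz's alternating method: a potential with a dipole *)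

Section Schwarz.
Implicit Types (x y : X) (i j : rs_idx X) (psi : C -> R).

Hypothesis Xc : compact [set: X].
Variables (i0 : rs_idx X) (a : C) (r R1 : R).
Hypotheses (gd : gdisk i0 a R1) (r0 : 0 < r) (rR1 : 2 * r < R1).
Local Notation K := (~` disk i0 a r).
Local Notation A := (~` cdisk i0 a r).
Local Notation rho := (fun y => nm (z i0 y - a)).
Local Notation Circ := (fun y => dom i0 y /\ rho y = r).

Definition ucont psi := bdr psi /\ forall w0, nm w0 = 1 -> forall e : R, 0 < e ->
  exists2 d : R, 0 < d & forall w, nm w = 1 -> nm (w - w0) < d -> `|psi w - psi w0| < e.

Definition spole y : R := re (z i0 y - a)^-1.
Definition inner psi y : R := dext (2 * r) psi (z i0 y - a).
Definition datum psi y : R := inner psi y + spole y.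
Definition outer psi : X -> R := perron i0 a r (datum psi).
Definition bpt (w : C) : X := par i0 (a + cr (2 * r) * w).
(** One round of the alternation: from values on the circle of radius [2 * r], solve inside, add the
    pole, solve outside the circle of radius [r], return to the larger circle and remove the
    pole. *)
Definition alt psi (w : C) : R := outer psi (bpt w) - spole (bpt w).

Lemma gd2 : gdisk i0 a (2 * r).
Proof.
split; first by rewrite mulr_gt0.
by move=> w h; apply: gd.2; exact: lt_trans rR1.
Qed.
Lemma r_lt : r < 3 / 2 * r. Proof. by have r0' := r0; lra. Qed.
Lemma r_lt2 : 3 / 2 * r < 2 * r. Proof. by have r0' := r0; lra. Qed.
Lemma r_lt3 : r < 2 * r. Proof. by have r0' := r0; lra. Qed.

Lemma spole_harm y : dom i0 y -> z i0 y != a -> harm spole y.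
Proof.
move=> dy ya; exists (fun y => (z i0 y - a)^-1).
have h1 : hdiff (fun y => z i0 y - a) y by apply: hdiffB (hdiff_coord dy) (hdiffC _ _).
have n1 : z i0 y - a != 0 by rewrite subr_eq0.
have nb : \forall t \near y, dom i0 t by apply: open_nbhs_nbhs; split => //; exact: rs_open_dom.
apply: filterS (filterI nb (hdiff_neq0 h1 n1)) => t [dt t0]; split => //.
by apply: hdiffV t0 _; apply: hdiffB (hdiff_coord dt) (hdiffC _ _).
Qed.

Lemma inner_harm psi y : bdr psi -> disk i0 a (2 * r) y -> harm (inner psi) y.
Proof.
move=> bp [dy yr]; have [F hF FE] := dext_hol (2 * r) bp.
exists (fun y => F (z i0 y - a)).
have nb : \forall t \near y, disk i0 a (2 * r) t by apply: nbhs_disk; split.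
apply: filterS nb => t [dt tr]; split; last by rewrite /inner FE.
have [|d Fd] := hF (z i0 t - a); first by rewrite subr0.
exists i0 => //; exists d.
have [e e0 He] := nbhs_chart dt (@filterT _ (nbhs t) _).
apply: cdiff_near e0 _ (cdiff_shift (a := - a) Fd) => w /He [dw zw _] /=.
by rewrite zw.
Qed.

Lemma datum_harm psi y : bdr psi -> dom i0 y -> 0 < rho y < 2 * r -> harm (datum psi) y.
Proof.
move=> bp dy /andP[y0 yr]; apply: harmD; first exact: inner_harm.
by apply: spole_harm => //; rewrite -subr_eq0 -nm_gt0.
Qed.

Lemma datum_bound psi : bdr psi -> exists M : R, forall y, Circ y -> - M <= datum psi y <= M.
Proof.
move=> [k Hk]; exists (k * 3 + r^-1) => y [dy yr].
have h2 : nm (z i0 y - a) < 2 * r by rewrite yr r_lt3.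
have h3 : nm (z i0 y - a) <= 2 * r / 2 by rewrite yr; have r0' := r0; lra.
rewrite -ler_norml; apply: le_trans (ler_normD _ _) (lerD _ _).
  apply: rmean_bound => w w1; rewrite normrM; apply: ler_pM => //; first exact: Hk.
  by rewrite gtr0_norm ?pker_gt0 //; have /andP[] := pker_half h2 h3 w1.
by apply: le_trans (re_le_nm _) _; rewrite nmV yr.
Qed.

Section Outer.
Variable psi : C -> R.
Hypothesis cp : ucont psi.

Lemma outer_harm x : A x -> harm (outer psi) x.
Proof.
have [bp _] := cp; have [M HM] := datum_bound bp.
move=> Ax; have hh := perron_harm Xc gd2 r0 r_lt r_lt2 HM Ax; exact: hh.
Qed.

Lemma outer_contK : contK K (outer psi).
Proof.
have [bp _] := cp; have [M HM] := datum_bound bp.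
apply: (perron_contK Xc gd2 r0 r_lt r_lt2 _ HM) => y dy hy; exact: datum_harm.
Qed.

Lemma outer_circ y : Circ y -> outer psi y = datum psi y.
Proof.
have [bp _] := cp; have [M HM] := datum_bound bp.
apply: (perron_circ Xc gd2 r0 r_lt r_lt2 _ HM) => t dt ht; exact: datum_harm.
Qed.

Lemma outer_bounded : exists M : R, forall y, K y -> `|outer psi y| <= M.
Proof.
have [bp _] := cp; have [M HM] := datum_bound bp.
by exists M => y Ky; rewrite ler_norml; exact: (perron_bound Xc gd2 r0 r_lt r_lt2 HM Ky).
Qed.

Lemma bptP w : nm w = 1 -> [/\ dom i0 (bpt w), z i0 (bpt w) = a + cr (2 * r) * w,
  rho (bpt w) = 2 * r & A (bpt w)].
Proof.
move=> w1; have r20 : 0 < 2 * r by rewrite mulr_gt0.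
have E := circle_in a w1 r20.
have [|dw zw] := gd.2 (a + cr (2 * r) * w); first by rewrite E.
have rw : rho (bpt w) = 2 * r by rewrite /bpt zw E.
by split => // -[_]; rewrite rw leNgt r_lt3.
Qed.

Lemma alt_ucont : ucont (alt psi).
Proof.
have [M HM] := outer_bounded; have r0' := r0; split.
  exists (M + (2 * r)^-1) => w w1; have [dw zw rw Aw] := bptP w1.
  apply: le_trans (ler_normB _ _) (lerD _ _).
    by apply: HM; exact: ext_sub.
  by apply: le_trans (re_le_nm _) _; rewrite nmV rw.
move=> w0 w01 e e0; have [dw zw rw Aw] := bptP w01.
have hh : harm (fun y => outer psi y - spole y) (bpt w0).
  apply: harmB; first exact: outer_harm.
  by apply: spole_harm => //; rewrite -subr_eq0 -nm_gt0 rw mulr_gt0.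
have [d d0 Hd] := nbhs_chart dw (harm_cont hh e0).
exists (d / (2 * r)); first by rewrite divr_gt0 // mulr_gt0.
move=> w w1 wd; have [|_ _ H] := Hd (a + cr (2 * r) * w); last exact: H.
rewrite zw; have -> : a + cr (2 * r) * w - (a + cr (2 * r) * w0) = cr (2 * r) * (w - w0) by ring.
by rewrite nmM nm_cr gtr0_norm ?mulr_gt0 // mulrC -ltr_pdivlMr // mulr_gt0.
Qed.
End Outer.

(** The circle of radius [r] is half-way in, where the Poisson kernel is at least [1 / 3]: a third
    of the distance from either bound to the mean is gained. The length of the interval of values
    thus shrinks by [2 / 3]. *)
Lemma inner_cmp psi psi' (al be : R) : ucont psi -> ucont psi' ->
  (forall w, nm w = 1 -> al <= psi w - psi' w <= be) ->
  exists m : R, al <= m <= be /\ forall y, Circ y ->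
    al + (m - al) / 3 <= inner psi y - inner psi' y <= be - (be - m) / 3.
Proof.
move=> [bp _] [bp' _] H; pose dl w := psi w - psi' w.
have bd : bdr dl by apply: bdrB.
have bk (k : R) : bdr (fun=> k : R) by exists `|k| => w _.
have mk (k : R) : rmean (fun=> k) = k by rewrite /rmean cmean_cst.
have v0 : nm (0 : C) < 2 * r by rewrite nm0 mulr_gt0.
exists (rmean dl); split.
  rewrite -{1}(mk al) -(mk be); apply/andP; split; apply: rmean_le => // w /H /andP[h1 h2] //.
move=> y [dy yr].
have h2 : nm (z i0 y - a) < 2 * r by rewrite yr r_lt3.
have h3 : nm (z i0 y - a) <= 2 * r / 2 by rewrite yr; have r0' := r0; lra.
have bp1 := bdr_pker h2.
have E (k : R) : rmean (fun w => k * pker (2 * r) (z i0 y - a) w) = k by rewrite rmeanMl // rmean_pker // mulr1.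
have ie : inner psi y - inner psi' y = rmean (fun w => dl w * pker (2 * r) (z i0 y - a) w).
  rewrite /inner /dext -rmeanB; [|exact: bdrM..].
  by apply: rmean_ext => w _; rewrite mulrBl.
have h3' (k : R) : rmean (fun w => 3^-1 * (dl w - k)) = (rmean dl - k) / 3.
  by rewrite rmeanMl ?rmeanB ?mk 1?mulrC //; exact: bdrB.
have hp (k : R) : rmean (fun w => (dl w - k) * pker (2 * r) (z i0 y - a) w) =
    rmean (fun w => dl w * pker (2 * r) (z i0 y - a) w) - k.
  rewrite -[in RHS](E k) -rmeanB; [|exact: bdrM|exact: bdrM].
  by apply: rmean_ext => w _; rewrite mulrBl.
have b3 (k : R) : bdr (fun w => 3^-1 * (dl w - k)) by apply: bdrMl; exact: bdrB.
have bq (k : R) : bdr (fun w => (dl w - k) * pker (2 * r) (z i0 y - a) w) by apply: bdrM => //; exact: bdrB.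
have k3 w : nm w = 1 -> 3^-1 <= pker (2 * r) (z i0 y - a) w.
  by move=> w1; have /andP[h _] := pker_half h2 h3 w1; rewrite div1r in h.
have lo : (rmean dl - al) / 3 <= inner psi y - inner psi' y - al.
  rewrite ie -h3' -hp; apply: rmean_le => // w w1.
  by rewrite mulrC ler_wpM2l ?k3 // subr_ge0; have /andP[] := H w w1.
have hi : inner psi y - inner psi' y - be <= (rmean dl - be) / 3.
  rewrite ie -h3' -hp; apply: rmean_le => // w w1.
  by rewrite [3^-1 * _]mulrC ler_wnM2l ?k3 // subr_le0; have /andP[] := H w w1.
by move: lo hi; rewrite /dl; move=> lo hi; apply/andP; split; lra.
Qed.

Lemma outer_le psi psi' (k : R) : ucont psi -> ucont psi' ->
  (forall y, Circ y -> inner psi y - inner psi' y <= k) ->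
  forall y, K y -> outer psi y - outer psi' y <= k.
Proof.
move=> cp cp' H.
apply: (@subh_le Xc K A (fun y => outer psi y - outer psi' y)).
- exact: ext_closed.
- exact: ext_proper gd r0.
- by apply: contKB; exact: outer_contK.
- move=> x Ax Kx; split.
    by apply: subh_at_harm; apply: harmB; exact: outer_harm.
  apply: filterS (@ext_sub i0 a r) _; apply: open_nbhs_nbhs; split => //.
  exact: ext_open gd2 r_lt r_lt2.
- move=> x Kx nA; have cx := ext_circ Kx nA.
  rewrite !outer_circ // /datum opprD addrACA subrr addr0; exact: H.
Qed.

Lemma outer_cmp psi psi' (al be : R) : ucont psi -> ucont psi' ->
  (forall w, nm w = 1 -> al <= psi w - psi' w <= be) ->
  exists al' be' : R, [/\ al <= al', be' <= be, be' - al' <= 2 / 3 * (be - al) &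
    forall y, K y -> al' <= outer psi y - outer psi' y <= be'].
Proof.
move=> cp cp' H; have [m [/andP[m1 m2] Hm]] := inner_cmp cp cp' H.
exists (al + (m - al) / 3), (be - (be - m) / 3); split; try lra.
move=> y Ky; apply/andP; split.
  rewrite -lerN2 opprB; apply: outer_le => // t /Hm /andP[h _].
  by rewrite -lerN2 opprB opprK.
by apply: outer_le => // t /Hm /andP[].
Qed.

Lemma alt_cmp psi psi' (al be : R) : ucont psi -> ucont psi' ->
  (forall w, nm w = 1 -> al <= psi w - psi' w <= be) ->
  exists al' be' : R, [/\ al <= al', be' <= be, be' - al' <= 2 / 3 * (be - al) &
    forall w, nm w = 1 -> al' <= alt psi w - alt psi' w <= be'].
Proof.
move=> cp cp' /(outer_cmp cp cp') [al' [be' [h1 h2 h3 h4]]].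
exists al', be'; split => // w w1; have [_ _ _ Aw] := bptP w1.
have -> : alt psi w - alt psi' w = outer psi (bpt w) - outer psi' (bpt w) by rewrite /alt; ring.
by apply: h4; exact: ext_sub.
Qed.

(** The alternation contracts oscillations, not the sup norm. The increments of its iterates
    therefore converge to a constant [c], the iterates minus [n%:R * c] converge uniformly, and the
    limit is fixed up to [c]. *)
Lemma alt_fixed : exists psi, exists c : R, ucont psi /\ forall w, nm w = 1 -> alt psi w = psi w + c.
Proof.
pose ps n := iter n alt (fun=> 0 : R).
have cps n : ucont (ps n).
  elim: n => [|n IH]; last exact: alt_ucont.
  split; first by exists 0 => w _; rewrite normr0.
  by move=> w0 _ e e0; exists 1 => // w _ _; rewrite subrr normr0.
pose P n (q : R * R) := forall w, nm w = 1 -> q.1 <= ps n.+1 w - ps n w <= q.2.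
have H0 : forall p : nat * (R * R), exists q : R * R, P p.1 p.2 ->
   [/\ P p.1.+1 q, p.2.1 <= q.1, q.2 <= p.2.2 & q.2 - q.1 <= 2 / 3 * (p.2.2 - p.2.1)].
  move=> p.
  have [h|h] := pselect (P p.1 p.2); last by exists (0, 0) => /h.
  have [al' [be' [h1 h2 h3 h4]]] := alt_cmp (cps p.1.+1) (cps p.1) h.
  by exists (al', be').
have [f Hf] := choice H0.
have [M HM] := (cps 1%N).1.
pose q := fix q n := if n is m.+1 then f (m, q m) else (- M, M).
have Pq n : P n (q n).
  elim: n => [|n IH]; first by move=> w /HM; rewrite ler_norml subr0.
  by have [] := Hf (n, q n) IH.
have mon n : [/\ (q n).1 <= (q n.+1).1, (q n.+1).2 <= (q n).2 &
   (q n.+1).2 - (q n.+1).1 <= 2 / 3 * ((q n).2 - (q n).1)].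
  by have [_ ? ? ?] := Hf (n, q n) (Pq n).
have nm11 : nm (1 : C) = 1 by exact: nm1.
have [|||c Hc] := nested_intervals (lo := fun n => (q n).1) (hi := fun n => (q n).2).
- by move=> n; have [] := mon n.
- by move=> n; have [] := mon n.
- by move=> n; have /andP[h1 h2] := Pq n 1 nm11; exact: le_trans h1 h2.
pose L := 2 * M; have L0 : 0 <= L.
  by have /andP[h1 h2] := Pq 0%N 1 nm11; move: (le_trans h1 h2) => /=; rewrite /L; lra.
have len n : (q n).2 - (q n).1 <= L * (2 / 3) ^+ n.
  elim: n => [|n IH]; first by rewrite expr0 mulr1 /L /=; lra.
  have [_ _ h] := mon n; apply: le_trans h _; rewrite exprS mulrCA ler_wpM2l //; lra.
have dif n w : nm w = 1 -> `|ps n.+1 w - ps n w - c| <= L * (2 / 3) ^+ n.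
  move=> w1; apply: le_trans (len n); rewrite ler_norml.
  have := Pq n w w1; have := Hc n; move=> /andP[a1 a2] /andP[b1 b2]; apply/andP; split; lra.
pose e n := L * (2 / 3) ^+ n.
have eS n : e n.+1 = 2 / 3 * e n by rewrite /e exprS; ring.
have e0 n : 0 <= e n by rewrite /e mulr_ge0 // exprn_ge0 //; lra.
have nS n : n.+1%:R * c = n%:R * c + c by rewrite -natr1 mulrDl mul1r.
(* The tail of the geometric series of ratio [2 / 3] starting at [e n] is [3 * e n]. *)
have lim w : exists l : R, nm w = 1 -> forall n, `|ps n w - n%:R * c - l| <= 3 * e n.
  have [w1|w1] := pselect (nm w = 1); last by exists 0.
  have [|||l Hl] := nested_intervals (lo := fun n => ps n w - n%:R * c - 3 * e n)
    (hi := fun n => ps n w - n%:R * c + 3 * e n).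
  - move=> n; rewrite eS nS.
    have := dif n w w1; rewrite -/(e n) ler_norml => /andP[]; move: (ps n.+1 w) (ps n w) (e n) (n%:R * c) => *; lra.
  - move=> n; rewrite eS nS.
    have := dif n w w1; rewrite -/(e n) ler_norml => /andP[]; move: (ps n.+1 w) (ps n w) (e n) (n%:R * c) => *; lra.
  - by move=> n; have := e0 n; lra.
  exists l => _ n; rewrite ler_norml; have := Hl n; move=> /andP[]; move=> h1 h2; apply/andP; split; lra.
have [psi Hpsi] := choice lim.
have cpsi : ucont psi.
  split.
    exists (3 * e 0%N) => w w1; have := Hpsi w w1 0%N.
    by rewrite /= mul0r subr0 sub0r normrN.
  move=> w0 w01 d d0; have d30 : 0 < d / 3 by rewrite divr_gt0.
  have [n en] := geometric_small (mulr_ge0 (ler0n R 3) L0) d30.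
  have [dl dl0 Hd] := (cps n).2 w0 w01 _ d30.
  exists dl => // w w1 /(Hd w w1); have := Hpsi w w1 n; have := Hpsi w0 w01 n.
  move: en; rewrite -mulrA -/(e n) => en.
  rewrite !ler_norml !ltr_norml => /andP[? ?] /andP[? ?] /andP[? ?]; apply/andP; split; lra.
exists psi, c; split => // w w1; apply/eqP; rewrite -subr_eq0 -normr_le0.
apply/ler_addgt0Pl => d d0; rewrite addr0.
have d60 : 0 < d / 2 by rewrite divr_gt0.
have [n en] := geometric_small (mulr_ge0 (ler0n R 3) L0) d60.
move: en; rewrite -mulrA -/(e n) => en.
have [|al [be [h1 h2 _ h4]]] := @alt_cmp (ps n) psi (n%:R * c - 3 * e n) (n%:R * c + 3 * e n) (cps n) cpsi.
  move=> t t1; have := Hpsi t t1 n; rewrite ler_norml => /andP[]; move=> a1 a2; apply/andP; split; lra.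
have := h4 w w1; have -> : alt (ps n) w = ps n.+1 w by [].
have := Hpsi w w1 n.+1; rewrite eS nS ler_norml.
have := e0 n; move: h1 h2 en; move: (n%:R * c); move=> t h1 h2 en e0n /andP[a1 a2] /andP[b1 b2].
by rewrite ler_norml; apply/andP; split; lra.
Qed.

(** The Poisson integral makes sense in the open disc; on the circle it is completed by its boundary
    values. *)
Definition glued psi y : R := if rho y < 2 * r then inner psi y else psi ((cr (2 * r))^-1 * (z i0 y - a)).

Lemma glued_cont psi : ucont psi -> contK (cdisk i0 a (2 * r)) (glued psi).
Proof.
move=> [bp cp] y [dy yr] e e0; have r0' := r0.
have [yr'|yr'] := ltP (rho y) (2 * r).
  have dk : disk i0 a (2 * r) y by [].
  have := harm_cont (inner_harm bp dk) e0.
  apply: filterS2 (nbhs_disk dk) => t [dt tr] h _; rewrite /glued tr.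
  by case: ifP => //; rewrite yr'.
have yE : rho y = 2 * r by apply/eqP; rewrite eq_le yr.
pose w0 := (cr (2 * r))^-1 * (z i0 y - a).
have r20 : 0 < 2 * r by rewrite mulr_gt0.
have crp : cr (2 * r) != 0 by rewrite cr_eq0 gt_eqF.
have unit t : rho t = 2 * r -> nm ((cr (2 * r))^-1 * (z i0 t - a)) = 1.
  by move=> E; rewrite nmM nmV nm_cr gtr0_norm // E mulVf // gt_eqF.
have w01 : nm w0 = 1 by exact: unit.
have w0E : cr (2 * r) * w0 = z i0 y - a by rewrite /w0 mulrA divff // mul1r.
have gy : glued psi y = psi w0 by rewrite /glued yE ltxx.
have [d d0 Hd] := dext_boundary r20 bp w01 (cp w0 w01) e0.
have [d' d'0 Hd'] := cp w0 w01 e e0.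
have [d1 [d10 d1d d1d']] : exists d1 : R, [/\ 0 < d1, d1 <= d & d1 <= d' * (2 * r)].
  exists (Num.min d (d' * (2 * r))); rewrite lt_min d0 mulr_gt0 //.
  by rewrite !ge_min !lexx orbT.
apply: (chart_nbhs dy d10) => t dt td [_ tr]; rewrite gy /glued; case: (ltP (rho t) (2 * r)) => h.
  rewrite /inner -/w0; apply: Hd => //; rewrite w0E.
  have -> : z i0 t - a - (z i0 y - a) = z i0 t - z i0 y by ring.
  exact: lt_le_trans td d1d.
apply: Hd'; first by apply: unit; apply/eqP; rewrite eq_le tr.
rewrite /w0 -mulrBr; have -> : z i0 t - a - (z i0 y - a) = z i0 t - z i0 y by ring.
rewrite nmM nmV nm_cr gtr0_norm // mulrC ltr_pdivrMr //.
exact: lt_le_trans td d1d'.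
Qed.

(* On the annulus, a fixed point up to a constant yields a log term: both sides
   are harmonic with equal values on the two bounding circles. *)
Lemma dipole_potential : exists (u v : X -> R) (c : R),
  [/\ forall x, A x -> harm u x, forall x, disk i0 a (2 * r) x -> harm v x &
      forall y, dom i0 y -> r < rho y < 2 * r -> u y = v y + spole y + c * ln (rho y)].
Proof.
have [psi [c [cp Hc]]] := alt_fixed; have [bp _] := cp.
have r0' := r0; have r20 : 0 < 2 * r by rewrite mulr_gt0.
have l2 : 0 < ln (2 : R) by apply: ln_gt0; lra.
pose k := c / ln 2.
pose lam y : R := k * (ln (rho y) - ln r).
exists (outer psi), (fun y => inner psi y - k * ln r), k; split.
- by move=> x Ax; exact: outer_harm.
- by move=> x dx; apply: harmB (harm_cst _ _); exact: inner_harm.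
have cl : closed (K `&` cdisk i0 a (2 * r)).
  by apply: closedI; [exact: ext_closed|exact: closed_cdisk gd rR1].
pose D y := outer psi y - (glued psi y + spole y + lam y).
have nz y : K y -> dom i0 y -> z i0 y != a.
  by move=> Ky dy; apply/eqP => E; apply: Ky; split => //; rewrite E subrr nm0.
have hl y : K y -> dom i0 y -> harm lam y.
  by move=> Ky dy; apply: harmMl; apply: harmB (harm_cst _ _); apply: harm_log => //; exact: nz.
have cD : contK (K `&` cdisk i0 a (2 * r)) D.
  apply: contKB.
    by apply: contK_sub (outer_contK cp) => t [].
  apply: contKD; last by apply: harm_contK => t [h1 [h2 _]]; exact: hl.
  apply: contKD; first by apply: contK_sub (glued_cont cp) => t [].
  by apply: harm_contK => t [h1 [h2 _]]; apply: spole_harm => //; exact: nz.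
have hD x : A x -> disk i0 a (2 * r) x -> harm D x.
  move=> Ax dx; have Kx := ext_sub Ax; have [dx1 dx2] := dx.
  apply: harmB; first exact: outer_harm.
  apply: harmD; last exact: hl.
  apply: harmD; last by apply: spole_harm => //; exact: nz.
  apply: harm_near (inner_harm bp dx); apply: filterS (nbhs_disk dx) => t [_ tr].
  by rewrite /glued tr.
have bD x : (K `&` cdisk i0 a (2 * r)) x -> ~ (A `&` disk i0 a (2 * r)) x -> D x = 0.
  move=> [Kx [dx xr]] nO; have [Ax|/(ext_circ Kx) cx] := pselect (A x); last first.
    have [_ rx] := cx; rewrite /D outer_circ // /datum /glued rx r_lt3 /lam rx subrr mulr0 addr0.
    by rewrite subrr.
  have xE : rho x = 2 * r.
    apply/eqP; rewrite eq_le xr leNgt; apply/negP => h; apply: nO; split => //.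
  pose w := (cr (2 * r))^-1 * (z i0 x - a).
  have w1 : nm w = 1 by rewrite nmM nmV nm_cr gtr0_norm // xE mulVf // gt_eqF.
  have bw : bpt w = x.
    rewrite /bpt /w mulrA divff ?mul1r ?cr_eq0 ?gt_eqF //.
    by rewrite addrC subrK rs_coordK.
  have := Hc w w1; rewrite /alt bw => E.
  rewrite /D /glued xE ltxx -/w /lam xE lnM ?posrE //.
  have -> : k * (ln 2 + ln r - ln r) = c by rewrite addrK /k divfK // gt_eqF.
  by apply/eqP; rewrite subr_eq0 addrAC -E subrK.
have nK : exists x, ~ (K `&` cdisk i0 a (2 * r)) x.
  by have [x nK] := ext_proper gd r0; exists x => -[].
have nb x : (A `&` disk i0 a (2 * r)) x -> nbhs x (K `&` cdisk i0 a (2 * r)).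
  move=> [Ax dx]; have oA := ext_open gd2 r_lt r_lt2.
  apply: filterS (filterI (open_nbhs_nbhs (conj oA Ax)) (nbhs_disk dx)).
  by move=> t [t1 [t2 t3]]; split; [exact: ext_sub|split => //; exact: ltW].
have D0 y : (K `&` cdisk i0 a (2 * r)) y -> D y = 0.
  move=> Ky; apply/eqP; rewrite eq_le; apply/andP; split.
    apply: (subh_le Xc (O := A `&` disk i0 a (2 * r)) cl nK cD) Ky => //.
      by move=> x [Ax dx] _; split; [apply: subh_at_harm; exact: hD|exact: nb].
    by move=> x h1 h2; rewrite bD.
  rewrite -oppr_le0.
  apply: (subh_le Xc (O := A `&` disk i0 a (2 * r)) (v := fun y => - D y) cl nK) Ky => //.
  - exact: contKN.
  - by move=> x [Ax dx] _; split; [apply: subh_at_harm; apply: harmN; exact: hD|exact: nb].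
  - by move=> x h1 h2; rewrite bD // oppr0.
move=> y dy /andP[y1 y2]; have := D0 y.
rewrite /D /glued y2 /lam => h; have {h} : outer psi y - (inner psi y + spole y + k * (ln (rho y) - ln r)) = 0.
  apply: h; split; last by split => //; exact: ltW.
  by move=> [_]; rewrite ltNge (ltW y1).
by move/eqP; rewrite subr_eq0 => /eqP ->; ring.
Qed.
End Schwarz.

(** * The meromorphic form with a double pole *)

Section DipoleForm.
Implicit Types (x y : X) (i j : rs_idx X).

(** A small step in the direction [cj d] would change the real part at the rate [nm d ^+ 2]. *)
Lemma cdiff_re0 (f : C -> C) w d (e : R) : 0 < e -> cdiff f w d ->
  (forall w', nm (w' - w) < e -> re (f w') = re (f w)) -> d = 0.
Proof.
move=> e0 fd H; apply/eqP; apply: contraT => dn; have n0 : 0 < nm d by rewrite nm_gt0.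
have n2 : 0 < nm d / 2 by rewrite divr_gt0.
have [dl dl0 Hd] := fd _ n2.
have [s s0 [s1 s2]] : exists2 s : R, 0 < s & s * nm d < dl /\ s * nm d < e.
  exists (Num.min dl e / (2 * nm d)); first by rewrite divr_gt0 ?lt_min ?dl0 // mulr_gt0.
  have -> : Num.min dl e / (2 * nm d) * nm d = Num.min dl e / 2 by field; rewrite gt_eqF.
  have m0 : 0 < Num.min dl e by rewrite lt_min dl0.
  have h1 : Num.min dl e <= dl by rewrite ge_min lexx.
  have h2 : Num.min dl e <= e by rewrite ge_min lexx orbT.
  by move: m0 h1 h2; clear; split; lra.
have nh : nm (cr s * cj d) = s * nm d by rewrite nmM nm_cr nm_cj gtr0_norm.
have := Hd (cr s * cj d); rewrite nh => /(_ s1) h.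
have := le_trans (re_le_nm _) h.
rewrite !reB H ?subrr ?sub0r; last by rewrite addrAC subrr add0r nh.
rewrite normrN mulrCA mul_cj -crM re_cr gtr0_norm ?mulr_gt0 ?exprn_gt0 //.
have -> : nm d / 2 * (s * nm d) = s * nm d ^+ 2 / 2 by ring.
have : 0 < s * nm d ^+ 2 by rewrite mulr_gt0 ?exprn_gt0.
by move: (s * _) => t; lra.
Qed.

Definition repr (u : X -> R) x (F : X -> C) := \forall y \near x, hdiff F y /\ u y = re (F y).

(* The coefficients of [dF], where [F] is holomorphic with real part [u]. *)
Definition dharm (u : X -> R) i x : C :=
  if pselect (harm u x) is left H then chart_deriv i (projT1 (cid H)) x else 0.

Lemma dharmE u x F i : repr u x F -> dom i x -> dharm u i x = chart_deriv i F x.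
Proof.
move=> rF di; rewrite /dharm; case: pselect => [H|]; last by case; exists F.
case: cid => G rG /=.
have hF := (nbhs_singleton rF).1; have hG := (nbhs_singleton rG).1.
apply/eqP; rewrite -subr_eq0 -chart_derivB //; apply/eqP.
have cd := chart_derivP (hdiffB hG hF) di.
have nn : \forall y \near x, (hdiff F y /\ u y = re (F y)) /\ (hdiff G y /\ u y = re (G y)).
  exact: filterI rF rG.
have [e e0 He] := nbhs_chart di nn.
apply: (cdiff_re0 e0 cd) => w /He [_ _ [[_ h1] [_ h2]]].
have [[_ h3] [_ h4]] := nbhs_singleton nn.
by rewrite /= rs_coordK // !reB -h1 -h2 -h3 -h4 !subrr.
Qed.

Lemma dharm_near u v x i : (\forall y \near x, u y = v y) -> harm u x -> dom i x ->
  dharm u i x = dharm v i x.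
Proof.
move=> uv [F HF] di; rewrite (dharmE HF di) (dharmE (F := F)) //.
by apply: filterS (filterI uv HF) => y [<- ].
Qed.

Lemma dharm_law u x i j : harm u x -> dom i x -> dom j x ->
  dharm u i x = chart_deriv i (z j) x * dharm u j x.
Proof.
move=> [F HF] di dj; rewrite !(dharmE HF) // mulrC; apply: chain_rule => //.
exact: (nbhs_singleton HF).1.
Qed.

Lemma near_dom i x : dom i x -> \forall y \near x, dom i y.
Proof. by move=> di; apply: open_nbhs_nbhs; split => //; exact: rs_open_dom. Qed.

Lemma dharm_hnear u x i : harm u x -> dom i x -> hnear (dharm u i) x.
Proof.
move=> [F HF] di; have hF : hnear F x by apply: filterS HF => y [].
apply: hnear_near (hnear_deriv hF di).
by apply: filterS (filterI (near_near HF) (near_dom di)) => y [h1 h2]; rewrite (dharmE h1).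
Qed.

Hypothesis Xc : compact [set: X].

(** The holomorphic differentials of the two potentials agree on the annulus and glue. Near [p] the
    singular part of the potential yields the double pole and its logarithm the term with [c]. *)
Theorem dipole_form i0 p : dom i0 p -> exists om : rs_idx X -> X -> C,
  [/\ forall i j x, x <> p -> dom i x -> dom j x -> om i x = chart_deriv i (z j) x * om j x,
      forall i x, x <> p -> dom i x -> hdiff (om i) x &
      exists (c : C) (g : X -> C), hnear g p /\ \forall y \near p, y <> p ->
        om i0 y = - (z i0 y - z i0 p) ^- 2 + c / (z i0 y - z i0 p) + g y].
Proof.
move=> dp; have [R1 gd _] := gdisk_exists dp (@filterT _ (nbhs p) _).
set a := z i0 p in gd *; have R10 := gd.1.
have [r r0 rR] : exists2 r : R, 0 < r & 2 * r < R1 by exists (R1 / 4); lra.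
have [u [v [c [hu hv huv]]]] := dipole_potential Xc gd r0 rR.
pose w y := v y + spole i0 a y + c * ln (nm (z i0 y - a)).
have zne x : x <> p -> dom i0 x -> z i0 x != a.
  by move=> xp dx; apply/eqP => E; apply: xp; rewrite -(rs_coordK dx) E rs_coordK.
have hw x : x <> p -> disk i0 a (2 * r) x -> harm w x.
  move=> xp dx; have dx1 := dx.1; apply: harmD.
    by apply: harmD; [exact: hv|apply: spole_harm => //; exact: zne].
  by apply: harmMl; apply: harm_log => //; exact: zne.
pose A : set X := ~` cdisk i0 a r.
have oA : open A by apply: (ext_open gd) (_ : r < 2 * r) _ => //; lra.
pose om i x := if `[< A x >] then dharm u i x else dharm w i x.
have omA i x : A x -> om i x = dharm u i x by move=> Ax; rewrite /om asboolT.
have omD i x : x <> p -> disk i0 a (2 * r) x -> dom i x -> om i x = dharm w i x.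
  move=> xp dx di; rewrite /om; case: asboolP => // Ax.
  apply: dharm_near => //; last exact: hu.
  apply: filterS (filterI (open_nbhs_nbhs (conj oA Ax)) (nbhs_disk dx)) => y [Ay [dy yr]].
  apply: huv => //; rewrite yr andbT ltNge; apply/negP => h; exact: Ay.
have dec x : A x \/ disk i0 a (2 * r) x.
  have [|/contrapT [dx xr]] := pselect (A x); [by left|right; split => //; lra].
have opp : \forall y \near p, disk i0 a (2 * r) y.
  by apply: nbhs_disk; split => //; rewrite subrr nm0 mulr_gt0.
exists om; split.
- move=> i j x xp di dj; have [Ax|dx] := dec x.
    by rewrite !omA //; apply: dharm_law => //; exact: hu.
  by rewrite !omD //; apply: dharm_law => //; exact: hw.
- move=> i x xp di; have [Ax|dx] := dec x.
    apply: hdiff_near (hnearW (dharm_hnear (hu x Ax) di)).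
    by apply: filterS (open_nbhs_nbhs (conj oA Ax)) => y Ay; rewrite omA.
  apply: hdiff_near (hnearW (dharm_hnear (hw x xp dx) di)).
  have np : \forall y \near x, y <> p.
    have := hdiff_neq0 (hdiffB (hdiff_coord dx.1) (hdiffC a x)).
    rewrite subr_eq0 => /(_ (zne _ xp dx.1)); apply: filterS => y + yp.
    by rewrite yp subrr eqxx.
  apply: filterS (filterI np (filterI (nbhs_disk dx) (near_dom di))) => y [yp [dy diy]].
  by rewrite omD.
have [G HG] : harm v p by apply: hv; split => //; rewrite subrr nm0 mulr_gt0.
have hG : hnear G p by apply: filterS HG => y [].
exists (cr c), (chart_deriv i0 G); split; first exact: hnear_deriv hG dp.
apply: filterS (filterI (near_near HG) opp) => x [Gx dx] xp.
have dx1 := dx.1; have xa : z i0 x - a != 0 by rewrite subr_eq0; exact: zne.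
rewrite omD //; have [e e0 [L HL LE]] := local_log xa.
pose F y := G y + (z i0 y - a)^-1 + cr c * L (z i0 y - a).
have hz y : dom i0 y -> hdiff (fun y => z i0 y - a) y.
  by move=> dy; exact: hdiffB (hdiff_coord dy) (hdiffC _ _).
have hL y : dom i0 y -> nm (z i0 y - z i0 x) < e -> hdiff (fun y => L (z i0 y - a)) y /\
    chart_deriv i0 (fun y => L (z i0 y - a)) y = (z i0 y - a)^-1.
  move=> dy ye; have := HL (z i0 y - a).
  have -> : z i0 y - a - (z i0 x - a) = z i0 y - z i0 x by ring.
  move=> /(_ ye) h; have [e' e'0 He'] := nbhs_chart dy (@filterT _ (nbhs y) _).
  have cd : cdiff ((fun y => L (z i0 y - a)) \o par i0) (z i0 y) (z i0 y - a)^-1.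
    apply: cdiff_near e'0 _ (cdiff_shift (a := - a) h) => t /He' [dt zt _] /=.
    by rewrite zt.
  by split; [exists i0 => //; exists (z i0 y - a)^-1|exact: chart_derivE cd].
have rF : repr w x F.
  have nL : \forall y \near x, dom i0 y /\ nm (z i0 y - z i0 x) < e.
    by apply: (chart_nbhs dx1 e0).
  apply: filterS (filterI (filterI Gx (hdiff_neq0 (hz _ dx1) xa)) nL).
  move=> y [[[Gy vy] ya] [dy ye]]; split.
    apply: hdiffD; first by apply: hdiffD => //; apply: hdiffV ya _; exact: hz.
    by apply: hdiffM (hdiffC _ _) _; have [] := hL y dy ye.
  rewrite /w /F /spole vy !reD re_crM LE //.
  by have -> : z i0 y - a - (z i0 x - a) = z i0 y - z i0 x by ring.
have [hLx dLx] : hdiff (fun y => L (z i0 y - a)) x /\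
    chart_deriv i0 (fun y => L (z i0 y - a)) x = (z i0 x - a)^-1.
  by apply: hL => //; rewrite subrr nm0.
have Gx1 := (nbhs_singleton Gx).1.
have hV : hdiff (fun y => (z i0 y - a)^-1) x by apply: hdiffV xa (hz _ dx1).
have hM : hdiff (fun y => cr c * L (z i0 y - a)) x by exact: hdiffM (hdiffC _ _) hLx.
have E1 := chart_derivD dx1 (hdiffD Gx1 hV) hM.
have E2 := chart_derivD dx1 Gx1 hV.
have E3 := chart_derivM dx1 (hdiffC (cr c) x) hLx.
have E4 := chart_derivV dx1 xa (hz _ dx1).
have E5 := chart_derivB dx1 (hdiff_coord dx1) (hdiffC a x).
have alg (q A1 B D V U K L0 l Z W g : C) : A1 = B + D -> B = g + V -> D = K * L0 + cr c * l ->
    V = - q ^- 2 * U -> U = Z - W -> K = 0 -> Z = 1 -> W = 0 -> l = q^-1 ->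
    A1 = - q ^- 2 + cr c / q + g.
  by move=> -> -> -> -> -> -> -> -> ->; ring.
rewrite (dharmE rF dx1).
exact: (alg _ _ _ _ _ _ _ _ _ _ _ _ E1 E2 E3 E4 E5 (chart_derivC _ _ _)
  (chart_deriv_id dx1) (chart_derivC _ _ _) dLx).
Qed.
End DipoleForm.

Lemma int_nat_diff (k l : int) : l <= k -> exists m : nat, k = l + m.
Proof. by move=> lk; exists `|k - l|%N; lia. Qed.

(** * Orders of meromorphic functions *)

Section Meromorphic.
Implicit Types (x y : X) (i j : rs_idx X) (f g : X -> C) (k l : int).

Lemma hnearC (a : C) x : hnear (fun _ : X => a) x.
Proof. by apply: filterE => y; exact: hdiffC. Qed.
Lemma hnearD f g x : hnear f x -> hnear g x -> hnear (fun y => f y + g y) x.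
Proof. by apply: filterS2 => y; exact: hdiffD. Qed.
Lemma hnearM f g x : hnear f x -> hnear g x -> hnear (fun y => f y * g y) x.
Proof. by apply: filterS2 => y; exact: hdiffM. Qed.
Lemma hnearXz f x k : f x != 0 -> hnear f x -> hnear (fun y => f y ^ k) x.
Proof.
move=> fx hf; apply: filterS2 hf (hdiff_neq0 (hnearW hf) fx) => y h1 h2.
exact: hdiffXz.
Qed.
Lemma hnearV f x : f x != 0 -> hnear f x -> hnear (fun y => (f y)^-1) x.
Proof. by move=> fx hf; have := @hnearXz f x (-1) fx hf. Qed.
Lemma hnear_coord i x : dom i x -> hnear (z i) x.
Proof. by move=> /near_dom; apply: filterS => y; exact: hdiff_coord. Qed.

Lemma coord_neq i x y : dom i x -> dom i y -> y <> x -> z i y - z i x != 0.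
Proof.
move=> dx dy; rewrite subr_eq0 => yx; apply/eqP => E; apply: yx.
by rewrite -(rs_coordK dy) E rs_coordK.
Qed.

Lemma coord_ratio i j x : dom i x -> dom j x -> exists u, [/\ hnear u x, u x != 0 &
  \forall y \near x, z i y - z i x = (z j y - z j x) * u y].
Proof.
move=> di dj; have hz : hnear (z i) x := hnear_coord di.
have [e e0 he] := hnear_hol hz dj; pose T := z i \o par j.
exists (fun y => divdiff T (z j x) (z j y)); split.
- exact: (hol_hnear dj e0 (hol_divdiff he)).
- have [d d0 Td] := coord_change di dj.
  by rewrite /divdiff eqxx (cdiff_derive1 Td).
- apply: filterS (near_dom dj) => y dy; have := divdiffE T (z j x) (z j y).
  by rewrite /T /= !rs_coordK // => ->; ring.
Qed.

(** Order at least [k], and in [oe] exactly [k]. The value at [x] itself is ignored, as sections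
    matter only off the marked points and forms only off a finite list. *)
Definition og f x k := exists2 i, dom i x & exists2 g, hnear g x &
  \forall y \near x, y <> x -> f y = (z i y - z i x) ^ k * g y.
Definition oe f x k := exists2 i, dom i x & exists g, [/\ hnear g x, g x != 0 &
  \forall y \near x, y <> x -> f y = (z i y - z i x) ^ k * g y].

Lemma og_chart f x k i : og f x k -> dom i x -> exists2 g, hnear g x &
  \forall y \near x, y <> x -> f y = (z i y - z i x) ^ k * g y.
Proof.
move=> [j dj [g hg fE]] di; have [u [hu u0 uE]] := coord_ratio dj di.
exists (fun y => u y ^ k * g y); first exact: hnearM (hnearXz _ u0 hu) hg.
apply: filterS2 fE uE => y h1 h2 yx.
by rewrite h1 // h2 expfzMl mulrA.
Qed.

Lemma oe_chart f x k i : oe f x k -> dom i x -> exists g, [/\ hnear g x, g x != 0 &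
  \forall y \near x, y <> x -> f y = (z i y - z i x) ^ k * g y].
Proof.
move=> [j dj [g [hg g0 fE]]] di; have [u [hu u0 uE]] := coord_ratio dj di.
exists (fun y => u y ^ k * g y); split; first exact: hnearM (hnearXz _ u0 hu) hg.
  by rewrite mulf_neq0 // expfz_neq0.
apply: filterS2 fE uE => y h1 h2 yx.
by rewrite h1 // h2 expfzMl mulrA.
Qed.

Lemma oe_og f x k : oe f x k -> og f x k.
Proof. by move=> [i di [g [hg _ fE]]]; exists i => //; exists g. Qed.

Lemma og_ext f g x k : (\forall y \near x, y <> x -> f y = g y) -> og f x k -> og g x k.
Proof.
move=> fg [i di [h hh fE]]; exists i => //; exists h => //.
by apply: filterS2 fg fE => y h1 h2 yx; rewrite -h1 // h2.
Qed.
Lemma oe_ext f g x k : (\forall y \near x, y <> x -> f y = g y) -> oe f x k -> oe g x k.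
Proof.
move=> fg [i di [h [hh h0 fE]]]; exists i => //; exists h; split=> //.
by apply: filterS2 fg fE => y h1 h2 yx; rewrite -h1 // h2.
Qed.

Lemma og_hnear f x : hnear f x -> og f x 0.
Proof.
have [i di] := rs_cover x; exists i => //; exists f => //.
by apply: filterE => y _; rewrite expr0z mul1r.
Qed.
Lemma oe_hnear f x : hnear f x -> f x != 0 -> oe f x 0.
Proof.
have [i di] := rs_cover x; exists i => //; exists f; split => //.
by apply: filterE => y _; rewrite expr0z mul1r.
Qed.

Lemma oe_coord i x : dom i x -> oe (fun y => z i y - z i x) x 1.
Proof.
move=> di; exists i => //; exists (fun=> 1); rewrite oner_eq0; split => //; first exact: hnearC.
by apply: filterE => y _; rewrite expr1z mulr1.
Qed.

Lemma og_weak f x k l : l <= k -> og f x k -> og f x l.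
Proof.
move=> lk [i di [g hg fE]]; exists i => //.
have [m kE] := int_nat_diff lk.
exists (fun y => (z i y - z i x) ^+ m * g y).
  apply: hnearM hg; apply: filterS (near_dom di) => y dy.
  by apply: hdiffX; exact: hdiffB (hdiff_coord dy) (hdiffC _ _).
apply: filterS2 fE (near_dom di) => y h dy yx; rewrite h // kE.
by rewrite expfzDr ?coord_neq // mulrA.
Qed.

Lemma ogD f g x k : og f x k -> og g x k -> og (fun y => f y + g y) x k.
Proof.
move=> [i di [f1 h1 E1]] /og_chart /(_ di) [g1 h2 E2]; exists i => //.
exists (fun y => f1 y + g1 y); first exact: hnearD.
by apply: filterS2 E1 E2 => y e1 e2 yx; rewrite e1 // e2 // mulrDr.
Qed.

Lemma ogM f g x k l : og f x k -> og g x l -> og (fun y => f y * g y) x (k + l).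
Proof.
move=> [i di [f1 h1 E1]] /og_chart /(_ di) [g1 h2 E2]; exists i => //.
exists (fun y => f1 y * g1 y); first exact: hnearM.
apply: filterS2 (filterI E1 E2) (near_dom di) => y [e1 e2] dy yx.
by rewrite e1 // e2 // expfzDr ?coord_neq // mulrACA.
Qed.

Lemma oeM f g x k l : oe f x k -> oe g x l -> oe (fun y => f y * g y) x (k + l).
Proof.
move=> [i di [f1 [h1 n1 E1]]] /oe_chart /(_ di) [g1 [h2 n2 E2]]; exists i => //.
exists (fun y => f1 y * g1 y); split; [exact: hnearM|by rewrite mulf_neq0|].
apply: filterS2 (filterI E1 E2) (near_dom di) => y [e1 e2] dy yx.
by rewrite e1 // e2 // expfzDr ?coord_neq // mulrACA.
Qed.

Lemma oeV f x k : oe f x k -> oe (fun y => (f y)^-1) x (- k).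
Proof.
move=> [i di [g [hg n1 E1]]]; exists i => //; exists (fun y => (g y)^-1); split.
- exact: hnearV.
- by rewrite invr_eq0.
- by apply: filterS E1 => y e1 yx; rewrite e1 // invfM invr_expz.
Qed.

Lemma ogX f x k (n : nat) : og f x k -> og (fun y => f y ^+ n) x (k * n).
Proof.
move=> [i di [g hg E]]; exists i => //; exists (fun y => g y ^+ n).
  by apply: filterS hg => y; exact: hdiffX.
by apply: filterS E => y e yx; rewrite e // exprMn -exprz_exp.
Qed.

Lemma oe_neq0 f x k : oe f x k -> \forall y \near x, y <> x -> f y != 0.
Proof.
move=> [i di [g [hg n1 E1]]].
apply: filterS2 (filterI E1 (near_dom di)) (hdiff_neq0 (hnearW hg) n1).
by move=> y [e1 dy] gy yx; rewrite e1 // mulf_neq0 // expfz_neq0 // coord_neq.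
Qed.

Lemma point_separated x y : y <> x -> \forall t \near y, t <> x.
Proof.
move=> yx; have := @rs_hausdorff _ X; rewrite open_hausdorff => /(_ y x) [].
  exact/eqP.
move=> [A B] /= [/set_mem Ay /set_mem Bx] [oA oB AB].
have : nbhs y A by exact: open_nbhs_nbhs.
apply: filterS => t At tx; have : (A `&` B) t by split=> //; rewrite tx.
by have -> : A `&` B = set0 by [exact: AB|exact/eqP].
Qed.

Lemma og_hdiff f x k : og f x k -> \forall y \near x, y <> x -> hnear f y.
Proof.
move=> [i di [g hg E]].
apply: filterS (filterI (near_near E) (filterI (near_near hg) (near_near (near_dom di)))).
move=> y [Ey [hy dy]] yx; have nx := point_separated yx.
have H : \forall t \near y, (z i t - z i x) ^ k * g t = f t.
  by apply: filterS2 Ey nx => t h1 h2; rewrite h1.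
apply: hnear_near H _; apply: hnearM hy; apply: hnearXz.
  by apply: coord_neq => //; exact: nbhs_singleton dy.
apply: filterS dy => t dt; exact: hdiffB (hdiff_coord dt) (hdiffC _ _).
Qed.

Lemma og_exact f x k : og f x k -> (\forall y \near x, y <> x -> f y = 0) \/
  exists2 l, k <= l & oe f x l.
Proof.
move=> [i di [g hg E]]; have [e e0 he] := hnear_hol hg di.
have nb : \forall y \near x, dom i y /\ nm (z i y - z i x) < e by exact: (chart_nbhs di e0).
have [Z|[N [h [hh h0 hE]]]] := zero_order e0 he; [left|right].
  apply: filterS2 E nb => y Ey [dy ye] yx; rewrite Ey //.
  by have := Z _ ye; rewrite /= rs_coordK // => ->; rewrite mulr0.
exists (k + N); first by rewrite lerDl.
exists i => //; exists (fun y => h (z i y)); split => //; first exact: hol_hnear di e0 hh.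
apply: filterS2 E nb => y Ey [dy ye] yx; rewrite Ey //.
have := hE (z i y); rewrite /= rs_coordK // => ->.
by rewrite expfzDr ?coord_neq // mulrA.
Qed.

Lemma exists_near (A : set X) x : (\forall y \near x, A y) -> exists2 y, y <> x & A y.
Proof.
move=> nA; have [i di] := rs_cover x; have [e e0 He] := nbhs_chart di nA.
have [|d1 d2 d3] := He (z i x + cr (e / 2)).
  by rewrite addrAC subrr add0r nm_cr gtr0_norm ?divr_gt0 //; move: e0; clear; lra.
exists (par i (z i x + cr (e / 2))) => // E; move: d2; rewrite E => /eqP.
by rewrite -subr_eq0 opprD addrA subrr sub0r oppr_eq0 cr_eq0 gt_eqF // divr_gt0.
Qed.

Lemma og_le f x k l : og f x k -> oe f x l -> k <= l.
Proof.
move=> [i di [g hg E]] /oe_chart /(_ di) [h [hh h0 Eh]].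
rewrite leNgt; apply/negP => lk.
have [m kE] : exists m : nat, k = l + m.+1.
  by have [|m kE] := @int_nat_diff k (l + 1); [lia|exists m; lia].
have hz : hnear (fun y => h y - (z i y - z i x) ^+ m.+1 * g y) x.
  apply: filterS2 (filterI hh hg) (near_dom di) => y [h1 h2] dy; apply: hdiffB => //.
  by apply: hdiffM h2; apply: hdiffX; exact: hdiffB (hdiff_coord dy) (hdiffC _ _).
have : h x - (z i x - z i x) ^+ m.+1 * g x != 0 by rewrite subrr expr0n mul0r subr0.
move=> /(hdiff_neq0 (hnearW hz)) nz.
have [y yx [[[Ey Ehy] dy] /eqP]] := exists_near (filterI (filterI (filterI E Eh) (near_dom di)) nz).
apply; have n0 := coord_neq di dy yx.
apply: (mulfI (expfz_neq0 l n0)); rewrite mulr0 mulrBr -Ehy // Ey // kE.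
by rewrite expfzDr // mulrA subrr.
Qed.

Lemma oe_unique f x k l : oe f x k -> oe f x l -> k = l.
Proof. by move=> h1 h2; apply/eqP; rewrite eq_le (og_le (oe_og h1) h2) (og_le (oe_og h2) h1). Qed.

Lemma oe_nonzero f x k : oe f x k -> ~ (\forall y \near x, y <> x -> f y = 0).
Proof.
move=> /oe_neq0 nz Z; have [y yx [h1 h2]] := exists_near (filterI nz Z).
by have := h1 yx; rewrite h2 // eqxx.
Qed.

Definition mero f := forall x, exists k, og f x k.

(** The identity theorem: the points near which [f] vanishes form an open and closed set, as the
    other points have an exact order. *)
Lemma mero_dich f : mero f -> (forall x, \forall y \near x, y <> x -> f y = 0) \/
  (forall x, exists k, oe f x k).
Proof.
move=> mf; pose T := [set x | \forall y \near x, y <> x -> f y = 0].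
have dec x : T x \/ exists k, oe f x k.
  by have [k /og_exact [|[l _ h]]] := mf x; [left|right; exists l].
have [[x0 Tx0]|nT] := pselect (T !=set0); last first.
  by right=> x; have [Tx|//] := dec x; case: nT; exists x.
left; apply: (clopen_full Tx0) => x.
  move=> Tx; apply: filterS (near_near Tx) => y Ty; have [->//|yx] := pselect (y = x).
  by rewrite /T /=; apply: filterS2 Ty (point_separated yx) => t h1 h2 _; exact: h1.
move=> nT; have [//|[k ok]] := dec x.
apply: filterS (near_near (oe_neq0 ok)) => y nz Ty.
have [yx|yx] := pselect (y = x); first by apply: nT; rewrite -yx.
have [t ty [[h1 h2] h3]] := exists_near (filterI (filterI nz (point_separated yx)) Ty).
by have := h1 h2; rewrite h3 // eqxx.
Qed.

Section Compact.
Hypothesis Xc : compact [set: X].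

(** The exceptional points are isolated, hence finite in number by compactness. The filter of
    eventual inclusion on lists casts a finite subcover as a list. *)
Lemma finite_exceptions (P : set X) : (forall x, \forall y \near x, y <> x -> P y) ->
  exists2 s : seq X, uniq s & forall x, x \notin s -> P x.
Proof.
move=> HP; pose F : set_system (seq X) := [set Q : set (seq X) | exists s : seq X, forall t : seq X, {subset s <= t} -> Q t].
have FF : Filter F.
  split; first by exists [::].
    move=> P1 P2 [s1 h1] [s2 h2]; exists (s1 ++ s2) => t st; split.
      by apply: h1 => y ys; apply: st; rewrite mem_cat ys.
    by apply: h2 => y ys; apply: st; rewrite mem_cat ys orbT.
  by move=> P1 P2 P12 [s1 h1]; exists s1 => t /h1 /P12.
have /compact_near_coveringP cX := Xc.
have [x _|s Hs] := cX _ F (fun t y => y \in t \/ P y) FF.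
  exists ((fun y => y <> x -> P y), [set t : seq X | x \in t]) => /=.
    by split; [exact: HP|exists [:: x] => t; apply; rewrite inE].
  move=> [y t] /= [h xt]; have [->|yx] := pselect (y = x); first by left.
  by right; exact: h.
exists (undup s); first exact: undup_uniq.
move=> y ys; have [] := Hs s (fun x h => h) y I => //.
by move: ys; rewrite mem_undup => /negP.
Qed.

Lemma harm_const (u : X -> R) : (forall x, harm u x) -> exists k : R, forall x, u x = k.
Proof.
move=> hu; have [[x0 _]|nX] := pselect ([set: X] !=set0); last first.
  by exists 0 => x; case: nX; exists x.
have cu : contK setT u by exact: harm_contK.
have X0 : [set: X] !=set0 by exists x0.
have [a _ ma] := compact_EVT_max X0 Xc (contK_within cu).
exists (u a); pose T := [set x | u x = u a].
have le x : u x <= u a by apply: ma; rewrite inE.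
apply: (@clopen_full T a) => // x.
  move=> Tx; have := harm_max (hu x); rewrite (Tx : u x = u a) => H.
  by apply: (filterS _ (H _)) => //; apply: filterE.
move=> nT; have e0 : 0 < u a - u x by rewrite subr_gt0 lt_neqAle le andbT; apply/eqP.
apply: filterS (harm_cont (hu x) e0) => y h Ty; move: h.
by rewrite (Ty : u y = u a) gtr0_norm // ltxx.
Qed.

Lemma hol_const f : (forall x, hdiff f x) -> exists k : C, forall x, f x = k.
Proof.
move=> hf; have [x|k1 H1] := @harm_const (fun x => re (f x)).
  by exists f; apply: filterE.
have [x|k2 H2] := @harm_const (fun x => re (- ci R * f x)).
  by exists (fun x => - ci R * f x); apply: filterE => y; split => //; exact: hdiffM (hdiffC _ _) _.
exists (cr k1 + ci R * cr k2) => x; rewrite (reimE (f x)) H1; congr (_ + _ * cr _).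
by rewrite -(H2 x) reM reN imN re_ci im_ci; ring.
Qed.

(** The values are first filled in by the local holomorphic representatives; the result is
    holomorphic everywhere, hence constant by the maximum principle. *)
Lemma mero_const f : (forall x, og f x 0) -> exists k : C, forall x, \forall y \near x, y <> x -> f y = k.
Proof.
move=> H; have ex x : exists v, exists2 g, hnear g x & g x = v /\ \forall y \near x, y <> x -> f y = g y.
  have [i di [g hg E]] := H x; exists (g x), g => //; split => //.
  by apply: filterS E => y h /h ->; rewrite expr0z mul1r.
have [F HF] := choice ex.
have FE x g : hnear g x -> F x = g x -> (\forall y \near x, y <> x -> f y = g y) ->
    \forall y \near x, F y = g y.
  move=> hg gx E; apply: filterS2 (near_near E) (near_near hg) => y Ey hgy.
  have [->//|yx] := pselect (y = x).
  have [g' hg' [<- Ey']] := HF y.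
  apply/eqP; apply: contraT => ne.
  have hd : hnear (fun t => g' t - g t) y.
    by apply: filterS2 hg' hgy => t; exact: hdiffB.
  have ne' : g' y - g y != 0 by rewrite subr_eq0.
  have nz := hdiff_neq0 (hnearW hd) ne'.
  have [t ty [[[h1 h2] h3] h4]] :=
    exists_near (filterI (filterI (filterI nz Ey) Ey') (point_separated yx)).
  by move: h1; rewrite -h3 // h2 // subrr eqxx.
have [x|k Hk] := @hol_const F.
  have [g hg [gx E]] := HF x; apply: hdiff_near (hnearW hg).
  by apply: filterS (FE x g hg (esym gx) E) => y ->.
exists k => x; have [g hg [gx E]] := HF x.
by apply: filterS2 E (FE x g hg (esym gx) E) => y h1 h2 yx; rewrite h1 // -h2.
Qed.
End Compact.
End Meromorphic.

(** * The residue theorem, given a non-constant function *)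

Section Residues.
Implicit Types (x y : X) (i j : rs_idx X) (f g : X -> C) (th : rs_idx X -> X -> C).

(* Meromorphic forms, regular off the finite list [s], on which the values are irrelevant. *)
Definition mform (s : seq X) th := [/\
  forall i j x, x \notin s -> dom i x -> dom j x -> th i x = chart_deriv i (z j) x * th j x,
  forall i x, x \notin s -> dom i x -> hdiff (th i) x &
  forall x, x \in s -> exists2 i, dom i x & exists k, og (th i) x k].

Definition res th x c := forall i, dom i x -> ppart (th i \o par i) (z i x) c.

Lemma near_notin (s : seq X) x : \forall y \near x, y <> x -> y \notin s.
Proof.
elim: s => [|t s IH]; first by apply: filterE.
have [E|xt] := pselect (x = t).
  by subst t; apply: filterS IH => y h yt; rewrite inE negb_or h // andbT; exact/eqP.
apply: filterS2 IH (point_separated xt) => y h yt yx; rewrite inE negb_or h // andbT.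
exact/eqP.
Qed.

Lemma notin_near (s : seq X) x : x \notin s -> \forall y \near x, y \notin s.
Proof.
move=> xs; apply: filterS (near_notin s x) => y h.
by have [->//|/h] := pselect (y = x).
Qed.

Lemma mform_hnear s th i x : mform s th -> x \notin s -> dom i x -> hnear (th i) x.
Proof.
move=> [_ h _] xs di; apply: filterS2 (notin_near xs) (near_dom di) => y ys dy; exact: h.
Qed.

Lemma mform_og s th i x : mform s th -> dom i x -> exists k, og (th i) x k.
Proof.
move=> mt di; have [xs|xs] := boolP (x \in s); last first.
  by exists 0; apply: og_hnear; exact: mform_hnear mt xs di.
have [law _ hs] := mt; have [j dj [k ok]] := hs x xs; exists (0 + k).
have hz := hnear_deriv (hnear_coord dj) di.
apply: og_ext (ogM (og_hnear hz) ok).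
apply: filterS2 (near_notin s x) (filterI (near_dom di) (near_dom dj)) => y h [d1 d2] yx.
by rewrite (law i j y) // h.
Qed.

Lemma near_punct i x (P : X -> Prop) : dom i x -> (\forall y \near x, y <> x -> P y) ->
  exists2 e : R, 0 < e & forall w, 0 < nm (w - z i x) < e ->
    [/\ dom i (par i w), z i (par i w) = w & P (par i w)].
Proof.
move=> di /(nbhs_chart di) [e e0 He]; exists e => // w /andP[w0 /He [dw zw H]].
by split => //; apply: H => E; move: w0; rewrite -zw E subrr nm0 ltxx.
Qed.

Lemma og_ppart f x k i : og f x k -> dom i x -> exists c, ppart (f \o par i) (z i x) c.
Proof.
move=> of1 di; have [m Hm] : exists m : nat, - (m : int) <= k by exists `|k|%N; lia.
have [g hg E] := og_chart (og_weak Hm of1) di.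
have [e e0 he] := hnear_hol hg di; have [c Hc] := ppart_pow m e0 he; exists c.
have [e1 e10 He1] := near_punct di E.
apply: ppart_ext e10 _ Hc => w /He1 [dw zw E'].
by rewrite /= E' zw mulrC; case: (m) => [|m'] //; rewrite expr0 invr1 oppr0 expr0z.
Qed.

Lemma res_chart s th x i c : mform s th -> dom i x -> ppart (th i \o par i) (z i x) c -> res th x c.
Proof.
move=> [law _ _] di pc j dj.
have hz : hnear (z i) x := hnear_coord di.
have [e e0 he] := hnear_hol hz dj; have [d d0 Td] := coord_change di dj.
have T0 : (z i \o par j) (z j x) = z i x by rewrite /= rs_coordK.
have Tn : derive1 (z i \o par j) (z j x) != 0 by rewrite (cdiff_derive1 Td).
rewrite -T0 in pc; have H := ppart_comp e0 he Tn pc.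
have nn : \forall y \near x, y <> x -> dom i y /\ (dom j y /\ y \notin s).
  by apply: filterS2 (filterI (near_dom di) (near_dom dj)) (near_notin s x) => y [h1 h2] h yx;
     split => //; split => //; exact: h.
have [e1 e10 He1] := near_punct dj nn.
apply: (ppart_ext e10 _ H) => w /He1 [dw zw [dy [_ ys]]].
have E : chart_deriv j (z i) (par j w) = derive1 (z i \o par j) w by rewrite /chart_deriv zw.
have L := law j i _ ys dw dy; rewrite E in L.
change (th i (par i (z i (par j w))) * derive1 (z i \o par j) w = th j (par j w)).
by rewrite L (rs_coordK dy); exact: mulrC.
Qed.

Lemma mform_res s th : mform s th -> forall x, exists c, res th x c.
Proof.
move=> mt x; have [i di] := rs_cover x; have [k ok] := mform_og mt di.
by have [c Hc] := og_ppart ok di; exists c; exact: res_chart mt di Hc.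
Qed.

Lemma res_unique th x c c' : res th x c -> res th x c' -> c = c'.
Proof. by move=> h h'; have [i di] := rs_cover x; exact: ppart_unique (h i di) (h' i di). Qed.

Lemma res_hnear th x : (forall i, dom i x -> hnear (th i) x) -> res th x 0.
Proof. by move=> H i di; have [e e0 he] := hnear_hol (H i di) di; exact: ppart_hol e0 he. Qed.

Lemma sum_support (c : X -> C) (s t : seq X) : uniq s -> uniq t ->
  (forall x, x \notin s -> c x = 0) -> (forall x, x \notin t -> c x = 0) ->
  \sum_(x <- s) c x = \sum_(x <- t) c x.
Proof.
move=> us ut hs ht.
have E (u : seq X) : \sum_(x <- u) c x = \sum_(x <- [seq x <- u | c x != 0]) c x.
  rewrite big_filter [RHS]big_mkcond; apply: eq_bigr => x _.
  by case: eqVneq => //= ->.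
rewrite E (E t); apply: perm_big; apply: uniq_perm; rewrite ?filter_uniq // => x.
rewrite !mem_filter; case: eqVneq => //= cx.
have -> : x \in s by apply: contraNT cx => /hs ->.
by symmetry; apply: contraNT cx => /ht ->.
Qed.

Section System.
Variables (S : seq X) (ii : X -> rs_idx X) (rr : X -> R).
Local Notation a x := (z (ii x) x).
Hypothesis uS : uniq S.
Hypothesis dS : forall x, x \in S -> dom (ii x) x.
Hypothesis gS : forall x, x \in S -> gdisk (ii x) (a x) (2 * rr x).
Hypothesis r0S : forall x, x \in S -> 0 < rr x.
Hypothesis disj : forall x x' y, x \in S -> x' \in S -> disk (ii x) (a x) (2 * rr x) y ->
  disk (ii x') (a x') (2 * rr x') y -> x = x'.

Definition rest : set X := [set y | forall x, x \in S -> ~ disk (ii x) (a x) (rr x) y].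

Lemma closed_rest : closed rest.
Proof.
rewrite -openC openE => y /existsNP [x /not_implyP [xS /contrapT h]].
by apply: filterS (nbhs_disk h) => t ht /(_ x xS).
Qed.

Lemma near_seq (s : seq X) (A : X -> set X) y : (forall x, x \in s -> nbhs y (A x)) ->
  \forall t \near y, forall x, x \in s -> A x t.
Proof.
elim: s => [|x s IH] H; first by apply: filterE => t x; rewrite inE.
have h1 := H x (mem_head _ _); have h2 : \forall t \near y, forall x', x' \in s -> A x' t.
  by apply: IH => x' xs; apply: H; rewrite inE xs orbT.
by apply: filterS2 h1 h2 => t t1 t2 x'; rewrite inE => /orP[/eqP ->|/t2].
Qed.

(** Where [F] is regular on [rest], residues can occur only in the closed discs of radius [rr x].
    The circles of radius [3 / 2 * rr x] lie strictly between these and the disjoint discs of radius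
    [2 * rr x], which leaves room on both sides. *)
Lemma system_residue (T : seq X) (F : rs_idx X -> X -> C) (c : X -> C) : uniq T -> mform T F ->
  (forall y i, rest y -> dom i y -> hdiff (F i) y) -> (forall y, res F y (c y)) ->
  (forall x, x \in S -> bdc (fun t => cr (3 / 2 * rr x) * t *
     F (ii x) (par (ii x) (a x + cr (3 / 2 * rr x) * t)))) /\
  \sum_(y <- T) c y = \sum_(x <- S) cint (a x) (3 / 2 * rr x) (F (ii x) \o par (ii x)).
Proof.
move=> uT mF hF rc.
have lt1 x : x \in S -> 3 / 2 * rr x < 2 * rr x by move=> /r0S; lra.
have sub x y : x \in S -> disk (ii x) (a x) (3 / 2 * rr x) y -> disk (ii x) (a x) (2 * rr x) y.
  by move=> xS [d1 d2]; split => //; exact: lt_trans (lt1 x xS).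
have one y : c y != 0 -> exists2 x, x \in S & disk (ii x) (a x) (3 / 2 * rr x) y.
  move=> cy; apply: contrapT => nex; move/eqP: cy; apply.
  apply: (res_unique (rc y)); apply: res_hnear => i di.
  have ny : \forall t \near y, forall x, x \in S -> ~ cdisk (ii x) (a x) (rr x) t.
    apply: near_seq => x xS; apply: open_nbhs_nbhs; split.
      rewrite openC; apply: closed_cdisk (gS xS) _; have := r0S xS; lra.
    by move=> [d1 d2]; apply: nex; exists x => //; split => //; have := r0S xS; lra.
  apply: filterS2 ny (near_dom di) => t h dt; apply: hF => // x xS [d1 d2].
  by apply: (h x xS); split => //; exact: ltW.
pose P x y : bool := `[< disk (ii x) (a x) (3 / 2 * rr x) y >].
have key x : x \in S -> bdc (fun t => cr (3 / 2 * rr x) * t *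
     F (ii x) (par (ii x) (a x + cr (3 / 2 * rr x) * t))) /\
     cint (a x) (3 / 2 * rr x) (F (ii x) \o par (ii x)) = \sum_(y <- T | P x y) c y.
  move=> xS; have r0 := r0S xS; have r0' : 0 < 3 / 2 * rr x by rewrite mulr_gt0 // divr_gt0.
  pose s := [seq z (ii x) y | y <- T & P x y].
  have us : uniq s.
    rewrite map_inj_in_uniq ?filter_uniq // => y y'; rewrite !mem_filter.
    move=> /andP[/asboolP [d1 _] _] /andP[/asboolP [d2 _] _] E.
    by rewrite -(rs_coordK d1) E rs_coordK.
  have [|||b1 b2] := @disc_residue R (a x) (3 / 2 * rr x) (2 * rr x) (F (ii x) \o par (ii x)) s
     (c \o par (ii x)) r0' (lt1 x xS) us.
  - by move=> w /mapP [y]; rewrite mem_filter => /andP[/asboolP [_ h] _] ->.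
  - move=> w wr ws; have [dw zw] := (gS xS).2 w wr.
    suff hh : hdiff (F (ii x)) (par (ii x) w) by have := hdiff_chart hh dw; rewrite zw.
    have [yT|yT] := boolP (par (ii x) w \in T); last by have [_ h _] := mF; exact: h.
    apply: hF => // x' xS' [d1 d2].
    have E : x = x'.
      apply: (disj xS xS' (y := par (ii x) w)); split => //; first by rewrite zw.
      by apply: lt_trans d2 _; have := r0S xS'; lra.
    subst x'; move/negP: ws; apply; apply/mapP; exists (par (ii x) w) => //.
    rewrite mem_filter yT andbT; apply/asboolP; split => //.
    by move: d2; lra.
  - move=> w /mapP [y]; rewrite mem_filter => /andP[/asboolP [dy _] _] ->.
    by rewrite /= rs_coordK //; exact: rc.
  split => //; rewrite b2 big_map big_filter; apply: eq_bigr => y /asboolP [dy _].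
  by rewrite /= rs_coordK.
split; first by move=> x /key [].
transitivity (\sum_(x <- S) \sum_(y <- T | P x y) c y); last first.
  by rewrite big_seq [RHS]big_seq; apply: eq_bigr => x /key [_ ->].
under [RHS]eq_bigr do rewrite big_mkcond.
rewrite exchange_big; apply: eq_bigr => y _.
have [->|cy] := eqVneq (c y) 0; first by rewrite big1 // => x _; case: ifP.
have [x xS dx] := one y cy; rewrite (bigD1_seq x) //= {1}/P asboolT // big1_seq ?addr0 //.
move=> x' /andP[/eqP ne xS']; case: ifP => // /asboolP h; case: ne.
exact: (disj xS' xS (sub _ _ xS' h) (sub _ _ xS dx)).
Qed.
End System.

(** The points are separated two by two; a disc inside the finite intersection of the neighbourhoods
    of each point serves. *)
Lemma system_exists (S : seq X) : exists (ii : X -> rs_idx X) (rr : X -> R), [/\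
  forall x, x \in S -> dom (ii x) x, forall x, x \in S -> gdisk (ii x) (z (ii x) x) (2 * rr x),
  forall x, x \in S -> 0 < rr x &
  forall x x' y, x \in S -> x' \in S -> disk (ii x) (z (ii x) x) (2 * rr x) y ->
    disk (ii x') (z (ii x') x') (2 * rr x') y -> x = x'].
Proof.
have sep (p : X * X) : exists UV : set X * set X, p.1 <> p.2 ->
    [/\ nbhs p.1 UV.1, nbhs p.2 UV.2 & UV.1 `&` UV.2 = set0].
  have [E|E] := pselect (p.1 = p.2); first by exists (setT, setT) => /(_ E).
  have := @rs_hausdorff _ X; rewrite open_hausdorff => /(_ p.1 p.2) [].
    exact/eqP.
  move=> [A B] /= [/set_mem Ay /set_mem Bx] [oA oB AB]; exists (A, B) => _.
  split; [exact: open_nbhs_nbhs|exact: open_nbhs_nbhs|].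
  by [exact: AB|exact/eqP].
have [f Hf] := choice sep.
pose N x : set X := [set y | forall x', x' \in S -> x' <> x -> (f (x, x')).1 y /\ (f (x', x)).2 y].
have nN x : nbhs x (N x).
  apply: near_seq => x' xS'; have [->|xx] := pselect (x' = x); first by apply: filterE.
  have [h1 _ _] := Hf (x, x') (fun E => xx (esym E)); have [_ h2 _] := Hf (x', x) xx.
  by apply: filterS2 h1 h2.
have ex x : exists q : rs_idx X * R, [/\ dom q.1 x, gdisk q.1 (z q.1 x) (2 * q.2), 0 < q.2 &
    disk q.1 (z q.1 x) (2 * q.2) `<=` N x].
  have [i di] := rs_cover x; have [r gr dr] := gdisk_exists di (nN x).
  exists (i, r / 2) => /=; rewrite mulrC divfK ?pnatr_eq0 //; split => //.
  by rewrite divr_gt0 // gr.1.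
have [q Hq] := choice ex.
exists (fun x => (q x).1), (fun x => (q x).2); split => [x _|x _|x _|x x' y xS xS'].
- by have [] := Hq x.
- by have [] := Hq x.
- by have [] := Hq x.
have [_ _ _ h1] := Hq x; have [_ _ _ h2] := Hq x'.
move=> /h1 n1 /h2 n2; apply: contrapT => ne.
have [_ _ E] := Hf (x, x') ne; have : ((f (x, x')).1 `&` (f (x, x')).2) y.
  by split; [exact: (n1 x' xS' (fun E => ne (esym E))).1|exact: (n2 x xS ne).2].
by rewrite E.
Qed.

Lemma cdiff_bigsum (S : seq X) (G D : X -> C -> C) w : (forall x, x \in S -> cdiff (G x) w (D x w)) ->
  cdiff (fun w => \sum_(x <- S) G x w) w (\sum_(x <- S) D x w).
Proof.
elim: S => [|x S IH] H.
  rewrite big_nil (_ : (fun w => _) = fun=> 0); first exact: cdiffC.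
  by apply/funext => v; rewrite big_nil.
rewrite big_cons (_ : (fun w => _) = fun w => G x w + \sum_(y <- S) G y w).
  apply: cdiffD; first by apply: H; exact: mem_head.
  by apply: IH => y yS; apply: H; rewrite inE yS orbT.
by apply/funext => v; rewrite big_cons.
Qed.

Hypothesis Xc : compact [set: X].

Lemma hdiff_bounded (K : set X) f : closed K -> (forall y, K y -> hdiff f y) ->
  exists M : R, forall y, K y -> nm (f y) <= M.
Proof.
move=> cK hf; have [M HM] : exists M : R, forall y, K y -> `|nm (f y)| <= M.
  apply: (contK_bounded Xc cK) => x Kx e e0.
  apply: filterS (hdiff_cont (hf x Kx) e0) => y h _; apply: le_lt_trans h.
  have h1 := nm_triB (f y) (f x); have h2 := nm_triB (f x) (f y); rewrite nmC in h2.
  by rewrite ler_norml; apply/andP; split; move: h1 h2; clear; lra.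
by exists M => y /HM; rewrite ger0_norm ?nm_ge0.
Qed.

Section ResidueSum.
Variable f : X -> C.
Hypothesis mf : mero f.
Hypothesis nf : forall (w : C) x, exists k, oe (fun y => f y - w) x k.
Variables (s : seq X) (th : rs_idx X -> X -> C).
Hypothesis mth : mform s th.

Definition quot w : rs_idx X -> X -> C := fun i y => th i y / (f y - w).

Lemma exceptions_ex w : exists e : seq X, forall y, y \notin e -> hnear f y /\ f y != w.
Proof.
have [|e _ He] := @finite_exceptions Xc [set y | hnear f y /\ f y != w].
  move=> x; have [k ok] := mf x; have [l ol] := nf w x.
  by apply: filterS2 (og_hdiff ok) (oe_neq0 ol) => y h1 h2 yx; split; [exact: h1|rewrite -subr_eq0; exact: h2].
by exists e.
Qed.

Definition exc w := projT1 (cid (exceptions_ex w)).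
Lemma excP w y : y \notin exc w -> hnear f y /\ f y != w.
Proof. by rewrite /exc; case: cid => e He /=; exact: He. Qed.

Definition qlist w := undup (s ++ exc w).
Lemma qlistP w y : y \notin qlist w -> [/\ y \notin s, hnear f y & f y != w].
Proof.
by rewrite mem_undup mem_cat negb_or => /andP[h /excP [h1 h2]].
Qed.

Lemma mform_quot w : mform (qlist w) (quot w).
Proof.
have [law reg _] := mth; split.
- move=> i j x /qlistP [xs hf fw] di dj; rewrite /quot (law i j x) //.
  by rewrite mulrA.
- move=> i x /qlistP [xs hf fw] di; apply: hdiffM; first exact: reg.
  apply: hdiffV; first by rewrite subr_eq0.
  exact: hdiffB (hnearW hf) (hdiffC _ _).
- move=> x _; have [i di] := rs_cover x; exists i => //.
  have [k ok] := mform_og mth di; have [l ol] := nf w x.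
  by eexists; apply: ogM ok (oe_og (oeV ol)).
Qed.

Lemma qres_ex w : exists c : X -> C, forall y, res (quot w) y (c y).
Proof. by have [c Hc] := choice (mform_res (mform_quot w)); exists c. Qed.
Definition qres w := projT1 (cid (qres_ex w)).
Lemma qresP w y : res (quot w) y (qres w y).
Proof. by rewrite /qres; case: cid. Qed.

(** The total residue of [th / (f - w)]. The list of possible poles changes with [w], which is why
    regularity in [w] is obtained from fixed circles. *)
Definition tot w : C := \sum_(y <- qlist w) qres w y.

Lemma tot_system S ii rr (w : C) : uniq S -> (forall x, x \in S -> dom (ii x) x) ->
  (forall x, x \in S -> gdisk (ii x) (z (ii x) x) (2 * rr x)) -> (forall x, x \in S -> 0 < rr x) ->
  (forall x x' y, x \in S -> x' \in S -> disk (ii x) (z (ii x) x) (2 * rr x) y ->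
    disk (ii x') (z (ii x') x') (2 * rr x') y -> x = x') -> {subset s <= S} ->
  (forall y, rest S ii rr y -> hdiff f y /\ f y != w) ->
  tot w = \sum_(x <- S) cint (z (ii x) x) (3 / 2 * rr x) (quot w (ii x) \o par (ii x)).
Proof.
move=> uS dS gS r0S disj sS H.
have [|_ E] := system_residue uS gS r0S disj (undup_uniq _) (mform_quot w) _ (qresP w); last exact: E.
move=> y i ry di; have [h1 h2] := H y ry.
have ys : y \notin s.
  apply/negP => /sS yS; apply: (ry y yS); split; first exact: dS.
  by rewrite subrr nm0 r0S.
have [_ reg _] := mth.
apply: hdiffM; first exact: reg.
by apply: hdiffV; [rewrite subr_eq0|exact: hdiffB h1 (hdiffC _ _)].
Qed.

Lemma th_system S ii rr (c : X -> C) : uniq S -> uniq s -> (forall x, x \in S -> dom (ii x) x) ->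
  (forall x, x \in S -> gdisk (ii x) (z (ii x) x) (2 * rr x)) -> (forall x, x \in S -> 0 < rr x) ->
  (forall x x' y, x \in S -> x' \in S -> disk (ii x) (z (ii x) x) (2 * rr x) y ->
    disk (ii x') (z (ii x') x') (2 * rr x') y -> x = x') ->
  {subset s <= S} -> (forall y, res th y (c y)) ->
  (forall x, x \in S -> bdc (fun t => cr (3 / 2 * rr x) * t *
     th (ii x) (par (ii x) (z (ii x) x + cr (3 / 2 * rr x) * t)))) /\
  \sum_(y <- s) c y = \sum_(x <- S) cint (z (ii x) x) (3 / 2 * rr x) (th (ii x) \o par (ii x)).
Proof.
move=> uS us dS gS r0S disj sS rc; apply: (system_residue uS gS r0S disj us mth _ rc).
move=> y i ry di; have [_ reg _] := mth; apply: reg => //.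
apply/negP => /sS yS; apply: (ry y yS); split; first exact: dS.
by rewrite subrr nm0 r0S.
Qed.

Lemma circle_rest S ii rr x t : (forall x, x \in S -> gdisk (ii x) (z (ii x) x) (2 * rr x)) ->
  (forall x, x \in S -> 0 < rr x) ->
  (forall x x' y, x \in S -> x' \in S -> disk (ii x) (z (ii x) x) (2 * rr x) y ->
    disk (ii x') (z (ii x') x') (2 * rr x') y -> x = x') ->
  x \in S -> nm t = 1 -> rest S ii rr (par (ii x) (z (ii x) x + cr (3 / 2 * rr x) * t)).
Proof.
move=> gS r0S disj xS t1; have r0 := r0S x xS; set y := par _ _.
have r0' : 0 < 3 / 2 * rr x by lra.
have ce := circle_in (z (ii x) x) t1 r0'.
have [|dy zy] := (gS x xS).2 (z (ii x) x + cr (3 / 2 * rr x) * t); first by rewrite ce; lra.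
move=> x' xS' [d1 d2]; have E : x = x'.
  apply: (disj x x' y xS xS'); split => //; first by rewrite zy ce; lra.
  by apply: lt_trans d2 _; have := r0S x' xS'; lra.
by subst x'; move: d2; rewrite zy ce; lra.
Qed.

(** Discs chosen for [w0] serve for all nearby [w], since [nm (f y - w0)] has a positive lower bound
    outside them. On the fixed circles the mean is differentiable in [w] as for a Cauchy kernel. *)
Lemma tot_entire w0 : exists d, cdiff tot w0 d.
Proof.
pose S := qlist w0; have uS : uniq S := undup_uniq _.
have [ii [rr [dS gS r0S disj]]] := system_exists S.
have sS : {subset s <= S} by move=> y ys; rewrite mem_undup mem_cat ys.
have RS y : rest S ii rr y -> [/\ y \notin s, hnear f y & f y != w0].
  move=> ry; apply: qlistP; apply/negP => yS; apply: (ry y yS); split; first exact: dS.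
  by rewrite subrr nm0 r0S.
have cR := @closed_rest S ii rr.
have [M HM] : exists M : R, forall y, rest S ii rr y -> nm (f y - w0)^-1 <= M.
  apply: (hdiff_bounded (f := fun y => (f y - w0)^-1) cR) => y /RS [_ hf fw].
  by apply: hdiffV; [rewrite subr_eq0|exact: hdiffB (hnearW hf) (hdiffC _ _)].
pose dl := (`|M| + 1)^-1; have dl0 : 0 < dl by rewrite invr_gt0 ltr_wpDl.
have lo y : rest S ii rr y -> dl <= nm (f y - w0).
  move=> ry; have [_ _ fw] := RS y ry; have p0 : 0 < nm (f y - w0) by rewrite nm_gt0 subr_eq0.
  rewrite -[leRHS]invrK lef_pV2 ?posrE ?invr_gt0 // ?ltr_wpDl //.
  by rewrite -nmV; have := HM y ry; have := ler_norm M; lra.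
have us : uniq (undup s) := undup_uniq s.
have mth' : mform (undup s) th.
  by have [h1 h2 h3] := mth; split => [i j x|i x|x]; rewrite mem_undup; [exact: h1|exact: h2|exact: h3].
have [c Hc] := choice (mform_res mth').
have bth x : x \in S -> bdc (fun t => cr (3 / 2 * rr x) * t *
     th (ii x) (par (ii x) (z (ii x) x + cr (3 / 2 * rr x) * t))).
  have [|h _] := system_residue uS gS r0S disj us mth' _ Hc; last exact: h.
  by move=> y i /RS [ys _ _] di; have [_ reg _] := mth; exact: reg.
pose G x w := cmean (fun t => cr (3 / 2 * rr x) * t *
     th (ii x) (par (ii x) (z (ii x) x + cr (3 / 2 * rr x) * t)) /
     (f (par (ii x) (z (ii x) x + cr (3 / 2 * rr x) * t)) - w)).
pose D x w := cmean (fun t => 1%:R * (cr (3 / 2 * rr x) * t *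
     th (ii x) (par (ii x) (z (ii x) x + cr (3 / 2 * rr x) * t))) /
     (f (par (ii x) (z (ii x) x + cr (3 / 2 * rr x) * t)) - w) ^+ 2).
exists (\sum_(x <- S) D x w0); apply: (cdiff_near dl0 _ (cdiff_bigsum (G := G) (D := D) _)).
  move=> w wd; rewrite (tot_system uS dS gS r0S disj sS).
    by apply: eq_bigr => x _; rewrite /cint /G; congr cmean; apply/funext => t; rewrite /quot /= mulrA.
  move=> y ry; have [_ hf fw] := RS y ry; split; first exact: hnearW.
  apply: contraTneq (lo y ry) => ->; rewrite -ltNge //.
move=> x xS; apply: (kernel_cdiff 1 dl0 (bth x xS)) => t t1.
by apply: lo; exact: circle_rest gS r0S disj xS t1.
Qed.

(** On the circles [f] is bounded by [M], so [tot w] is of the order of the inverse of [nm w] and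
    vanishes by Liouville. The coefficient of [w^-1] in its expansion at infinity is minus the sum
    of the residues of [th]. *)
Lemma residue_sum_aux (c : X -> C) : uniq s -> (forall y, res th y (c y)) -> \sum_(y <- s) c y = 0.
Proof.
move=> us Hc; pose S := qlist 0; have uS : uniq S := undup_uniq _.
have [ii [rr [dS gS r0S disj]]] := system_exists S.
have sS : {subset s <= S} by move=> y ys; rewrite mem_undup mem_cat ys.
have RS y : rest S ii rr y -> hnear f y.
  move=> ry; suff /qlistP [] : y \notin qlist 0 by [].
  apply/negP => yS; apply: (ry y yS); split; first exact: dS.
  by rewrite subrr nm0 r0S.
have cR := @closed_rest S ii rr.
have [M0 HM0] : exists M : R, forall y, rest S ii rr y -> nm (f y) <= M.
  by apply: (hdiff_bounded cR) => y /RS /hnearW.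
pose M := `|M0|; have HM y : rest S ii rr y -> nm (f y) <= M.
  by move=> /HM0 h; apply: le_trans h (ler_norm _).
have M_ge0 : 0 <= M by rewrite normr_ge0.
have [bth ->] := th_system uS us dS gS r0S disj sS Hc.
have [B HB] : exists B : X -> R, forall x, x \in S -> forall t, nm t = 1 -> nm (cr (3 / 2 * rr x) * t *
     th (ii x) (par (ii x) (z (ii x) x + cr (3 / 2 * rr x) * t))) <= B x.
  have ex x : exists b : R, x \in S -> forall t, nm t = 1 -> nm (cr (3 / 2 * rr x) * t *
     th (ii x) (par (ii x) (z (ii x) x + cr (3 / 2 * rr x) * t))) <= b.
    by have [xS|xS] := boolP (x \in S); [have [b Hb] := bth x xS; exists b|exists 0].
  by have [B HB] := choice ex; exists B.
have B0 x : x \in S -> 0 <= B x.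
  by move=> xS; apply: le_trans (nm_ge0 _) (HB x xS 1 _); rewrite nm1.
pose BB := \sum_(x <- S) B x; have BB0 : 0 <= BB by rewrite /BB big_seq sumr_ge0.
pose F x t := f (par (ii x) (z (ii x) x + cr (3 / 2 * rr x) * t)).
pose Q x t := cr (3 / 2 * rr x) * t * th (ii x) (par (ii x) (z (ii x) x + cr (3 / 2 * rr x) * t)).
have FM x t : x \in S -> nm t = 1 -> nm (F x t) <= M.
  by move=> xS t1; apply: HM; exact: circle_rest gS r0S disj xS t1.
have far (w y : C) : M < nm w -> nm y <= M -> nm w - M <= nm (y - w).
  by move=> _ h; have := nm_triB w y; rewrite nmC; lra.
have totE w : M < nm w -> tot w = \sum_(x <- S) cmean (fun t => Q x t / (F x t - w)).
  move=> wM; rewrite (tot_system uS dS gS r0S disj sS).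
    by apply: eq_bigr => x _; rewrite /cint; congr cmean; apply/funext => t; rewrite /quot /= mulrA.
  move=> y ry; split; first exact: hnearW (RS y ry).
  by apply: contraTneq (HM y ry) => ->; rewrite -ltNge.
have qb w x t : M < nm w -> x \in S -> nm t = 1 -> nm (Q x t / (F x t - w)) <= B x / (nm w - M).
  move=> wM xS t1; rewrite nmM nmV; apply: ler_pM; rewrite ?nm_ge0 ?invr_ge0 ?nm_ge0 //; first exact: HB.
  have h := far w _ wM (FM x t xS t1); have p : 0 < nm w - M by rewrite subr_gt0.
  by rewrite lef_pV2 ?posrE // (lt_le_trans p).
have tb w : M < nm w -> nm (tot w) <= BB / (nm w - M).
  move=> wM; rewrite totE //; apply: le_trans (nm_sum _ _ _) _.
  rewrite /BB mulr_suml big_seq [leRHS]big_seq; apply: ler_sum => x xS.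
  by apply: cmean_bound => t t1; exact: qb.
have tot0 : forall w, tot w = 0.
  apply: (entire_vanish tot_entire) => e e0; exists (M + BB / e + 1) => w wA.
  have q0 : 0 <= BB / e by rewrite divr_ge0 // ltW.
  have wM : M < nm w by lra.
  apply: le_trans (tb w wM) _; rewrite ler_pdivrMr ?subr_gt0 // mulrC -ler_pdivrMr //; lra.
apply/eqP; rewrite -nm_eq0 eq_le nm_ge0 andbT; apply/ler_addgt0Pl => e e0; rewrite addr0.
pose A := M + BB * M / e + 1; have q0 : 0 <= BB * M / e by rewrite divr_ge0 ?mulr_ge0 // ltW.
have A0 : 0 < A by rewrite /A; lra.
pose w := cr A; have wE : nm w = A by rewrite nm_cr gtr0_norm.
have wM : M < nm w by rewrite wE /A; lra.
have p : 0 < nm w - M by rewrite subr_gt0.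
(* On the circles [th] equals [th * f / (f - w)] minus [w * th / (f - w)]. The second part sums to
   [w * tot w], which is 0, and the first is small for large [w]. *)
have -> : \sum_(x <- S) cint (z (ii x) x) (3 / 2 * rr x) (th (ii x) \o par (ii x)) =
    \sum_(x <- S) cmean (fun t => Q x t * F x t / (F x t - w)) - w * tot w.
  rewrite totE // mulr_sumr -sumrB big_seq [RHS]big_seq; apply: eq_bigr => x xS.
  have b1 : bdc (fun t => Q x t / (F x t - w)) by exists (B x / (nm w - M)) => t t1; exact: qb.
  have b2 : bdc (fun t => Q x t * F x t / (F x t - w)).
    exists (B x / (nm w - M) * M) => t t1; rewrite mulrAC nmM.
    by apply: ler_pM; rewrite ?nm_ge0 ?FM ?qb.
  rewrite -cmeanM // -cmeanB //; last exact: bdcMl.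
  apply: cmean_ext => t t1; rewrite -/(Q x t).
  have n0 : F x t - w != 0.
    by rewrite -nm_gt0; apply: lt_le_trans p (far w _ wM (FM x t xS t1)).
  by field.
rewrite tot0 mulr0 subr0; apply: le_trans (nm_sum _ _ _) _.
apply: (@le_trans _ _ (BB / (nm w - M) * M)).
  rewrite /BB !mulr_suml big_seq [leRHS]big_seq; apply: ler_sum => x xS.
  apply: cmean_bound => t t1; rewrite mulrAC nmM.
  by apply: ler_pM; rewrite ?nm_ge0 ?FM ?qb.
rewrite mulrAC ler_pdivrMr // [leRHS]mulrC -ler_pdivrMr // wE /A; lra.
Qed.
End ResidueSum.
End Residues.

(** * Dipole forms, residue theorem and orders on the compact surface *)

Section GlobalForms.
Implicit Types (x y : X) (i j : rs_idx X) (f g h : X -> C) (th : rs_idx X -> X -> C) (k l : int).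

Lemma mform_sub s s' th : {subset s <= s'} -> mform s th -> mform s' th.
Proof.
move=> ss mt; have [h1 h2 h3] := mt.
have ns x : x \notin s' -> x \notin s by apply: contra; exact: ss.
split => [i j x /ns|i x /ns|x _]; [exact: h1|exact: h2|].
by have [i di] := rs_cover x; exists i => //; exact: mform_og mt di.
Qed.

Lemma oe_form s th i j x k : mform s th -> dom i x -> dom j x -> oe (th i) x k -> oe (th j) x k.
Proof.
move=> [law _ _] di dj ok; have hz := hnear_deriv (hnear_coord di) dj.
have := oeM (oe_hnear hz (chart_deriv_neq0 dj di)) ok; rewrite add0r; apply: oe_ext.
apply: filterS2 (near_notin s x) (filterI (near_dom di) (near_dom dj)) => y h [d1 d2] yx.
by rewrite [RHS](law j i) // h.
Qed.

Lemma form_dich s th : mform s th ->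
  (forall x i, dom i x -> \forall y \near x, y <> x -> th i y = 0) \/
  (forall x, exists k, forall i, dom i x -> oe (th i) x k).
Proof.
move=> mt; have [law _ _] := mt.
pose Z x i := \forall y \near x, y <> x -> th i y = 0.
have ZC x i j : dom i x -> dom j x -> Z x i -> Z x j.
  move=> di dj Zi; apply: filterS2 (filterI (near_notin s x) Zi) (filterI (near_dom di) (near_dom dj)).
  by move=> y [h1 h2] [d1 d2] yx; rewrite (law j i) ?h1 // h2 // mulr0.
pose T := [set x | exists2 i, dom i x & Z x i].
have dec x i : dom i x -> Z x i \/ exists k, oe (th i) x k.
  move=> di; have [k ok] := mform_og mt di.
  by have [|[l _ h]] := og_exact ok; [left|right; exists l].
have [[x0 Tx0]|nT] := pselect (T !=set0); last first.
  right=> x; have [i di] := rs_cover x; have [Zi|[k ok]] := dec x i di.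
    by case: nT; exists x; exists i.
  by exists k => j dj; exact: oe_form mt di dj ok.
left=> x i di; suff [j dj Zj] : T x by exact: ZC Zj.
apply: (clopen_full Tx0) => {x i di} x.
  move=> [i di Zi]; apply: filterS2 (near_near Zi) (near_dom di) => y Zy dy.
  exists i => //; have [->//|yx] := pselect (y = x).
  by apply: filterS2 Zy (point_separated yx) => t h1 h2 _; exact: h1.
move=> nT; have [i di] := rs_cover x.
have [Zi|[k ok]] := dec x i di; first by case: nT; exists i.
apply: filterS2 (near_near (oe_neq0 ok)) (near_dom di) => y nz dy [j dj Zj].
have [yx|yx] := pselect (y = x); first by apply: nT; rewrite -yx; exists j.
have [t ty [[h1 h2] h3]] := exists_near (filterI (filterI nz (point_separated yx)) (ZC _ _ _ dj dy Zj)).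
by have := h1 h2; rewrite h3 // eqxx.
Qed.

Hypothesis Xc : compact [set: X].

Lemma form_orders s th : mform s th -> (forall x, exists k, forall i, dom i x -> oe (th i) x k) ->
  exists s' (o : X -> int), [/\ uniq s', mform s' th, forall x i, dom i x -> oe (th i) x (o x) &
    forall x, x \notin s' -> o x = 0].
Proof.
move=> mt ex; have [od Hod] := choice ex.
have [|e ue He] := @finite_exceptions Xc [set y | od y = 0].
  move=> x; have [i di] := rs_cover x.
  have nz := oe_neq0 (Hod x i di).
  apply: filterS2 (filterI nz (near_dom di)) (near_notin s x) => y [h1 dy] h2 yx.
  apply: (oe_unique (Hod y i dy)); apply: oe_hnear; last exact: h1.
  by apply: mform_hnear mt _ dy; exact: h2.
exists (undup (s ++ e)), od; split => //; first exact: undup_uniq.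
  by apply: mform_sub mt => y ys; rewrite mem_undup mem_cat ys.
by move=> x; rewrite mem_undup mem_cat negb_or => /andP[_ /He].
Qed.

Lemma dipole_exists p : exists th, [/\ mform [:: p] th,
  forall x, exists k, forall i, dom i x -> oe (th i) x k & forall i, dom i p -> oe (th i) p (- 2)].
Proof.
have [i0 dp] := rs_cover p; have [th [law reg [c [g [hg E]]]]] := dipole_form Xc dp.
have o2 : oe (th i0) p (-2).
  exists i0 => //; pose u y := z i0 y - z i0 p.
  have hu : hnear u p by apply: filterS (near_dom dp) => y dy; exact: hdiffB (hdiff_coord dy) (hdiffC _ _).
  exists (fun y => - 1 + c * u y + u y * u y * g y); split.
  - apply: hnearD; last by apply: hnearM hg; exact: hnearM.
    by apply: hnearD; [exact: hnearC|apply: hnearM => //; exact: hnearC].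
  - by rewrite /u subrr mulr0 !mul0r !addr0 oppr_eq0 oner_eq0.
  apply: filterS2 E (near_dom dp) => y h dy yp; have n0 := coord_neq dp dy yp.
  by rewrite h // -/(u y) -exprnN /u; field.
have mt : mform [:: p] th.
  split => [i j x|i x|x]; rewrite inE => /eqP xp; [exact: law|exact: reg|].
  by rewrite xp; exists i0 => //; exists (-2); exact: oe_og.
exists th; split => //.
  by have [/(_ p i0 dp) Z|//] := form_dich mt; have := oe_nonzero o2 Z.
by move=> i di; exact: oe_form mt dp di o2.
Qed.

(** The quotient of dipole forms with double poles at distinct points [p] and [q]: at [p] the
    denominator is regular, so the quotient has a pole there and is not constant. *)
Lemma nonconstant_exists : [set: X] !=set0 -> exists f, mero f /\
  forall (w : C) x, exists k, oe (fun y => f y - w) x k.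
Proof.
move=> [p _]; have [q qp _] := exists_near (@filterT _ (nbhs p) _).
have [tp [mp ep op]] := dipole_exists p; have [tq [mq eq oq]] := dipole_exists q.
have [ii Hii] := choice (@rs_cover _ X).
pose f x := tp (ii x) x / tq (ii x) x.
have fE x i : dom i x -> \forall y \near x, y <> x -> f y = tp i y / tq i y.
  move=> di; apply: filterS2 (near_notin [:: p; q] x) (near_dom di) => y h dy yx.
  have := h yx; rewrite !inE negb_or => /andP[yp yq].
  have [lp _ _] := mp; have [lq _ _] := mq.
  rewrite /f (lp (ii y) i) ?inE // (lq (ii y) i) ?inE // invfM mulrACA divff ?mul1r //.
  exact: chart_deriv_neq0.
have ofx x i k l : dom i x -> oe (tp i) x k -> oe (tq i) x l -> oe f x (k - l).
  move=> di h1 h2; apply: oe_ext (oeM h1 (oeV h2)).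
  by apply: filterS (fE x i di) => y h yx; rewrite h.
have mf : mero f.
  move=> x; have [i di] := rs_cover x; have [k ok] := ep x; have [l ol] := eq x.
  by exists (k - l); apply: oe_og; exact: ofx di (ok i di) (ol i di).
exists f; split => // w.
have mw : mero (fun y => f y - w).
  move=> x; have [k ok] := mf x; exists (Num.min k 0).
  apply: ogD; first by apply: og_weak ok; rewrite ge_min lexx.
  by apply: og_weak (og_hnear (hnearC _ _)); rewrite ge_min lexx orbT.
have [Z|//] := mero_dich mw.
have [i di] := rs_cover p; have [l ol] := eq p.
have l0 : 0 <= l.
  apply: og_le (ol i di); apply: og_hnear; apply: mform_hnear mq _ di.
  by rewrite inE; apply/eqP => E; exact: qp.
have o1 := ofx p i _ _ di (op i di) (ol i di).
have : og f p 0.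
  apply: og_ext (og_hnear (hnearC w p)); apply: filterS (Z p) => y h yp.
  by apply/esym/eqP; rewrite -subr_eq0; apply/eqP; exact: h.
by move=> /og_le /(_ o1) h; exfalso; move: h l0; clear; lia.
Qed.

Theorem residue_sum s th (c : X -> C) : mform s th -> uniq s -> (forall y, res th y (c y)) ->
  \sum_(y <- s) c y = 0.
Proof.
case: s => [|p s] mt us Hc; first by rewrite big_nil.
have [|f [mf nf]] := nonconstant_exists; first by exists p.
exact (residue_sum_aux Xc mf nf mt us Hc).
Qed.

Lemma chart_derivXz i f x k : dom i x -> hdiff f x -> f x != 0 ->
  chart_deriv i (fun y => f y ^ k) x = k%:~R * f x ^ k / f x * chart_deriv i f x.
Proof.
move=> di hf f0; case: k => m.
  have := chart_derivX m di hf => E; apply: (eq_trans E).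
  case: m {E} => [|m]; first by rewrite !mul0r.
  by rewrite /= -exprnP exprSr mulrA mulfK.
have hX := hdiffX m.+1 hf; have nX : f x ^+ m.+1 != 0 by rewrite expf_neq0.
have := chart_derivV di nX hX; have := chart_derivX m.+1 di hf.
move=> E1 E2; rewrite E1 in E2; apply: (eq_trans E2).
rewrite NegzE mulrNz -pmulrn -exprnN -[m.+1.-1]/m.
have -> : f x ^+ m.+1 = f x * f x ^+ m by exact: exprS.
have q0 : f x ^+ m != 0 by rewrite expf_neq0.
move: (f x ^+ m) (f x) (m.+1%:R : C) (chart_deriv i f x) q0 f0 => q v M d q0 v0.
by field; rewrite q0 v0.
Qed.

Lemma og_exD f g y : (exists k, og f y k) -> (exists k, og g y k) -> exists k, og (fun x => f x + g x) y k.
Proof.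
move=> [k fk] [k' gk]; exists (Num.min k k'); apply: ogD.
  by apply: og_weak fk; rewrite ge_min lexx.
by apply: og_weak gk; rewrite ge_min lexx orbT.
Qed.

Lemma og_exM f g y : (exists k, og f y k) -> (exists k, og g y k) -> exists k, og (fun x => f x * g x) y k.
Proof. by move=> [k fk] [k' gk]; exists (k + k'); exact: ogM. Qed.

Lemma ppart_og f y i (k : C) : dom i y -> ppart (f \o par i) (z i y) k -> exists k, og f y k.
Proof.
move=> di [p [r [g [r0 hg _ E]]]].
have oV := oe_og (oeV (oe_coord di)).
have og1 : exists k, og (fun x => (z i x - z i y)^-1 * p.[(z i x - z i y)^-1] + g (z i x)) y k.
  apply: og_exD; last by exists 0; apply: og_hnear; exact: hol_hnear di r0 hg.
  apply: og_exM; first by eexists; exact: oV.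
  elim/poly_ind: p {E} => [|p a IH].
    exists 0; apply: og_ext (og_hnear (hnearC 0 y)); apply: filterE => x _.
    by rewrite horner0.
  have h1 : exists k, og (fun x => p.[(z i x - z i y)^-1] * (z i x - z i y)^-1) y k.
    by apply: og_exM => //; eexists; exact: oV.
  have h2 : exists k, og (fun=> a) y k by exists 0; apply: og_hnear; exact: hnearC.
  have [k0 h3] := og_exD h1 h2; exists k0; apply: og_ext h3; apply: filterE => x _.
  by rewrite hornerMXaddC.
have [k0 h3] := og1; exists k0; apply: og_ext h3.
have nn : \forall x \near y, nm (z i x - z i y) < r.
  exact: (hdiff_cont (hdiff_coord di) r0).
apply: filterS2 nn (near_dom di) => x h1 dx xy.
have n0 := coord_neq di dx xy; have := E (z i x); rewrite /= rs_coordK // => -> //.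
by rewrite h1 nm_gt0 n0.
Qed.

Lemma dlog_pow i x y k : dom i y -> z i y - z i x != 0 ->
  chart_deriv i (fun t => (z i t - z i x) ^ k) y = k%:~R * (z i y - z i x) ^ k / (z i y - z i x).
Proof.
move=> dy n0; have hu : hdiff (fun t => z i t - z i x) y by exact: hdiffB (hdiff_coord dy) (hdiffC _ _).
have E := chart_derivXz k dy hu n0; apply: (etrans E).
by have E1 := chart_deriv_coordB (z i x) dy; rewrite (congr1 (fun v => _ * v) E1) mulr1.
Qed.

Lemma dlog_ppart h x i k : dom i x -> oe h x k ->
  ppart ((fun y => chart_deriv i h y / h y) \o par i) (z i x) (k%:~R).
Proof.
move=> di /oe_chart /(_ di) [g [hg g0 E]].
pose u y := z i y - z i x.
have hq : hnear (fun y => k%:~R + u y * (chart_deriv i g y / g y)) x.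
  apply: hnearD (hnearC _ _) _; apply: hnearM.
    by apply: filterS (near_dom di) => y dy; exact: hdiffB (hdiff_coord dy) (hdiffC _ _).
  by apply: hnearM (hnear_deriv hg di) _; exact: hnearV.
have [e e0 he] := hnear_hol hq di.
have := ppart_simple e0 he; rewrite /= rs_coordK // /u subrr mul0r addr0.
have nn : \forall y \near x, y <> x -> chart_deriv i h y / h y =
    (k%:~R + u y * (chart_deriv i g y / g y)) / u y.
  apply: filterS (filterI (filterI (near_near E) (near_near hg))
    (filterI (near_near (near_dom di)) (hdiff_neq0 (hnearW hg) g0))).
  move=> y [[Ey hy] [dy gy]] yx.
  have dy1 := nbhs_singleton dy; have n0 := coord_neq di dy1 yx.
  have Eh : \forall t \near y, u t ^ k * g t = h t.
    by apply: filterS2 Ey (point_separated yx) => t h1 h2; rewrite h1.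
  have hu : hdiff u y by exact: hdiffB (hdiff_coord dy1) (hdiffC _ _).
  have hgy := hnearW hy.
  have dE := chart_deriv_near dy1 Eh (hdiffM (hdiffXz k n0 hu) hgy).
  have dM := chart_derivM dy1 (hdiffXz k n0 hu) hgy.
  have hyE : h y = u y ^ k * g y by rewrite (nbhs_singleton Eh).
  have dX := dlog_pow k dy1 n0.
  have alg (A B D P Q q g1 : C) : u y != 0 -> q != 0 -> g1 != 0 -> B = D -> B = P * g1 + q * Q -> P = k%:~R * q / u y ->
      A = q * g1 -> D / A = (k%:~R + u y * (Q / g1)) / u y.
    by move=> a1 a2 a3 <- -> -> ->; field; rewrite a1 a2 a3.
  exact: (alg _ _ _ _ _ _ _ n0 (expfz_neq0 k n0) gy dE dM dX hyE).
have [e1 e10 He1] := near_punct di nn.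
move=> H; apply: (ppart_ext e10 _ H) => w /He1 [dw zw E'].
by apply: (eq_trans _ (esym E')); rewrite /u zw.
Qed.

Lemma dlog_mform h : (forall x, exists k, oe h x k) -> exists (s : seq X),
  uniq s /\ mform s (fun i y => chart_deriv i h y / h y) /\
  forall x, x \notin s -> hnear h x /\ h x != 0.
Proof.
move=> ex; have [|s us Hs] := @finite_exceptions Xc [set y | hnear h y /\ h y != 0].
  move=> x; have [k ok] := ex x.
  apply: filterS2 (og_hdiff (oe_og ok)) (oe_neq0 ok) => y h1 h2 yx.
  by split; [exact: h1|exact: h2].
exists s; split => //; split => //; split => [i j x /Hs [hh h0] di dj|i x /Hs [hh h0] di|x _].
- by rewrite (chain_rule di dj (hnearW hh)) mulrAC mulrC.
- by apply: hdiffM; [exact: hnearW (hnear_deriv hh di)|apply: hdiffV h0 (hnearW hh)].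
have [i di] := rs_cover x; exists i => //; have [k ok] := ex x.
exact: ppart_og di (dlog_ppart di ok).
Qed.

(** The logarithmic derivative of [h] has the orders of [h] as residues, so they sum to 0. Lower
    bounds with non-negative sum must then be attained at every point. *)
Theorem order_sum h (s : seq X) (l : X -> int) : mero h -> uniq s ->
  (forall x, x \in s -> og h x (l x)) -> (forall x, x \notin s -> og h x 0) ->
  0 <= \sum_(x <- s) l x -> (forall x, \forall y \near x, y <> x -> h y = 0) \/
  [/\ \sum_(x <- s) l x = 0, forall x, x \in s -> oe h x (l x) & forall x, x \notin s -> oe h x 0].
Proof.
move=> mh us hl h0 l0; have [|ex] := mero_dich mh; [by left|right].
have [k Hk] := choice ex; have [t [ut [mt ht]]] := dlog_mform ex.
have kt x : x \notin t -> k x = 0.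
  by move=> /ht [hh hx]; apply: (oe_unique (Hk x)); exact: oe_hnear.
have rk y : res (fun i y => chart_deriv i h y / h y) y ((k y)%:~R : C).
  by move=> i di; exact: dlog_ppart di (Hk y).
have S0 := residue_sum mt ut rk.
have {}S0 : \sum_(y <- t) k y = 0.
  by apply/eqP; rewrite -(intr_eq0 C) raddf_sum /= S0.
pose l' x := if x \in s then l x else 0.
have lk x : l' x <= k x.
  rewrite /l'; case: ifPn => xs; apply: og_le (Hk x); [exact: hl|exact: h0].
have supp (f : X -> int) (a b : seq X) : uniq a -> uniq b -> (forall x, x \notin a -> f x = 0) ->
    (forall x, x \notin b -> f x = 0) -> \sum_(x <- a) f x = \sum_(x <- b) f x.
  move=> ua ub fa fb.
  have E (v : seq X) : \sum_(x <- v) f x = \sum_(x <- [seq x <- v | f x != 0]) f x.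
    rewrite big_filter [RHS]big_mkcond; apply: eq_bigr => x _.
    by case: eqVneq => //= ->.
  rewrite E (E b); apply: perm_big; apply: uniq_perm; rewrite ?filter_uniq // => x.
  rewrite !mem_filter; case: eqVneq => //= cx.
  have -> : x \in a by apply: contraNT cx => /fa ->.
  by symmetry; apply: contraNT cx => /fb ->.
pose U := undup (s ++ t); have uU : uniq U := undup_uniq _.
have inU x : (x \in U) = (x \in s) || (x \in t) by rewrite mem_undup mem_cat.
have Uk : \sum_(x <- U) k x = 0.
  apply: (etrans _ S0); apply: supp => // x; rewrite inU negb_or => /andP[_]; exact: kt.
have ls : \sum_(x <- s) l x = \sum_(x <- s) l' x.
  by rewrite big_seq [RHS]big_seq; apply: eq_bigr => x xs; rewrite /l' xs.
have Ul : \sum_(x <- U) l' x = \sum_(x <- s) l x.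
  rewrite ls; apply: supp => // x; last by rewrite /l' => /negbTE ->.
  by rewrite inU negb_or /l' => /andP[/negbTE ->].
have D : \sum_(x <- U) (k x - l' x) = - \sum_(x <- s) l x by rewrite sumrB Uk Ul sub0r.
have D0 : 0 <= \sum_(x <- U) (k x - l' x) by rewrite sumr_ge0 // => x _; rewrite subr_ge0.
have sl : \sum_(x <- s) l x = 0 by apply/eqP; rewrite eq_le l0 andbT -oppr_ge0 -D.
have kl x : x \in U -> k x = l' x.
  move=> xU; apply/eqP; rewrite -subr_eq0.
  have := D; rewrite sl oppr0 => /eqP; rewrite psumr_eq0; last by move=> y _; rewrite subr_ge0.
  by move=> /allP /(_ x xU).
have kE x : k x = l' x.
  have [/kl//|] := boolP (x \in U); rewrite inU negb_or /l' => /andP[/negbTE -> /kt ->] //.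
by split => // x xs; have := Hk x; rewrite kE /l' ?xs // (negbTE xs).
Qed.

(** Unless the genus is 0 there is a non-zero holomorphic form; in genus 0 a dipole form is taken.
    In both cases only lower bounds on the divisor are recorded, and its degree is never
    computed. *)
Theorem base_form : [set: X] !=set0 -> exists (th : rs_idx X -> X -> C) (s : seq X) (l : X -> int),
  [/\ uniq s, mform s th, forall x i, dom i x -> oe (th i) x (l x), forall x, x \notin s -> l x = 0 &
   (forall x, 0 <= l x) \/ (has_genus X 0 /\ exists p, forall x, (if x == p then - 2 else 0) <= l x)].
Proof.
move=> [p _]; have [g0|g0] := pselect (has_genus X 0).
  have [th [mt ex op]] := dipole_exists p.
  have [s [l [us ms hl l0]]] := form_orders mt ex.
  exists th, s, l; split => //; right; split => //; exists p => x.
  have [i di] := rs_cover x; have := hl x i di; case: eqP => [xp|xp] h.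
    by subst x; rewrite (oe_unique (op i di) h).
  apply: og_le h; apply: og_hnear; apply: mform_hnear mt _ di; rewrite inE; exact/eqP.
have [f [hf [i [x [di fx]]]]] : exists om : rs_idx X -> X -> C, hol_form om /\
    exists i x, dom i x /\ om i x != 0.
  apply: contrapT => nex; apply: g0; exists (fun k _ _ => 0); split; first by case.
  move=> om hf; exists 0; split; last by move=> a _; apply/matrixP => ? [].
  move=> i x di; rewrite big_ord0; apply/eqP; apply: contrapT => /negP fx.
  by apply: nex; exists om; split => //; exists i, x.
have [law hol] := hf.
have mf : mform [::] f.
  split => // [j k y _|j y _ dj]; first exact: law.
  by have /holo_onP := hol j; exact.
have [Z|ex] := form_dich mf.
  have hh : hnear (f i) x by exact: mform_hnear mf _ di.
  by have := oe_nonzero (oe_hnear hh fx) (Z x i di).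
have [s [l [us ms hl l0]]] := form_orders mf ex.
exists f, s, l; split => //; left => y; have [j dj] := rs_cover y.
by apply: og_le (hl y j dj); apply: og_hnear; exact: mform_hnear mf _ dj.
Qed.
End GlobalForms.

(** * Binary forms as polynomials in one variable *)

Section HomogeneousForms.

(** The form of degree [m] in [e] and [t] with dehomogenization [P]. Products of forms become
    products of polynomials, and [t + v *: e] becomes the substitution of ['X + v%:P]. *)
Definition homf (m : nat) (e t : MP) (P : {poly C}) : MP :=
  \sum_(b < m.+1) P`_b *: (e ^+ (m - b) * t ^+ b).

Lemma homD m e t P Q : homf m e t (P + Q) = homf m e t P + homf m e t Q.
Proof. by rewrite /homf -big_split; apply: eq_bigr => b _; rewrite coefD scalerDl. Qed.
Lemma homZ m e t (k : C) P : homf m e t (k *: P) = k *: homf m e t P.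
Proof. by rewrite /homf scaler_sumr; apply: eq_bigr => b _; rewrite coefZ scalerA. Qed.
Lemma hom0 m e t : homf m e t 0 = 0.
Proof. by rewrite /homf big1 // => b _; rewrite coef0 scale0r. Qed.
Lemma hom_sum m e t (I : Type) (s : seq I) (p : pred I) (F : I -> {poly C}) :
  homf m e t (\sum_(k <- s | p k) F k) = \sum_(k <- s | p k) homf m e t (F k).
Proof. by elim/big_rec2: _ => [|k x y _ <-]; rewrite ?hom0 ?homD. Qed.

Lemma homX m e t b : (b <= m)%N -> homf m e t 'X^b = e ^+ (m - b) * t ^+ b.
Proof.
move=> bm; rewrite /homf (bigD1 (Ordinal (bm : (b < m.+1)%N))) //= coefXn eqxx scale1r.
rewrite big1 ?addr0 // => k /eqP kb; rewrite coefXn; case: eqP => [E|]; last by rewrite scale0r.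
by case: kb; apply/val_inj.
Qed.

Lemma homf_deg0 e t P : homf 0 e t P = P`_0 *: 1.
Proof. by rewrite /homf big_ord1 /= !expr0 mulr1. Qed.
Lemma homf_deg1 e t P : homf 1 e t P = P`_0 *: e + P`_1 *: t.
Proof.
rewrite /homf !big_ord_recl big_ord0 /= addr0 subn0 subnn !expr0 !expr1.
by rewrite mulr1 mul1r.
Qed.

Lemma size_expand m (P : {poly C}) : (size P <= m.+1)%N -> P = \sum_(b < m.+1) P`_b *: 'X^b.
Proof.
move=> sP; apply/polyP => k; rewrite coef_sum; have [km|km] := ltnP k m.+1.
  rewrite (bigD1 (Ordinal km)) //= coefZ coefXn eqxx mulr1 big1 ?addr0 // => j /eqP jk.
  by rewrite coefZ coefXn; case: eqP => [E|]; rewrite ?mulr0 //; case: jk; apply/val_inj.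
rewrite nth_default ?(leq_trans sP) // big1 // => j _.
by rewrite coefZ coefXn gtn_eqF ?mulr0 // (leq_trans (ltn_ord j)).
Qed.

Lemma hom_mul m1 m2 e t (P Q : {poly C}) : (size P <= m1.+1)%N -> (size Q <= m2.+1)%N ->
  homf m1 e t P * homf m2 e t Q = homf (m1 + m2) e t (P * Q).
Proof.
move=> sP sQ.
have E : P * Q = \sum_(i < m1.+1) \sum_(j < m2.+1) (P`_i * Q`_j) *: 'X^(i + j).
  rewrite {1}(size_expand sP) {1}(size_expand sQ) mulr_suml; apply: eq_bigr => i _.
  rewrite mulr_sumr; apply: eq_bigr => j _.
  by rewrite -scalerAl -scalerAr scalerA exprD.
rewrite E hom_sum {1 2}/homf mulr_suml; apply: eq_bigr => i _.
rewrite mulr_sumr hom_sum; apply: eq_bigr => j _.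
have i1 : (i <= m1)%N by rewrite -ltnS.
have j1 : (j <= m2)%N by rewrite -ltnS.
rewrite homZ homX ?leq_add // -scalerAl -scalerAr scalerA; congr (_ *: _).
have -> : (m1 + m2 - (i + j) = (m1 - i) + (m2 - j))%N by lia.
by rewrite !exprD mulrACA.
Qed.

Lemma size_XaddCn (v : C) b : size (('X + v%:P) ^+ b) = b.+1.
Proof. by rewrite -[v]opprK polyCN size_exp_XsubC. Qed.

Lemma hom_shiftX m e t (v : C) b : (b <= m)%N ->
  homf m e (t + v *: e) 'X^b = homf m e t (('X + v%:P) ^+ b).
Proof.
have one : t + v *: e = homf 1 e t ('X + v%:P).
  rewrite /homf !big_ord_recl big_ord0 /= /bump /= addr0 !coefD !coefX !coefC /= add0r addr0.
  by rewrite scale1r !expr0 !expr1 mul1r mulr1 addrC.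
have pw k : (t + v *: e) ^+ k = homf k e t (('X + v%:P) ^+ k).
  elim: k => [|k IH]; first by rewrite !expr0 /homf big_ord1 coef1 scale1r !expr0 mulr1.
  rewrite exprS IH one hom_mul ?add1n -?exprS //; first by rewrite size_XaddC.
  by rewrite size_XaddCn.
move=> bm; have ee : e ^+ (m - b) = homf (m - b) e t 1.
  by have := @homX (m - b) e t 0 (leq0n _); rewrite !expr0 subn0 mulr1 => ->.
by rewrite homX // pw ee hom_mul ?size_poly1 ?size_XaddCn // mul1r subnK.
Qed.

Lemma hom_shift m e t (v : C) (P : {poly C}) : (size P <= m.+1)%N ->
  homf m e (t + v *: e) P = homf m e t (P \Po ('X + v%:P)).
Proof.
move=> sP; rewrite [in RHS](size_expand sP) {1}(size_expand sP) raddf_sum !hom_sum /=.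
apply: eq_bigr => b _; rewrite linearZ /= !homZ comp_Xn_poly hom_shiftX // -ltnS //.
Qed.

Lemma hom_scale m (e t : MP) (u : C) b : (b <= m)%N -> u != 0 ->
  homf m (u *: e) (u^-1 *: t) 'X^b = (u ^+ (m - b) * u ^- b) *: homf m e t 'X^b.
Proof.
by move=> bm u0; rewrite !homX // !exprZn -scalerAl -scalerAr scalerA exprVn.
Qed.

Lemma linear_formD (u v : 'cV[C]_2) : linear_form (u + v) = linear_form u + linear_form v.
Proof. by rewrite /linear_form -big_split; apply: eq_bigr => i _; rewrite mxE scalerDl. Qed.
Lemma linear_formZ (k : C) (v : 'cV[C]_2) : linear_form (k *: v) = k *: linear_form v.
Proof. by rewrite /linear_form scaler_sumr; apply: eq_bigr => i _; rewrite mxE scalerA. Qed.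

Lemma meval_linear (v : 'cV[C]_2) (w : 'I_2 -> C) :
  meval w (linear_form v) = \sum_(i < 2) v i 0 * w i.
Proof.
rewrite /linear_form raddf_sum /=; apply: eq_bigr => i _.
by rewrite mevalZ mevalXU.
Qed.

(** For linearly independent [u] and [v] there is a point where the first form is 1 and the second
    any prescribed [s]; the difference of the truncated polynomials thus vanishes at every [s]. *)
Lemma hom_inj m (u v : 'cV[C]_2) P Q : u 0 0 * v 1 0 - v 0 0 * u 1 0 != 0 ->
  homf m (linear_form u) (linear_form v) P = homf m (linear_form u) (linear_form v) Q ->
  forall b, (b <= m)%N -> P`_b = Q`_b.
Proof.
move=> dn E; pose p := \poly_(b < m.+1) (P`_b - Q`_b).
have Z (s : C) : p.[s] = 0.
  pose d := u 0 0 * v 1 0 - v 0 0 * u 1 0.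
  pose w (i : 'I_2) : C := if i == 0 then (v 1 0 - s * u 1 0) / d else (s * u 0 0 - v 0 0) / d.
  have ue : meval w (linear_form u) = 1.
    rewrite meval_linear !big_ord_recl big_ord0 /w /= addr0.
    rewrite (_ : lift ord0 ord0 = 1); last exact/val_inj.
    by rewrite /d; field.
  have ve : meval w (linear_form v) = s.
    rewrite meval_linear !big_ord_recl big_ord0 /w /= addr0.
    rewrite (_ : lift ord0 ord0 = 1); last exact/val_inj.
    by rewrite /d; field.
  have ev (A : {poly C}) : meval w (homf m (linear_form u) (linear_form v) A) = \sum_(b < m.+1) A`_b * s ^+ b.
    rewrite /homf raddf_sum /=; apply: eq_bigr => b _.
    by rewrite mevalZ rmorphM /= !rmorphXn /= ue ve expr1n mul1r.
  rewrite horner_poly; under eq_bigr do rewrite mulrBl.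
  by rewrite sumrB -!ev E subrr.
have p0 : p = 0.
  apply/eqP; apply: contraT => pn.
  pose rs := [seq (k%:R : C) | k <- iota 0 (size p)].
  have ur : uniq rs.
    by rewrite map_inj_uniq ?iota_uniq // => x y /eqP; rewrite eqr_nat => /eqP.
  have ar : all (root p) rs by apply/allP => x _; rewrite /root Z.
  by have := max_poly_roots pn ar ur; rewrite size_map size_iota ltnn.
move=> b bm; apply/eqP; rewrite -subr_eq0.
have : p`_b = 0 by rewrite p0 coef0.
by rewrite coef_poly ltnS bm => ->.
Qed.
End HomogeneousForms.

Arguments vb_dom {R X r} v _ _.
Arguments vb_triv {R X r} v _ _.

(** * Sections and local frames of the Gunning bundle *)

Section Bundles.
Implicit Types (x y : X) (W U : set X).

Definition hsec r (F : vbundle X r) (s : X -> 'cV[C]_r) x : Prop :=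
  exists2 a, vb_dom F a x & forall k, hdiff (fun y => (vb_triv F a y *m s y) k 0) x.

Lemma vb_near r (F : vbundle X r) a x : vb_dom F a x -> \forall y \near x, vb_dom F a y.
Proof. by move=> da; apply: open_nbhs_nbhs; split => //; exact: vb_open_dom. Qed.

Lemma hdiff_mulmx m n p (A : X -> 'M[C]_(m, n)) (B : X -> 'M[C]_(n, p)) x :
  (forall i j, hdiff (fun y => A y i j) x) -> (forall i j, hdiff (fun y => B y i j) x) ->
  forall i j, hdiff (fun y => (A y *m B y) i j) x.
Proof.
move=> hA hB i j; rewrite (_ : (fun y => _) = fun y => \sum_k A y i k * B y k j).
  by apply: hdiff_sum => k; apply: hdiffM.
by apply/funext => y; rewrite mxE.
Qed.

Lemma hsec_triv r (F : vbundle X r) s x a : hsec F s x -> vb_dom F a x ->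
  forall k, hdiff (fun y => (vb_triv F a y *m s y) k 0) x.
Proof.
move=> [b db hs] da k.
have ht : forall i j, hdiff (fun y => (vb_triv F a y *m invmx (vb_triv F b y)) i j) x.
  by move=> i j; have /holo_onP := @vb_trans_hol _ _ _ F b a i j; apply.
have hs' : forall (i : 'I_r) (j : 'I_1), hdiff (fun y => (vb_triv F b y *m s y) i j) x.
  by move=> i j; rewrite (ord1 j); exact: hs.
apply: hdiff_near (hdiff_mulmx ht hs' k 0); apply: filterS (vb_near db) => y dy.
by rewrite mulmxA mulmxKV // vb_unit.
Qed.

Lemma hol_sectionP r (F : vbundle X r) W s : hol_section F W s <-> forall x, W x -> hsec F s x.
Proof.
split=> [H x Wx|H a k].
  have [a da] := vb_cover F x; exists a => // k.
  by have /holo_onP := H a k; apply.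
by apply/holo_onP => x [Wx da]; exact: hsec_triv (H x Wx) da k.
Qed.

Lemma hsec_hom r q (F : vbundle X r) (G : vbundle X q) W A s x : hol_hom F G W A -> W x ->
  hsec F s x -> hsec G (fun y => A y *m s y) x.
Proof.
move=> hA Wx [a da hs]; have [b db] := vb_cover G x; exists b => // k.
have hA' : forall i j, hdiff (fun y => (vb_triv G b y *m A y *m invmx (vb_triv F a y)) i j) x.
  by move=> i j; have /holo_onP := hA a b i j; apply.
have hs' : forall (i : 'I_r) (j : 'I_1), hdiff (fun y => (vb_triv F a y *m s y) i j) x.
  by move=> i j; rewrite (ord1 j); exact: hs.
apply: hdiff_near (hdiff_mulmx hA' hs' k 0); apply: filterS (vb_near da) => y dy.
by rewrite -!mulmxA mulKmx // vb_unit.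
Qed.

Lemma hsec_near r (F : vbundle X r) s s' x : (\forall y \near x, s y = s' y) -> hsec F s x -> hsec F s' x.
Proof.
move=> ss [a da hs]; exists a => // k; apply: hdiff_near (hs k).
by apply: filterS ss => y ->.
Qed.

Lemma hsecZ r (F : vbundle X r) (f : X -> C) s x : hdiff f x -> hsec F s x -> hsec F (fun y => f y *: s y) x.
Proof.
move=> hf [a da hs]; exists a => // k; apply: hdiff_near (hdiffM hf (hs k)).
by apply: filterE => y; rewrite -scalemxAr; symmetry; exact: mxE.
Qed.

Lemma hsec0 r (F : vbundle X r) x : hsec F (fun=> 0) x.
Proof.
have [a da] := vb_cover F x; exists a => // k.
by apply: hdiff_near (hdiffC 0 x); apply: filterE => y; rewrite mulmx0 mxE.
Qed.

Definition det2 (u v : 'cV[C]_2) : C := u 0 0 * v 1 0 - v 0 0 * u 1 0.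

Lemma det2_neq0 (u v : 'cV[C]_2) :
  (forall k l : C, k *: u + l *: v = 0 -> k = 0 /\ l = 0) -> det2 u v != 0.
Proof.
move=> H; apply/eqP => d0.
have ex (w : 'cV[C]_2) : w 0 0 = 0 -> w 1 0 = 0 -> w = 0.
  move=> w0 w1; apply/colP => k; rewrite mxE; case: k => -[|[|//]] lt.
    by rewrite -[RHS]w0; congr (w _ _); exact/val_inj.
  by rewrite -[RHS]w1; congr (w _ _); exact/val_inj.
have [v1 _] : v 1 0 = 0 /\ - u 1 0 = 0.
  apply: H; apply: ex; rewrite !mxE; last by ring.
  by rewrite -[RHS]d0 /det2; ring.
have [v0 _] : v 0 0 = 0 /\ - u 0 0 = 0.
  apply: H; apply: ex; rewrite !mxE; first by ring.
  by rewrite -[RHS]oppr0 -[in RHS]d0 /det2; ring.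
have v00 : v = 0 by exact: ex.
have [|_ /eqP] := H 0 1; last by rewrite oner_eq0.
by rewrite v00 scale0r scaler0 addr0.
Qed.

Lemma cramer2 (u v s : 'cV[C]_2) k l : det2 u v != 0 -> s = k *: u + l *: v ->
  k = det2 s v / det2 u v /\ l = det2 u s / det2 u v.
Proof.
move=> d0 ->; split; apply: (mulIf d0); rewrite divfK // /det2 !mxE; ring.
Qed.

Lemma cramer2_ex (u v s : 'cV[C]_2) : det2 u v != 0 ->
  s = (det2 s v / det2 u v) *: u + (det2 u s / det2 u v) *: v.
Proof.
move=> d0; apply/colP => k; rewrite !mxE; apply: (mulfI d0).
case: k => -[|[|//]] lt.
  rewrite (_ : Ordinal lt = 0); last exact/val_inj.
  by rewrite /det2 in d0 *; field.
rewrite (_ : Ordinal lt = 1); last exact/val_inj.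
by rewrite /det2 in d0 *; field.
Qed.

Variables (G : gunning_bundle X).
Local Notation L := (gL G).
Local Notation E := (gE G).

(** The data for a frame of [E] over [W]: a coordinate, a trivialization of [L] and a holomorphic
    splitting of the projection to the dual of [L]. *)
Record frame W i (a : vb_idx L) (tau : X -> 'M[C]_(2, 1)) : Prop := Frame { fr_open : open W;
  fr_dom : W `<=` dom i; fr_triv : W `<=` vb_dom L a; fr_hol : hol_hom (dual_vb L) E W tau;
  fr_split : forall x, W x -> gp G x *m tau x = 1%:M
}.

(** The section of [L] that is constantly 1 in the trivialization [a], written in the fibre [C].
    Then [ev] is its image in [E], and [tv] the image under [tau] of the dual section. *)
Definition lam (a : vb_idx L) x : C := invmx (vb_triv L a x) 0 0.
Definition ev (a : vb_idx L) x : 'cV[C]_2 := giota G x *m const_mx (lam a x).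
Definition tv (a : vb_idx L) (tau : X -> 'M[C]_(2, 1)) x : 'cV[C]_2 := tau x *m const_mx (lam a x)^-1.

Lemma frame_sub W W' i a tau : open W' -> W' `<=` W -> frame W i a tau -> frame W' i a tau.
Proof.
move=> oW' WW [oW dW tW hW sW]; split => //; try by move=> x /WW; auto.
by move=> b d k l; apply/holo_onP => x [/WW Wx db]; have /holo_onP := hW b d k l; exact.
Qed.

Lemma triv_lam a x : vb_dom L a x -> vb_triv L a x 0 0 * lam a x = 1.
Proof.
move=> da; have := mulmxV (vb_unit da) => /matrixP /(_ 0 0).
by rewrite mxE big_ord1 !mxE.
Qed.

Lemma lam_neq0 a x : vb_dom L a x -> lam a x != 0.
Proof.
by move=> da; apply: contraTneq (oner_neq0 C) => E0; rewrite -(triv_lam da) E0 mulr0 eqxx.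
Qed.

Lemma hsec_lam a x : vb_dom L a x -> hsec L (fun y => const_mx (lam a y)) x.
Proof.
move=> da; exists a => // k; apply: hdiff_near (hdiffC 1 x).
apply: filterS (vb_near da) => y dy; rewrite mxE big_ord1 (ord1 k) [X in _ * X]mxE.
by rewrite triv_lam.
Qed.

Lemma hsec_dual a x : vb_dom L a x -> hsec (dual_vb L) (fun y => const_mx (lam a y)^-1) x.
Proof.
move=> da; exists a => // k; apply: hdiff_near (hdiffC 1 x).
apply: filterS (vb_near da) => y dy; rewrite mxE big_ord1 (ord1 k) [X in _ * X]mxE [X in X * _]mxE.
by rewrite divff // lam_neq0.
Qed.

Lemma dual_coord a x (q : X -> 'cV[C]_1) : vb_dom L a x -> hsec (dual_vb L) q x ->
  hdiff (fun y => lam a y * q y 0 0) x.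
Proof.
move=> da hq; have /(_ 0) := hsec_triv hq (da : vb_dom (dual_vb L) a x).
by apply: hdiff_near; apply: filterE => y; rewrite mxE big_ord1 [X in X * _]mxE.
Qed.

Section Frame.
Variables (W : set X) (i : rs_idx X) (a : vb_idx L) (tau : X -> 'M[C]_(2, 1)).
Hypothesis fr : frame W i a tau.

Lemma frame_near x : W x -> \forall y \near x, W y.
Proof. by move=> Wx; apply: open_nbhs_nbhs; split => //; have [] := fr. Qed.

Lemma hsec_ev x : W x -> hsec E (ev a) x.
Proof.
move=> Wx; have [hi _ _] := g_exact G; apply: (hsec_hom hi I).
by apply: hsec_lam; have [_ _ t _ _] := fr; exact: t.
Qed.

Lemma hsec_tv x : W x -> hsec E (tv a tau) x.
Proof.
move=> Wx; have [_ _ t h _] := fr; apply: (hsec_hom h Wx).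
by apply: hsec_dual; exact: t.
Qed.

Lemma p_ev x : gp G x *m ev a x = 0.
Proof. by have [_ _ /(_ x) [_ _ h]] := g_exact G; rewrite /ev mulmxA h mul0mx. Qed.

Lemma p_tv x : W x -> gp G x *m tv a tau x = const_mx (lam a x)^-1.
Proof. by move=> Wx; have [_ _ _ _ h] := fr; rewrite /tv mulmxA h // mul1mx. Qed.

Lemma ev_tv_free x : W x -> forall k l : C, k *: ev a x + l *: tv a tau x = 0 -> k = 0 /\ l = 0.
Proof.
move=> Wx k l H; have [_ _ t _ _] := fr; have l0 := lam_neq0 (t x Wx).
have l00 : l = 0.
  have := congr1 (fun v => (gp G x *m v) 0 0) H.
  rewrite mulmxDr -!scalemxAr p_ev p_tv // scaler0 add0r mulmx0 !mxE => /eqP.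
  by rewrite mulf_eq0 invr_eq0 (negbTE l0) orbF => /eqP.
split => //; move: H; rewrite l00 scale0r addr0 => /eqP; rewrite scaler_eq0 => /orP[/eqP //|].
have [_ _ /(_ x) [r1 _ _]] := g_exact G.
move=> /eqP e0; have i0 : giota G x = 0.
  apply/matrixP => m1 m2; rewrite (ord1 m2) [RHS]mxE; apply: (mulIf l0); rewrite mul0r.
  have := congr1 (fun v : 'cV[C]_2 => v m1 0) e0.
  by rewrite /ev !mxE big_ord1 mxE.
by move: r1; rewrite i0 mxrank0.
Qed.

Lemma det_ev_tv x : W x -> det2 (ev a x) (tv a tau x) != 0.
Proof. by move=> /ev_tv_free; exact: det2_neq0. Qed.

Definition ca (s : X -> 'cV[C]_2) x := det2 (s x) (tv a tau x) / det2 (ev a x) (tv a tau x).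
Definition cb (s : X -> 'cV[C]_2) x := det2 (ev a x) (s x) / det2 (ev a x) (tv a tau x).

Lemma coordE s x : W x -> s x = ca s x *: ev a x + cb s x *: tv a tau x.
Proof. by move=> Wx; exact: cramer2_ex (det_ev_tv Wx). Qed.

Lemma hdiff_coords s x : W x -> hsec E s x -> hdiff (ca s) x /\ hdiff (cb s) x.
Proof.
move=> Wx hs; have [d dd] := vb_cover E x; pose M y := vb_triv E d y.
have hM (v : X -> 'cV[C]_2) : hsec E v x -> forall k, hdiff (fun y => (M y *m v y) k 0) x.
  by move=> hv; exact: hsec_triv hv dd.
have hd u v : hsec E u x -> hsec E v x -> hdiff (fun y => det2 (M y *m u y) (M y *m v y)) x.
  by move=> hu hv; apply: hdiffB; apply: hdiffM; exact: hM.
have nd y : W y -> vb_dom E d y -> det2 (M y *m ev a y) (M y *m tv a tau y) != 0.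
  move=> Wy dy; apply: det2_neq0 => k l.
  have -> : k *: (M y *m ev a y) + l *: (M y *m tv a tau y) = M y *m (k *: ev a y + l *: tv a tau y).
    by rewrite mulmxDr -!scalemxAr.
  move=> H; have H2 : k *: ev a y + l *: tv a tau y = 0 by rewrite -[LHS](mulKmx (vb_unit dy)) H mulmx0.
  exact: (ev_tv_free Wy H2).
have he := hsec_ev Wx; have ht := hsec_tv Wx.
have nb : \forall y \near x, [/\ W y & vb_dom E d y].
  by apply: filterS2 (frame_near Wx) (vb_near dd).
have eq y : W y -> vb_dom E d y ->
    ca s y = det2 (M y *m s y) (M y *m tv a tau y) / det2 (M y *m ev a y) (M y *m tv a tau y) /\
    cb s y = det2 (M y *m ev a y) (M y *m s y) / det2 (M y *m ev a y) (M y *m tv a tau y).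
  move=> Wy dy; apply: (cramer2 (nd y Wy dy)).
  by rewrite {1}(coordE s Wy) mulmxDr -!scalemxAr.
have hV : hdiff (fun y => (det2 (M y *m ev a y) (M y *m tv a tau y))^-1) x.
  by apply: hdiffV; [exact: nd|exact: hd].
split.
  apply: hdiff_near (hdiffM (hd _ _ hs ht) hV).
  by apply: filterS nb => y [Wy dy]; have [-> _] := eq y Wy dy.
apply: hdiff_near (hdiffM (hd _ _ he hs) hV).
by apply: filterS nb => y [Wy dy]; have [_ ->] := eq y Wy dy.
Qed.

End Frame.
End Bundles.

(** * Finite sets of points and neighbourhoods *)

Section PointSets.
Implicit Types (x y : X) (f : X -> C) (k l : int).

Lemma near_fin (I : finType) (A : I -> set X) y : (forall k : I, nbhs y (A k)) ->
  \forall x \near y, forall k : I, A k x.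
Proof.
move=> H; have : \forall x \near y, forall k : I, k \in enum I -> A k x.
  elim: (enum I) => [|k s IH]; first by apply: filterE.
  by apply: filterS2 (H k) IH => x h1 h2 j; rewrite inE => /orP[/eqP ->|/h2].
by apply: filterS => x h k; apply: h; rewrite mem_enum.
Qed.

Lemma oe_exprz f x k l : oe f x k -> oe (fun y => f y ^ l) x (k * l).
Proof.
move=> [i di [g [hg g0 E]]]; exists i => //; exists (fun y => g y ^ l); split.
- exact: hnearXz.
- by rewrite expfz_neq0.
by apply: filterS E => y e yx; rewrite e // expfzMl exprz_exp.
Qed.

Lemma ceil_add (u v : R) : Num.ceil (u + v) <= Num.ceil u + Num.ceil v.
Proof. by rewrite ceil_le_int intrD lerD // ceil_ge. Qed.

Variables (n : nat) (pts : 'I_n -> X).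
Local Notation S := (range pts).

Lemma S_codom x : S x <-> x \in codom pts.
Proof.
by split => [[k _ <-]|/codomP [k ->]]; [exact: codom_f|exists k].
Qed.

Lemma near_S y : \forall x \near y, x <> y -> ~ S x.
Proof.
apply: filterS (near_notin (codom pts) y) => x h /h; by apply: contraNnot => /S_codom.
Qed.

Lemma near_nS y : ~ S y -> \forall x \near y, ~ S x.
Proof. by move=> yS; apply: filterS (near_S y) => x h; have [->|/h] := pselect (x = y). Qed.

Lemma open_nS : open (~` S).
Proof.
rewrite openE => y yS; exact: near_nS.
Qed.

End PointSets.

(** * Residues from germs; the frame of [K_X] induced by one of [gL] *)

Section LocalTools.
Implicit Types (x y : X) (W U : set X) (f g : X -> C).

Lemma sum_support_int (l : X -> int) (s t : seq X) : uniq s -> uniq t ->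
  (forall x, x \notin s -> l x = 0) -> (forall x, x \notin t -> l x = 0) ->
  \sum_(x <- s) l x = \sum_(x <- t) l x.
Proof.
move=> us ut hs ht; apply: (@intr_inj C); rewrite !rmorph_sum /=.
by apply: sum_support => // x; [move=> /hs ->|move=> /ht ->].
Qed.

Lemma hdiff_eq f g x : hdiff f x -> hdiff g x -> (\forall y \near x, y <> x -> f y = g y) -> f x = g x.
Proof.
move=> hf hg E; apply/eqP; rewrite -subr_eq0; apply/eqP; apply: contrapT => /eqP ne.
have := hdiff_neq0 (hdiffB hf hg) ne => nn.
have [y yx [h1 h2]] := exists_near (filterI E nn).
by move: h2; rewrite h1 // subrr eqxx.
Qed.

Lemma oe0_neq0 f x : hdiff f x -> oe f x 0 -> f x != 0.
Proof.
move=> hf [i di [g [hg g0 E]]]; rewrite (hdiff_eq hf (hnearW hg)) //.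
by apply: filterS E => y h /h ->; rewrite expr0z mul1r.
Qed.

Lemma ppart_near f g y i c : dom i y -> (\forall x \near y, x <> y -> f x = g x) ->
  ppart (f \o par i) (z i y) c -> ppart (g \o par i) (z i y) c.
Proof.
move=> di E; have [e e0 H] := near_punct di E.
by apply: ppart_ext e0 _ => w /H [].
Qed.

Lemma ppart_hnear f y i : dom i y -> hnear f y -> ppart (f \o par i) (z i y) 0.
Proof. by move=> di hf; have [e e0 he] := hnear_hol hf di; exact: ppart_hol e0 he. Qed.

Lemma has_residue_ppart i y f c : dom i y -> has_residue i y f c -> ppart (f \o par i) (z i y) c.
Proof.
move=> di [N [a [W [g [oW Wy hg a0 E]]]]].
have [e e0 he] := hnear_hol (holo_hnear oW Wy hg) di.
have nW : \forall x \near y, x <> y -> W x /\ dom i x.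
  have nW : \forall x \near y, W x by apply: open_nbhs_nbhs.
  by apply: filterS2 nW (near_dom di).
have [e1 e10 H] := near_punct di nW.
exists (\poly_(k < N.+1) a k), (Num.min e e1), (g \o par i); split.
- by rewrite lt_min e0.
- by apply: hol_sub he; rewrite ?ge_min ?lexx // lt_min e0.
- by rewrite coef_poly.
move=> w /andP[w0 we]; have [|dw zw [Ww dw']] := H w.
  by rewrite w0 (lt_le_trans we) // ge_min lexx orbT.
rewrite /= E //; last first.
  by move=> Ey; move: w0; rewrite -zw Ey subrr nm0 ltxx.
rewrite zw horner_poly mulr_sumr; congr (_ + _); apply: eq_bigr => k _.
by rewrite exprVn exprS invfM mulrCA mulrA.
Qed.

Variable (G : gunning_bundle X).
Local Notation kappa := (@gkappa _ _ G).

Definition kap (a : vb_idx (gL G)) i x := kappa i x * lam a x ^+ 2.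

Lemma kap_hnear a i x : vb_dom (gL G) a x -> dom i x -> hnear (kap a i) x.
Proof.
move=> da di; have [_ _ hk] := g_square_root G.
have hl : hol_section (gL G) (vb_dom (gL G) a) (fun y => const_mx (lam a y)).
  by apply/hol_sectionP => y; exact: hsec_lam.
have := hk i _ _ _ (@vb_open_dom _ _ _ (gL G) a) hl hl => H.
have oW : open (vb_dom (gL G) a `&` dom i) by apply: openI; [exact: vb_open_dom|exact: rs_open_dom].
apply: hnear_near (holo_hnear oW (conj da di) H); apply: filterE => y.
by rewrite !mxE /kap expr2 mulrA.
Qed.

Lemma kap_neq0 a i x : vb_dom (gL G) a x -> dom i x -> kap a i x != 0.
Proof.
move=> da di; have [_ k0 _] := g_square_root G.
by rewrite mulf_neq0 ?k0 // expf_neq0 // lam_neq0.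
Qed.

Lemma kap_change a a' i i' x (u : C) : dom i x -> dom i' x -> lam a' x = u * lam a x ->
  kap a' i' x = chart_deriv i' (z i) x * u ^+ 2 * kap a i x.
Proof.
move=> di di' E; have [lk _ _] := g_square_root G.
rewrite /kap E (lk i' i x di' di) exprMn.
by move: (chart_deriv _ _ _) (kappa i x) (lam a x) => p q r; ring.
Qed.
End LocalTools.

(** * Parabolic weights and orders at the marked points *)

Section ParabolicGunning.
Implicit Types (x y : X) (W U : set X) (f g : X -> C).
Variables (n : nat) (pts : 'I_n -> X) (c : 'I_n -> R) (G : gunning_bundle X).
Hypothesis pts_inj : injective pts.
Hypothesis c_gt1 : forall k : 'I_n, 1 < c k.
Local Notation S := (range pts).

(** The weight of [L] at a marked point. Elsewhere any value in the same interval does, here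
    [2 / 5], so that [gam_bounds] holds everywhere. *)
Definition gam y : R := if pselect (exists k : 'I_n, pts k = y) is left H then weight_E c (projT1 (cid H)) else 2 / 5.

Lemma gam_pts (k : 'I_n) : gam (pts k) = weight_E c k.
Proof.
rewrite /gam; case: pselect => [H|]; last by case; exists k.
by case: cid => j /= /pts_inj ->.
Qed.

Lemma weight_bounds (k : 'I_n) : 1 / 3 < weight_E c k < 1 / 2.
Proof.
have c1 := c_gt1 k; have p : 0 < 2 * c k + 1 by lra.
by rewrite /weight_E ltr_pdivlMr // ltr_pdivrMr //; lra.
Qed.

Lemma weight_lineE (k : 'I_n) : weight_line c k = 1 - weight_E c k.
Proof.
have c1 := c_gt1 k; have p : 2 * c k + 1 != 0 by rewrite gt_eqF //; lra.
by rewrite /weight_line /weight_E; field.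
Qed.

Lemma gam_bounds y : 1 / 3 < gam y < 1 / 2.
Proof. by rewrite /gam; case: pselect => H; [exact: weight_bounds|lra]. Qed.

(** At a marked point the order is bounded below by [k]. Elsewhere regularity is asked whatever [k]
    is, as twisting by multiples of [S] changes nothing there. *)
Definition ogs f y k : Prop := if `[< S y >] then og f y k else hnear f y.

Lemma ogs_ext f g y k : (\forall x \near y, ~ S x -> f x = g x) -> ogs f y k -> ogs g y k.
Proof.
rewrite /ogs => fg; case: asboolP => yS.
  by apply: og_ext; apply: filterS2 fg (near_S pts y) => x h1 h2 /h2.
by apply: hnear_near; apply: filterS2 fg (near_nS yS) => x.
Qed.
Lemma ogs_out f y k l : ~ S y -> ogs f y k -> ogs f y l.
Proof. by rewrite /ogs => yS; rewrite asboolF. Qed.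
Lemma ogs_in f y k : S y -> ogs f y k -> og f y k.
Proof. by rewrite /ogs => yS; rewrite asboolT. Qed.
Lemma ogs_hol f y k : ~ S y -> ogs f y k -> hnear f y.
Proof. by rewrite /ogs => yS; rewrite asboolF. Qed.
Lemma ogsD f g y k : ogs f y k -> ogs g y k -> ogs (fun x => f x + g x) y k.
Proof. by rewrite /ogs; case: asboolP => _; [exact: ogD|exact: hnearD]. Qed.
Lemma ogsM f g y k l : ogs f y k -> ogs g y l -> ogs (fun x => f x * g x) y (k + l).
Proof. by rewrite /ogs; case: asboolP => _; [exact: ogM|exact: hnearM]. Qed.
Lemma ogs_weak f y k l : l <= k -> ogs f y k -> ogs f y l.
Proof. by rewrite /ogs; case: asboolP => // _; exact: og_weak. Qed.
Lemma ogs_hnear f y : hnear f y -> ogs f y 0.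
Proof. by rewrite /ogs; case: asboolP => // _; exact: og_hnear. Qed.
Lemma ogs0 y k : ogs (fun=> 0) y k.
Proof.
rewrite /ogs; case: asboolP => _; last exact: hnearC.
have [i di] := rs_cover y; exists i => //; exists (fun=> 0); first exact: hnearC.
by apply: filterE => x _; rewrite mulr0.
Qed.
Lemma ogs_sum (I : Type) (s : seq I) (F : I -> X -> C) y k :
  (forall j, ogs (F j) y k) -> ogs (fun x => \sum_(j <- s) F j x) y k.
Proof.
move=> H; elim: s => [|j s IH].
  by apply: ogs_ext (ogs0 y k); apply: filterE => x _; rewrite big_nil.
by apply: ogs_ext (ogsD (H j) IH); apply: filterE => x _; rewrite big_cons.
Qed.

Lemma local_eq_ogs W h y k : open W -> W y -> local_equation pts W h -> ogs (fun x => h x ^ k) y k.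
Proof.
move=> oW Wy [hh hz]; have [h1 h2] := hz y Wy; have hn := holo_hnear oW Wy hh.
rewrite /ogs; case: asboolP => yS; last by apply: hnearXz hn; apply/eqP => /h1.
have [i di] := rs_cover y; have dn := h2 yS i di; have h0 := h1.2 yS.
have [e e0 he] := hnear_hol hn di.
have o1 : oe h y 1.
  exists i => //; exists (fun x => divdiff (h \o rs_param i) (z i y) (z i x)); split.
  - exact: (hol_hnear di e0 (hol_divdiff he)).
  - by rewrite /divdiff eqxx.
  - apply: filterS (near_dom di) => x dx _; have := divdiffE (h \o rs_param i) (z i y) (z i x).
    by rewrite /= !rs_coordK // h0 add0r expr1z.
by have := oe_og (oe_exprz k o1); rewrite mul1r.
Qed.

Local Notation frameG := (frame (G := G)).

(** * From parabolic sections to orders of their coefficients *)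

Section FrameElim.
Variables (W : set X) (i : rs_idx X) (a : vb_idx (gL G)) (tau : X -> 'M[C]_(2, 1)).
Hypothesis fr : frame W i a tau.
Local Notation e := (ev a).
Local Notation t := (tv a tau).

(** The germ at [y] of a section in the frame, with lower bounds [k] and [l] on the orders of its
    coefficients along [ev] and [tv]. *)
Definition des2 (s : X -> 'cV[C]_2) y k l := exists al be : X -> C,
  [/\ \forall x \near y, ~ S x -> s x = al x *: e x + be x *: t x, ogs al y k & ogs be y l].

Lemma des2_weak s y k l k' l' : k' <= k -> l' <= l -> des2 s y k l -> des2 s y k' l'.
Proof. by move=> hk hl [al [be [h1 h2 h3]]]; exists al, be; split => //; [exact: ogs_weak h2|exact: ogs_weak h3]. Qed.

Lemma des2_out s y k l k' l' : ~ S y -> des2 s y k l -> des2 s y k' l'.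
Proof. by move=> yS [al [be [h1 h2 h3]]]; exists al, be; split => //; [exact: ogs_out h2|exact: ogs_out h3]. Qed.

Lemma des2D s s' y k l : des2 s y k l -> des2 s' y k l -> des2 (fun x => s x + s' x) y k l.
Proof.
move=> [al [be [h1 h2 h3]]] [al' [be' [h1' h2' h3']]].
exists (fun x => al x + al' x), (fun x => be x + be' x); split; [|exact: ogsD|exact: ogsD].
apply: filterS2 h1 h1' => x e1 e2 nS; rewrite (e1 nS) (e2 nS) !scalerDl; exact: addrACA.
Qed.

Lemma des2_ext s s' y k l : (\forall x \near y, ~ S x -> s x = s' x) -> des2 s y k l -> des2 s' y k l.
Proof.
move=> ss [al [be [h1 h2 h3]]]; exists al, be; split => //.
by apply: filterS2 ss h1 => x e1 e2 nS; rewrite -e1 // e2.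
Qed.

Lemma des2_twist (F : sheaf X 'cV[C]_2) U s y k ka kb : twist pts k F U s -> U y ->
  (forall W' s', open W' -> W' y -> F W' s' -> des2 s' y ka kb) -> des2 s y (ka - k) (kb - k).
Proof.
move=> tw Uy H; have [W' [h [oW Wy WU lh Fh]]] := tw y Uy.
have [al [be [h1 h2 h3]]] := H _ _ oW Wy Fh.
have oh := local_eq_ogs (- k) oW Wy lh.
exists (fun x => al x * h x ^ (- k)), (fun x => be x * h x ^ (- k)).
split; [|exact: ogsM|exact: ogsM].
have nW : \forall x \near y, W' x by apply: open_nbhs_nbhs.
apply: filterS2 h1 nW => x e1 Wx nS; have hx : h x != 0 by apply/eqP => /(lh.2 x Wx).1.
have := congr1 (fun v => h x ^ (- k) *: v) (e1 nS).
rewrite scalerA -expfzDr // addNr expr0z scale1r scalerDr !scalerA => ->.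
by rewrite ![_ * h x ^ _]mulrC.
Qed.

Lemma des2_sec U s y : open U -> U y -> W y -> sections pts (gE G) U s -> des2 s y 0 0.
Proof.
move=> oU Uy Wy [s' /hol_sectionP hs ss].
have nb : \forall x \near y, W x /\ U x.
  by apply: filterI; apply: open_nbhs_nbhs => //; split => //; exact: (fr_open fr).
exists (ca a tau s'), (cb a tau s'); split.
- by apply: filterS nb => x [Wx Ux] nS; rewrite ss // (coordE fr).
- apply: ogs_hnear; apply: filterS nb => x [Wx Ux].
  by have [] := hdiff_coords fr Wx (hs x Ux).
- apply: ogs_hnear; apply: filterS nb => x [Wx Ux].
  by have [] := hdiff_coords fr Wx (hs x Ux).
Qed.

Lemma des2_E U s y : open U -> U y -> W y -> Esheaf pts G U s -> des2 s y 0 1.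
Proof.
move=> oU Uy Wy [/(des2_sec oU Uy Wy) [al [be [h1 h2 h3]]] tw].
exists al, be; split => //.
have [W' [h [oW' W'y WU lh [q /hol_sectionP hq qE]]]] := tw y Uy.
have nb : \forall x \near y, W x /\ W' x.
  by apply: filterI; apply: open_nbhs_nbhs; split => //; exact: (fr_open fr).
have hl : hnear (fun x => lam a x * q x 0 0) y.
  by apply: filterS nb => x [Wx W'x]; apply: dual_coord; [exact: (fr_triv fr)|exact: hq].
have := ogsM (local_eq_ogs 1 oW' W'y lh) (ogs_hnear hl); rewrite addr0; apply: ogs_ext.
apply: filterS2 h1 nb => x e1 [Wx W'x] nS.
have hx : h x != 0 by apply/eqP => /(lh.2 x W'x).1.
have l0 := lam_neq0 (fr_triv fr Wx).
have := qE x W'x nS; rewrite e1 // mulmxDr -!scalemxAr p_ev (p_tv fr) // scaler0 add0r scalerA.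
move=> /(congr1 (fun v : 'cV[C]_1 => v 0 0)); rewrite !mxE => <-.
by rewrite expr1z exprN1; field; rewrite hx l0.
Qed.

Lemma des2_zero s y : W y -> E_zero_at pts G y s -> des2 s y 1 2.
Proof.
move=> Wy [U [oU Uy tw]]; apply: (des2_twist (ka := 0) (kb := 1) tw Uy) => W' s' oW' W'y.
exact: des2_E.
Qed.

Lemma des2_line s y : W y -> E_line_at pts G y s -> des2 s y 1 1.
Proof.
move=> Wy [U [s' [oU Uy tw ze]]].
have d1 : des2 s' y 1 1.
  by apply: (des2_twist (ka := 0) (kb := 0) tw Uy) => W' s'' oW' W'y; exact: des2_sec.
have d2 : des2 (fun x => s x - s' x) y 1 1 by apply: des2_weak (des2_zero Wy ze).
by apply: des2_ext (des2D d2 d1); apply: filterE => x _; rewrite subrK.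
Qed.

(** The steps of the flag give the bounds [(0, 1)], [(1, 1)] and [(1, 2)] as [T] passes [gam y] and
    [1 - gam y]. They coincide with the ceilings of [T - gam y] and [T + gam y], so [ev] and [tv]
    behave as if of weights [gam y] and [- gam y]. *)
Lemma des2_Epar01 U s y (T : R) : open U -> U y -> W y -> 0 <= T < 1 -> Epar01 pts c G T U s ->
  des2 s y (Num.ceil (T - gam y)) (Num.ceil (T + gam y)).
Proof.
move=> oU Uy Wy /andP[T0 T1] [hE hS]; have dE := des2_E oU Uy Wy hE.
have [yS|yS] := pselect (S y); last exact: des2_out yS dE.
have [k _ ky] := yS; have gk := gam_pts k; rewrite ky in gk.
have [] := hS k; rewrite ky // weight_lineE -gk => hl hz.
have /andP[g1 g2] := gam_bounds y.
have [Tl|Tl] := ltP (1 - gam y) T.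
  apply: des2_weak (des2_zero Wy (hz Tl)); rewrite ceil_le_int; lra.
have [Tg|Tg] := ltP (gam y) T.
  apply: des2_weak (des2_line Wy (hl Tg)); rewrite ceil_le_int; lra.
apply: des2_weak dE; rewrite ceil_le_int; lra.
Qed.

Lemma des2_Epar U s y (T : R) : open U -> U y -> W y -> Epar pts c G T U s ->
  des2 s y (Num.ceil (T - gam y)) (Num.ceil (T + gam y)).
Proof.
move=> oU Uy Wy tw; set T' := T - (Num.floor T)%:~R.
have T01 : 0 <= T' < 1.
  by have := floor_itv T; rewrite intrD /T' => /andP[h1 h2]; apply/andP; split; lra.
have := des2_twist tw Uy (fun W' s' oW' W'y => des2_Epar01 oW' W'y Wy T01).
apply: des2_weak; rewrite ceil_le_int opprK intrD.
  by have := ceil_ge (T' - gam y); rewrite /T'; lra.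
by have := ceil_ge (T' + gam y); rewrite /T'; lra.
Qed.

Local Notation eh := (fun x => linear_form (e x)).
Local Notation th := (fun x => linear_form (t x)).

Definition wt (m b : nat) y : R := (m%:R - 2 * b%:R) * gam y.

(** The analogue in the symmetric power: the coefficient of each monomial is bounded by the weight
    of that monomial, and [J] bounds the degree in [tv], which encodes the step of the
    filtration. *)
Definition desS (m J : nat) (T : R) (s : X -> MP) y := exists P : X -> {poly C},
  [/\ \forall x \near y, ~ S x -> s x = homf m (eh x) (th x) (P x),
      forall x, (size (P x) <= m.+1)%N,
      forall b, (b <= m)%N -> ogs (fun x => (P x)`_b) y (Num.ceil (T - wt m b y)) &
      forall x b, (J < b)%N -> (P x)`_b = 0].

Lemma desS_ext m J T s s' y : (\forall x \near y, ~ S x -> s x = s' x) ->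
  desS m J T s y -> desS m J T s' y.
Proof.
move=> ss [P [h1 h2 h3 h4]]; exists P; split => //.
by apply: filterS2 ss h1 => x e1 e2 nS; rewrite -e1 // e2.
Qed.

Lemma desSM m1 m2 J1 J2 T1 T2 u v y : desS m1 J1 T1 u y -> desS m2 J2 T2 v y ->
  desS (m1 + m2) (J1 + J2) (T1 + T2) (fun x => u x * v x) y.
Proof.
move=> [P [P1 P2 P3 P4]] [Q [Q1 Q2 Q3 Q4]]; exists (fun x => P x * Q x); split.
- by apply: filterS2 P1 Q1 => x e1 e2 nS; rewrite e1 // e2 // hom_mul.
- move=> x; apply: leq_trans (size_polyMleq _ _) _.
  by have := P2 x; have := Q2 x; lia.
- move=> b bm; rewrite (_ : (fun x => _) = fun x => \sum_(j < b.+1) (P x)`_j * (Q x)`_(b - j)).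
    apply: ogs_sum => j; have jb : (j <= b)%N by rewrite -ltnS.
    have [j1|j1] := leqP j m1; last first.
      apply: ogs_ext (ogs0 _ _); apply: filterE => x _.
      by rewrite (nth_default _ (leq_trans (P2 x) j1)) mul0r.
    have [j2|j2] := leqP (b - j) m2; last first.
      apply: ogs_ext (ogs0 _ _); apply: filterE => x _.
      by rewrite (nth_default _ (leq_trans (Q2 x) j2)) mulr0.
    apply: ogs_weak (ogsM (P3 j j1) (Q3 (b - j)%N j2)).
    apply: le_trans (ceil_add _ _); apply: ceil_le; rewrite /wt natrB // natrD.
    by move: (gam y) => g; rewrite le_eqVlt; apply/orP; left; apply/eqP; ring.
  by apply/funext => x; rewrite coefM.
- move=> x b Jb; rewrite coefM big1 // => j _.
  have [h|h] := leqP j J1; last by rewrite P4 // mul0r.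
  by rewrite Q4 ?mulr0 //; have := ltn_ord j; lia.
Qed.

Lemma desS_sum m J T N (s : 'I_N -> X -> MP) y : (forall k : 'I_N, desS m J T (s k) y) ->
  desS m J T (fun x => \sum_k s k x) y.
Proof.
move=> /choice [P HP]; exists (fun x => \sum_k P k x); split.
- have nn : \forall x \near y, forall k : 'I_N, ~ S x -> s k x = homf m (eh x) (th x) (P k x).
    by apply: near_fin => k; have [] := HP k.
  apply: filterS nn => x h nS; rewrite hom_sum; apply: eq_bigr => k _.
  exact: h.
- by move=> x; apply: (leq_trans (size_sum _ _ _)); apply/bigmax_leqP => k _; have [_ h _ _] := HP k.
- move=> b bm; rewrite (_ : (fun x => _) = fun x => \sum_k (P k x)`_b).
    by apply: ogs_sum => k; have [_ _ h _] := HP k; exact: h.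
  by apply/funext => x; rewrite coef_sum.
- by move=> x b Jb; rewrite coef_sum big1 // => k _; have [_ _ _ h] := HP k; exact: h.
Qed.

Lemma desS_par_mul m1 m2 J1 J2 (F F' : filtered X) T U s y : U y -> par_mul pts F F' T U s ->
  (forall T U s, open U -> U y -> F T U s -> desS m1 J1 T s y) ->
  (forall T U s, open U -> U y -> F' T U s -> desS m2 J2 T s y) -> desS (m1 + m2) (J1 + J2) T s y.
Proof.
move=> Uy /(_ y Uy) [V [N [al [u [v [oV Vy VU Fuv E]]]]]] HF HF'.
have nV : \forall x \near y, V x by apply: open_nbhs_nbhs.
apply: (desS_ext (s := fun x => \sum_k u k x * v k x)).
  by apply: filterS nV => x Vx nS; rewrite E.
apply: desS_sum => k; have [h1 h2] := Fuv k.
have := desSM (HF _ _ _ oV Vy h1) (HF' _ _ _ oV Vy h2).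
by rewrite addrC subrK.
Qed.

Lemma desS_triv T U s y : U y -> trivial_par pts T U s -> desS 0 0 T s y.
Proof.
move=> Uy /(_ y Uy) [V [h [oV Vy VU lh [f hf E]]]].
have nV : \forall x \near y, V x by apply: open_nbhs_nbhs.
exists (fun x => (h x ^ Num.ceil T * f x)%:P); split.
- apply: filterS nV => x Vx nS; have hx : h x != 0 by apply/eqP => /(lh.2 x Vx).1.
  have := congr1 (fun v => h x ^ Num.ceil T *: v) (E x Vx nS).
  rewrite scalerA -expfzDr // addrN expr0z scale1r => ->.
  rewrite homf_deg0 coefC /= -scalerA; congr (_ *: _).
  by rewrite -mul_mpolyC mulr1.
- by move=> x; exact: size_polyC_leq1.
- move=> b; rewrite leqn0 => /eqP ->; rewrite /wt mulr0 subr0 mul0r subr0.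
  rewrite (_ : (fun x => _) = fun x => h x ^ Num.ceil T * f x).
    have := ogsM (local_eq_ogs (Num.ceil T) oV Vy lh) (ogs_hnear (holo_hnear oV Vy hf)).
    by rewrite addr0.
  by apply/funext => x; rewrite coefC.
- by move=> x b b0; rewrite coefC gtn_eqF.
Qed.

Lemma desS_E T U s y : open U -> U y -> W y -> in_degree1 pts (Epar pts c G) T U s -> desS 1 1 T s y.
Proof.
move=> oU Uy Wy [v /(des2_Epar oU Uy Wy) [al [be [h1 h2 h3]]] E].
have nU : \forall x \near y, U x by apply: open_nbhs_nbhs.
exists (fun x => (al x)%:P + be x *: 'X); split.
- apply: filterS2 h1 nU => x e1 Ux nS; rewrite E // e1 // linear_formD !linear_formZ.
  by rewrite homf_deg1 !coefD !coefC !coefZ !coefX /= mulr0 mulr1 addr0 add0r.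
- move=> x; apply: leq_trans (size_polyD _ _) _; rewrite geq_max.
  rewrite (leq_trans (size_polyC_leq1 _)) //=.
  by apply: leq_trans (size_scale_leq _ _) _; rewrite size_polyX.
- case=> [|[|//]] _; rewrite /wt.
    rewrite (_ : (fun x => _) = al); last by apply/funext => x; rewrite coefD coefC coefZ coefX /= mulr0 addr0.
    by rewrite mulr0 subr0 mul1r.
  rewrite (_ : (fun x => _) = be); last by apply/funext => x; rewrite coefD coefC coefZ coefX /= mulr1 add0r.
  by apply: ogs_weak h3; apply: ceil_le; lra.
- by move=> x [|[|b]] // _; rewrite coefD coefC coefZ coefX /= mulr0 addr0.
Qed.

Lemma desS_L T U s y : open U -> U y -> W y -> in_degree1 pts (Lpar pts c G) T U s -> desS 1 0 T s y.
Proof.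
move=> oU Uy Wy [v [/(des2_Epar oU Uy Wy) [al [be [h1 h2 h3]]] [u uE]] E].
have nb : \forall x \near y, W x /\ U x.
  by apply: filterI; apply: open_nbhs_nbhs => //; split => //; exact: (fr_open fr).
exists (fun x => (al x)%:P); split.
- apply: filterS2 h1 nb => x e1 [Wx Ux] nS; have l0 := lam_neq0 (fr_triv fr Wx).
  have := e1 nS; have be0 : be x = 0.
    have := congr1 (mulmx (gp G x)) (e1 nS); rewrite uE // mulmxDr -!scalemxAr p_ev (p_tv fr) //.
    have [_ _ /(_ x) [_ _ pi]] := g_exact G; rewrite mulmxA pi mul0mx scaler0 add0r.
    move=> /(congr1 (fun v : 'cV[C]_1 => v 0 0)); rewrite !mxE => /esym/eqP.
    by rewrite mulf_eq0 invr_eq0 (negbTE l0) orbF => /eqP.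
  rewrite be0 scale0r addr0 E // => ->; rewrite linear_formZ.
  by rewrite homf_deg1 !coefC /= scale0r addr0.
- by move=> x; apply: leq_trans (size_polyC_leq1 _) _.
- case=> [|[|//]] _; rewrite /wt.
    rewrite (_ : (fun x => _) = al); last by apply/funext => x; rewrite coefC.
    by rewrite mulr0 subr0 mul1r.
  by apply: ogs_ext (ogs0 _ _); apply: filterE => x _; rewrite coefC.
- by move=> x [|b] // _; rewrite coefC.
Qed.

Lemma desS_Sym m T U s y : open U -> U y -> W y -> SymE pts c G m T U s -> desS m m T s y.
Proof.
elim: m T U s => [|m IH] T U s oU Uy Wy; first exact: desS_triv.
rewrite /SymE /par_pow iterS => H.
apply: (desS_par_mul (m1 := 1) (J1 := 1) Uy H) => T' U' s' oU' U'y; [exact: desS_E|exact: IH].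
Qed.

Lemma desS_Lpow m T U s y : open U -> U y -> W y ->
  par_pow pts (in_degree1 pts (Lpar pts c G)) m T U s -> desS m 0 T s y.
Proof.
elim: m T U s => [|m IH] T U s oU Uy Wy; first exact: desS_triv.
rewrite /par_pow iterS => H.
apply: (desS_par_mul (m1 := 1) (J1 := 0) Uy H) => T' U' s' oU' U'y; [exact: desS_L|exact: IH].
Qed.

Lemma desS_filtration r j T U s y : (0 < j <= r)%N -> open U -> U y -> W y ->
  filtration pts c G r j T U s -> desS r.-1 j.-1 T s y.
Proof.
move=> /andP[j0 jr] oU Uy Wy H.
have -> : r.-1 = (j.-1 + (r - j))%N by lia.
rewrite -[X in desS _ X]addn0.
apply: (desS_par_mul Uy H) => T' U' s' oU' U'y; [exact: desS_Sym|exact: desS_Lpow].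
Qed.
End FrameElim.

(** * From orders of coefficients back to parabolic sections *)

Section Good.
Variables (W : set X) (i : rs_idx X) (a : vb_idx (gL G)) (tau : X -> 'M[C]_(2, 1)).
Hypothesis fr : frame W i a tau.
Variable y : X.
Hypothesis Wy : W y.
Hypothesis good : forall k, W (pts k) -> pts k = y.
Local Notation e := (ev a).
Local Notation t := (tv a tau).
Local Notation eh := (fun x => linear_form (e x)).
Local Notation th := (fun x => linear_form (t x)).

(** A local equation of [S] on [W], which meets [S] at most in [y]. *)
Definition hl x : C := if `[< S y >] then z i x - z i y else 1.

Lemma good_S x : W x -> S x -> x = y /\ S y.
Proof. by move=> Wx [k _ kx]; subst x; have E := good Wx; split => //; exists k. Qed.

Lemma hl_neq0 x : W x -> ~ S x -> hl x != 0.
Proof.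
move=> Wx nS; rewrite /hl; case: asboolP => yS; last by rewrite oner_eq0.
apply: coord_neq; [exact: (fr_dom fr)|exact: (fr_dom fr)|].
by move=> E; apply: nS; rewrite E.
Qed.

Lemma hl_hdiff x : W x -> hdiff hl x.
Proof.
move=> Wx; rewrite /hl; case: asboolP => yS; last exact: hdiffC.
exact: hdiffB (hdiff_coord (fr_dom fr Wx)) (hdiffC _ _).
Qed.

Lemma hl_eq : local_equation pts W hl.
Proof.
split; first by apply/holo_onP => x; exact: hl_hdiff.
move=> x Wx; split.
  split; last by move=> xS; have [E yS] := good_S Wx xS; rewrite /hl asboolT // E subrr.
  by move=> h0; apply: contrapT => nS; have := hl_neq0 Wx nS; rewrite h0 eqxx.
move=> xS j dj; have [E yS] := good_S Wx xS.
have -> : hl = fun x => z i x - z i y by apply/funext => v; rewrite /hl asboolT.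
have dx := fr_dom fr Wx.
have := chart_derivB dj (hdiff_coord dx) (hdiffC (z i y) x).
rewrite chart_derivC subr0 => ->; exact: chart_deriv_neq0.
Qed.

Lemma twist_intro (M : lmodType C) (F : sheaf X M) k s :
  F W (fun x => hl x ^ k *: s x) -> twist pts k F W s.
Proof.
move=> H x Wx; exists W, hl; split => //; [exact: (fr_open fr)|exact: hl_eq].
Qed.

Lemma sections_intro r (F : vbundle X r) s s' : (forall x, W x -> hsec F s' x) ->
  eq_off_S pts W s s' -> sections pts F W s.
Proof. by move=> hs E; exists s' => //; apply/hol_sectionP. Qed.

Lemma twist_sections r (F : vbundle X r) k s s' : (forall x, W x -> hsec F s' x) ->
  (forall x, W x -> ~ S x -> s x = hl x ^ (- k) *: s' x) -> twist pts k (sections pts F) W s.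
Proof.
move=> hs E; apply: twist_intro; apply: (sections_intro hs) => x Wx nS.
by rewrite E // scalerA -expfzDr ?hl_neq0 // addrN expr0z scale1r.
Qed.

Lemma good_gam (k : 'I_n) : W (pts k) -> pts k = y /\ weight_E c k = gam y.
Proof. by move=> h; have E := good h; split => //; rewrite -E gam_pts. Qed.

Lemma Epar_ev : Epar pts c G (gam y) W e.
Proof.
have /andP[g1 g2] := gam_bounds y.
have f0 : Num.floor (gam y) = 0 by apply: floor_def; rewrite add0r; lra.
rewrite /Epar f0 oppr0 subr0; apply: twist_intro.
rewrite (_ : (fun x => _) = e); last by apply/funext => x; rewrite expr0z scale1r.
split.
  split; first by apply: (sections_intro (s' := e)) => // x Wx; exact: (hsec_ev fr Wx).
  apply: (twist_sections (s' := fun=> 0)) => [x _|x _ _]; first exact: hsec0.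
  by rewrite p_ev scaler0.
move=> k Wk; have [E gk] := good_gam Wk; rewrite weight_lineE // gk ltxx; split => // h.
by exfalso; move: h; lra.
Qed.

(** Since [- gam y] has floor -1, the claim is that [hl * tv] lies in step [1 - gam y], that is,
    takes its value in the distinguished line. It does, being a section of the untwisted extension
    times a local equation of [S]. *)
Lemma Epar_tv : Epar pts c G (- gam y) W t.
Proof.
have /andP[g1 g2] := gam_bounds y.
have f0 : Num.floor (- gam y) = -1 by apply: floor_def; rewrite addNr; lra.
rewrite /Epar f0 opprK; apply: twist_intro.
set s := fun x => _; have sE x : s x = hl x *: t x by rewrite /s expr1z.
have hs x : W x -> hsec (gE G) s x.
  move=> Wx; apply: hsec_near (hsecZ (hl_hdiff Wx) (hsec_tv fr Wx)).
  by apply: filterE => x'; rewrite sE.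
split.
  split; first by apply: (sections_intro (s' := s)).
  apply: (twist_sections (s' := fun x => const_mx (lam a x)^-1)) => [x Wx|x Wx nS].
    by apply: hsec_dual; exact: (fr_triv fr).
  by rewrite opprK sE -scalemxAr (p_tv fr) // expr1z.
move=> k Wk; have [E gk] := good_gam Wk; rewrite weight_lineE // gk; split; last first.
  by move=> h; exfalso; move: h; lra.
move=> _; exists W, s; split => //; first exact: (fr_open fr).
  apply: (twist_sections (s' := t)) => [x Wx|x Wx nS]; first exact: (hsec_tv fr Wx).
  by rewrite opprK sE expr1z.
exists W; split => //; first exact: (fr_open fr).
apply: twist_intro; set s0 := fun x => _.
have s00 : s0 = fun=> 0 by apply/funext => x; rewrite /s0 subrr scaler0.
rewrite s00; split.
  by apply: (sections_intro (s' := fun=> 0)) => // x _; exact: hsec0.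
apply: (twist_sections (s' := fun=> 0)) => [x _|x _ _]; first exact: hsec0.
by rewrite mulmx0 scaler0.
Qed.

Lemma par_mul1 (F F' : filtered X) al T u v s : F al W u -> F' (T - al) W v ->
  eq_off_S pts W s (fun x => u x * v x) -> par_mul pts F F' T W s.
Proof.
move=> Fu Fv E x Wx; exists W, 1%N, (fun=> al), (fun=> u), (fun=> v); split => //.
  exact: (fr_open fr).
by move=> x' Wx' nS; rewrite big_ord1 E.
Qed.

Lemma E1_ev : in_degree1 pts (Epar pts c G) (gam y) W eh.
Proof. by exists e => //; exact: Epar_ev. Qed.
Lemma E1_tv : in_degree1 pts (Epar pts c G) (- gam y) W th.
Proof. by exists t => //; exact: Epar_tv. Qed.
Lemma L1_ev : in_degree1 pts (Lpar pts c G) (gam y) W eh.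
Proof.
exists e => //; split; first exact: Epar_ev.
by exists (fun x => const_mx (lam a x)).
Qed.

Definition mono m b k f x : MP := (hl x ^ k * f x) *: (eh x ^+ (m - b) * th x ^+ b).

Lemma triv_mono T f k : holo_on W f -> k = Num.ceil T -> trivial_par pts T W (mono 0 0 k f).
Proof.
move=> hf ->; apply: twist_intro; exists f => // x Wx nS.
rewrite /mono !expr0 mulr1 scalerA mulrA -expfzDr ?hl_neq0 // addNr expr0z mul1r.
by rewrite -mul_mpolyC mulr1.
Qed.

Lemma mono_Sym m b T f k : (b <= m)%N -> holo_on W f -> k = Num.ceil (T - wt m b y) ->
  SymE pts c G m T W (mono m b k f).
Proof.
elim: m b T k => [|m IH] b T k bm hf kE.
  move: bm kE; rewrite leqn0 => /eqP -> kE; apply: triv_mono => //.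
  by rewrite kE /wt; congr Num.ceil; ring.
rewrite /SymE /par_pow iterS; have [b1|b1] := leqP b m.
  apply: (par_mul1 (al := gam y) (u := eh) (v := mono m b k f) E1_ev).
    by apply: IH => //; rewrite kE /wt; congr Num.ceil; rewrite -natr1; ring.
  by move=> x _ _; rewrite /mono subSn // exprS -scalerAr mulrA.
have bE : b = m.+1 by apply/eqP; rewrite eqn_leq bm.
subst b; apply: (par_mul1 (al := - gam y) (u := th) (v := mono m m k f) E1_tv).
  by apply: IH => //; rewrite kE /wt; congr Num.ceil; rewrite -natr1; ring.
by move=> x _ _; rewrite /mono !subnn !expr0 !mul1r exprS -scalerAr.
Qed.

Lemma mono_L m T f k : holo_on W f -> k = Num.ceil (T - wt m 0 y) ->
  par_pow pts (in_degree1 pts (Lpar pts c G)) m T W (mono m 0 k f).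
Proof.
elim: m T k => [|m IH] T k hf kE.
  by apply: triv_mono => //; rewrite kE /wt; congr Num.ceil; ring.
rewrite /par_pow iterS.
apply: (par_mul1 (al := gam y) (u := eh) (v := mono m 0 k f) L1_ev).
  by apply: IH => //; rewrite kE /wt; congr Num.ceil; rewrite -natr1; ring.
by move=> x _ _; rewrite /mono !subn0 exprS -scalerAr mulrA.
Qed.

(** [par_mul] admits finite sums, so the sum is absorbed into the outermost product. This needs a
    positive degree: all monomials get a factor [ev], except the pure power of [tv]. *)
Lemma sum_Sym m T (f : nat -> X -> C) s : (forall b, holo_on W (f b)) ->
  eq_off_S pts W s (fun x => \sum_(b < m.+2) mono m.+1 b (Num.ceil (T - wt m.+1 b y)) (f b) x) ->
  SymE pts c G m.+1 T W s.
Proof.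
move=> hf E; rewrite /SymE /par_pow iterS => x Wx.
pose kk b := Num.ceil (T - wt m.+1 b y).
exists W, m.+2, (fun b : 'I_m.+2 => if (b <= m)%N then gam y else - gam y),
  (fun b : 'I_m.+2 => if (b <= m)%N then eh else th),
  (fun b : 'I_m.+2 => if (b <= m)%N then mono m b (kk b) (f b) else mono m m (kk b) (f b)).
split => //; first exact: (fr_open fr).
  move=> b; case: ifP => bm.
    split; first exact: E1_ev.
    by apply: mono_Sym => //; rewrite /kk /wt; congr Num.ceil; rewrite -natr1; ring.
  have bE : (b : nat) = m.+1 by have := ltn_ord b; move: bm; lia.
  split; first exact: E1_tv.
  by apply: mono_Sym => //; rewrite /kk bE /wt; congr Num.ceil; rewrite -natr1; ring.
move=> x' Wx' nS; rewrite E //; apply: eq_bigr => b _; case: ifP => bm.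
  by rewrite /mono subSn // exprS -scalerAr mulrA.
have bE : (b : nat) = m.+1 by have := ltn_ord b; move: bm; lia.
by rewrite /mono bE !subnn !expr0 !mul1r exprS -scalerAr.
Qed.

(** A monomial of degree less than [j] in [tv] splits off the factor [ev ^+ (r - j)], a power of the
    line subbundle. *)
Lemma sum_filtration r j T (f : nat -> X -> C) s : (0 < j <= r)%N -> (forall b, holo_on W (f b)) ->
  eq_off_S pts W s (fun x => \sum_(b < j) mono r.-1 b (Num.ceil (T - wt r.-1 b y)) (f b) x) ->
  filtration pts c G r j T W s.
Proof.
move=> /andP[j0 jr] hf E x Wx; pose kk b := Num.ceil (T - wt r.-1 b y).
exists W, j, (fun b => T - wt (r - j) 0 y), (fun b => mono j.-1 b (kk b) (f b)),
  (fun b => mono (r - j) 0 0 (fun=> 1)).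
split => //; first exact: (fr_open fr).
  move=> b; have bj := ltn_ord b; split.
    apply: mono_Sym => //; first by lia.
    rewrite /kk /wt; congr Num.ceil.
    have -> : (r.-1 = (r - j) + j.-1)%N by lia.
    by rewrite natrD; ring.
  apply: mono_L; first by apply/holo_onP => v _; exact: hdiffC.
  have -> : T - (T - wt (r - j) 0 y) - wt (r - j) 0 y = 0 by ring.
  by rewrite ceil0.
move=> x' Wx' nS; rewrite E //; apply: eq_bigr => b _; have bj := ltn_ord b.
rewrite /mono expr0z mulr1 scale1r subn0 expr0 mulr1 -scalerAl; congr (_ *: _).
have -> : (r.-1 - b = (j.-1 - b) + (r - j))%N by lia.
by rewrite exprD mulrAC.
Qed.
End Good.

Lemma ogs_hl f y i k : dom i y -> ogs f y k -> exists2 g, hnear g y &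
  \forall x \near y, ~ S x -> f x = hl i y x ^ k * g x.
Proof.
rewrite /ogs /hl => di; case: asboolP => yS.
  move=> /og_chart /(_ di) [g hg E]; exists g => //.
  by apply: filterS E => x h nS; apply: h => xy; apply: nS; rewrite xy.
by move=> hf; exists f => //; apply: filterE => x _; rewrite expr1n_z || rewrite exp1rz mul1r.
Qed.

(** Only finitely many conditions on germs occur; the interior of the set where all of them hold is
    a neighbourhood on which the section is a sum of monomials with holomorphic coefficients. *)
Lemma desS_local W i a (tau : X -> 'M[C]_(2, 1)) (fr : frame W i a tau) m J T s y U : W y -> open U -> U y ->
  desS a tau m J T s y -> exists (W' : set X) (f : nat -> X -> C),
  [/\ frame W' i a tau, W' y, W' `<=` U, forall k, W' (pts k) -> pts k = y &
     (forall b, holo_on W' (f b)) /\ (forall b, (J < b)%N -> f b = fun=> 0) /\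
     eq_off_S pts W' s (fun x => \sum_(b < m.+1) mono i a tau y m b (Num.ceil (T - wt m b y)) (f b) x)].
Proof.
move=> Wy oU Uy [P [P1 P2 P3 P4]]; have di := fr_dom fr Wy.
have ex b : exists g, hnear g y /\ ((J < b)%N -> g = fun=> 0) /\ ((b <= m)%N ->
    \forall x \near y, ~ S x -> (P x)`_b = hl i y x ^ (Num.ceil (T - wt m b y)) * g x).
  have [Jb|Jb] := ltnP J b.
    exists (fun=> 0); split; first exact: hnearC.
    by split => // _; apply: filterE => x _; rewrite mulr0 P4.
  have [bm|bm] := leqP b m; last first.
    by exists (fun=> 0); split; [exact: hnearC|split].
  by have [g hg E] := ogs_hl di (P3 b bm); exists g.
have [f Hf] := choice ex.
have nE : \forall x \near y, forall b : 'I_m.+1, ~ S x ->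
    (P x)`_b = hl i y x ^ (Num.ceil (T - wt m b y)) * f b x.
  by apply: near_fin => b; have [_ [_ h]] := Hf b; apply: h; rewrite -ltnS.
have nf : \forall x \near y, forall b : 'I_m.+1, hdiff (f b) x.
  by apply: near_fin => b; have [h _] := Hf b.
have nWU : \forall x \near y, W x /\ U x.
  by apply: filterI; apply: open_nbhs_nbhs => //; split => //; exact: (fr_open fr).
pose B : set X := [set x | [/\ W x /\ U x, x <> y -> ~ S x, forall b : 'I_m.+1, hdiff (f b) x &
   ~ S x -> s x = \sum_(b < m.+1) mono i a tau y m b (Num.ceil (T - wt m b y)) (f b) x]].
have nB : nbhs y B.
  apply: filterS (filterI (filterI nWU (near_S pts y)) (filterI nf (filterI nE P1))).
  move=> x [[h1 h2] [h3 [h4 h5]]]; split => // nS; rewrite h5 //.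
  by apply: eq_bigr => b _; rewrite /mono h4.
pose f' b := if (b <= m)%N then f b else fun=> 0.
exists B°, f'; split.
- by apply: frame_sub fr; [exact: open_interior|move=> x /interior_subset [[]]].
- exact: nB.
- by move=> x /interior_subset [[]].
- move=> k /interior_subset [_ h _ _]; apply: contrapT => ne; apply: (h ne); by exists k.
split; last split.
- move=> b; apply/holo_onP => x /interior_subset [_ _ h _]; rewrite /f'.
  case: leqP => bm; last exact: hdiffC.
  by have := h (Ordinal (bm : (b < m.+1)%N)).
- by move=> b Jb; rewrite /f'; case: leqP => // _; have [_ [h _]] := Hf b; exact: h.
- move=> x /interior_subset [_ _ _ h] nS; rewrite h //; apply: eq_bigr => b _.
  by rewrite /f' -ltnS ltn_ord.
Qed.

Lemma SymE_intro m T U s : open U -> (forall y, U y -> exists W i a (tau : X -> 'M[C]_(2, 1)),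
    [/\ frameG W i a tau, W y & desS a tau m.+1 m.+1 T s y]) -> SymE pts c G m.+1 T U s.
Proof.
move=> oU H y Uy; have [W [i [a [tau [fr Wy ds]]]]] := H y Uy.
have [W' [f [fr' W'y WU gd [hf [_ E]]]]] := desS_local fr Wy oU Uy ds.
have := sum_Sym fr' W'y gd hf E; rewrite /SymE /par_pow iterS => /(_ y W'y).
move=> [V [N [al [u [v [oV Vy VW h1 h2]]]]]]; exists V, N, al, u, v; split => //.
exact: subset_trans VW WU.
Qed.

Lemma filtration_intro r j T U s : (0 < j <= r)%N -> open U ->
  (forall y, U y -> exists W i a (tau : X -> 'M[C]_(2, 1)),
    [/\ frameG W i a tau, W y & desS a tau r.-1 j.-1 T s y]) -> filtration pts c G r j T U s.
Proof.
move=> jr oU H y Uy; have [W [i [a [tau [fr Wy ds]]]]] := H y Uy.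
have [W' [f [fr' W'y WU gd [hf [f0 E]]]]] := desS_local fr Wy oU Uy ds.
have E' : eq_off_S pts W' s (fun x => \sum_(b < j) mono i a tau y r.-1 b (Num.ceil (T - wt r.-1 b y)) (f b) x).
  move=> x Wx nS; rewrite E //.
  rewrite [RHS](@big_ord_widen _ _ _ j r.-1.+1 (fun b => mono i a tau y r.-1 b (Num.ceil (T - wt r.-1 b y)) (f b) x)); last by lia.
  rewrite [RHS]big_mkcond; apply: eq_bigr => b _ /=; case: ltnP => // jb.
  by rewrite f0 ?/mono ?mulr0 ?scale0r //; lia.
have /(_ y W'y) := sum_filtration fr' W'y gd jr hf E'.
move=> [V [N [al [u [v [oV Vy VW h1 h2]]]]]]; exists V, N, al, u, v; split => //.
exact: subset_trans VW WU.
Qed.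

(** * Existence and comparison of local frames *)

Lemma frame_good y W i (a : vb_idx (gL G)) (tau : X -> 'M[C]_(2, 1)) : frame W i a tau -> W y ->
  exists W', [/\ W' `<=` W, frame W' i a tau, W' y & forall k : 'I_n, W' (pts k) -> pts k = y].
Proof.
move=> fr Wy; have nb : nbhs y (W `&` [set x | x <> y -> ~ S x]).
  by apply: filterI (near_S pts y); exact: (frame_near fr Wy).
have sub : (W `&` [set x | x <> y -> ~ S x])° `<=` W by move=> x /interior_subset [].
exists (W `&` [set x | x <> y -> ~ S x])°; split => //.
- by apply: frame_sub fr => //; exact: open_interior.
- move=> k /interior_subset [_ h]; apply: contrapT => ne; apply: (h ne); by exists k.
Qed.

Lemma frame_restrict W0 i (a : vb_idx (gL G)) (tau : X -> 'M[C]_(2, 1)) : open W0 ->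
  hol_hom (dual_vb (gL G)) (gE G) W0 tau -> (forall x, W0 x -> gp G x *m tau x = 1%:M) ->
  frame (W0 `&` (dom i `&` vb_dom (gL G) a)) i a tau.
Proof.
move=> oW0 ht pt; split; try by move=> x [? []].
- by apply: openI => //; apply: openI; [exact: rs_open_dom|exact: vb_open_dom].
- by move=> d e k j; apply/holo_onP => x [[h _] dd]; have /holo_onP := ht d e k j; exact.
- by move=> x [h _]; exact: pt.
Qed.

(** Local splittings come with the datum of the extension class: the meromorphic splitting away from
    its poles, and a holomorphic one near each pole. *)
Lemma exists_frame y i : dom i y -> exists W (a : vb_idx (gL G)) (tau : X -> 'M[C]_(2, 1)),
  [/\ frame W i a tau, W y & forall k : 'I_n, W (pts k) -> pts k = y].
Proof.
move=> di; have [a da] := vb_cover (gL G) y.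
have [m [Y [rho [sg [_ hsg psg HY _]]]]] := g_class G.
have [W0 [tau [oW0 W0y ht pt]]] : exists W0 (tau : X -> 'M[C]_(2, 1)),
    [/\ open W0, W0 y, hol_hom (dual_vb (gL G)) (gE G) W0 tau & forall x, W0 x -> gp G x *m tau x = 1%:M].
  have [[k _ <-]|nY] := pselect (range Y y).
    by have [W0 [tau [_ [[h1 h2] h3 h4 _ _]]]] := HY k; exists W0, tau.
  by exists (~` range Y), sg; split => //; exact: open_nS.
have fr := frame_restrict i a oW0 ht pt.
have [W [_ fr' Wy gd]] := frame_good fr (conj W0y (conj di da)).
by exists W, a, tau.
Qed.

(** The difference of two splittings maps the dual of [L] to [L]; [v] is its coefficient in the
    frame. *)
Lemma split_diff W W' i a tau tau' : frameG W i a tau -> frame W' i a tau' ->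
  exists v : X -> C, forall x, W x -> W' x -> hdiff v x /\ tv a tau' x = tv a tau x + v x *: ev a x.
Proof.
move=> fr fr'; exists (ca a tau (tv a tau')) => x Wx Wx'; split.
  by have [] := hdiff_coords fr Wx (hsec_tv fr' Wx').
have E := coordE fr (tv a tau') Wx.
have l0 := lam_neq0 (fr_triv fr Wx).
have b1 : cb a tau (tv a tau') x = 1.
  have := congr1 (fun w => (gp G x *m w) 0 0) E.
  rewrite mulmxDr -!scalemxAr p_ev (p_tv fr Wx) (p_tv fr' Wx') scaler0 add0r !mxE => E1.
  by apply: (mulIf (invr_neq0 l0)); rewrite -E1 mul1r.
by rewrite {1}E b1 scale1r addrC.
Qed.

Lemma lam_ratio a a' : exists u : X -> C, forall x, vb_dom (gL G) a x -> vb_dom (gL G) a' x ->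
  [/\ hdiff u x, u x != 0 & lam a' x = u x * lam a x].
Proof.
exists (fun x => (vb_triv (gL G) a x *m invmx (vb_triv (gL G) a' x)) 0 0) => x da da'; split.
- by have /holo_onP := @vb_trans_hol _ _ _ (gL G) a' a 0 0; apply.
- have : (vb_triv (gL G) a x *m invmx (vb_triv (gL G) a' x)) 0 0 = vb_triv (gL G) a x 0 0 * lam a' x.
    by rewrite mxE big_ord1.
  move=> ->; rewrite mulf_neq0 ?lam_neq0 //; apply/eqP => E.
  by have /eqP := triv_lam da; rewrite E mul0r eq_sym oner_eq0.
- rewrite mxE big_ord1 mulrAC (triv_lam da) mul1r //.
Qed.

Lemma open_int W W' i i' (a a' : vb_idx (gL G)) (tau tau' : X -> 'M[C]_(2, 1)) : frameG W i a tau -> frame W' i' a' tau' ->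
  open ((W `&` W') `\` S).
Proof.
move=> fr fr'; rewrite setDE; apply: openI; last exact: open_nS.
by apply: openI; [exact: (fr_open fr)|exact: (fr_open fr')].
Qed.

Variable N' : nat.
Local Notation N := N'.+1.
Local Notation V := (SymE pts c G N).
Variable D : operator X.
Hypothesis D_par : parabolic_connection pts V D.

Lemma sum_coef_monom M (A : nat -> {poly C}) (mu : C) b : (b <= M)%N ->
  \sum_(s < M.+1) (mu *: ('X^b : {poly C}))`_s *: A s = mu *: A b.
Proof.
move=> bM; rewrite (bigD1 (Ordinal (bM : (b < M.+1)%N))) //= coefZ coefXn eqxx mulr1.
rewrite big1 ?addr0 // => s /eqP sb; rewrite coefZ coefXn.
case: eqP => [E5|]; last by rewrite mulr0 scale0r.
by case: sb; apply/val_inj.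
Qed.

Lemma desT W i (a : vb_idx (gL G)) (tau : X -> 'M[C]_(2, 1)) (fr : frame W i a tau) m (F : sheaf X MP) T U s y k :
  twist pts k F U s -> U y -> W y -> (forall U s, open U -> U y -> F U s -> desS a tau m m T s y) ->
  exists P : X -> {poly C},
  [/\ \forall x \near y, ~ S x -> s x = homf m (linear_form (ev a x)) (linear_form (tv a tau x)) (P x),
      forall x, (size (P x) <= m.+1)%N &
      forall b, (b <= m)%N -> ogs (fun x => (P x)`_b) y (Num.ceil (T - wt m b y) - k)].
Proof.
move=> tw Uy Wy HF; have [W' [h [oW W'y WU lh Fh]]] := tw y Uy.
have [P [P1 P2 P3 P4]] := HF _ _ oW W'y Fh.
exists (fun x => h x ^ (- k) *: P x); split.
- have nW : \forall x \near y, W' x by apply: open_nbhs_nbhs.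
  apply: filterS2 P1 nW => x e1 Wx nS; have hx : h x != 0 by apply/eqP => /(lh.2 x Wx).1.
  have := congr1 (fun v => h x ^ (- k) *: v) (e1 nS).
  by rewrite scalerA -expfzDr // addNr expr0z scale1r homZ.
- by move=> x; apply: leq_trans (size_scale_leq _ _) (P2 x).
- move=> b bm; rewrite addrC; rewrite (_ : (fun x => _) = fun x => h x ^ (- k) * (P x)`_b).
    exact: ogsM (local_eq_ogs (- k) oW W'y lh) (P3 b bm).
  by apply/funext => x; rewrite coefZ.
Qed.

(** * The connection matrix in one frame *)

Section OneFrame.
Variables (W : set X) (i : rs_idx X) (a : vb_idx (gL G)) (tau : X -> 'M[C]_(2, 1)).
Hypothesis fr : frame W i a tau.
Local Notation H P x := (homf N (linear_form (ev a x)) (linear_form (tv a tau x)) P).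

Lemma homf_uniq x (P Q : {poly C}) : W x -> (size P <= N.+1)%N -> (size Q <= N.+1)%N -> H P x = H Q x -> P = Q.
Proof.
move=> Wx sP sQ E; apply/polyP => b; have [bN|bN] := leqP b N.
  exact: (hom_inj (det_ev_tv fr Wx) E).
by rewrite !nth_default // (leq_trans _ bN).
Qed.

Lemma sec_off U (Q : X -> {poly C}) : open U -> U `<=` W `\` S -> (forall x, (size (Q x) <= N.+1)%N) ->
  (forall x b, U x -> hdiff (fun x => (Q x)`_b) x) -> V 0 U (fun x => H (Q x) x).
Proof.
move=> oU UW sQ hQ; apply: (SymE_intro oU) => y Uy.
have [Wy yS] := UW y Uy; exists W, i, a, tau; split => //; exists Q; split.
- by apply: filterE.
- exact: sQ.
- move=> b bN; rewrite /ogs asboolF //.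
  have : \forall x \near y, U x by apply: open_nbhs_nbhs.
  by apply: filterS => x Ux; exact: hQ.
- by move=> x b bN; rewrite nth_default // (leq_trans (sQ x)).
Qed.

Lemma sec_basis U b : (b <= N)%N -> open U -> U `<=` W `\` S -> V 0 U (fun x => H 'X^b x).
Proof.
move=> bN oU UW; apply: (sec_off (Q := fun=> 'X^b) oU UW) => [x|x k _].
  by rewrite size_polyXn ltnS.
exact: hdiffC.
Qed.

Lemma open_off : open (W `\` S).
Proof. by rewrite setDE; apply: openI; [exact: (fr_open fr)|exact: open_nS]. Qed.

Lemma conn_local U b y : (b <= N)%N -> open U -> U `<=` W `\` S -> U y -> exists P : X -> {poly C},
  [/\ \forall x \near y, D U (fun x => H 'X^b x) i x = H (P x) x,
      forall x, (size (P x) <= N.+1)%N & forall k, hnear (fun x => (P x)`_k) y].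
Proof.
move=> bN oU UW Uy; have [[sD _ _ _ _] _] := D_par; have [Wy yS] := UW y Uy.
have := sD U _ i oU (sec_basis bN oU UW) => tw.
have di := fr_dom fr Wy.
have [|P [P1 P2 P3]] := desT fr tw (conj Uy di) Wy (T := 0) (m := N).
  by move=> U' s' oU' U'y; exact: (desS_Sym fr).
exists P; split => //.
  by apply: filterS2 P1 (near_nS yS) => x h /h.
move=> k; have [kN|kN] := leqP k N; first exact: ogs_hol yS (P3 k kN).
apply: hnear_near (hnearC 0 y); apply: filterE => x.
by rewrite nth_default // (leq_trans (P2 x)).
Qed.

Lemma conn_ex b x : exists P : {poly C}, (size P <= N.+1)%N /\
  ((b <= N)%N -> W x -> ~ S x -> D (W `\` S) (fun x => H 'X^b x) i x = H P x).
Proof.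
have [bN|bN] := leqP b N; last by exists 0; rewrite size_poly0.
have [[Wx xS]|nW] := pselect (W x /\ ~ S x); last first.
  by exists 0; rewrite size_poly0; split => // _ Wx xS; case: nW.
have [P [P1 P2 _]] := conn_local bN open_off (fun _ h => h) (conj Wx xS).
by exists (P x); split => // _ _ _; exact: nbhs_singleton P1.
Qed.

(** Column [b] of the connection matrix as a polynomial: its coefficient of index [c] is the entry
    [A c b]. It is meaningful off [S] only, where monomials in the frame are sections. *)
Definition cA b x : {poly C} := projT1 (cid (conn_ex b x)).

Lemma size_cA b x : (size (cA b x) <= N.+1)%N.
Proof. by rewrite /cA; case: cid => P []. Qed.

Lemma cA_P U b x : (b <= N)%N -> open U -> U `<=` W `\` S -> U x ->
  D U (fun x => H 'X^b x) i x = H (cA b x) x.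
Proof.
move=> bN oU UW Ux; have [Wx xS] := UW x Ux; have [[_ _ cp _ _] _] := D_par.
have <- : D (W `\` S) (fun x => H 'X^b x) i x = H (cA b x) x.
  by rewrite /cA; case: cid => P [_] /=; apply.
symmetry; apply: (cp (W `\` S) U _ _ i open_off oU UW (sec_basis bN open_off (fun _ h => h)) (sec_basis bN oU UW)).
- by [].
- by split => //; exact: (fr_dom fr).
- exact: xS.
Qed.

Lemma cA_hnear b k y : (b <= N)%N -> W y -> ~ S y -> hnear (fun x => (cA b x)`_k) y.
Proof.
move=> bN Wy yS; have Uy : (W `\` S) y by [].
have [P [P1 P2 P3]] := conn_local bN open_off (fun _ h => h) Uy.
have nU : \forall x \near y, (W `\` S) x by apply: open_nbhs_nbhs; split => //; exact: open_off.
apply: hnear_near (P3 k); apply: filterS2 P1 nU => x E Ux.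
have E2 := cA_P bN open_off (fun _ h => h) Ux; rewrite E in E2.
by rewrite (homf_uniq Ux.1 (P2 x) (size_cA b x) E2).
Qed.

Definition dpoly (Q : X -> {poly C}) x : {poly C} :=
  \poly_(b < N.+1) chart_deriv i (fun x => (Q x)`_b) x.
Definition act (Q : X -> {poly C}) x : {poly C} := \sum_(b < N.+1) (Q x)`_b *: cA b x.

Lemma coef_dpoly (Q : X -> {poly C}) x k : (k <= N)%N -> (dpoly Q x)`_k = chart_deriv i (fun y => (Q y)`_k) x.
Proof. by move=> kN; apply: (etrans (coef_poly _ _ _)); rewrite ltnS kN. Qed.

Lemma monomial_coef (mu : X -> C) x b k : (b <= N)%N -> (k <= N)%N ->
  (dpoly (fun y => mu y *: 'X^b) x + act (fun y => mu y *: 'X^b) x)`_k =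
  (if k == b then chart_deriv i mu x else 0) + mu x * (cA b x)`_k.
Proof.
move=> bN kN; rewrite coefD; congr (_ + _); last first.
  by apply: (etrans (congr1 (fun p : {poly C} => p`_k) (sum_coef_monom (fun s => cA s x) (mu x) bN))); exact: coefZ.
apply: (etrans (coef_dpoly _ _ kN)).
have -> : (fun y => (mu y *: ('X^b : {poly C}))`_k) = fun y => mu y * (k == b)%:R.
  by apply/funext => y; rewrite coefZ coefXn.
case: eqP => _.
  by congr (chart_deriv i _ x); apply/funext => y; rewrite mulr1.
rewrite (_ : (fun y => _) = fun=> 0); first exact: chart_derivC.
by apply/funext => y; rewrite mulr0.
Qed.

(** Additivity concerns two sections at a time, so the formula is proved by induction on the size of
    [Q], splitting off the leading monomial. *)
Lemma leibniz U (Q : X -> {poly C}) x : open U -> U `<=` W `\` S -> (forall x, (size (Q x) <= N.+1)%N) ->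
  (forall x b, U x -> hdiff (fun x => (Q x)`_b) x) -> U x ->
  D U (fun x => H (Q x) x) i x = H (dpoly Q x + act Q x) x.
Proof.
move=> oU UW sQ hQ Ux; have [Wx xS] := UW x Ux; have di := fr_dom fr Wx.
have [[_ _ cp ad lz] _] := D_par.
suff K k : (k <= N.+1)%N -> forall Q : X -> {poly C}, (forall x, (size (Q x) <= k)%N) ->
    (forall x b, U x -> hdiff (fun x => (Q x)`_b) x) ->
    D U (fun x => H (Q x) x) i x = H (dpoly Q x + act Q x) x by exact: (K N.+1).
elim: k => [|k IH] kN {}Q {}sQ {}hQ.
  have s0 : V 0 U (fun x => H (0 : {poly C}) x).
    by apply: (sec_off (Q := fun=> 0) oU UW) => [v|v b _]; rewrite ?size_poly0 //; exact: hdiffC.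
  have Q0 : Q = fun=> 0 by apply/funext => v; apply/eqP; rewrite -size_poly_leq0.
  (* Additivity at [0 + 0 = 0] gives [D 0 = 0]. *)
  have := ad U _ _ i oU s0 s0 x (conj Ux di) xS.
  have e0 : (fun v => H (0 : {poly C}) v + H 0 v) = (fun v => H (0 : {poly C}) v).
    by apply/funext => v; rewrite hom0 addr0.
  rewrite e0 Q0 => /eqP; rewrite -subr_eq0 opprD addrA subrr sub0r oppr_eq0 => /eqP ->.
  have -> : dpoly (fun=> 0) x + act (fun=> 0) x = 0.
    apply/polyP => b; rewrite coefD coef_poly coef_sum big1 ?addr0; last first.
      by move=> j _; rewrite coefZ coef0 mul0r.
    rewrite coef0; case: ifP => // _.
    exact: chart_derivC.
  by rewrite hom0.
pose Q1 v := \poly_(b < k) (Q v)`_b; pose q v := (Q v)`_k.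
have kN' : (k <= N)%N by [].
have s1 v : (size (Q1 v) <= k)%N by exact: size_poly.
have h1 v b : U v -> hdiff (fun x => (Q1 x)`_b) v.
  move=> Uv; have [bk|bk] := ltnP b k.
    by rewrite (_ : (fun x => _) = fun x => (Q x)`_b); [exact: hQ|apply/funext => t; rewrite coef_poly bk].
  rewrite (_ : (fun x => _) = fun=> 0); first exact: hdiffC.
  by apply/funext => t; rewrite coef_poly ltnNge bk.
have QE v : Q v = Q1 v + q v *: 'X^k.
  apply/polyP => b; rewrite coefD coefZ coefXn coef_poly; case: (ltngtP b k) => bk.
  - by rewrite mulr0 addr0.
  - by rewrite mulr0 addr0 nth_default // (leq_trans (sQ v)).
  - by rewrite bk mulr1 add0r.
have hq : holo_on U q by apply/holo_onP => v Uv; exact: hQ.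
have sec1 : V 0 U (fun v => H (Q1 v) v).
  by apply: (sec_off oU UW) => // v; exact: leq_trans (s1 v) (ltnW kN).
have seck := sec_basis kN' oU UW.
have sec2 : V 0 U (fun v => q v *: H 'X^k v).
  rewrite (_ : (fun v => _) = fun v => H (q v *: 'X^k) v); last by apply/funext => v; rewrite homZ.
  apply: (sec_off oU UW) => [v|v b Uv]; first by apply: leq_trans (size_scale_leq _ _) _; rewrite size_polyXn.
  rewrite (_ : (fun x => _) = fun x => q x * ('X^k : {poly C})`_b); last by apply/funext => t; rewrite coefZ.
  by apply: hdiffM (hdiffC _ _); exact: hQ.
have -> : (fun v => H (Q v) v) = fun v => H (Q1 v) v + q v *: H 'X^k v.
  by apply/funext => v; rewrite {1}QE homD homZ.
rewrite (ad U _ _ i oU sec1 sec2 x (conj Ux di) xS) (IH (ltnW kN) Q1 s1 h1).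
pose cd b := chart_deriv i (fun v => (Q v)`_b) x.
have lzE : D U (fun v => q v *: H 'X^k v) i x = q x *: D U (fun v => H 'X^k v) i x + cd k *: H 'X^k x.
  exact: (lz U q _ i oU hq seck x (conj Ux di) xS).
rewrite lzE (cA_P kN' oU UW Ux).
rewrite -!homZ -!homD; congr (homf _ _ _ _).
have -> : act Q x = act Q1 x + q x *: cA k x.
  rewrite /act; have kord : (k < N.+1)%N by [].
  rewrite (bigD1 (Ordinal kord)) //= [in RHS](bigD1 (Ordinal kord)) //= coef_poly ltnn scale0r add0r addrC.
  congr (_ + _); apply: eq_bigr => b /eqP bk; rewrite coef_poly.
  case: ltngtP => // h; last by case: bk; apply/val_inj.
  by rewrite nth_default // (leq_trans (sQ x)).
have c1 b : (dpoly Q x)`_b = if (b < N.+1)%N then cd b else 0 by exact: coef_poly.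
have c2 b : (dpoly Q1 x)`_b = if (b < N.+1)%N then (if (b < k)%N then cd b else 0) else 0.
  rewrite coef_poly; congr (if _ then _ else _); case: ltnP => bk.
    by congr (chart_deriv i _ x); apply/funext => v; rewrite coef_poly bk.
  rewrite (_ : (fun v => (Q1 v)`_b) = fun=> 0); first exact: chart_derivC.
  by apply/funext => v; rewrite coef_poly ltnNge bk.
have c3 b : (k < b)%N -> cd b = 0.
  move=> kb; rewrite /cd (_ : (fun v => (Q v)`_b) = fun=> 0); first exact: chart_derivC.
  by apply/funext => v; rewrite nth_default // (leq_trans (sQ v)).
clearbody cd.
have -> : dpoly Q x = dpoly Q1 x + cd k *: 'X^k.
  move: (dpoly Q x) (dpoly Q1 x) c1 c2 => d0 d1 c1 c2.
  apply/polyP => b; rewrite coefD coefZ coefXn c1 c2.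
  case: (ltnP b N.+1) => bN; last by rewrite gtn_eqF ?mulr0 ?addr0 // (leq_trans _ bN).
  case: (ltngtP b k) => bk; [by rewrite mulr0 addr0|by rewrite mulr0 addr0 c3|by rewrite bk mulr1 add0r].
by ring.
Qed.

End OneFrame.

(** * The connection matrix under a change of frame *)

Lemma coef_shift_gt (v : C) j k : (j < k)%N -> (('X + v%:P) ^+ j)`_k = 0.
Proof. by move=> jk; rewrite nth_default // size_XaddCn. Qed.

Lemma coef_shift_eq (v : C) j : (('X + v%:P) ^+ j)`_j = 1.
Proof.
elim: j => [|j IH]; first by rewrite expr0 coef1.
by rewrite exprS mulrDl coefD coefXM IH mul_polyC coefZ coef_shift_gt // mulr0 addr0.
Qed.

Lemma coef_shift_pred (v : C) j : (('X + v%:P) ^+ j.+1)`_j = j.+1%:R * v.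
Proof.
elim: j => [|j IH].
  by rewrite expr1 coefD coefX coefC /= add0r mul1r.
rewrite exprS mulrDl coefD coefXM /= IH mul_polyC coefZ coef_shift_eq mulr1.
by rewrite -[in RHS]natr1 mulrDl mul1r.
Qed.

Lemma size_shift (P : {poly C}) (v : C) : size (P \Po ('X + v%:P)) = size P.
Proof. by rewrite size_comp_poly2 // size_XaddC. Qed.

(** The two highest coefficients of [('X + v%:P) ^+ b] are 1 and [b%:R * v]. Comparing coefficients
    [b + m] and [b + m - 1] yields the top entry unchanged and, below it, the combination of
    neighbouring top entries that drives the recursion. *)
Lemma shift_top (T d : {poly C}) (A : nat -> {poly C}) (v : C) (N b m : nat) :
  (b + m <= N)%N -> (0 < m)%N -> (forall k, (b + m < k)%N -> T`_k = 0) ->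
  (forall s k, (s + m < k)%N -> (A s)`_k = 0) -> (forall k, (b <= k)%N -> d`_k = 0) ->
  T \Po ('X + v%:P) = d + \sum_(s < N.+1) (('X + v%:P) ^+ b)`_s *: A s ->
  T`_(b + m) = (A b)`_(b + m) /\
  T`_(b + m.-1) = (A b)`_(b + m.-1) + v * (b%:R * (A b.-1)`_(b + m.-1) - (b + m)%:R * (A b)`_(b + m)).
Proof.
move=> bmN m0 hT hA hd E.
have bN : (b < N.+1)%N by lia.
have sT : (size T <= (b + m).+1)%N by apply/leq_sizeP => k; exact: hT.
have lhs k : (T \Po ('X + v%:P))`_k = \sum_(j < (b + m).+1) T`_j * (('X + v%:P) ^+ j)`_k.
  rewrite coef_comp_poly (big_ord_widen _ (fun j => T`_j * (('X + v%:P) ^+ j)`_k) sT) big_mkcond.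
  by apply: eq_bigr => j _; case: ltnP => // h; rewrite nth_default ?mul0r.
have rhs k : (b <= k)%N -> (d + \sum_(s < N.+1) (('X + v%:P) ^+ b)`_s *: A s)`_k =
    \sum_(s < N.+1) (('X + v%:P) ^+ b)`_s * (A s)`_k.
  by move=> bk; rewrite coefD hd // add0r coef_sum; apply: eq_bigr => s _; rewrite coefZ.
have r1 : \sum_(s < N.+1) (('X + v%:P) ^+ b)`_s * (A s)`_(b + m) = (A b)`_(b + m).
  rewrite (bigD1 (Ordinal bN)) //= coef_shift_eq mul1r big1 ?addr0 // => s /eqP sb.
  have [h|h] := ltnP b s; first by rewrite coef_shift_gt ?mul0r.
  rewrite hA ?mulr0 // ltn_add2r ltn_neqAle h andbT; apply/eqP => E1; apply: sb.
  exact/val_inj.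
have l1 : \sum_(j < (b + m).+1) T`_j * (('X + v%:P) ^+ j)`_(b + m) = T`_(b + m).
  rewrite big_ord_recr /= coef_shift_eq mulr1 big1 ?add0r // => j _.
  by rewrite coef_shift_gt ?mulr0.
have top : T`_(b + m) = (A b)`_(b + m) by rewrite -l1 -r1 -lhs -rhs ?leq_addr // E.
split => //.
have r2 : \sum_(s < N.+1) (('X + v%:P) ^+ b)`_s * (A s)`_(b + m.-1) =
    (A b)`_(b + m.-1) + b%:R * v * (A b.-1)`_(b + m.-1).
  rewrite (bigD1 (Ordinal bN)) //= coef_shift_eq mul1r; congr (_ + _).
  case: b bN {bmN hT hd E sT lhs rhs r1 l1 top} => [|b] bN.
    rewrite big1 ?mul0r // => s /eqP sb; rewrite coef_shift_gt ?mul0r // lt0n.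
    by apply/eqP => E1; apply: sb; exact/val_inj.
  have bN' : (b < N.+1)%N by lia.
  rewrite (bigD1 (Ordinal bN')) /=; last by apply/eqP => /(congr1 val) /=; lia.
  rewrite coef_shift_pred big1 ?addr0 // => s /andP[/eqP s1 /eqP s2].
  have [h|h] := ltnP b.+1 s; first by rewrite coef_shift_gt ?mul0r.
  rewrite hA ?mulr0 //.
  have n1 : (s : nat) <> b.+1 by move=> E1; apply: s1; exact/val_inj.
  have n2 : (s : nat) <> b by move=> E1; apply: s2; exact/val_inj.
  lia.
have l2 : \sum_(j < (b + m).+1) T`_j * (('X + v%:P) ^+ j)`_(b + m.-1) =
    T`_(b + m.-1) + (b + m)%:R * v * T`_(b + m).
  have e1 : (b + m = (b + m.-1).+1)%N by lia.
  move: (b + m.-1)%N e1 => k0 ->; rewrite big_ord_recr /= coef_shift_pred big_ord_recr /= coef_shift_eq mulr1.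
  rewrite big1 ?add0r => [|j _]; last by rewrite coef_shift_gt ?mulr0.
  by congr (_ + _); rewrite mulrC.
have := congr1 (fun p : {poly C} => p`_(b + m.-1)) E; rewrite lhs rhs ?leq_addr // l2 r2 top => E1.
by apply: (addIr ((b + m)%:R * v * (A b)`_(b + m))); rewrite E1; ring.
Qed.

Local Notation eh a x := (linear_form (ev a x)).
Local Notation th a tau x := (linear_form (tv a tau x)).

Local Notation hform a tau x := (homf N (linear_form (ev a x)) (linear_form (tv a tau x))).

Lemma D_ext U s s' i x : open U -> V 0 U s -> V 0 U s' -> (forall x, U x -> s x = s' x) ->
  U x -> dom i x -> ~ S x -> D U s i x = D U s' i x.
Proof.
move=> oU Vs Vs' Es Ux dx xS; have [[_ _ cp _ _] _] := D_par.
exact: (cp U U s s' i oU oU (fun _ h => h) Vs Vs' (fun x Ux _ => Es x Ux) x (conj Ux dx) xS).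
Qed.

Lemma hdiff_coefM (P Q : X -> {poly C}) x : (forall k, hdiff (fun y => (P y)`_k) x) ->
  (forall k, hdiff (fun y => (Q y)`_k) x) -> forall k, hdiff (fun y => (P y * Q y)`_k) x.
Proof.
move=> hP hQ k; rewrite (_ : (fun y => _) = fun y => \sum_(j < k.+1) (P y)`_j * (Q y)`_(k - j)).
  by apply: hdiff_sum => j; apply: hdiffM.
by apply/funext => y; rewrite coefM.
Qed.

Lemma hdiff_shift (v : X -> C) x b k : hdiff v x -> hdiff (fun y => (('X + (v y)%:P) ^+ b)`_k) x.
Proof.
move=> hv; elim: b k => [|b IH] k.
  rewrite (_ : (fun y => _) = fun=> (1 : {poly C})`_k); first exact: hdiffC.
  by apply/funext => y; rewrite expr0.
rewrite (_ : (fun y => _) = fun y => (('X + (v y)%:P) * ('X + (v y)%:P) ^+ b)`_k).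
  apply: hdiff_coefM => // j; case: j => [|[|j]].
  - by rewrite (_ : (fun y => _) = v) //; apply/funext => y; rewrite coefD coefX coefC /= add0r.
  - rewrite (_ : (fun y => _) = fun=> 1); first exact: hdiffC.
    by apply/funext => y; rewrite coefD coefX coefC /= addr0.
  - rewrite (_ : (fun y => _) = fun=> 0); first exact: hdiffC.
    by apply/funext => y; rewrite coefD coefX coefC /= addr0.
by apply/funext => y; rewrite exprS.
Qed.

(** Both sides express the connection on the same section, the monomial in the new splitting,
    through the old frame. *)
Lemma cA_unip W W' i a tau tau' (fr : frameG W i a tau) (fr' : frame W' i a tau')
  U (v : X -> C) b x : open U -> U `<=` W `\` S -> U `<=` W' `\` S ->
  (forall y, U y -> hdiff v y) -> (forall y, U y -> tv a tau' y = tv a tau y + v y *: ev a y) ->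
  (b <= N)%N -> U x -> cA fr' b x \Po ('X + (v x)%:P) = dpoly i (fun y => ('X + (v y)%:P) ^+ b) x +
   act fr (fun y => ('X + (v y)%:P) ^+ b) x.
Proof.
move=> oU U1 U2 hv E bN Ux; have [Wx xS] := U1 x Ux.
have di := fr_dom fr Wx.
pose Q y := ('X + (v y)%:P) ^+ b.
have sQ y : (size (Q y) <= N.+1)%N by rewrite size_XaddCn ltnS.
have hQ y k : U y -> hdiff (fun y => (Q y)`_k) y by move=> /hv; exact: hdiff_shift.
have tE y : U y -> th a tau' y = th a tau y + v y *: eh a y.
  by move=> /E ->; rewrite linear_formD linear_formZ.
have s1 := sec_basis fr' bN oU U2.
have s2 := sec_off fr oU U1 sQ hQ.
have sE y : U y -> homf N (eh a y) (th a tau' y) 'X^b = homf N (eh a y) (th a tau y) (Q y).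
  by move=> Uy; rewrite (tE y Uy); exact: hom_shiftX.
have E0 := D_ext oU s1 s2 sE Ux di xS.
have E2 := cA_P fr' bN oU U2 Ux.
have E3 := leibniz fr oU U1 sQ hQ Ux.
have E4 := hom_shift (eh a x) (th a tau x) (v x) (size_cA fr' b x).
have E5 := congr1 (fun q => homf N (eh a x) q (cA fr' b x)) (esym (tE x Ux)).
have E1 := etrans (esym E4) (etrans E5 (etrans (esym E2) (etrans E0 E3))).
apply: (homf_uniq fr Wx _ _ E1).
  by rewrite size_shift; exact: size_cA.
apply: leq_trans (size_polyD _ _) _; rewrite geq_max; apply/andP; split; first exact: size_poly.
apply: leq_trans (size_sum _ _ _) _; apply/bigmax_leqP => k _.
by apply: leq_trans (size_scale_leq _ _) _; exact: size_cA.
Qed.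

Lemma homf_scale m (e t : MP) (u : C) (P : {poly C}) : u != 0 ->
  homf m (u *: e) (u^-1 *: t) P = homf m e t (\poly_(b < m.+1) (P`_b * (u ^+ (m - b) * u ^- b))).
Proof.
move=> u0; rewrite /homf; apply: eq_bigr => b _; rewrite coef_poly ltn_ord.
by rewrite !exprZn -scalerAl -scalerAr !scalerA exprVn mulrA.
Qed.

(** With the splitting kept, a new trivialization multiplies the two frame vectors by [u] and
    [u^-1], and the new coordinate multiplies the coefficient of the form. The derivative of the
    scaling factor touches the diagonal only. *)
Lemma cA_scale W W' i i' a a' tau (fr : frameG W i a tau) (fr' : frame W' i' a' tau)
  U (u : X -> C) b k x : open U -> U `<=` W `\` S -> U `<=` W' `\` S ->
  (forall y, U y -> hdiff u y) -> (forall y, U y -> u y != 0) ->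
  (forall y, U y -> lam a' y = u y * lam a y) -> (b <= N)%N -> (k <= N)%N -> U x ->
  (cA fr' b x)`_k * (u x ^+ (N - k) * u x ^- k) = chart_deriv i' (z i) x *
   ((if k == b then chart_deriv i (fun y => u y ^+ (N - b) * u y ^- b) x else 0) +
     (u x ^+ (N - b) * u x ^- b) * (cA fr b x)`_k).
Proof.
move=> oU U1 U2 hu u0 E bN kN Ux; have [Wx xS] := U1 x Ux; have [Wx' _] := U2 x Ux.
have di := fr_dom fr Wx; have di' := fr_dom fr' Wx'.
pose mu y := u y ^+ (N - b) * u y ^- b; pose Q y := mu y *: ('X^b : {poly C}).
have hmu y : U y -> hdiff mu y.
  move=> Uy; apply: hdiffM; first exact: hdiffX (hu y Uy).
  apply: hdiffV; first by rewrite expf_neq0 // u0.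
  exact: hdiffX (hu y Uy).
have sQ y : (size (Q y) <= N.+1)%N by apply: leq_trans (size_scale_leq _ _) _; rewrite size_polyXn ltnS.
have hQ y j : U y -> hdiff (fun y => (Q y)`_j) y.
  move=> Uy; rewrite (_ : (fun y => _) = fun y => mu y * ('X^b : {poly C})`_j).
    exact: hdiffM (hmu y Uy) (hdiffC _ _).
  by apply/funext => t; rewrite coefZ.
have eE y : U y -> eh a' y = u y *: eh a y.
  move=> Uy; rewrite /ev E // -linear_formZ scalemxAr; congr (linear_form (_ *m _)).
  by apply/matrixP => p q; rewrite !mxE.
have tE y : U y -> th a' tau y = (u y)^-1 *: th a tau y.
  move=> Uy; rewrite /tv E // -linear_formZ scalemxAr; congr (linear_form (_ *m _)).
  by apply/matrixP => p q; rewrite !mxE invfM.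
have s1 := sec_basis fr' bN oU U2.
have s2 := sec_off fr oU U1 sQ hQ.
have sE y : U y -> homf N (eh a' y) (th a' tau y) 'X^b = homf N (eh a y) (th a tau y) (Q y).
  by move=> Uy; rewrite (eE y Uy) (tE y Uy) (hom_scale _ _ bN (u0 y Uy)) /Q homZ.
have E1 := D_ext oU s1 s2 sE Ux di xS.
have E3 := leibniz fr oU U1 sQ hQ Ux.
have E4 := cA_P fr' bN oU U2 Ux.
have [[_ fo _ _ _] _] := D_par.
have E2 : homf N (eh a' x) (th a' tau x) (cA fr' b x) =
    chart_deriv i' (z i) x *: homf N (eh a x) (th a tau x) (dpoly i Q x + act fr Q x).
  exact: (etrans (esym E4) (etrans (fo U _ oU s1 i' i x (conj Ux xS) di' di)
    (congr1 (fun v => chart_deriv i' (z i) x *: v) (etrans E1 E3)))).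
have c1 := monomial_coef fr mu x bN kN.
have E5 := congr1 (fun e => homf N e (th a' tau x) (cA fr' b x)) (eE x Ux).
have E6 := congr1 (fun t => homf N (u x *: eh a x) t (cA fr' b x)) (tE x Ux).
have E7 := homf_scale N (eh a x) (th a tau x) (cA fr' b x) (u0 x Ux).
have E8 := etrans (esym E7) (etrans (esym E6) (etrans (esym E5) (etrans E2 (esym (homZ _ _ _ _ _))))).
have E9 := hom_inj (det_ev_tv fr Wx) E8 kN.
clear E1 E2 E3 E4 E5 E6 E7 E8 sE s1 s2 fo.
move: (dpoly i Q x + act fr Q x) c1 E9 => p c1.
move: (chart_deriv i' (z i) x) => T0; rewrite -/mu -/(mu x).
move: (cA fr' b x) (cA fr b x) c1 => A' A0 c1 E9.
have E10 : A'`_k * (u x ^+ (N - k) * u x ^- k) = (T0 *: p)`_k.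
  by rewrite -E9 coef_poly ltnS kN.
by rewrite E10 coefZ c1.
Qed.

(** * Orders of the connection matrix at a marked point *)

Lemma zero_section W i a tau (fr : frameG W i a tau) y : W y ->
  (forall k : 'I_n, W (pts k) -> pts k = y) -> V 0 W (fun=> 0).
Proof.
move=> Wy gd; have h0 : holo_on W (fun=> 0) by apply/holo_onP => x _; exact: hdiffC.
have := mono_Sym fr Wy gd (leq0n N) h0 (erefl (Num.ceil (0 - wt N 0 y))).
congr (V 0 W _); apply/funext => x; by rewrite /mono mulr0 scale0r.
Qed.

Lemma hl_deriv W i a tau (fr : frameG W i a tau) y (k : int) x : W y -> S y -> W x -> ~ S x ->
  hdiff (fun x => hl i y x ^ k) x /\
  chart_deriv i (fun x => hl i y x ^ k) x = k%:~R * hl i y x ^ k / hl i y x.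
Proof.
move=> Wy yS Wx xS; have dx := fr_dom fr Wx; have h0 := hl_neq0 fr Wy Wx xS.
have hh := hl_hdiff fr y Wx; split; first exact: hdiffXz.
have := chart_derivXz k dx hh h0 => E; apply: (etrans E).
have -> : hl i y = fun x => z i x - z i y by apply/funext => v; rewrite /hl asboolT.
by have E1 := chart_deriv_coordB (z i y) dx; rewrite (congr1 (fun v => _ * v) E1) mulr1.
Qed.

(** The parabolic condition is applied to one monomial, shifted by a power of the local equation so
    that its weight falls into [[0, 1)]. That the residue minus [t] lands in a strictly higher step
    [t'] says that the orders exceed [t - wt N j y]; undoing the shift gives the bound and the
    eigenvalue [wt N b y]. *)
Lemma conn_orders W i a tau (fr : frameG W i a tau) y b j : W y -> S y ->
  (forall k : 'I_n, W (pts k) -> pts k = y) -> (b <= N)%N -> (j <= N)%N ->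
  og (fun x => (z i x - z i y) * (cA fr b x)`_j - (if j == b then cr (wt N b y) else 0)) y
    (Num.floor (wt N b y - wt N j y) + 1).
Proof.
move=> Wy yS gd bN jN; have di := fr_dom fr Wy; have [k0 _ ky] := yS.
(* [t] is the fractional part of the weight. The power [k] of the local equation adds [k] to the
   residue, which turns [t] back into the weight itself. *)
pose w := wt N b y; pose k := - Num.floor w; pose t := w - (Num.floor w)%:~R.
have t01 : 0 <= t < 1.
  by have := floor_itv w; rewrite intrD /t => /andP[h1 h2]; apply/andP; split; lra.
pose s := mono i a tau y N b k (fun=> 1).
have h1 : holo_on W (fun=> 1) by apply/holo_onP => x _; exact: hdiffC.
have V0s : V 0 W s.
  have kE : k = Num.ceil (0 - w) by rewrite /k sub0r ceilNfloor opprK.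
  exact: (mono_Sym fr Wy gd bN h1 kE).
have Vts : V t W s.
  have kE : k = Num.ceil (t - w); last exact: (mono_Sym fr Wy gd bN h1 kE).
  by rewrite /t (_ : w - _ - w = k%:~R) ?intrKceil // /k intrN; ring.
have fl : in_flag pts V t y s.
  exists W, s; split => //; first exact: (fr_open fr).
  apply: (twist_intro fr Wy gd).
  rewrite (_ : (fun x => _) = fun=> 0); first exact (zero_section fr Wy gd).
  by apply/funext => x; rewrite subrr scaler0.
rewrite -ky in fl di Wy.
have [_ [t' /andP[tt' t'1]]] := D_par.2 k0 i W s t di (fr_open fr) Wy V0s t01 fl.
rewrite ky in di Wy *; move=> [W1 [s' [oW1 W1y Vs' tw]]].
have [P [P1 P2 P3 _]] := desS_Sym fr oW1 W1y Wy Vs'.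
have [|Q [Q1 Q2 Q3]] := desT fr tw W1y Wy (T := 0) (m := N).
  by move=> U' s'' oU' U'y; exact: (desS_Sym fr).
pose q x := hl i y x ^ k *: ('X^b : {poly C}).
pose U := W `\` S.
have oU : open U by exact: open_off fr.
have UU : U `<=` W `\` S by [].
have sq x : (size (q x) <= N.+1)%N.
  by apply: leq_trans (size_scale_leq _ _) _; rewrite size_polyXn ltnS.
have cq l : (fun x => (q x)`_l) = fun x => hl i y x ^ k * (l == b)%:R.
  by apply/funext => x; rewrite coefZ coefXn.
have hq x l : U x -> hdiff (fun x => (q x)`_l) x.
  move=> [Wx xS]; rewrite cq; apply: hdiffM (hdiffC _ _).
  by have [] := hl_deriv fr k Wy yS Wx xS.
have sE x : s x = hform a tau x (q x).
  by rewrite /s /mono mulr1 /q homZ homX.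
have V0q := sec_off fr oU UU sq hq.
have DE x : U x -> D W s i x = hform a tau x (dpoly i q x + act fr q x).
  move=> Ux; have [[_ _ cp _ _] _] := D_par.
  rewrite -(leibniz fr oU UU sq hq Ux).
  have [Wx xS] := Ux.
  exact: (cp W U s _ i (fr_open fr) oU (fun _ h => h.1) V0s V0q (fun x _ _ => sE x) x (conj Ux (fr_dom fr Wx)) xS).
have key x : U x -> s' x = hform a tau x (P x) ->
    (fun y0 => residue_rep D i y W s y0 - (t%:C)%C *: s y0 - s' y0) x = hform a tau x (Q x) ->
    hl i y x ^ k * ((z i x - z i y) * (cA fr b x)`_j - (if j == b then cr w else 0)) = (P x + Q x)`_j.
  move=> Ux EP EQ; have [Wx xS] := Ux.
  have h0 := hl_neq0 fr Wy Wx xS.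
  have hz : hl i y x = z i x - z i y by rewrite /hl asboolT.
  pose F p := hform a tau x p.
  have E1 : F (P x + Q x) = F ((z i x - z i y) *: (dpoly i q x + act fr q x) - cr t *: q x).
    have FE (a1 a2 : C) (p1 p2 : {poly C}) : F (a1 *: p1 - a2 *: p2) = a1 *: F p1 - a2 *: F p2.
      by rewrite /F homD -scaleNr !homZ scaleNr.
    have F2 (p1 p2 : {poly C}) : F (p1 + p2) = F p1 + F p2 by exact: homD.
    have E3 : F (P x) + F (Q x) = (z i x - z i y) *: D W s i x - cr t *: s x.
      by rewrite /F -EP -EQ /= addrC subrK.
    rewrite F2 E3 FE; congr (_ *: _ - _ *: _); [exact: DE|exact: sE].
  have E2 := hom_inj (det_ev_tv fr Wx) E1 jN.
  have c1 := monomial_coef fr (fun x => hl i y x ^ k) x bN jN.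
  have [_ dk] := hl_deriv fr k Wy yS Wx xS.
  rewrite dk in c1.
  have c3 : (q x)`_j = hl i y x ^ k * (j == b)%:R by rewrite coefZ coefXn.
  have tw' : cr t = cr w + k%:~R.
    by rewrite /t /k intrN crB; congr (_ - _); rewrite /cr rmorph_int.
  move: E2 c1 c3; rewrite -/q; move: (dpoly i q x + act fr q x) (q x) (P x + Q x) => p1 p3 p4 E2 c1 c3.
  rewrite E2 coefB !coefZ c1 c3 tw' -hz.
  move: (cA fr b x)`_j (hl i y x ^ k) (hl i y x) h0 (cr w) (k%:~R : C) => A hk h h0 w0 kC.
  by case: eqP => _ /=; field.
have nU : \forall x \near y, x <> y -> U x.
  have nW : \forall x \near y, W x by apply: open_nbhs_nbhs; split => //; exact: (fr_open fr).
  by apply: filterS2 nW (near_S pts y) => x h1' h2 /h2.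
have oPQ : og (fun x => (P x + Q x)`_j) y (Num.ceil (t' - wt N j y)).
  rewrite (_ : (fun x => _) = fun x => (P x)`_j + (Q x)`_j); last by apply/funext => x; rewrite coefD.
  apply: ogD; first exact: ogs_in yS (P3 j jN).
  (* The error term lies in [V_0(-S)], hence has order at least one more than for step 0; this is
     enough for step [t'] because [t' <= 1]. *)
  apply: og_weak (ogs_in yS (Q3 j jN)); rewrite opprK ceil_le_int intrD.
  by have := ceil_ge (0 - wt N j y); lra.
have ohk : og (fun x => hl i y x ^ (- k)) y (- k).
  have := oe_og (oe_exprz (- k) (oe_coord di)); rewrite mul1r; apply: og_ext.
  by apply: filterE => x _; rewrite /hl asboolT.
have := ogM ohk oPQ => og1.
have : og (fun x => (z i x - z i y) * (cA fr b x)`_j - (if j == b then cr w else 0)) y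
    (- k + Num.ceil (t' - wt N j y)).
  apply: og_ext og1; apply: filterS2 (filterI P1 Q1) nU => x [e1 e2] h xy.
  have Ux := h xy; have [Wx xS] := Ux; rewrite -(key x Ux (e1 xS) (e2 xS)).
  by rewrite mulrA -expfzDr ?(hl_neq0 fr) // addNr expr0z mul1r.
apply: og_weak.
suff : Num.floor (w - wt N j y) + 1 + k <= Num.ceil (t' - wt N j y).
  rewrite -/w; move: (Num.floor _) (Num.ceil _) (k) => p p' k'; clear; lia.
have h2 := floor_itv (w - wt N j y); have h3 := ceil_ge (t' - wt N j y).
have : ((Num.floor (w - wt N j y) + k)%:~R : R) < (Num.ceil (t' - wt N j y))%:~R.
  rewrite intrD /k intrN; apply: lt_le_trans h3; move: tt'; rewrite /t.
  by move: h2 => /andP[h2 _]; lra.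
rewrite ltr_int; move: (Num.floor _) (Num.ceil _) (k) => p p' k'; clear; lia.
Qed.
(** Below the diagonal the entries are multiplied by a factor. On the diagonal, where the scaling
    factor is [u] to the power [N - 2 * b], its logarithmic derivative appears as well. *)
Lemma cA_rescale W W' i i' a a' tau (fr : frameG W i a tau) (fr' : frame W' i' a' tau)
  U (u : X -> C) b x : open U -> U `<=` W `\` S -> U `<=` W' `\` S ->
  (forall y, U y -> hdiff u y) -> (forall y, U y -> u y != 0) ->
  (forall y, U y -> lam a' y = u y * lam a y) -> (b <= N)%N -> U x ->
  (forall m, (0 < m)%N -> (b + m <= N)%N ->
    (cA fr' b x)`_(b + m) = chart_deriv i' (z i) x * u x ^+ (2 * m) * (cA fr b x)`_(b + m)) /\
  (cA fr' b x)`_b = chart_deriv i' (z i) x *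
    ((cA fr b x)`_b + (N%:R - 2 * b%:R) * (chart_deriv i u x / u x)).
Proof.
move=> oU U1 U2 hu u0 E bN Ux.
have sc k (kN : (k <= N)%N) := cA_scale fr fr' oU U1 U2 hu u0 E bN kN Ux.
have ux := u0 x Ux; split; last first.
  have alg (A' A0 T0 p d k : C) : p != 0 -> A' * p = T0 * (k * d * p + p * A0) -> A' = T0 * (A0 + k * d).
    by move=> p0 E1; apply: (mulIf p0); rewrite E1; ring.
  have := sc b bN; rewrite eqxx.
  have dx := fr_dom fr (U1 x Ux).1.
  have -> : chart_deriv i (fun y => u y ^+ (N - b) * u y ^- b) x =
      (N%:R - 2 * b%:R) * (chart_deriv i u x / u x) * (u x ^+ (N - b) * u x ^- b).
    have uz y : U y -> u y ^+ (N - b) * u y ^- b = u y ^ ((N - b)%:Z - b%:Z).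
      by move=> Uy; rewrite expfzDr ?u0 // exprnN.
    have nU : \forall y \near x, U y by apply: open_nbhs_nbhs.
    have hz : hdiff (fun y => u y ^ ((N - b)%:Z - b%:Z)) x by apply: hdiffXz ux (hu x Ux).
    have nz : \forall y \near x, u y ^ ((N - b)%:Z - b%:Z) = u y ^+ (N - b) * u y ^- b.
      by apply: filterS nU => y /uz.
    have E1 := chart_deriv_near dx nz hz.
    have E2 := chart_derivXz ((N - b)%:Z - b%:Z) dx (hu x Ux) ux.
    apply: (etrans (esym E1)); apply: (etrans E2); rewrite (uz x Ux).
    have -> : (((N - b)%:Z - b%:Z)%:~R : C) = N%:R - 2 * b%:R.
      by rewrite intrD intrN -!pmulrn natrB //; ring.
    by move: (u x ^+ (N - b) * u x ^- b) (chart_deriv i u x) (u x) ux => p q r r0; field.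
  have p1 : u x ^+ (N - b) * u x ^- b != 0 by rewrite mulf_neq0 ?invr_eq0 ?expf_neq0.
  exact (@alg _ _ _ _ _ _ p1).
move=> m m0 bmN; have := sc (b + m)%N bmN; rewrite -[X in _ == X]addn0 eqn_add2l eqn0Ngt m0 add0r.
move: (cA fr' b x)`_(b + m) (cA fr b x)`_(b + m) (chart_deriv i' (z i) x) => A' A0 T0 E1.
have e1 : (N - b = (N - (b + m)) + m)%N by lia.
rewrite e1 !exprD in E1.
have p1 : u x ^+ (N - (b + m)) != 0 by rewrite expf_neq0.
have p2 : u x ^+ m != 0 by rewrite expf_neq0.
have p3 : u x ^+ b != 0 by rewrite expf_neq0.
rewrite mulnC exprM expr2.
move: (u x ^+ (N - (b + m))) (u x ^+ m) (u x ^+ b) p1 p2 p3 E1 => q1 q2 q3 p1 p2 p3 E1.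
apply: (mulIf (mulf_neq0 p1 (invr_neq0 (mulf_neq0 p3 p2)))); rewrite E1.
by field; rewrite p2 p3.
Qed.

Definition vanishes_above m := forall W i a tau (fr : frameG W i a tau) x b m',
  W x -> ~ S x -> (m < m')%N -> (b + m' <= N)%N -> (cA fr b x)`_(b + m') = 0.

Lemma cA_top m W W' i a tau tau' (fr : frameG W i a tau) (fr' : frame W' i a tau') (v : X -> C) b x :
  vanishes_above m -> (0 < m)%N -> (b + m <= N)%N ->
  (forall x, W x -> W' x -> hdiff v x /\ tv a tau' x = tv a tau x + v x *: ev a x) ->
  W x -> W' x -> ~ S x -> (cA fr' b x)`_(b + m) = (cA fr b x)`_(b + m) /\
  (cA fr' b x)`_(b + m.-1) = (cA fr b x)`_(b + m.-1) +
    v x * (b%:R * (cA fr b.-1 x)`_(b + m.-1) - (b + m)%:R * (cA fr b x)`_(b + m)).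
Proof.
move=> vm m0 bmN hv Wx Wx' xS; pose U := (W `&` W') `\` S.
have oU : open U by exact: open_int fr fr'.
have U1 : U `<=` W `\` S by move=> y [[]].
have U2 : U `<=` W' `\` S by move=> y [[]].
have bN : (b <= N)%N by lia.
have Ux : U x by [].
have hvU y : U y -> hdiff v y by move=> [[h1 h2] _]; have [] := hv y h1 h2.
have tU y : U y -> tv a tau' y = tv a tau y + v y *: ev a y.
  by move=> [[h1 h2] _]; have [] := hv y h1 h2.
have E := cA_unip fr fr' oU U1 U2 hvU tU bN Ux.
have van W0 tau0 (f0 : frame W0 i a tau0) s k : W0 x -> (s <= N)%N -> (s + m < k)%N -> (cA f0 s x)`_k = 0.
  move=> W0x sN smk; have [kN|kN] := leqP k N.
    have := vm _ _ _ _ f0 x s (k - s)%N W0x xS; have -> : (s + (k - s) = k)%N by lia.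
    by apply => //; lia.
  by rewrite nth_default // (leq_trans (size_cA f0 s x)).
have hd k : (b <= k)%N -> (dpoly i (fun y => ('X + (v y)%:P) ^+ b) x)`_k = 0.
  move=> bk; have [kN|kN] := leqP k N; last by rewrite nth_default // (leq_trans (size_poly _ _)).
  apply: (etrans (coef_dpoly _ _ _ kN)); move: bk; rewrite leq_eqVlt => /orP[/eqP <-|bk].
    rewrite (_ : (fun y => _) = fun=> 1); first exact: chart_derivC.
    by apply/funext => y; rewrite coef_shift_eq.
  rewrite (_ : (fun y => _) = fun=> 0); first exact: chart_derivC.
  by apply/funext => y; rewrite coef_shift_gt.
have hA s k : (s + m < k)%N -> (if (s <= N)%N then cA fr s x else 0)`_k = 0.
  by move=> smk; case: leqP => sN; rewrite ?coef0 //; exact: van.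
have [||r1 r2] := shift_top bmN m0 _ hA hd (T := cA fr' b x) (v := v x).
- by move=> k bmk; exact: van.
- apply: (etrans E); congr (_ + _); apply: eq_bigr => s _.
  by have := ltn_ord s; rewrite ltnS => ->.
have b1N : (b.-1 <= N)%N by lia.
by move: r1 r2; rewrite bN b1N.
Qed.

(** Under the vanishing hypothesis a change of splitting leaves the entry alone, and a change of
    coordinate and trivialization multiplies it. The multiplier is that of [kap ^+ m] up to [m - 1]
    factors of the coordinate change, which [phi] will absorb. *)
Lemma cA_inv m W W' i i' a a' tau tau' (fr : frameG W i a tau) (fr' : frame W' i' a' tau')
  (u : X -> C) b x : vanishes_above m -> (0 < m)%N -> (b + m <= N)%N ->
  (forall x, vb_dom (gL G) a x -> vb_dom (gL G) a' x -> [/\ hdiff u x, u x != 0 & lam a' x = u x * lam a x]) ->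
  W x -> W' x -> ~ S x ->
  (cA fr' b x)`_(b + m) = chart_deriv i' (z i) x * u x ^+ (2 * m) * (cA fr b x)`_(b + m).
Proof.
move=> vm m0 bmN hu Wx Wx' xS.
have oW : open (W `&` W') by apply: openI; [exact: (fr_open fr)|exact: (fr_open fr')].
(* An intermediate frame, with the old coordinate and trivialization and the new splitting,
   separates the two kinds of change. *)
have fr2 : frameG (W `&` W') i a tau'.
  have f1 : frame (W `&` W') i' a' tau' by apply: frame_sub fr' => // y [].
  split => //; [by move=> y [/(fr_dom fr)]|by move=> y [/(fr_triv fr)]|exact: (fr_hol f1)|exact: (fr_split f1)].
have [v hv] := split_diff fr fr2.
have [<- _] := cA_top fr fr2 (b := b) vm m0 bmN hv Wx (conj Wx Wx') xS.
have oU := open_int fr fr'.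
have U1 : ((W `&` W') `\` S) `<=` (W `&` W') `\` S by [].
have U2 : ((W `&` W') `\` S) `<=` W' `\` S by move=> y [[]].
have bN : (b <= N)%N by lia.
have dU y : ((W `&` W') `\` S) y -> [/\ hdiff u y, u y != 0 & lam a' y = u y * lam a y].
  by move=> [[h1 h2] _]; apply: hu; [exact: (fr_triv fr)|exact: (fr_triv fr')].
have [||| h _] := cA_rescale fr2 fr' (u := u) oU U1 U2 _ _ _ bN (conj (conj Wx Wx') xS).
- by move=> y /dU [].
- by move=> y /dU [].
- by move=> y /dU [].
exact: h.
Qed.

(** * Order bounds, and the action on the filtration *)

Definition sfl m y : int := if y \in codom pts then Num.floor ((2 * m)%:R * gam y) else 0.

(** From [gam y > 1/3] the floor plus 1 exceeds [2 * m / 3]; integrality turns the strict inequality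
    into this one. For [m = 0] it is checked directly. *)
Lemma sfl_ge m y : y \in codom pts -> 2 * m%:Z + 1 <= 3 * (sfl m y + 1).
Proof.
rewrite /sfl => ->; have /andP[g1 _] := gam_bounds y.
have /andP[_ f1] := floor_itv ((2 * m)%:R * gam y).
have [->|m0] := posnP m; first by rewrite muln0 mul0r floor0.
have : ((2 * m%:Z)%:~R : R) < (3 * (Num.floor ((2 * m)%:R * gam y) + 1))%:~R.
  have -> : ((2 * m%:Z)%:~R : R) = (2 * m)%:R by rewrite intrM natrM.
  rewrite intrM; move: f1 => f1.
  have mp : 0 < (2 * m)%:R :> R by rewrite ltr0n; lia.
  have h : 0 < (2 * m)%:R * (gam y - 1 / 3) by apply: mulr_gt0 => //; lra.
  have e : (2 * m)%:R * (gam y - 1 / 3) = (2 * m)%:R * gam y - (2 * m)%:R / 3 by ring.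
  by rewrite e in h; lra.
by rewrite ltr_int; lia.
Qed.

Lemma sfl_1 y : sfl 1 y = 0.
Proof.
rewrite /sfl; case: ifP => // _; have /andP[g1 g2] := gam_bounds y.
by apply: floor_def; rewrite add0r muln1; apply/andP; split; lra.
Qed.

Lemma cA_og W i a tau (fr : frameG W i a tau) y b m : W y ->
  (forall k : 'I_n, W (pts k) -> pts k = y) -> (0 < m)%N -> (b + m <= N)%N ->
  og (fun x => (cA fr b x)`_(b + m)) y (sfl m y).
Proof.
move=> Wy gd m0 bmN; have bN : (b <= N)%N by lia.
rewrite /sfl; case: ifPn => yS; last first.
  apply: og_hnear; apply: cA_hnear => //; by move=> /S_codom h; rewrite h in yS.
have yS' : S y by exact/S_codom.
have := conn_orders fr Wy yS' gd bN bmN.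
rewrite -[X in _ == X]addn0 eqn_add2l eqn0Ngt m0 /=.
have di := fr_dom fr Wy; have := oe_og (oeV (oe_coord di)) => o1 o2.
have -> : Num.floor ((2 * m)%:R * gam y) = - 1 + (Num.floor (wt N b y - wt N (b + m) y) + 1).
  rewrite addrCA addrN addr0 /wt natrD natrM; congr Num.floor.
  by ring.
apply: og_ext (ogM o1 o2); apply: filterS (near_dom di) => x dx xy.
by rewrite subr0 mulKf // coord_neq.
Qed.

(** The diagonal entry has at most a simple pole, whose residue is the weight of the monomial. *)
Lemma cA_diag W i a tau (fr : frameG W i a tau) y b : W y ->
  (forall k : 'I_n, W (pts k) -> pts k = y) -> (b <= N)%N ->
  ppart ((fun x => (cA fr b x)`_b) \o rs_param i) (z i y) (if y \in codom pts then cr (wt N b y) else 0).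
Proof.
move=> Wy gd bN; have di := fr_dom fr Wy; case: ifPn => yS; last first.
  apply: ppart_hnear => //; apply: cA_hnear => //; by move=> /S_codom h; rewrite h in yS.
have yS' : S y by exact/S_codom.
have := conn_orders fr Wy yS' gd bN bN.
rewrite eqxx subrr floor0 add0r => /og_chart /(_ di) [g hg E].
have e1 := oe_coord di.
have p1 := dlog_ppart di e1.
have := ppartD (ppartMl (cr (wt N b y)) p1) (ppart_hnear di hg); rewrite addr0 mulr1.
pose f x := cr (wt N b y) * (chart_deriv i (fun y0 => z i y0 - z i y) x / (z i x - z i y)) + g x.
apply: (ppart_near (f := f) di); rewrite /f.
apply: filterS2 E (near_dom di) => x h dx xy.
have z0 := coord_neq di dx xy; have := h xy; rewrite expr1z => E1.
have E3 := chart_deriv_coordB (z i y) dx; rewrite E3.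
apply: (mulfI z0); move: E1.
move: (z i x - z i y) z0 (cA fr b x)`_b (cr (wt N b y)) (g x) => u u0 A w q E1.
have {E1} -> : u * A = u * q + w by rewrite -E1 subrK.
by field.
Qed.
Local Notation filt j := (filtration pts c G N.+1 j 0).

(** The monomial of degree [j.-1] in [tv] lies in the step of rank [j], and a non-zero subdiagonal
    entry gives its image a component of degree [j]. *)
Lemma not_preserved j W i a tau (fr : frameG W i a tau) x : (0 < j <= N)%N -> W x -> ~ S x ->
  (cA fr j.-1 x)`_j != 0 -> ~ sends_into pts D (filt j) (filt j).
Proof.
move=> /andP[j0 jN] Wx xS A0 H; have bN : (j.-1 <= N)%N by lia.
have jr : (0 < j <= N.+1)%N by lia.
pose U := W `\` S; have oU : open U by exact: open_off fr.
have UU : U `<=` W `\` S by [].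
have Ux : U x by [].
pose sec x := hform a tau x ('X^(j.-1) : {poly C}).
have Fs : filt j U sec.
  apply: (filtration_intro jr oU) => y [Wy yS]; exists W, i, a, tau; split => //.
  exists (fun=> 'X^(j.-1)); split.
  - by apply: filterE.
  - by move=> _; rewrite size_polyXn ltnS.
  - by move=> b _; apply: ogs_out yS (ogs_hnear (hnearC _ y)).
  - by move=> _ b jb; rewrite coefXn gtn_eqF.
have [W' [h [oW W'x WU lh Fh]]] := H U sec i oU Fs x (conj Ux (fr_dom fr Wx)).
have [P [P1 _ _ P4]] := desS_filtration fr jr oW W'x Wx Fh.
have := nbhs_singleton P1 xS => E1.
have E2 := cA_P fr bN oU UU Ux.
have E3 : hform a tau x (h x *: cA fr j.-1 x) = hform a tau x (P x).
  apply: (etrans (homZ _ _ _ _ _)); apply: (etrans _ E1).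
  exact: (congr1 (fun v => (h x ^ 1) *: v) (esym E2)).
have := hom_inj (det_ev_tv fr Wx) E3 jN; rewrite (P4 x j) ?prednK // coefZ => /eqP.
rewrite mulf_eq0 (negbTE A0) orbF => /eqP h0; apply: xS.
exact: (lh.2 x W'x).1.1.
Qed.

(** The matrix raises the degree in [tv] by at most one and differentiating coefficients does not
    raise it. The bounds on orders come from [D] preserving the whole symmetric power up to a simple
    pole along [S]. *)
Lemma griffiths_transversal j : vanishes_above 1 -> (0 < j <= N)%N -> sends_into pts D (filt j) (filt j.+1).
Proof.
move=> v1 /andP[j0 jN] U sec i oU Fs y [Uy di].
have jr : (0 < j <= N.+1)%N by lia.
have [[sD _ cp _ _] _] := D_par.
have Vs : V 0 U sec.
  apply: (SymE_intro oU) => y' Uy'; have [i' di'] := rs_cover y'.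
  have [W [a [tau [fr Wy _]]]] := exists_frame di'; exists W, i', a, tau; split => //.
  have [P [P1 P2 P3 _]] := desS_filtration fr jr oU Uy' Wy Fs.
  exists P; split => // x b Nb; rewrite nth_default // (leq_trans (P2 x)) //.
have tw := sD U sec i oU Vs.
have [W1 [a [tau [fr1 W1y gd1]]]] := exists_frame di.
pose W := W1 `&` U.
have oW : open W by apply: openI => //; exact: (fr_open fr1).
have fr : frame W i a tau by apply: frame_sub fr1 => // x [].
have Wy : W y by [].
have gd (k : 'I_n) : W (pts k) -> pts k = y by move=> [/gd1].
have lh := hl_eq fr Wy gd.
exists W, (hl i y); split => //.
  by move=> x [W1x Ux]; split => //; exact: (fr_dom fr1).
have jr1 : (0 < j.+1 <= N.+1)%N by lia.
apply: (filtration_intro jr1 oW) => y' Wy'; exists W, i, a, tau; split => //.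
have [|P [P1 P2 P3]] := desT fr tw (conj Wy'.2 (fr_dom fr Wy')) Wy' (T := 0) (m := N).
  by move=> U' s' oU' U'y; exact: (desS_Sym fr).
have [Q [Q1 Q2 Q3 Q4]] := desS_filtration fr jr oU Wy'.2 Wy' Fs.
pose B : set X := [set x | W x /\ (~ S x -> sec x = hform a tau x (Q x) /\
  forall b, hdiff (fun x => (Q x)`_b) x)].
have nB : nbhs y' B.
  have nQ : \forall x \near y', forall b : 'I_N.+1, ~ S x -> hdiff (fun x => (Q x)`_b) x.
    apply: near_fin => b; have bN : (b <= N)%N by have := ltn_ord b; rewrite ltnS.
    have [yS|yS] := pselect (S y'); last first.
      by apply: filterS (ogs_hol yS (Q3 b bN)) => x hx _.
    apply: filterS (og_hdiff (ogs_in yS (Q3 b bN))) => x hx xS; apply: hnearW; apply: hx.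
    by move=> E; apply: xS; rewrite E.
  apply: filterS (filterI (frame_near fr Wy') (filterI Q1 nQ)) => x [Wx [e1 e2]].
  split=> // xS; split; first exact: e1.
  move=> b; have [bN|bN] := ltnP b N.+1; first exact: (e2 (Ordinal bN) xS).
  rewrite (_ : (fun x => _) = fun=> 0); first exact: hdiffC.
  by apply/funext => v; rewrite nth_default // (leq_trans (Q2 v)).
have key x : B° x -> ~ S x -> D U sec i x = hform a tau x (P x) ->
    forall k, (j < k)%N -> (P x)`_k = 0.
  move=> Bx xS EP k jk; have [kN|kN] := leqP k N; last by rewrite nth_default // (leq_trans (P2 x)).
  pose U' := B° `\` S.
  have oU' : open U'.
    by rewrite /U' setDE; apply: openI; [exact: open_interior|exact: open_nS].
  have UW : U' `<=` W `\` S by move=> v [/interior_subset [Wv _] vS].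
  have hQ v b : U' v -> hdiff (fun x => (Q x)`_b) v.
    by move=> [/interior_subset [_ h] vS]; have [_] := h vS; apply.
  have VQ := sec_off fr oU' UW Q2 hQ.
  have sE : eq_off_S pts U' sec (fun x => hform a tau x (Q x)).
    by move=> v [/interior_subset [_ h] vS] _; have [] := h vS.
  have U'x : U' x by [].
  have Wx : W x by have [] := UW x U'x.
  have E1 := cp U U' sec _ i oU oU' (fun v h => (UW v h).1.2) Vs VQ sE x (conj U'x (fr_dom fr Wx)) xS.
  have E2 := leibniz fr oU' UW Q2 hQ U'x.
  have E3 := hom_inj (det_ev_tv fr Wx) (etrans (esym EP) (etrans E1 E2)) kN.
  rewrite E3 coefD.
  have -> : (dpoly i Q x)`_k = 0.
    apply: (etrans (coef_dpoly _ _ _ kN)); rewrite (_ : (fun y => _) = fun=> 0); first exact: chart_derivC.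
    by apply/funext => v; rewrite Q4 //; lia.
  rewrite add0r /act coef_sum big1 // => b _; rewrite coefZ.
  have [bj|bj] := ltnP j.-1 b; first by rewrite Q4 // mul0r.
  have ebk : (k = b + (k - b))%N by have := ltn_ord b; lia.
  by rewrite ebk (v1 _ _ _ _ fr x b _ Wx xS) ?mulr0 //; lia.
(* The coefficients beyond degree [j] vanish off [S] only, so they are cut off explicitly; the
   factor [hl] is the twist by [S]. *)
pose P' x := hl i y x *: \poly_(b < j.+1) (P x)`_b.
exists P'; split.
- have nB' : nbhs y' B° by exact: near_near nB.
  apply: filterS2 P1 nB' => x e1 Bx xS; rewrite expr1z (e1 xS) -homZ.
  congr (homf _ _ _ _); congr (_ *: _); apply/polyP => k; rewrite coef_poly; case: ltnP => // jk.
  exact: (key x Bx xS (e1 xS)).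
- move=> x; apply: leq_trans (size_scale_leq _ _) _; apply: leq_trans (size_poly _ _) _.
  by rewrite ltnS.
- move=> b bN; rewrite (_ : (fun x => _) = fun x => hl i y x ^ 1 * (if (b < j.+1)%N then (P x)`_b else 0)); last first.
    by apply/funext => x; rewrite coefZ coef_poly expr1z.
  have -> : Num.ceil (0 - wt N b y') = 1 + (Num.ceil (0 - wt N b y') - 1).
    by move: (Num.ceil _) => v; ring.
  have o2 : ogs (fun x => if (b < j.+1)%N then (P x)`_b else 0) y' (Num.ceil (0 - wt N b y') - 1).
    by case: (b < j.+1)%N; [exact: P3|exact: ogs0].
  exact: ogsM (local_eq_ogs 1 oW Wy' lh) o2.
- by move=> x b jb; rewrite coefZ coef_poly ltnNge jb mulr0.
Qed.
Hypothesis Xc : compact [set: X].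
Hypothesis n_gt0 : (0 < n)%N.
Hypothesis genus0 : has_genus X 0 -> (3 <= n)%N.

(** * Degrees, and the global functions made from the top entries *)

Section BaseForm.
Variables (phi : rs_idx X -> X -> C) (s : seq X) (l : X -> int).
Hypothesis us : uniq s.
Hypothesis phi_form : mform s phi.
Hypothesis phi_oe : forall x i, dom i x -> oe (phi i) x (l x).
Hypothesis l_out : forall x, x \notin s -> l x = 0.
Hypothesis l_ge : (forall x, 0 <= l x) \/ (has_genus X 0 /\ exists p, forall x, (if x == p then - 2 else 0) <= l x).
Local Notation deg := (\sum_(x <- s) l x).

(** A form bounded below by 0 has non-negative degree and there is at least one marked point;
    otherwise the genus is 0, the degree is at least -2 and there are three marked points. *)
Lemma deg_ge : 0 <= 2 * n%:Z + 3 * deg - 2 \/ (3 <= n)%N /\ - 2 <= deg.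
Proof.
case: l_ge => [h|[g0 [p h]]].
  have d0 : 0 <= deg by apply: sumr_ge0.
  by left; lia.
right; split; first exact: genus0.
have E : \sum_(x <- s) (if x == p then - 2 else 0 : int) <= deg by apply: ler_sum.
apply: le_trans E; rewrite -big_mkcond /= -big_filter; case ps: (p \in s).
  have -> : [seq x <- s | x == p] = [:: p].
    by apply/perm_small_eq => //; apply: uniq_perm; rewrite ?filter_uniq // => x; rewrite mem_filter inE; case: eqP => // ->; rewrite ps.
  by rewrite big_seq1.
rewrite big_seq big1 // => x; rewrite mem_filter => /andP[/eqP -> h']; by rewrite h' in ps.
Qed.

(** Three times [d] is a sum of the non-negative integers [T k] plus [m.-1] times the non-negative
    [2 * n + 3 * deg]. If [d] is 0 every [T k] is 0, which is the rigidity used in [van_pred]. *)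
Lemma degree_bound m : (0 < m)%N -> let d := \sum_(k < n) sfl m (pts k) + m.-1%:Z * deg in
  0 <= d /\ (d = 0 -> forall k : 'I_n, 3 * sfl m (pts k) = 2 * m.-1%:Z).
Proof.
move=> m0 d; pose T (k : 'I_n) : int := 3 * sfl m (pts k) - 2 * m.-1%:Z.
have T0 k : 0 <= T k.
  have := sfl_ge m (codom_f pts k); rewrite /T.
  by move: (sfl m (pts k)) => F; lia.
have dE : 3 * d = \sum_k T k + m.-1%:Z * (2 * n%:Z + 3 * deg).
  rewrite /T sumrB -mulr_sumr sumr_const card_ord /d.
  by move: (\sum_(k < n) _) deg => a b; rewrite -mulr_natr natz; ring.
have q0 : 0 <= 2 * n%:Z + 3 * deg.
  by case: deg_ge => [h|[n3 h]]; move: h; move: deg => dg; lia.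
have p0 : 0 <= m.-1%:Z * (2 * n%:Z + 3 * deg) by apply: mulr_ge0.
have s0 : 0 <= \sum_k T k by apply: sumr_ge0.
split; first by move: dE p0 s0; move: (\sum_k T k) (_ * _) d => a b e; lia.
move=> d0 k; have s00 : \sum_k T k = 0.
  by move: dE p0 s0; rewrite d0; move: (\sum_k T k) (m.-1%:Z * _) => a b; lia.
have Tk : T k = 0.
  have H : forall j : 'I_n, true -> 0 <= T j by move=> j _; exact: T0.
  exact (psumr_eq0P H s00 isT).
by move: Tk; rewrite /T => /eqP; rewrite subr_eq0 => /eqP.
Qed.

(** Each weight exceeds [1 / 3] and there is at least one, so the sum is greater than
    [(2 * n + 3 * deg) / 6], which is non-negative. *)
Lemma gamma_degree : 0 < \sum_(k < n) gam (pts k) + deg%:~R / 2.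
Proof.
have g (k : 'I_n) : 1 / 3 <= gam (pts k).
  by have /andP[h _] := gam_bounds (pts k); exact: ltW.
have g' : n%:R / 3 < \sum_(k < n) gam (pts k).
  have -> : (n%:R / 3 : R) = \sum_(k < n) (1 / 3).
    by rewrite sumr_const card_ord -mulr_natr; lra.
  apply: ltr_sum => [|k _]; last by have /andP[] := gam_bounds (pts k).
  by apply/hasP; exists (Ordinal n_gt0); rewrite ?mem_index_enum.
have : 0 <= ((2 * n%:Z + 3 * deg)%:~R : R).
  by rewrite ler0z; case: deg_ge => [h|[n3 h]]; move: h; move: deg => dg; lia.
rewrite intrD !intrM -pmulrn => h.
lra.
Qed.

Definition hval m b W i a tau (fr : frameG W i a tau) x : C :=
  (cA fr b x)`_(b + m) * phi i x ^+ m.-1 / kap a i x ^+ m.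

Lemma hval_inv m b W W' i i' a a' tau tau' (fr : frameG W i a tau) (fr' : frame W' i' a' tau') x :
  vanishes_above m -> (0 < m)%N -> (b + m <= N)%N -> W x -> W' x -> ~ S x -> x \notin s ->
  hval m b fr' x = hval m b fr x.
Proof.
move=> vm m0 bmN Wx Wx' xS xs; have [u hu] := lam_ratio a a'.
have di := fr_dom fr Wx; have di' := fr_dom fr' Wx'.
have [_ u0 lE] := hu x (fr_triv fr Wx) (fr_triv fr' Wx').
have E1 := cA_inv fr fr' vm m0 bmN hu Wx Wx' xS.
have E2 := kap_change di di' lE.
have [law _ _] := phi_form; have E3 := law i' i x xs di' di.
have T0 := chart_deriv_neq0 di' di; have k0 := kap_neq0 (fr_triv fr Wx) di.
rewrite /hval E1 E2 E3.
move: (chart_deriv i' (z i) x) (u x) (kap a i x) (phi i x) (cA fr b x)`_(b + m) T0 u0 k0.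
move=> T v k p A T0 v0 k0; rewrite !exprMn mul2n -addnn exprD.
case: m m0 {vm bmN E1} => // m _ /=; rewrite [T ^+ m.+1]exprS [k ^+ m.+1]exprS.
have q1 : T ^+ m != 0 by rewrite expf_neq0.
have q2 : v ^+ m.+1 != 0 by rewrite expf_neq0.
have q3 : k ^+ m != 0 by rewrite expf_neq0.
move: (T ^+ m) (v ^+ m.+1) (k ^+ m) (p ^+ m) q1 q2 q3 => a1 a2 a3 a4 q1 q2 q3.
by field; rewrite T0 q1 q2 k0 q3.
Qed.

Lemma hfun_ex m b : vanishes_above m -> (0 < m)%N -> (b + m <= N)%N -> exists h : X -> C,
  forall W i a tau (fr : frameG W i a tau) x, W x -> ~ S x -> x \notin s -> h x = hval m b fr x.
Proof.
move=> vm m0 bmN.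
have ex x : exists v : C, forall W i a tau (fr : frameG W i a tau), W x -> ~ S x -> x \notin s -> v = hval m b fr x.
  have [xS|xS] := pselect (S x); first by exists 0.
  have [xs|xs] := boolP (x \in s); first by exists 0.
  have [i di] := rs_cover x; have [W [a [tau [fr Wx _]]]] := exists_frame di.
  by exists (hval m b fr x) => W' i' a' tau' fr' Wx' _ _; exact: hval_inv.
by have [h Hh] := choice ex; exists h => W i a tau fr x; exact: Hh.
Qed.

Lemma near_good y W i a tau (fr : frameG W i a tau) : W y ->
  \forall x \near y, x <> y -> [/\ W x, ~ S x, x \notin s, phi i x != 0 & kap a i x != 0].
Proof.
move=> Wy; have di := fr_dom fr Wy.
apply: filterS (filterI (filterI (frame_near fr Wy) (near_S pts y)) (filterI (near_notin s y) (oe_neq0 (phi_oe di)))).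
move=> x [[h1 h2] [h3 h4]] xy; split; [by []|exact: h2|exact: h3|exact: h4|].
by apply: kap_neq0; [exact: (fr_triv fr)|exact: (fr_dom fr)].
Qed.

Lemma kapX_oe y W i a tau (fr : frameG W i a tau) m : W y -> oe (fun x => kap a i x ^+ m) y 0.
Proof.
move=> Wy; apply: oe_hnear; last by rewrite expf_neq0 // kap_neq0 //; [exact: (fr_triv fr)|exact: (fr_dom fr)].
have := kap_hnear (fr_triv fr Wy) (fr_dom fr Wy); apply: filterS => x; exact: hdiffX.
Qed.

(** A change of trivialization multiplies [psi] by [u ^+ 2], whatever the coordinates. Half its
    logarithmic derivative therefore compensates the term that [cA_rescale] adds on the diagonal. *)
Definition psi (a : vb_idx (gL G)) i x : C := kap a i x / phi i x.

Lemma phi_neq0 i x : dom i x -> x \notin s -> hdiff (phi i) x /\ phi i x != 0.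
Proof.
move=> di xs; have [_ hd _] := phi_form; split; first exact: hd.
by apply: oe0_neq0 (hd i x xs di) _; rewrite -(l_out xs); exact: phi_oe.
Qed.

Lemma psi_hdiff a i x : dom i x -> vb_dom (gL G) a x -> x \notin s -> hdiff (psi a i) x /\ psi a i x != 0.
Proof.
move=> di da xs; have [h1 h2] := phi_neq0 di xs; split; last by rewrite mulf_neq0 ?invr_neq0 ?kap_neq0.
by apply: hdiffM; [exact: hnearW (kap_hnear da di)|exact: hdiffV].
Qed.

Section TopCoefficients.
Variables (m b : nat) (h : X -> C).
Hypothesis vm : vanishes_above m.
Hypothesis m0 : (0 < m)%N.
Hypothesis bmN : (b + m <= N)%N.
Hypothesis hE : forall W i a tau (fr : frameG W i a tau) x, W x -> ~ S x -> x \notin s -> h x = hval m b fr x.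
Local Notation L y := (sfl m y + m.-1%:Z * l y).

Lemma h_og y : og h y (L y).
Proof.
have [i di] := rs_cover y; have [W [a [tau [fr Wy gd]]]] := exists_frame di.
have o1 := cA_og fr Wy gd m0 bmN.
have o2 := ogX m.-1 (oe_og (phi_oe di)).
have o3 := oe_og (oeV (kapX_oe fr m Wy)).
have := ogM (ogM o1 o2) o3; rewrite oppr0 addr0 [l y * _]mulrC; apply: og_ext.
by apply: filterS (near_good fr Wy) => x H /H [Wx xS xs _ _]; rewrite (hE fr).
Qed.

(** The lower bounds on the orders of [h] have a non-negative sum. So [h] vanishes identically, or
    all bounds are attained and the equality case of [degree_bound] applies. *)
Lemma top_dichotomy :
  (forall W i a tau (fr : frameG W i a tau) x, W x -> ~ S x -> (cA fr b x)`_(b + m) = 0) \/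
  ((forall y, oe h y (L y)) /\ forall k : 'I_n, 3 * sfl m (pts k) = 2 * m.-1%:Z).
Proof.
pose t := undup (s ++ codom pts).
have ut : uniq t by exact: undup_uniq.
have Lout y : y \notin t -> L y = 0.
  rewrite mem_undup mem_cat negb_or => /andP[ys yS].
  by rewrite /sfl (negbTE yS) l_out // mulr0 addr0.
have sum : \sum_(y <- t) L y = \sum_(k < n) sfl m (pts k) + m.-1%:Z * deg.
  rewrite big_split /= -mulr_sumr; congr (_ + _ * _).
    have up : uniq (codom pts) by rewrite map_inj_uniq // enum_uniq.
    rewrite (sum_support_int ut up).
    - by rewrite big_map enumT.
    - move=> x; rewrite mem_undup mem_cat negb_or => /andP[_ xS]; by rewrite /sfl (negbTE xS).
    - by move=> x xS; rewrite /sfl (negbTE xS).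
  apply: sum_support_int => // x; rewrite mem_undup mem_cat negb_or => /andP[xs _].
  exact: l_out.
have [d0 d1] := degree_bound m0.
have mh : mero h by move=> y; exists (L y); exact: h_og.
have [|||hz|[S0 e1 e2]] := order_sum Xc mh ut (l := fun y => L y).
- by move=> x _; exact: h_og.
- by move=> x /Lout E; rewrite -E; exact: h_og.
- by rewrite sum.
- left => W i a tau fr x Wx xS; have bN : (b <= N)%N by lia.
  have hA := cA_hnear fr (b + m) bN Wx xS.
  apply: (hdiff_eq (hnearW hA) (hdiffC 0 x)).
  apply: filterS2 (near_good fr Wx) (hz x) => y H hy yx; have [Wy yS ys p0 k0] := H yx.
  have := hy yx; rewrite (hE fr Wy yS ys) /hval => /eqP.
  by rewrite !mulf_eq0 invr_eq0 !expf_eq0 (negbTE p0) (negbTE k0) !andbF !orbF => /eqP.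
- right; split; last by apply: d1; rewrite -sum.
  move=> y; have [yt|yt] := boolP (y \in t); first exact: e1.
  by rewrite Lout //; exact: e2.
Qed.
End TopCoefficients.

(** * The residue identity for the meromorphic splitting *)

Section ResidueIdentity.
Variables (q : nat) (Y : 'I_q -> X) (rho : 'I_q -> C) (sg : X -> 'M[C]_(2, 1)).
Hypothesis Y_inj : injective Y.
Hypothesis sg_hol : hol_hom (dual_vb (gL G)) (gE G) (~` range Y) sg.
Hypothesis sg_split : forall x, ~ range Y x -> gp G x *m sg x = 1%:M.
Hypothesis sg_poles : forall k : 'I_q, exists W (tau : X -> 'M[C]_(2, 1)) (eta : X -> 'M[C]_1),
  [/\ open W /\ W (Y k), hol_hom (dual_vb (gL G)) (gE G) W tau,
      forall x, W x -> gp G x *m tau x = 1%:M,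
      forall x, W x -> ~ range Y x -> sg x - tau x = giota G x *m eta x &
      forall i, dom i (Y k) -> has_residue i (Y k) (fun x => gkappa G i x * eta x 0 0) (rho k)].

Definition sgW i (a : vb_idx (gL G)) : set X := ~` range Y `&` (dom i `&` vb_dom (gL G) a).

Lemma sg_frame i a : frame (sgW i a) i a sg.
Proof. by apply: frame_restrict => //; exact: open_nS. Qed.

Definition rtot y : C := \sum_k (if Y k == y then rho k else 0).

(** The passage from the definition of the extension class to frames: the difference [v] of the
    meromorphic and a local holomorphic splitting, seen as a form through [kap], has the prescribed
    residue. *)
Lemma split_residue y i : dom i y -> exists W a (tau : X -> 'M[C]_(2, 1)) (v : X -> C),
  [/\ frame W i a tau, W y, forall k : 'I_n, W (pts k) -> pts k = y,
      forall x, W x -> sgW i a x -> hdiff v x /\ tv a sg x = tv a tau x + v x *: ev a x &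
      ppart ((fun x => kap a i x * v x) \o par i) (z i y) (rtot y)].
Proof.
move=> di; have [a da] := vb_cover (gL G) y; have [[k _ ky]|nY] := pselect (range Y y); last first.
  have [W [sW fr Wy gd]] := frame_good (sg_frame i a) (conj nY (conj di da)).
  exists W, a, sg, (fun=> 0); split => //.
    by move=> x _ _; split; [exact: hdiffC|rewrite scale0r addr0].
  have -> : rtot y = 0.
    by rewrite /rtot big1 // => k _; case: eqP => // E; case: nY; exists k.
  apply: ppart_hnear => //; apply: hnear_near (hnearC 0 y); apply: filterE => x.
  by rewrite mulr0.
have [W0 [tau [eta [[oW0 W0y] ht pt se hr]]]] := sg_poles k; rewrite ky in W0y hr.
have fr1 := frame_restrict i a oW0 ht pt.
have [W [sW fr Wy gd]] := frame_good fr1 (conj W0y (conj di da)).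
have [v hv] := split_diff fr (sg_frame i a).
exists W, a, tau, v; split => //.
have -> : rtot y = rho k.
  rewrite /rtot (bigD1 k) //= ky eqxx big1 ?addr0 // => j jk; case: eqP => // E.
  by move: jk; rewrite -(inj_eq Y_inj) E ky eqxx.
apply: ppart_near (has_residue_ppart di (hr i di)) => //.
have nY : \forall x \near y, x <> y -> ~ range Y x by exact: near_S.
apply: filterS2 (frame_near fr Wy) nY => x Wx h xy; have nx := h xy.
have [W0x [dx dax]] := sW x Wx.
have [_ E1] := hv x Wx (conj nx (conj dx dax)).
have E2 := se x W0x nx.
have l0 := lam_neq0 dax.
(* [v] compares the images of the dual frame, [eta] those of the fibre coordinate. Both dual frame
   and frame contain [lam], so [v] is [eta] divided by its square, and [kap] restores the factor. *)
have E3 : v x *: ev a x = (eta x 0 0 / lam a x ^+ 2) *: ev a x.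
  apply: (addrI (tv a tau x)); rewrite -E1.
  have Es : sg x = tau x + giota G x *m eta x by rewrite -E2 addrC subrK.
  rewrite /tv Es mulmxDl; congr (_ + _); rewrite /ev -mulmxA scalemxAr; congr (_ *m _).
  by apply/matrixP => p1 p2; rewrite !mxE big_ord1 !mxE (ord1 p1); field.
have E4 : (v x - eta x 0 0 / lam a x ^+ 2) *: ev a x + 0 *: tv a tau x = 0.
  by rewrite scale0r addr0 scalerBl E3 subrr.
have [/eqP E5 _] := ev_tv_free fr Wx E4; move: E5; rewrite subr_eq0 => /eqP ->.
by rewrite /kap; field.
Qed.

Variables (m b : nat) (h : X -> C) (lamb : nat -> C).
Hypothesis vm : vanishes_above m.
Hypothesis m0 : (0 < m)%N.
Hypothesis bmN : (b + m <= N)%N.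
Hypothesis h_oe : forall y, oe h y (sfl m y + m.-1%:Z * l y).
Hypothesis h_one : m = 1%N -> h = fun=> 1.
Hypothesis sfl_le : forall y, sfl m y <= sfl m.-1 y.
Hypothesis coef_h : forall b', (b' + m <= N)%N -> forall W i a tau (fr : frameG W i a tau) y, W y ->
  \forall x \near y, x <> y -> (cA fr b' x)`_(b' + m) * phi i x ^+ m.-1 = lamb b' * h x * kap a i x ^+ m.

(** The coefficient of a 1-form made from the entry one step above the top one. Dividing by [h]
    makes it comparable across frames; for [m = 1] the entry is diagonal and the correction by [psi]
    is subtracted. *)
Definition form_coef i (a : vb_idx (gL G)) (A : {poly C}) x : C :=
  A`_(b + m.-1) * phi i x ^+ m.-1 / (kap a i x ^+ m.-1 * h x) -
  (if m == 1%N then (N%:R - 2 * b%:R) / 2 * (chart_deriv i (psi a i) x / psi a i x) else 0).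

Lemma form_coef_change W W' i i' a a' (fr : frameG W i a sg) (fr' : frame W' i' a' sg) x :
  W x -> W' x -> ~ S x -> x \notin s ->
  form_coef i' a' (cA fr' b x) x = chart_deriv i' (z i) x * form_coef i a (cA fr b x) x.
Proof.
move=> Wx Wx' xS xs; have [u hu] := lam_ratio a a'.
have di := fr_dom fr Wx; have di' := fr_dom fr' Wx'.
have da := fr_triv fr Wx; have da' := fr_triv fr' Wx'.
have [hux u0 lE] := hu x da da'.
have T0 := chart_deriv_neq0 di' di; have k0 := kap_neq0 da di.
have E2 := kap_change di di' lE.
have [law _ _] := phi_form; have E3 := law i' i x xs di' di.
have oU := open_int fr fr'; pose U := (W `&` W') `\` S.
have U1 : U `<=` W `\` S by move=> y [[]].
have U2 : U `<=` W' `\` S by move=> y [[]].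
have bN : (b <= N)%N by lia.
have dU y : U y -> [/\ hdiff u y, u y != 0 & lam a' y = u y * lam a y].
  by move=> [[h1 h2] _]; apply: hu; [exact: (fr_triv fr)|exact: (fr_triv fr')].
have [||| r1 r2] := cA_rescale fr fr' (u := u) oU U1 U2 _ _ _ bN (conj (conj Wx Wx') xS).
- by move=> y /dU [].
- by move=> y /dU [].
- by move=> y /dU [].
rewrite /form_coef E2 E3; case: eqP => m1; last first.
  rewrite (r1 m.-1) ?subr0; [|lia|lia].
  move: (chart_deriv i' (z i) x) (u x) (kap a i x) (phi i x) (cA fr b x)`_(b + m.-1) T0 u0 k0.
  move=> T v k p A T0 v0 k0; rewrite !exprMn mul2n -addnn exprD.
  have q1 : T ^+ m.-1 != 0 by rewrite expf_neq0.
  have q2 : v ^+ m.-1 != 0 by rewrite expf_neq0.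
  rewrite invfM [in RHS]invfM.
  move: (T ^+ m.-1) (v ^+ m.-1) (k ^+ m.-1) (p ^+ m.-1) (h x) q1 q2 => a1 a2 a3 a4 h0 q1 q2.
  rewrite !invfM; move: (a3^-1) (h0^-1) => b3 b4.
  by field; rewrite q1 q2.
have [hp p0] := psi_hdiff di da xs.
have nE : \forall y \near x, u y ^+ 2 * psi a i y = psi a' i' y.
  apply: filterS (filterI (filterI (frame_near fr Wx) (frame_near fr' Wx')) (notin_near xs)).
  move=> y [[Wy Wy'] ys]; have dy := fr_dom fr Wy; have dy' := fr_dom fr' Wy'.
  have [_ _ lEy] := hu y (fr_triv fr Wy) (fr_triv fr' Wy').
  rewrite /psi (kap_change dy dy' lEy) (law i' i y ys dy' dy).
  have T0y := chart_deriv_neq0 dy' dy; have [_ p0y] := phi_neq0 dy ys.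
  move: (chart_deriv i' (z i) y) (u y) (kap a i y) (phi i y) T0y p0y => T v k p T0y p0y.
  by field; rewrite T0y p0y.
have h2 : hdiff (fun y => u y ^+ 2) x by exact: hdiffX.
have d1 := chart_deriv_near di' nE (hdiffM h2 hp).
have d2 := chain_rule di' di (hdiffM h2 hp).
have d3 := chart_derivM di h2 hp.
have d4 := chart_derivX 2 di hux.
have v1 : psi a' i' x = u x ^+ 2 * psi a i x by rewrite (nbhs_singleton nE).
have alg (dP' dP dQ du T A0 K P v : C) : P != 0 -> v != 0 ->
    dP' = dP * T -> dP = dQ * P + v ^+ 2 * du -> dQ = 2%:R * v ^+ 1 * K ->
    dP' / (v ^+ 2 * P) = T * (2 * (K / v) + du / P).
  by move=> P0 v0 -> -> ->; field; rewrite P0 v0.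
have d5 := alg _ _ _ _ _ 0 _ _ _ p0 u0 (etrans (esym d1) d2) d3 d4.
have d6 := etrans (congr1 (fun t => chart_deriv i' (psi a' i') x / t) v1) d5.
have r2' k : k = b -> (cA fr' b x)`_k = chart_deriv i' (z i) x *
    ((cA fr b x)`_k + (N%:R - 2 * b%:R) * (chart_deriv i u x / u x)) by move=> ->; exact: r2.
have alg2 (k : nat) (A' A T p p' q1 q2 h0 w d' d e : C) : k = 0%N -> h0 = 1 -> A' = T * (A + w * e) ->
    d' = T * (2 * e + d) -> A' * p' ^+ k / (q2 ^+ k * h0) - w / 2 * d' = T * (A * p ^+ k / (q1 ^+ k * h0) - w / 2 * d).
  by move=> -> -> -> ->; rewrite !expr0 !mulr1 !divr1; field.
have hx : h x = 1 by rewrite (h_one m1).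
have k00 : m.-1 = 0%N by rewrite m1.
have eb : (b + m.-1)%N = b by rewrite k00 addn0.
exact: (alg2 _ _ _ _ _ _ _ _ _ _ _ _ _ k00 hx (r2' _ eb) d6).
Qed.

Lemma residue_form : exists Om : rs_idx X -> X -> C, forall i x W a (fr : frameG W i a sg),
  W x -> ~ S x -> x \notin s -> Om i x = form_coef i a (cA fr b x) x.
Proof.
have ex (p : rs_idx X * X) : exists v : C, forall W a (fr : frameG W p.1 a sg),
    W p.2 -> ~ S p.2 -> p.2 \notin s -> v = form_coef p.1 a (cA fr b p.2) p.2.
  case: p => i x /=.
  have [[W [a [fr Wx]]]|no] := pselect (exists W a, exists fr : frameG W i a sg, W x); last first.
    by exists 0 => W a fr Wx; case: no; exists W, a, fr.
  exists (form_coef i a (cA fr b x) x) => W' a' fr' Wx' xS xs.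
  rewrite (form_coef_change fr fr' Wx Wx' xS xs).
  have := chart_deriv_id (fr_dom fr Wx) => E.
  by rewrite (congr1 (fun t => t * _) E) mul1r.
by have [Om HO] := choice ex; exists (fun i x => Om (i, x)) => i x; exact: (HO (i, x)).
Qed.
Definition form_res y : C := (if m == 1%N then (if y \in codom pts then cr (wt N b y) else 0) +
     (N%:R - 2 * b%:R) / 2 * (l y)%:~R else 0) + (b%:R * lamb b.-1 - (b + m)%:R * lamb b) * rtot y.

Variable Om : rs_idx X -> X -> C.
Hypothesis Om_coef : forall i x W a (fr : frameG W i a sg),
  W x -> ~ S x -> x \notin s -> Om i x = form_coef i a (cA fr b x) x.

(** For [m > 1] the order bound [sfl m.-1 y] of the entry covers the order of [h], as the
    contributions of [phi] cancel and [sfl m y <= sfl m.-1 y]: no residue. For [m = 1] the diagonal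
    entry contributes its weight. *)
Lemma main_ppart W i a tau (fr : frameG W i a tau) y : W y -> (forall k : 'I_n, W (pts k) -> pts k = y) ->
  ppart ((fun x => (cA fr b x)`_(b + m.-1) * phi i x ^+ m.-1 / (kap a i x ^+ m.-1 * h x)) \o par i) (z i y)
    (if m == 1%N then (if y \in codom pts then cr (wt N b y) else 0) else 0).
Proof.
move=> Wy gd; have di := fr_dom fr Wy; case: eqP => m1.
  have bN : (b <= N)%N by lia.
  apply: ppart_near di _ (cA_diag fr Wy gd bN); apply: filterE => x _.
  have hx : h x = 1 by rewrite (h_one m1).
  have alg (k : nat) (p : {poly C}) (u v w : C) : k = 0%N -> w = 1 -> p`_b = p`_(b + k) * u ^+ k / (v ^+ k * w).
    by move=> -> ->; rewrite addn0 !expr0 !mulr1 divr1.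
  by apply: alg => //; rewrite m1.
have m2 : (0 < m.-1)%N by lia.
have bm2 : (b + m.-1 <= N)%N by lia.
have o1 := cA_og fr Wy gd m2 bm2.
have o2 := ogX m.-1 (oe_og (phi_oe di)).
have o3 := oe_og (oeV (oeM (kapX_oe fr m.-1 Wy) (h_oe y))).
have := ogM (ogM o1 o2) o3 => /(og_weak (l := 0)).
case.
  by have := sfl_le y; move: (sfl m y) (sfl m.-1 y) (l y) => p1 p2 p3; rewrite mulrC; lia.
move=> i' di' [g hg E]; have [g' hg' E'] := og_chart (ex_intro2 _ _ i' di' (ex_intro2 _ _ g hg E)) di.
apply: ppart_near di _ (ppart_hnear di hg'); apply: filterS E' => x H /H ->.
by rewrite expr0z mul1r.
Qed.

(** The meromorphic splitting is compared with a local holomorphic one. The residue comes from the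
    local diagonal entry, from the logarithmic derivative of [psi], of order [- l y], and from the
    term in [v], multiplied by the combination of [lamb] found in [cA_top]. *)
Lemma form_ppart i y : dom i y -> ppart (Om i \o par i) (z i y) (form_res y).
Proof.
move=> di; have [W [a [tau [v [fr Wy gd hv pv]]]]] := split_residue di.
have da := fr_triv fr Wy.
have p1 := main_ppart fr Wy gd.
have opsi : oe (psi a i) y (- l y).
  by have := oeM (oe_hnear (kap_hnear da di) (kap_neq0 da di)) (oeV (phi_oe di)); rewrite add0r.
have p2 := dlog_ppart di opsi.
set e0 := b%:R * lamb b.-1 - (b + m)%:R * lamb b.
pose w : C := if m == 1%N then - ((N%:R - 2 * b%:R) / 2) else 0.
have := ppartD (ppartD p1 (ppartMl w p2)) (ppartMl e0 pv).
have -> : (if m == 1%N then (if y \in codom pts then cr (wt N b y) else 0) else 0) +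
    w * (- l y)%:~R + e0 * rtot y = form_res y.
  rewrite /form_res -/e0 /w; congr (_ + _); case: eqP => _; last by rewrite mul0r addr0.
  by rewrite intrN mulrNN.
pose f x := (cA fr b x)`_(b + m.-1) * phi i x ^+ m.-1 / (kap a i x ^+ m.-1 * h x) +
  w * (chart_deriv i (psi a i) x / psi a i x) + e0 * (kap a i x * v x).
apply: (ppart_near (f := f) di).
have b1m : (b.-1 + m <= N)%N by lia.
have nY : \forall x \near y, x <> y -> ~ range Y x by exact: near_S.
apply: filterS (filterI (filterI (near_good fr Wy) nY)
  (filterI (oe_neq0 (h_oe y)) (filterI (coef_h bmN fr Wy) (coef_h b1m fr Wy)))).
move=> x [[H1 H2] [H3 [H4 H5]]] xy; have [Wx xS xs p0 k0] := H1 xy.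
have nx := H2 xy; have h0 := H3 xy; have E4 := H4 xy; have E5 := H5 xy.
have dx := fr_dom fr Wx; have dax := fr_triv fr Wx.
have sWx : sgW i a x by [].
have EO := Om_coef (sg_frame i a) sWx xS xs.
have [_ ET] := cA_top fr (sg_frame i a) vm m0 bmN hv Wx sWx xS.
have E6 : b%:R * (cA fr b.-1 x)`_(b + m.-1) * phi i x ^+ m.-1 = b%:R * lamb b.-1 * h x * kap a i x ^+ m.
  (* Here [0.-1] is 0, but the factor [b%:R] removes the term that has no meaning for [b = 0]. *)
  have [b0|b0] := posnP b; first by rewrite b0 !mul0r.
  have <- : (b.-1 + m = b + m.-1)%N by lia.
  by rewrite -!mulrA; congr (_ * _); rewrite mulrA -E5.
have kE : kap a i x ^+ m = kap a i x * kap a i x ^+ m.-1 by rewrite -exprS prednK.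
have q0 : kap a i x ^+ m.-1 != 0 by rewrite expf_neq0.
have alg (A A' B1 B2 P Q k hh vv bl lb nn d om : C) : Q != 0 -> hh != 0 ->
    om = A' * P / (Q * hh) - d -> A' = A + vv * (B1 - nn * B2) ->
    B1 * P = bl * hh * (k * Q) -> B2 * P = lb * hh * (k * Q) ->
    A * P / (Q * hh) + - d + (bl - nn * lb) * (k * vv) = om.
  move=> Q0 hh0 -> -> e1 e2.
  have -> : (A + vv * (B1 - nn * B2)) * P / (Q * hh) = A * P / (Q * hh) + vv * (B1 * P - nn * (B2 * P)) / (Q * hh).
    by rewrite -mulrDl; congr (_ / _); ring.
  by rewrite e1 e2; field; rewrite Q0 hh0.
rewrite kE in E4 E6.
have -> : f x = (cA fr b x)`_(b + m.-1) * phi i x ^+ m.-1 / (kap a i x ^+ m.-1 * h x) +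
    - (if m == 1%N then (N%:R - 2 * b%:R) / 2 * (chart_deriv i (psi a i) x / psi a i x) else 0) + e0 * (kap a i x * v x).
  rewrite /f /w; congr (_ + _ + _); case: eqP => _; last by rewrite mul0r oppr0.
  by rewrite mulNr.
exact: (alg _ _ _ _ _ _ _ _ _ _ _ _ _ _ q0 h0 EO ET E6 E4).
Qed.

Lemma form_coef_hdiff i a x : sgW i a x -> ~ S x -> x \notin s -> hnear h x -> h x != 0 ->
  hdiff (fun y => form_coef i a (cA (sg_frame i a) b y) y) x.
Proof.
move=> sx xS xs hh h0; have [_ [dx da]] := sx.
have bN : (b <= N)%N by lia.
have h1 := hnearW (cA_hnear (sg_frame i a) (b + m.-1) bN sx xS).
have [h2 _] := phi_neq0 dx xs.
have h3 := hnearW (kap_hnear da dx).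
have k0 := kap_neq0 da dx.
apply: hdiffB.
  apply: hdiffM; first exact: hdiffM h1 (hdiffX m.-1 h2).
  apply: hdiffV; first by rewrite mulf_neq0 // expf_neq0.
  exact: hdiffM (hdiffX m.-1 h3) (hnearW hh).
case: eqP => _; last exact: hdiffC.
have hp : hnear (psi a i) x.
  apply: filterS (filterI (filterI (near_dom dx) (vb_near da)) (notin_near xs)) => y [[dy day] ys].
  by have [] := psi_hdiff dy day ys.
apply: hdiffM (hdiffC _ _) _; apply: hdiffM; first exact: hnearW (hnear_deriv hp dx).
by apply: hdiffV (hnearW hp); have [] := psi_hdiff dx da xs.
Qed.

(** The residue theorem for [Om]: the weights sum to [N%:R - 2 * b%:R] times the sum of [gam], the
    logarithmic derivative adds half the degree with the same factor, and the poles of the splitting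
    add the extension class. *)
Lemma residue_identity :
  (if m == 1%N then (N%:R - 2 * b%:R) * (cr (\sum_(k < n) gam (pts k)) + (\sum_(x <- s) l x)%:~R / 2) else 0) +
  (b%:R * lamb b.-1 - (b + m)%:R * lamb b) * \sum_k rho k = 0.
Proof.
have [|e ue he] := @finite_exceptions Xc [set y | hnear h y /\ h y != 0].
  move=> x; apply: filterS2 (og_hdiff (oe_og (h_oe x))) (oe_neq0 (h_oe x)) => y h1 h2 yx.
  by split; [exact: h1|exact: h2].
pose t := undup (s ++ (codom pts ++ (codom Y ++ e))).
have tP x : x \notin t -> [/\ x \notin s, ~ S x, ~ range Y x & hnear h x /\ h x != 0].
  rewrite mem_undup !mem_cat !negb_or => /andP[xs /andP[xS /andP[xY xe]]]; split => //.
  - by move=> /S_codom E; rewrite E in xS.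
  - by move=> /S_codom E; rewrite E in xY.
  - exact: he.
have ut : uniq t by exact: undup_uniq.
have mO : mform t Om.
  split => [i j x /tP [xs xS xY _] di dj|i x /tP [xs xS xY [hh h0]] di|x _].
  - have [a da] := vb_cover (gL G) x.
    have si : sgW i a x by []. have sj : sgW j a x by [].
    rewrite (Om_coef (sg_frame i a) si xS xs) (Om_coef (sg_frame j a) sj xS xs).
    exact: form_coef_change.
  - have [a da] := vb_cover (gL G) x; have si : sgW i a x by [].
    apply: hdiff_near (form_coef_hdiff si xS xs hh h0).
    apply: filterS (filterI (filterI (frame_near (sg_frame i a) si) (near_nS xS)) (notin_near xs)).
    by move=> y [[sy yS] ys]; rewrite (Om_coef (sg_frame i a) sy yS ys).
  - have [i di] := rs_cover x; exists i => //; exact: ppart_og di (form_ppart di).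
have := residue_sum Xc mO ut (c := form_res) (fun y i di => form_ppart di) => sum0.
rewrite -[RHS]sum0 /form_res big_split /= -mulr_sumr; congr (_ + _ * _); last first.
  rewrite /rtot exchange_big; apply: eq_bigr => k _.
  rewrite (@sum_support (fun y => if Y k == y then rho k else 0) t [:: Y k]) ?big_seq1 ?eqxx //.
    move=> x; rewrite mem_undup !mem_cat !negb_or => /andP[_ /andP[_ /andP[xY _]]].
    by case: eqP => // E; rewrite -E codom_f in xY.
  by move=> x; rewrite inE; case: eqVneq.
case: eqP => _; last by rewrite big1.
rewrite big_split /= -mulr_sumr mulrDr; congr (_ + _); last first.
  rewrite -rmorph_sum (sum_support_int ut us); last by move=> x /l_out.
    by rewrite /= mulrAC mulrA.
  by move=> x /tP [xs _ _ _]; exact: l_out.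
have up : uniq (codom pts) by rewrite map_inj_uniq // enum_uniq.
rewrite (sum_support ut up).
- rewrite big_map enumT.
  have -> : cr (\sum_(k < n) gam (pts k)) = \sum_(k < n) cr (gam (pts k)) by exact: rmorph_sum.
  rewrite mulr_sumr; apply: eq_bigr => k _.
  by rewrite codom_f /wt crM crB crM !cr_nat.
- by move=> x /tP [_ xS _ _]; case: ifP => // /S_codom.
- by move=> x /negbTE ->.
Qed.
End ResidueIdentity.

(** * Descending induction on the diagonals, and the subdiagonal *)

Lemma class_identity m (h : X -> C) (lamb : nat -> C) : vanishes_above m -> (0 < m)%N ->
  (forall y, oe h y (sfl m y + m.-1%:Z * l y)) -> (m = 1%N -> h = fun=> 1) ->
  (forall y, sfl m y <= sfl m.-1 y) ->
  (forall b, (b + m <= N)%N -> forall W i a tau (fr : frameG W i a tau) y, W y ->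
    \forall x \near y, x <> y -> (cA fr b x)`_(b + m) * phi i x ^+ m.-1 = lamb b * h x * kap a i x ^+ m) ->
  forall b, (b + m <= N)%N ->
  (if m == 1%N then (N%:R - 2 * b%:R) * (cr (\sum_(k < n) gam (pts k)) + deg%:~R / 2) else 0) +
  (b%:R * lamb b.-1 - (b + m)%:R * lamb b) = 0.
Proof.
move=> vm m0 h_oe h1 sle ch b bmN.
have [q [Y [rho [sg [Yi hsg psg HY rho1]]]]] := g_class G.
have [Om HO] := residue_form sg m0 bmN h1.
have := residue_identity Yi hsg psg HY vm m0 bmN h_oe h1 sle ch HO.
by rewrite rho1 mulr1.
Qed.

Lemma hfuns m : vanishes_above m -> (0 < m)%N -> exists h : nat -> X -> C, forall b, (b + m <= N)%N ->
  forall W i a tau (fr : frameG W i a tau) x, W x -> ~ S x -> x \notin s -> h b x = hval m b fr x.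
Proof.
move=> vm m0; have ex b : exists h : X -> C, (b + m <= N)%N ->
    forall W i a tau (fr : frameG W i a tau) x, W x -> ~ S x -> x \notin s -> h x = hval m b fr x.
  have [bmN|bmN] := leqP (b + m) N; last by exists 0.
  by have [h Hh] := hfun_ex vm m0 bmN; exists h.
by have [h Hh] := choice ex; exists h.
Qed.

Lemma hval_coef m b (lam0 : C) (h h0 : X -> C) : (b + m <= N)%N ->
  (forall W i a tau (fr : frameG W i a tau) x, W x -> ~ S x -> x \notin s -> h x = hval m b fr x) ->
  (forall y, \forall x \near y, x <> y -> h x = lam0 * h0 x) ->
  forall W i a tau (fr : frameG W i a tau) y, W y ->
    \forall x \near y, x <> y -> (cA fr b x)`_(b + m) * phi i x ^+ m.-1 = lam0 * h0 x * kap a i x ^+ m.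
Proof.
move=> bmN hE hl W i a tau fr y Wy; apply: filterS2 (near_good fr Wy) (hl y) => x H1 H2 xy.
have [Wx xS xs p0 k0] := H1 xy; have := H2 xy; rewrite (hE _ _ _ _ fr x Wx xS xs) /hval => <-.
by rewrite divfK // expf_neq0.
Qed.

(** If some entry at distance [m] is not identically zero, its function attains all order bounds, so
    the functions of the other columns are constant multiples of it. The recursion makes all these
    constants 0, including that of the entry itself. *)
Lemma van_pred m : (1 < m)%N -> vanishes_above m -> vanishes_above m.-1.
Proof.
move=> m1 vm; have m0 : (0 < m)%N by exact: ltnW.
pose vb b := forall W i a tau (fr : frameG W i a tau) x, W x -> ~ S x -> (cA fr b x)`_(b + m) = 0.
suff all b : (b + m <= N)%N -> vb b.
  move=> W i a tau fr x b m' Wx xS mm bN; have [E|ne] := eqVneq m' m.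
    by subst m'; exact: (all b bN).
  by apply: vm => //; move: ne => /eqP; lia.
move=> bmN0; apply: contrapT => nv; move: b bmN0 nv => b0 bmN0 nv.
have [h hE] := hfuns vm m0.
have [//|[oe0 sE]] := top_dichotomy m0 bmN0 (hE b0 bmN0).
have ex b : exists lb : C, (b + m <= N)%N -> forall y, \forall x \near y, x <> y -> h b x = lb * h b0 x.
  have [bmN|bmN] := leqP (b + m) N; last by exists 0.
  have [y|lb Hl] := mero_const Xc (f := fun x => h b x / h b0 x).
    have := ogM (h_og m0 bmN (hE b bmN) y) (oe_og (oeV (oe0 y))).
    by rewrite subrr.
  exists lb => _ y; apply: filterS2 (Hl y) (oe_neq0 (oe0 y)) => x h1 h2 xy.
  by rewrite -(h1 xy) divfK // h2.
have [lamb Hl] := choice ex.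
(* Equality in the degree bound says [3 * sfl m y = 2 * m.-1]; compared with [sfl_ge] at [m.-1],
   integrality gives the claim. *)
have sle y : sfl m y <= sfl m.-1 y.
  have [yS|yS] := boolP (y \in codom pts); last by rewrite /sfl (negbTE yS).
  have /codomP [k ky] := yS; have := sE k; rewrite -ky.
  have := sfl_ge m.-1 yS.
  by move: (sfl m y) (sfl m.-1 y) => p1 p2; lia.
have hm1 : m = 1%N -> h b0 = fun=> 1 by move=> E; rewrite E in m1.
have ch b (bmN : (b + m <= N)%N) := hval_coef bmN (hE b bmN) (Hl b bmN).
have id b (bmN : (b + m <= N)%N) := class_identity vm m0 oe0 hm1 sle ch bmN.
(* For [b = 0] the identity reads [m%:R * lamb 0 = 0], and each constant is then a multiple of the
   one before. *)
have l0 b : (b + m <= N)%N -> lamb b = 0.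
  elim: b => [|b IH] bmN; have := id _ bmN; rewrite [m == 1%N]gtn_eqF // add0r.
    rewrite mul0r sub0r add0n => /eqP; rewrite oppr_eq0 mulf_eq0 pnatr_eq0.
    by rewrite gtn_eqF //= => /eqP.
  rewrite /= IH; last by lia.
  rewrite mulr0 sub0r => /eqP; rewrite oppr_eq0 mulf_eq0 pnatr_eq0.
  by rewrite addSn => /eqP.
have [x0] : [set: X] !=set0 by exists (pts (Ordinal n_gt0)).
move=> _; have [y yx [h1 h2]] := exists_near (filterI (Hl b0 bmN0 x0) (oe_neq0 (oe0 x0))).
by have := h2 yx; rewrite (h1 yx) l0 // mul0r eqxx.
Qed.

(** The descent starts at [m = N], where the claim is empty: no entry lies further below the
    diagonal. *)
Lemma van_one : vanishes_above 1.
Proof.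
suff H k : (k < N)%N -> vanishes_above (N - k) by have := H N.-1 (ltnSn _); rewrite subSnn.
elim: k => [|k IH] kN.
  by move=> W i a tau fr x b m' Wx xS; rewrite subn0 => h1 h2; lia.
have -> : (N - k.+1)%N = (N - k).-1 by lia.
by apply: van_pred (IH _); lia.
Qed.

(** At distance 1 the order bounds are 0 and [phi] drops out, so entry divided by [kap] is a
    constant. The extension class 1 balances it against the positive number [K]. *)
Lemma subdiagonal : exists lamb : nat -> C, forall b, (b < N)%N -> lamb b != 0 /\
  forall W i a tau (fr : frameG W i a tau) y, W y ->
    \forall x \near y, x <> y -> (cA fr b x)`_b.+1 = lamb b * kap a i x.
Proof.
have vm := van_one; have m0 : (0 < 1)%N by [].
have [h hE] := hfuns vm m0.
have L0 y : sfl 1 y + (1.-1)%:Z * l y = 0 by rewrite sfl_1 // mul0r addr0.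
have ex b : exists lb : C, (b + 1 <= N)%N -> forall y, \forall x \near y, x <> y -> h b x = lb * 1.
  have [bmN|bmN] := leqP (b + 1) N; last by exists 0.
  have [y|lb Hl] := mero_const Xc (f := h b).
    by have := h_og m0 bmN (hE b bmN) y; rewrite L0.
  by exists lb => _ y; apply: filterS (Hl y) => x h1 xy; rewrite mulr1 h1.
have [lamb Hl] := choice ex.
have oe1 y : oe (fun=> 1) y (sfl 1 y + (1.-1)%:Z * l y).
  by rewrite L0; apply: oe_hnear (hnearC 1 y) _; exact: oner_neq0.
have sle y : sfl 1 y <= sfl 1.-1 y.
  by rewrite sfl_1 // /sfl /= muln0 mul0r floor0; case: ifP.
have ch b (bmN : (b + 1 <= N)%N) := hval_coef bmN (hE b bmN) (Hl b bmN).
pose K : C := cr (\sum_(k < n) gam (pts k)) + deg%:~R / 2.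
have K0 : K != 0.
  have -> : K = cr (\sum_(k < n) gam (pts k) + deg%:~R / 2).
    rewrite /K crD crM crV cr_nat; congr (_ + _ * _); by rewrite /cr rmorph_int.
  by rewrite cr_eq0 gt_eqF // gamma_degree.
have id b (bmN : (b + 1 <= N)%N) : (N%:R - 2 * b%:R) * K + (b%:R * lamb b.-1 - (b + 1)%:R * lamb b) = 0.
  exact: (class_identity vm m0 oe1 (fun _ => erefl) sle ch bmN).
(* The solution of [(b + 1) * lamb b = b * lamb b.-1 + K * (N - 2 * b)] starting from
   [lamb 0 = K * N]; the factor [N - b] is not 0 in the range. *)
have lE b : (b < N)%N -> lamb b = K * (N%:R - b%:R).
  elim: b => [|b IH] bN.
    have b1 : (0 + 1 <= N)%N by [].
    have := id 0%N b1; rewrite mul0r sub0r add0n mul1r mulr0 !subr0 => /eqP.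
    by rewrite subr_eq0 => /eqP <-; rewrite mulrC.
  have b1 : (b.+1 + 1 <= N)%N by lia.
  have := id _ b1; rewrite /= IH; last by lia.
  have nz : (b.+1 + 1)%:R != 0 :> C by rewrite pnatr_eq0 addn1.
  move=> E; apply: (mulfI nz); move: E nz; have e2 : (b.+1%:R : C) = b%:R + 1 by rewrite natr1.
  rewrite natrD e2.
  move: (b%:R : C) (N%:R : C) (lamb b.+1) => B M v E _.
  apply/eqP; rewrite -subr_eq0 -oppr_eq0; apply/eqP; rewrite -[RHS]E; ring.
exists lamb => b bN; split.
  by rewrite lE // mulf_neq0 // subr_eq0 eqr_nat gtn_eqF.
move=> W i a tau fr y Wy; have b1 : (b + 1 <= N)%N by lia.
apply: filterS (ch b b1 _ _ _ _ fr y Wy) => x H /H.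
by rewrite addn1 expr0 !mulr1 expr1.
Qed.
End BaseForm.
End ParabolicGunning.
End RiemannSurfaces.

(** * Non-invariance and transversality for an arbitrary parabolic connection *)

Theorem lemma4p3 (R : realType) (X : riemann_surface R)
    (X_compact : compact [set: X])
    (n : nat) (pts : 'I_n -> X) (pts_inj : injective pts) (n_gt0 : (0 < n)%N)
    (genus0 : has_genus X 0 -> (3 <= n)%N)
    (c : 'I_n -> R) (c_gt1 : forall k, 1 < c k)
    (G : gunning_bundle X)
    (r : nat) (r_ge2 : (2 <= r)%N)
    (D : operator X) (D_par : parabolic_connection pts (SymE pts c G r.-1) D) :
  (forall j : nat, (1 <= j <= r.-1)%N ->
     ~ sends_into pts D (filtration pts c G r j 0) (filtration pts c G r j 0)) /\
  (forall j : nat, (1 <= j <= r.-1)%N ->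
     sends_into pts D (filtration pts c G r j 0) (filtration pts c G r j.+1 0)).
Proof.
(* The degree [r - 1] becomes the successor of [N'], as needed to absorb sums of monomials into the
   outermost product. *)
case: r r_ge2 D_par => [|[|N']] // _ D_par.
have nX : [set: X] !=set0 by exists (pts (Ordinal n_gt0)).
have [phi [s [l [us mf po lo lg]]]] := base_form X_compact nX.
have v1 := van_one pts_inj c_gt1 D_par X_compact n_gt0 genus0 us mf po lo lg.
split=> j jN; last exact: griffiths_transversal v1 jN.
have [lamb Hl] := subdiagonal pts_inj c_gt1 D_par X_compact n_gt0 genus0 us mf po lo lg.
(* Near any point, off that point, the subdiagonal entry is a non-zero constant times the
   non-vanishing [kap]; a marked point is at hand because [n] is positive. *)
pose y := pts (Ordinal n_gt0); have [i di] := rs_cover y.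
have [W [a [tau [fr Wy gd]]]] := exists_frame pts G di.
have jb : (j.-1 < N'.+1)%N by move: jN => /andP[j0 j1]; rewrite prednK.
have [l0 HA] := Hl j.-1 jb.
have [x xy [H1 H2]] := exists_near (filterI (HA _ _ _ _ fr y Wy) (near_good pts s po fr Wy)).
have [Wx xS _ _ k0] := H2 xy; have := H1 xy; rewrite prednK; last by case/andP: jN.
move=> E; have A0 : (cA pts_inj c_gt1 D_par fr j.-1 x)`_j != 0 by rewrite E mulf_neq0.
exact: (not_preserved jN Wx xS A0).
Qed.
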